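(* Let $a,b$ be integers with $1\le a\le b$, $\gcd(a,b)=1$ and $\frac ab\ne1$, and let $\zeta_b^a:=e^{2\pi ia/b}$. Then, as $n\to\infty$, $$\mathcal{A}_n(\zeta_b^a)\sim(1-\zeta_b^a)^{-\frac1{12}}\,\frac{e^{\zeta'(-1)}\left(\zeta(3)-\mathrm{Li}_3(\zeta_b^a)\right)^{\frac7{36}}}{2^{\frac{11}{36}}\sqrt{3\pi}\,n^{\frac{25}{36}}}\exp\left(\frac{3}{2^{\frac23}}\left(\zeta(3)-\mathrm{Li}_3(\zeta_b^a)\right)^{\frac13}n^{\frac23}\right).$$
   Context: The polynomials $\mathcal{A}_n(\zeta)$ are defined by the generating function $$\sum_{n\ge0}\mathcal{A}_n(\zeta)q^n:=\prod_{n\ge1}\left(\frac{1-\zeta q^n}{1-q^n}\right)^n.$$ The trilogarithm is $\mathrm{Li}_3(z)=\sum_{n\ge1}\frac{z^n}{n^3}$ for $|z|\le1$; $\zeta(s)$ in $\zeta(3)$ and $\zeta'(-1)$ is the Riemann zeta function. All fractional powers of complex numbers are principal branches. $f(n)\sim g(n)$ means $f(n)/g(n)\to1$ as $n\to\infty$. *)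

(* Defs.v *)
From Stdlib Require Import Reals ZArith Arith Lia.
From Coquelicot Require Import Coquelicot.

(* Formal power series in q over C, as coefficient sequences. *)

Definition fps := nat -> C.

Definition fps_one : fps := fun n => if n =? 0 then RtoC 1 else RtoC 0.

Definition fps_mul (u v : fps) : fps :=
  fun n => sum_n (fun k => Cmult (u k) (v (n - k)%nat)) n.

Definition fps_pow (u : fps) (m : nat) : fps := Nat.iter m (fps_mul u) fps_one.

(* 1 - z q^m *)
Definition fps_binomial (z : C) (m : nat) : fps :=
  fun n => Cminus (fps_one n) (if n =? m then z else RtoC 0).

(* For m >= 1, 1 / (1 - q^m) = \sum_j q^(j m); see [fps_binomial_geom]. *)
Definition fps_geom (m : nat) : fps :=
  fun n => if n mod m =? 0 then RtoC 1 else RtoC 0.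

Definition factor (z : C) (m : nat) : fps :=
  fps_pow (fps_mul (fps_binomial z m) (fps_geom m)) m.

Fixpoint partial_product (z : C) (N : nat) : fps :=
  match N with
  | 0%nat => fps_one
  | S N' => fps_mul (partial_product z N') (factor z N)
  end.

(* The factor of index m is 1 + O(q^m), so the coefficient of q^n in the partial
   products is constant from N = n on; see [partial_product_stable]. *)
Definition A (n : nat) (z : C) : C := partial_product z n n.

Ltac C_ring := lazymatch goal with |- ?x = ?y => change (@eq C x y); ring end.

Lemma sum_n_delta (f : nat -> C) (m n : nat) :
  sum_n (fun k => if k =? m then f k else RtoC 0) n
  = if m <=? n then f m else RtoC 0.
Proof.
induction n as [|n IH].
- rewrite sum_O. destruct m; reflexivity.
- rewrite sum_Sn, IH. change (@plus C_AbelianMonoid) with Cplus.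
  destruct (Nat.eqb_spec (S n) m) as [<-|H].
  + destruct (Nat.leb_spec (S n) n); [lia|].
    destruct (Nat.leb_spec (S n) (S n)); [|lia]. now rewrite Cplus_0_l.
  + rewrite Cplus_0_r.
    destruct (Nat.leb_spec m n), (Nat.leb_spec m (S n)); trivial; lia.
Qed.

Lemma fps_binomial_geom (m : nat) : (1 <= m)%nat ->
  forall n, fps_mul (fps_binomial (RtoC 1) m) (fps_geom m) n = fps_one n.
Proof.
intros Hm n. unfold fps_mul.
rewrite (sum_n_ext _ (fun k =>
  plus (if k =? 0 then fps_geom m (n - k)%nat else RtoC 0)
       (if k =? m then Copp (fps_geom m (n - k)%nat) else RtoC 0))).
2:{ intros k. change (@plus C_AbelianMonoid) with Cplus.
    unfold fps_binomial, fps_one.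
    destruct (k =? 0), (k =? m); C_ring. }
rewrite sum_n_plus,
  (sum_n_delta (fun k => fps_geom m (n - k)%nat)),
  (sum_n_delta (fun k => Copp (fps_geom m (n - k)%nat))).
change (@plus C_AbelianMonoid) with Cplus.
rewrite Nat.sub_0_r; simpl. unfold fps_geom, fps_one.
destruct (Nat.leb_spec m n) as [H|H].
- replace (n mod m) with ((n - m) mod m).
  2:{ replace n with ((n - m) + 1 * m)%nat at 2 by lia.
      now rewrite Nat.Div0.mod_add. }
  destruct (Nat.eqb_spec n 0); [lia|]. C_ring.
- rewrite Nat.mod_small by lia. C_ring.
Qed.

Lemma fps_mul_low (u v : fps) (n : nat) :
  (forall k, (k <= n)%nat -> v k = fps_one k) -> fps_mul u v n = u n.
Proof.
intros H. unfold fps_mul.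
rewrite (sum_n_ext_loc _ (fun k => if k =? n then u k else RtoC 0)).
- rewrite sum_n_delta. now rewrite Nat.leb_refl.
- intros k Hk. rewrite H by lia. unfold fps_one.
  destruct (Nat.eqb_spec k n), (Nat.eqb_spec (n - k) 0); try lia; C_ring.
Qed.

Lemma factor_low (z : C) (m n : nat) :
  (n < m)%nat -> factor z m n = fps_one n.
Proof.
intros Hn. unfold factor.
assert (H : forall k, (k <= n)%nat ->
    fps_mul (fps_binomial z m) (fps_geom m) k = fps_one k).
{ intros k Hk. rewrite fps_mul_low.
  - unfold fps_binomial. destruct (Nat.eqb_spec k m); [lia|]. C_ring.
  - intros j Hj. unfold fps_geom, fps_one. now rewrite Nat.mod_small by lia. }
unfold fps_pow. clear Hn. generalize m at 1 as p.
revert H. generalize (fps_mul (fps_binomial z m) (fps_geom m)) as u.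
intros u H p.
enough (forall k, (k <= n)%nat -> Nat.iter p (fps_mul u) fps_one k = fps_one k)
  by auto with arith.
induction p as [|p IH]; simpl; trivial.
intros k Hk. rewrite fps_mul_low; [auto|]. intros j Hj. apply IH. lia.
Qed.

Lemma partial_product_stable (z : C) (n N : nat) :
  (n <= N)%nat -> partial_product z N n = A n z.
Proof.
induction 1 as [|N H IH]; trivial. rewrite <- IH.
apply fps_mul_low. intros k Hk. apply factor_low. lia.
Qed.

Definition Cexp (z : C) : C :=
  Cmult (RtoC (exp (Re z))) (cos (Im z), sin (Im z)).

(* Principal argument, in (-PI, PI]; meaningful for z <> 0 only. *)
Definition Carg (z : C) : R :=
  if Rle_dec 0 (Im z) then acos (Re z / Cmod z) else (- acos (Re z / Cmod z))%R.

Definition Clog (z : C) : C := (ln (Cmod z), Carg z).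

Definition Cpower (z w : C) : C := Cexp (Cmult w (Clog z)).

Definition zeta_root (a b : Z) : C :=
  Cexp (Cdiv (Cmult (Cmult (Cmult (RtoC 2) (RtoC PI)) Ci) (RtoC (IZR a)))
             (RtoC (IZR b))).

Definition CSeries (u : nat -> C) : C :=
  (Series (fun n => Re (u n)), Series (fun n => Im (u n))).

Definition Li3 (z : C) : C :=
  CSeries (fun n => Cdiv (Cpow z (S n)) (Cpow (RtoC (INR (S n))) 3)).

Definition analytic_at (f : C -> C) (s0 : C) : Prop :=
  exists (c : nat -> C) (r : R), (0 < r)%R /\
    forall s : C, (Cmod (Cminus s s0) < r)%R ->
      @is_pseries C_AbsRing C_NormedModule c (Cminus s s0) (f s).

(* The analytic continuation of \sum_n n^(-s) to C \ {1}, unique by the identity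
   theorem; the value at the pole 1 is left free. *)
Definition is_riemann_zeta (Z : C -> C) : Prop :=
  (forall s : C, s <> RtoC 1 -> analytic_at Z s) /\
  (forall s : C, (1 < Re s)%R ->
     @is_series C_AbsRing C_NormedModule
       (fun n => Cpower (RtoC (INR (S n))) (Copp s)) (Z s)).

Definition asymp_equiv (f g : nat -> C) : Prop :=
  filterlim (fun n => Cdiv (f n) (g n)) eventually (locally (RtoC 1)).

(* Main.v *)
Require Import Defs.
From Stdlib Require Import Reals ZArith Lia Lra Classical.
From Coquelicot Require Import Coquelicot.
Local Open Scope R_scope.
Local Open Scope C_scope.

(** Put [q = e^(-t)]. By the product formula the generating function at [q] is
    [exp (Lam 1 t - Lam z0 t)] with [Lam z0 t = sum_n n Li_1 (z0 e^(-n t))], and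
    [A n z0] is the integral of [exp (Lam 1 t - Lam z0 t + n t) / (2 pi)] over
    [t = e + i y], [|y| <= pi].

    Major arc.  Euler-Maclaurin summation of [x -> x Li_1 (z0 e^(-x t))] against
    the kernel [B_3] gives, uniformly in a cone [|Im t| <= k Re t],
      [Lam 1 t - Lam z0 t = c / t^2 + (log t) / 12 + zeta'(-1) - (1/12) log (1 - z0) + o(1)],
    where [c = zeta(3) - Li_3(z0)].  The constant appears as an absolutely convergent
    integral [J(-1) - 1/6]; the same kernel expresses [zeta] for [Re s > 1], and the
    identity theorem, propagated along the segment from [2 + 2i] to [-1], identifies
    it with [zeta'(-1)].

    Minor arcs.  Expanding [Li_1] and summing over [n] first,
      [Lam 1 t - Lam z0 t = sum_m ((1 - z0^m) / m) w^m / (1 - w^m)^2] with [w = e^(-t)].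
    The term [m] has size [1 / (m^3 e^2)] only if [m y] is within [O(e)] of
    [2 pi Z], which fails for [m = 1] and never holds for two consecutive [m].

    The exponent [c / t^2 + n t] has its saddle at [t = (2 c / n)^(1/3)], which is complex;
    [e] is the real part of it, and Laplace's method leads to the integral of
    [exp (- a x^2)] with [Re a > 0]. *)

(** The delicate point is that the minor arcs must lose for every [z0], also as [z0] approaches 1,
    where [c] itself tends to 0. On [Re t = e] with [n e^3 = 2 m] the term [n t] has real part
    [2 m / e^2] everywhere, so [m] has to be compared with [e^2 |Lam 1 t - Lam z0 t|] off the cone.
    Now [m] is the maximum over real [v] of [Re (c / (1 + i v)^2)], so any single [v] bounds it
    below. The choice [v = -1/2] or [1/2], by the sign of [Im z0], gives a series with rational
    coefficients that beats the minor-arc bound; near [z0 = 1] both are linear in [|1 - z0|].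

    The kernel [B_3] fits both roles because the third derivative of [- x log x] is [x^(-2)], the
    integrand of the continuation formula for [zeta] at [s = -1]. In that formula the integral
    carries the factor [s + 1], so its continuity is enough to differentiate at [-1].

    The complex saddle lies on the line [Re t = e], so no contour is moved; and the exponent minus
    its saddle value is an explicit multiple of [(v - v0)^2], without a Taylor remainder. *)

(** * Real parts, imaginary parts and moduli *)

Lemma C_eq (z w : C) : Re z = Re w -> Im z = Im w -> z = w.
Proof. destruct z, w; simpl; intros; subst; reflexivity. Qed.

Ltac Cring := apply C_eq; simpl; unfold Re, Im; simpl; ring.

Lemma Cmod_ge_Re (z : C) : (Rabs (Re z) <= Cmod z)%R.
Proof. apply re_le_Cmod. Qed.

Lemma Cmod_ge_Im (z : C) : (Rabs (Im z) <= Cmod z)%R.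
Proof.
pose proof (Rmax_Cmod z) as H. pose proof (Rmax_r (Rabs (fst z)) (Rabs (snd z))).
unfold Im. lra.
Qed.

Lemma Cmod_le_sum (z : C) : (Cmod z <= Rabs (Re z) + Rabs (Im z))%R.
Proof.
destruct z as [x y]; unfold Cmod, Re, Im; simpl fst; simpl snd.
apply Rsqr_incr_0_var.
- rewrite Rsqr_sqrt by nra. unfold Rsqr.
  pose proof (Rabs_pos x); pose proof (Rabs_pos y).
  pose proof (pow2_abs x); pose proof (pow2_abs y). nra.
- pose proof (Rabs_pos x); pose proof (Rabs_pos y). lra.
Qed.

Lemma Cmod_sqr (z : C) : (Cmod z * Cmod z = Re z * Re z + Im z * Im z)%R.
Proof. pose proof (Cmod2_alt z). simpl in H. lra. Qed.

Lemma Cmod_minus_sym (z w : C) : Cmod (z - w) = Cmod (w - z).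
Proof. rewrite <- Cmod_opp. f_equal. ring. Qed.

Lemma Cmod_triangle_minus (z w : C) : (Cmod (z - w) <= Cmod z + Cmod w)%R.
Proof. unfold Cminus. rewrite <- (Cmod_opp w). apply Cmod_triangle. Qed.

Lemma Cmod_triangle_inv (z w : C) : (Cmod z - Cmod w <= Cmod (z - w))%R.
Proof.
pose proof (Cmod_triangle (z - w) w). replace (z - w + w) with z in H by ring. lra.
Qed.

Lemma Cmod_RtoC_pos (x : R) : (0 <= x)%R -> Cmod x = x.
Proof. intros; rewrite Cmod_R; now apply Rabs_pos_eq. Qed.

Lemma Cmod_pos_nz (z : C) : (0 < Cmod z)%R -> z <> 0.
Proof. intros H E. rewrite E, Cmod_0 in H. lra. Qed.

Lemma Re_pos_nz (z : C) : (0 < Re z)%R -> z <> 0.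
Proof. intros H ->. simpl in H. lra. Qed.

(** * The exponential *)

Lemma exp_mono (x y : R) : (x <= y)%R -> (exp x <= exp y)%R.
Proof. intros [H|H]; [left; now apply exp_increasing|right; now f_equal]. Qed.

Lemma Cexp_add (z w : C) : Cexp (z + w) = Cexp z * Cexp w.
Proof.
destruct z as [a b], w as [c d]. unfold Cexp. simpl. rewrite exp_plus, cos_plus, sin_plus.
Cring.
Qed.

Lemma Cexp_R (x : R) : Cexp x = exp x.
Proof. unfold Cexp. simpl. rewrite cos_0, sin_0. Cring. Qed.

Lemma Cexp_0 : Cexp 0 = 1.
Proof. now rewrite Cexp_R, exp_0. Qed.

Lemma Cmod_Cexp (z : C) : Cmod (Cexp z) = exp (Re z).
Proof.
unfold Cexp. rewrite Cmod_mult, Cmod_RtoC_pos by (left; apply exp_pos).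
replace (Cmod (cos (Im z), sin (Im z))) with 1%R; [ring|].
unfold Cmod; simpl. symmetry.
replace (_ + _)%R with 1%R; [apply sqrt_1|].
pose proof (sin2_cos2 (Im z)) as H; unfold Rsqr in H; lra.
Qed.

Lemma Cexp_nz (z : C) : Cexp z <> 0.
Proof. apply Cmod_pos_nz. rewrite Cmod_Cexp. apply exp_pos. Qed.

Lemma Cexp_opp (z : C) : Cexp (- z) = / Cexp z.
Proof.
assert (H : Cexp (- z) * Cexp z = 1).
{ rewrite <- Cexp_add. replace (- z + z) with (RtoC 0) by ring. apply Cexp_0. }
rewrite <- (Cmult_1_l (/ _)), <- H. field. apply Cexp_nz.
Qed.

Lemma Cexp_minus (z w : C) : Cexp (z - w) = Cexp z / Cexp w.
Proof. unfold Cminus, Cdiv. now rewrite Cexp_add, Cexp_opp. Qed.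

Lemma Cexp_pow (z : C) (n : nat) : Cpow (Cexp z) n = Cexp (INR n * z).
Proof.
induction n as [|n IH].
- simpl Cpow. simpl INR. rewrite Cmult_0_l. now rewrite Cexp_0.
- rewrite Cpow_S, IH, <- Cexp_add, S_INR. f_equal. rewrite RtoC_plus. ring.
Qed.

(** * Logarithm on the right half-plane *)

(** The [acos] form is awkward to differentiate on the positive real axis, where [acos] is taken at
    1. All logarithms below are taken in the right half-plane: of [t], [1 - z0 e^(-z)], [1 - z0],
    [1 + i v] and [zeta(3) - Li_3(z0)]. *)
Lemma Carg_atan (z : C) : (0 < Re z)%R -> Carg z = atan (Im z / Re z).
Proof.
intros Hx. pose proof (Cmod_sqr z) as Hs. pose proof (Cmod_ge_Re z) as Hr.
pose proof (Rle_abs (Re z)).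
set (th := atan (Im z / Re z)).
assert (Hc : (Re z / Cmod z = cos th)%R).
{ unfold th. rewrite cos_atan.
  assert (Hq : (0 < 1 + (Im z / Re z)²)%R)
    by (pose proof (Rle_0_sqr (Im z / Re z)); lra).
  assert (E : (Cmod z = Re z * sqrt (1 + (Im z / Re z)²))%R).
  { apply Rsqr_inj; [lra| |].
    - apply Rmult_le_pos; [lra|apply sqrt_pos].
    - rewrite Rsqr_mult, Rsqr_sqrt by lra. unfold Rsqr. rewrite Hs. field. lra. }
  rewrite E. field. split; [|lra].
  apply Rgt_not_eq, sqrt_lt_R0; lra. }
destruct (atan_bound (Im z / Re z)) as [B1 B2]. fold th in B1, B2.
pose proof PI_RGT_0.
unfold Carg. rewrite Hc. destruct (Rle_dec 0 (Im z)) as [Hi|Hi].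
- apply acos_cos. split; [|lra].
  unfold th. rewrite <- atan_0. destruct (Req_dec (Im z) 0) as [->|].
  + unfold Rdiv. rewrite Rmult_0_l. lra.
  + left. apply atan_increasing. apply Rdiv_lt_0_compat; lra.
- rewrite <- cos_neg, acos_cos; [ring|].
  assert (th < 0)%R; [|lra].
  unfold th. rewrite <- atan_0. apply atan_increasing.
  apply Rmult_lt_reg_r with (Re z); [lra|]. unfold Rdiv.
  rewrite Rmult_assoc, Rinv_l by lra. lra.
Qed.

Lemma Clog_atan (z : C) : (0 < Re z)%R -> Clog z = (ln (Cmod z), atan (Im z / Re z)).
Proof. intros H. unfold Clog. now rewrite Carg_atan. Qed.

Lemma Cmod_pos_Re (z : C) : (0 < Re z)%R -> (0 < Cmod z)%R.
Proof. intros H. apply Cmod_gt_0. now apply Re_pos_nz. Qed.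

Lemma Cexp_Clog (z : C) : (0 < Re z)%R -> Cexp (Clog z) = z.
Proof.
intros Hx. rewrite Clog_atan by trivial. unfold Cexp; simpl.
pose proof (Cmod_pos_Re z Hx) as Hm. pose proof (Cmod_sqr z) as Hs.
rewrite exp_ln by trivial.
rewrite cos_atan, sin_atan.
assert (Hq : (0 < 1 + (Im z / Re z)²)%R)
  by (pose proof (Rle_0_sqr (Im z / Re z)); lra).
assert (E : (Cmod z = Re z * sqrt (1 + (Im z / Re z)²))%R).
{ apply Rsqr_inj; [lra| |].
  - apply Rmult_le_pos; [lra|apply sqrt_pos].
  - rewrite Rsqr_mult, Rsqr_sqrt by lra. unfold Rsqr. rewrite Hs. field. lra. }
assert (sqrt (1 + (Im z / Re z)²) <> 0)%R by (apply Rgt_not_eq, sqrt_lt_R0; lra).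
rewrite E. apply C_eq; simpl; unfold Rdiv; field; split; trivial; lra.
Qed.

Lemma Clog_bound (z : C) : (0 < Re z)%R -> (- PI / 2 < Im (Clog z) < PI / 2)%R.
Proof. intros H. rewrite Clog_atan by trivial. simpl. pose proof (atan_bound (Im z / Re z)). lra. Qed.

Lemma Clog_Cexp (z : C) : (- PI / 2 < Im z < PI / 2)%R -> Clog (Cexp z) = z.
Proof.
intros H. assert (Hc : (0 < cos (Im z))%R) by (apply cos_gt_0; lra).
assert (Hr : (0 < Re (Cexp z))%R).
{ unfold Cexp; simpl. rewrite Rmult_0_l, Rminus_0_r. apply Rmult_lt_0_compat; trivial. apply exp_pos. }
rewrite Clog_atan by trivial. rewrite Cmod_Cexp, ln_exp.
apply C_eq; simpl; trivial.
unfold Cexp; simpl. pose proof (exp_pos (Re z)).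
replace (_ / _)%R with (tan (Im z)).
- apply atan_tan. lra.
- unfold tan. field. split; lra.
Qed.

Lemma Clog_R (x : R) : (0 < x)%R -> Clog x = ln x.
Proof.
intros H. rewrite Clog_atan by (simpl; lra).
rewrite Cmod_RtoC_pos by lra. simpl. unfold Rdiv. rewrite Rmult_0_l, atan_0. reflexivity.
Qed.

Lemma Clog_1 : Clog 1 = 0.
Proof. rewrite Clog_R by lra. now rewrite ln_1. Qed.

(** * Derivatives of complex functions of a real variable *)

Lemma isd_plus (f g : R -> R) (x a b : R) : is_derive f x a -> is_derive g x b ->
  is_derive (fun y => f y + g y)%R x (a + b)%R.
Proof. intros; now apply (is_derive_plus (V := R_NormedModule)). Qed.

Lemma isd_opp (f : R -> R) (x a : R) : is_derive f x a -> is_derive (fun y => - f y)%R x (- a)%R.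
Proof. intros; now apply (is_derive_opp (V := R_NormedModule)). Qed.

Lemma isd_minus (f g : R -> R) (x a b : R) : is_derive f x a -> is_derive g x b ->
  is_derive (fun y => f y - g y)%R x (a - b)%R.
Proof. intros; now apply (is_derive_minus (V := R_NormedModule)). Qed.

Lemma isd_mult (f g : R -> R) (x a b : R) : is_derive f x a -> is_derive g x b ->
  is_derive (fun y => f y * g y)%R x (a * g x + f x * b)%R.
Proof. intros; apply (is_derive_mult f g); trivial; intros; apply Rmult_comm. Qed.

Lemma isd_comp (f g : R -> R) (x a b : R) : is_derive f (g x) a -> is_derive g x b ->
  is_derive (fun y => f (g y)) x (b * a)%R.
Proof. intros; now apply (is_derive_comp (V := R_NormedModule) f g). Qed.

Lemma isd_scal (c : R) (f : R -> R) (x a : R) : is_derive f x a ->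
  is_derive (fun y => c * f y)%R x (c * a)%R.
Proof. intros; now apply (is_derive_scal f). Qed.

(** Differentiation along a real parameter, by components: complex functions are followed along rays
    [x * t] or vertical lines, so real calculus suffices. *)
Definition CD (f : R -> C) (x : R) (l : C) : Prop :=
  is_derive (fun y => Re (f y)) x (Re l) /\ is_derive (fun y => Im (f y)) x (Im l).

Lemma CD_eq (f : R -> C) (x : R) (l l' : C) : CD f x l -> l = l' -> CD f x l'.
Proof. now intros H <-. Qed.

Lemma CD_ext (f g : R -> C) (x : R) (l : C) : (forall y, f y = g y) -> CD f x l -> CD g x l.
Proof. intros H [H1 H2]; split; (eapply is_derive_ext; [|eassumption]); intros; simpl; now rewrite H. Qed.

Lemma CD_const (c : C) (x : R) : CD (fun _ => c) x 0.
Proof. split; simpl; auto_derive; trivial. Qed.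

Lemma CD_RtoC (f : R -> R) (x l : R) : is_derive f x l -> CD (fun y => RtoC (f y)) x l.
Proof. intros H; split; simpl; trivial. auto_derive; trivial. Qed.

Lemma CD_id (x : R) : CD RtoC x 1.
Proof. apply (CD_RtoC (fun y => y)). auto_derive; trivial. Qed.

Lemma CD_plus (f g : R -> C) (x : R) (a b : C) :
  CD f x a -> CD g x b -> CD (fun y => f y + g y) x (a + b).
Proof. intros [H1 H2] [H3 H4]; split; simpl; now apply isd_plus. Qed.

Lemma CD_opp (f : R -> C) (x : R) (a : C) : CD f x a -> CD (fun y => - f y) x (- a).
Proof. intros [H1 H2]; split; simpl; now apply isd_opp. Qed.

Lemma CD_minus (f g : R -> C) (x : R) (a b : C) :
  CD f x a -> CD g x b -> CD (fun y => f y - g y) x (a - b).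
Proof. intros H1 H2. apply CD_plus; trivial. now apply CD_opp. Qed.

Lemma CD_mult (f g : R -> C) (x : R) (a b : C) :
  CD f x a -> CD g x b -> CD (fun y => f y * g y) x (a * g x + f x * b).
Proof.
intros [H1 H2] [H3 H4]; split; simpl.
- evar_last.
  + apply isd_minus; apply isd_mult; eassumption.
  + unfold minus, plus, mult, opp; simpl; unfold Re, Im; ring.
- evar_last.
  + apply isd_plus; apply isd_mult; eassumption.
  + unfold minus, plus, mult, opp; simpl; unfold Re, Im; ring.
Qed.

Lemma CD_scal (c : C) (f : R -> C) (x : R) (a : C) : CD f x a -> CD (fun y => c * f y) x (c * a).
Proof.
intros H. eapply CD_eq; [apply CD_mult; [apply CD_const|exact H]|]; cbv beta; ring.
Qed.

Lemma CD_Cexp (f : R -> C) (x : R) (a : C) :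
  CD f x a -> CD (fun y => Cexp (f y)) x (a * Cexp (f x)).
Proof.
intros [H1 H2]; split; simpl.
- apply (is_derive_ext (fun y => exp (Re (f y)) * cos (Im (f y)))%R).
  { intros; unfold Cexp, Re, Im; simpl; ring. }
  evar_last.
  + apply isd_mult.
    * apply (isd_comp exp); [apply is_derive_exp|exact H1].
    * apply (isd_comp cos); [apply is_derive_cos|exact H2].
  + unfold plus, mult, scal; simpl; unfold mult; simpl; unfold Re, Im; simpl; ring.
- apply (is_derive_ext (fun y => exp (Re (f y)) * sin (Im (f y)))%R).
  { intros; unfold Cexp, Re, Im; simpl; ring. }
  evar_last.
  + apply isd_mult.
    * apply (isd_comp exp); [apply is_derive_exp|exact H1].
    * apply (isd_comp sin); [apply is_derive_sin|exact H2].
  + unfold plus, mult, scal; simpl; unfold mult; simpl; unfold Re, Im; simpl; ring.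
Qed.

Lemma CD_Clog (f : R -> C) (x : R) (a : C) :
  (0 < Re (f x))%R -> CD f x a -> CD (fun y => Clog (f y)) x (a / f x).
Proof.
intros Hp [H1 H2].
assert (Hm := Cmod_pos_Re _ Hp).
assert (Hloc : locally x (fun y => 0 < Re (f y))%R).
{ assert (Hc : continuous (fun y => Re (f y)) x) by (apply (ex_derive_continuous (V := R_NormedModule)); now exists (Re a)).
  apply (Hc (fun u => 0 < u)%R). now apply open_gt. }
assert (Hd : is_derive (fun y => Re (f y) ^ 2 + Im (f y) ^ 2)%R x
   (2 * Re (f x) * Re a + 2 * Im (f x) * Im a)%R).
{ evar_last.
  - apply isd_plus; apply is_derive_pow; eassumption.
  - unfold plus; simpl; ring. }
assert (Hq : (0 < Re (f x) ^ 2 + Im (f x) ^ 2)%R) by (pose proof (pow2_ge_0 (Im (f x))); nra).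
split.
- apply (is_derive_ext_loc (fun y => ln (sqrt (Re (f y) ^ 2 + Im (f y) ^ 2)))%R).
  { eapply filter_imp; [|exact Hloc]; intros y Hy. reflexivity. }
  evar_last.
  { apply (isd_comp ln).
    - apply is_derive_ln. now apply sqrt_lt_R0.
    - apply is_derive_sqrt; [exact Hd|exact Hq]. }
  set (q := (Re (f x) ^ 2 + Im (f x) ^ 2)%R) in *.
  assert (Hs : (0 < sqrt q)%R) by now apply sqrt_lt_R0.
  assert (Hss : (sqrt q * sqrt q = q)%R) by (apply sqrt_sqrt; lra).
  transitivity ((2 * Re (f x) * Re a + 2 * Im (f x) * Im a) / (2 * (sqrt q * sqrt q)))%R.
  { field. apply Rgt_not_eq; exact Hs. }
  rewrite Hss. unfold q in *. unfold Cdiv, Cinv, Cmult, Re, Im in *; simpl in *. field. lra.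
- apply (is_derive_ext_loc (fun y => atan (Im (f y) / Re (f y)))%R).
  { eapply filter_imp; [|exact Hloc]; intros y Hy. now rewrite Clog_atan. }
  evar_last.
  { apply (isd_comp atan).
    - apply is_derive_atan.
    - apply is_derive_div; [exact H2|exact H1|lra]. }
  unfold scal; simpl; unfold mult; simpl.
  unfold Cdiv, Cinv, Cmult, Re, Im, Rsqr in *; simpl in *. field. repeat split; try lra.
Qed.

Lemma CD_comp_real (f : R -> C) (g : R -> R) (x l : R) (a : C) :
  CD f (g x) a -> is_derive g x l -> CD (fun y => f (g y)) x (l * a).
Proof.
intros [H1 H2] Hg. split.
- evar_last; [apply (isd_comp (fun y => Re (f y))); eassumption|].
  unfold scal; simpl; unfold mult; simpl. unfold Re, Im; ring.
- evar_last; [apply (isd_comp (fun y => Im (f y))); eassumption|].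
  unfold scal; simpl; unfold mult; simpl. unfold Re, Im; ring.
Qed.

(** The increment [f b - f a] is turned onto the real axis by a unit [c], and the real mean value
    theorem is applied to [Re (c * f) - M]. With a varying majorant [M] this also stands in for
    integrating the bound on [f']. *)
Lemma CD_MVT (f f' : R -> C) (M m : R -> R) (a b : R) : (a <= b)%R ->
  (forall x, (a <= x <= b)%R -> CD f x (f' x)) ->
  (forall x, (a <= x <= b)%R -> is_derive M x (m x)) ->
  (forall x, (a <= x <= b)%R -> Cmod (f' x) <= m x)%R ->
  (Cmod (f b - f a) <= M b - M a)%R.
Proof.
intros Hab Hf HM Hle. set (d := f b - f a).
assert (Hg : forall c : C, (Cmod c <= 1)%R ->
  (Re c * (Re (f b) - Re (f a)) - Im c * (Im (f b) - Im (f a)) <= M b - M a)%R).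
{ intros c Hc.
  set (g := fun x => (Re c * Re (f x) - Im c * Im (f x) - M x)%R).
  destruct (MVT_gen g a b (fun x => Re c * Re (f' x) - Im c * Im (f' x) - m x)%R) as [x [Hx E]].
  - intros x Hx. rewrite Rmin_left, Rmax_right in Hx by trivial.
    destruct (Hf x) as [F1 F2]; [lra|]. specialize (HM x ltac:(lra)).
    apply isd_minus; trivial. apply isd_minus; now apply isd_scal.
  - intros x Hx. rewrite Rmin_left, Rmax_right in Hx by trivial.
    apply continuity_pt_filterlim, (ex_derive_continuous (V := R_NormedModule)). eexists.
    destruct (Hf x) as [F1 F2]; [lra|]. specialize (HM x ltac:(lra)).
    apply isd_minus; [|exact HM]. apply isd_minus; apply isd_scal; eassumption.
  - rewrite Rmin_left, Rmax_right in Hx by trivial. unfold g in E.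
    specialize (Hle x ltac:(lra)).
    assert (Re c * Re (f' x) - Im c * Im (f' x) <= m x)%R.
    { replace (Re c * Re (f' x) - Im c * Im (f' x))%R with (Re (c * f' x)) by reflexivity.
      pose proof (Cmod_ge_Re (c * f' x)). rewrite Cmod_mult in H.
      pose proof (Rle_abs (Re (c * f' x))). pose proof (Cmod_ge_0 (f' x)). nra. }
    nra. }
destruct (Req_dec (Cmod d) 0) as [E|E].
- rewrite E. specialize (Hg 0). rewrite Cmod_0 in Hg. simpl in Hg. lra.
- pose proof (Cmod_ge_0 d).
  specialize (Hg (Cconj d / Cmod d)).
  assert (Hm : RtoC (Cmod d) <> 0) by (intros F; apply RtoC_inj in F; lra).
  rewrite Cmod_div, Cmod_conj, Cmod_R, Rabs_pos_eq in Hg by trivial.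
  specialize (Hg ltac:(right; field; trivial)).
  replace (Cconj d / Cmod d) with (/ Cmod d * Cconj d) in Hg by (field; trivial).
  rewrite <- RtoC_inv, re_scal_l, im_scal_l, re_conj, im_conj in Hg by trivial.
  replace (Re (f b) - Re (f a))%R with (Re d) in Hg by reflexivity.
  replace (Im (f b) - Im (f a))%R with (Im d) in Hg by reflexivity.
  replace (Cmod d) with (/ Cmod d * (Cmod d * Cmod d))%R at 1 by (field; trivial).
  rewrite Cmod_sqr. lra.
Qed.

Lemma CD_MVT_const (f f' : R -> C) (B a b : R) : (a <= b)%R ->
  (forall x, (a <= x <= b)%R -> CD f x (f' x)) ->
  (forall x, (a <= x <= b)%R -> Cmod (f' x) <= B)%R ->
  (Cmod (f b - f a) <= B * (b - a))%R.
Proof.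
intros Hab Hf HB.
replace (B * (b - a))%R with (B * b - B * a)%R by ring.
apply (CD_MVT f f' (fun x => B * x)%R (fun _ => B)); trivial.
intros; auto_derive; trivial; ring.
Qed.

Lemma CD_scaled_exp (w : C) (x : R) : CD (fun y => Cexp (y * w)) x (w * Cexp (x * w)).
Proof.
apply CD_Cexp. eapply CD_eq; [apply CD_mult; [apply CD_id|apply CD_const]|]; cbv beta; ring.
Qed.

(** There are [K] terms, of degree below [K], so the remainder has order [K]. *)
Fixpoint Cexp_taylor (K : nat) (w : C) : C :=
  match K with
  | 0%nat => 0
  | S K' => Cexp_taylor K' w + Cpow w K' / INR (fact K')
  end.

Lemma CD_taylor (K : nat) (w : C) (x : R) :
  CD (fun y => Cexp_taylor (S K) (y * w)) x (w * Cexp_taylor K (x * w)).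
Proof.
assert (Hl : forall x : R, CD (fun y => RtoC y * w) x w).
{ intros y. eapply CD_eq; [apply CD_mult; [apply CD_id|apply CD_const]|]; cbv beta; ring. }
assert (Hp : forall (k : nat) (x : R), CD (fun y => Cpow (y * w) (S k)) x (INR (S k) * w * Cpow (x * w) k)).
{ intros k. induction k as [|k IH]; intros y.
  - eapply CD_ext; [|eapply CD_eq; [apply Hl|]].
    + intros; now rewrite Cpow_1_r.
    + simpl. ring.
  - eapply CD_ext; [|eapply CD_eq; [apply CD_mult; [apply Hl|apply IH]|]].
    + intros; reflexivity.
    + cbv beta; rewrite (Cpow_S _ k), (S_INR (S k)), RtoC_plus. ring. }
induction K as [|K IH].
- simpl. eapply CD_eq; [apply CD_const|]; cbv beta; ring.
- eapply CD_ext; [|eapply CD_eq; [apply CD_plus; [exact IH|]|]].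
  + intros; reflexivity.
  + unfold Cdiv. apply CD_mult; [apply Hp|apply CD_const].
  + assert (Hf : RtoC (INR (fact K)) <> 0).
    { intros E; apply RtoC_inj in E. revert E. apply INR_fact_neq_0. }
    assert (HS : RtoC (INR (S K)) <> 0).
    { intros E; apply RtoC_inj in E. revert E. now apply not_0_INR. }
    change (fact (S K)) with (S K * fact K)%nat. rewrite mult_INR, RtoC_mult.
    simpl Cexp_taylor. field. split; trivial.
Qed.

Lemma Cexp_taylor_0 (K : nat) : Cexp_taylor (S K) 0 = 1.
Proof.
induction K as [|K IH].
- simpl. field.
- change (Cexp_taylor (S (S K)) 0) with (Cexp_taylor (S K) 0 + Cpow 0 (S K) / INR (fact (S K))).
  rewrite IH, Cpow_S, Cmult_0_l. unfold Cdiv. ring.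
Qed.

(** Along the ray [x * w] the derivative of the remainder of order [K + 1] is [w] times the
    remainder of order [K], so [CD_MVT] with majorant [c x^(K+1)] carries the induction. *)
Lemma Cexp_taylor_bound (K : nat) (w : C) :
  (Cmod (Cexp w - Cexp_taylor K w) <= Cmod w ^ K / INR (fact K) * exp (Cmod w))%R.
Proof.
set (r := Cmod w). assert (Hr : (0 <= r)%R) by apply Cmod_ge_0.
enough (H : forall x, (0 <= x <= 1)%R ->
  (Cmod (Cexp (x * w) - Cexp_taylor K (x * w)) <= (r ^ K / INR (fact K) * exp r) * x ^ K)%R).
{ specialize (H 1%R ltac:(lra)). rewrite pow1, Cmult_1_l, Rmult_1_r in H. exact H. }
induction K as [|K IH]; intros x Hx.
- simpl. replace (Cexp (x * w) - 0) with (Cexp (x * w)) by ring. rewrite Cmod_Cexp.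
  replace (1 / 1 * exp r * 1)%R with (exp r) by field.
  assert (Re (x * w) <= r)%R.
  { pose proof (Cmod_ge_Re (x * w)). pose proof (Rle_abs (Re (x * w))).
    rewrite Cmod_mult, Cmod_RtoC_pos in H by lra. fold r in H. nra. }
  destruct H; [left; now apply exp_increasing|right; now f_equal].
- set (c := (r ^ S K / INR (fact (S K)) * exp r)%R).
  pose proof (CD_MVT (fun x => Cexp (x * w) - Cexp_taylor (S K) (x * w))
    (fun x => w * Cexp (x * w) - w * Cexp_taylor K (x * w))
    (fun x => c * x ^ S K)%R (fun x => c * (INR (S K) * x ^ K))%R 0%R x ltac:(lra)) as H.
  cbv beta in H. rewrite Cmult_0_l, Cexp_0, Cexp_taylor_0 in H.
  replace (Cexp (x * w) - Cexp_taylor (S K) (x * w) - (1 - 1)) with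
    (Cexp (x * w) - Cexp_taylor (S K) (x * w)) in H by ring.
  replace (c * x ^ S K - c * 0 ^ S K)%R with (c * x ^ S K)%R in H by (simpl; ring).
  apply H.
  + intros y Hy. apply CD_minus; [apply CD_scaled_exp|apply CD_taylor].
  + intros y Hy. evar_last. { apply is_derive_scal. apply is_derive_pow. apply (is_derive_id (K := R_AbsRing)). }
    simpl pred. unfold one; simpl. ring.
  + intros y Hy. rewrite <- Cmult_minus_distr_l || replace (w * Cexp (y * w) - w * Cexp_taylor K (y * w)) with (w * (Cexp (y * w) - Cexp_taylor K (y * w))) by ring.
    rewrite Cmod_mult. fold r.
    apply Rle_trans with (r * (r ^ K / INR (fact K) * exp r * y ^ K))%R.
    * apply Rmult_le_compat_l; trivial. apply IH. lra.
    * right. unfold c. change (fact (S K)) with (S K * fact K)%nat. rewrite mult_INR.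
      simpl pow. field. split; [apply INR_fact_neq_0|now apply not_0_INR].
Qed.

(** Integrals are defined by components; testing against every [c] of the unit disc gives the
    modulus bound [CI_bound] without the loss of bounding the two components separately. *)
Lemma Cmod_le_rot (z : C) (M : R) :
  (forall c : C, Cmod c <= 1 -> Re (c * z) <= M)%R -> (Cmod z <= M)%R.
Proof.
intros H. pose proof (Cmod_ge_0 z).
destruct (Req_dec (Cmod z) 0) as [E|E].
- rewrite E. specialize (H 0). rewrite Cmod_0, Cmult_0_l in H. simpl in H. apply H. lra.
- assert (Hm : RtoC (Cmod z) <> 0) by (intros F; apply RtoC_inj in F; lra).
  specialize (H (Cconj z / Cmod z)).
  rewrite Cmod_div, Cmod_conj, Cmod_R, Rabs_pos_eq in H by trivial.
  specialize (H ltac:(right; field; trivial)).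
  replace (Cconj z / Cmod z * z) with (/ Cmod z * (Cconj z * z)) in H by (field; trivial).
  rewrite <- RtoC_inv, re_scal_l, re_mult, re_conj, im_conj in H by trivial.
  replace (Cmod z) with (/ Cmod z * (Cmod z * Cmod z))%R at 1 by (field; trivial).
  rewrite Cmod_sqr. lra.
Qed.

(** * Limits of complex sequences *)

Definition Clim (u : nat -> C) (l : C) : Prop := is_lim_seq (fun n => Cmod (u n - l)) 0%R.

Lemma Clim_squeeze (u : nat -> C) (l : C) (e : nat -> R) :
  eventually (fun n => Cmod (u n - l) <= e n)%R -> is_lim_seq e 0%R -> Clim u l.
Proof.
intros H He. unfold Clim.
apply is_lim_seq_le_le_loc with (u := fun _ => 0%R) (w := e); trivial.
- eapply filter_imp; [|exact H]. intros n Hn; split; trivial. apply Cmod_ge_0.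
- apply is_lim_seq_const.
Qed.

Lemma Clim_Re (u : nat -> C) (l : C) : Clim u l -> is_lim_seq (fun n => Re (u n)) (Re l).
Proof.
intros H. apply (is_lim_seq_ext (fun n => Re (u n - l) + Re l)%R).
{ intros n. unfold Cminus. rewrite re_plus, re_opp. ring. }
replace (Finite (Re l)) with (Rbar_plus 0 (Re l)) by (simpl; f_equal; ring).
apply is_lim_seq_plus with 0%R (Re l).
- apply is_lim_seq_abs_0.
  apply is_lim_seq_le_le with (u := fun _ => 0%R) (w := fun n => Cmod (u n - l)); trivial.
  + intros n; split; [apply Rabs_pos|apply Cmod_ge_Re].
  + apply is_lim_seq_const.
- apply is_lim_seq_const.
- reflexivity.
Qed.

Lemma Clim_Im (u : nat -> C) (l : C) : Clim u l -> is_lim_seq (fun n => Im (u n)) (Im l).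
Proof.
intros H. apply (is_lim_seq_ext (fun n => Im (u n - l) + Im l)%R).
{ intros n. unfold Cminus. rewrite im_plus, im_opp. ring. }
replace (Finite (Im l)) with (Rbar_plus 0 (Im l)) by (simpl; f_equal; ring).
apply is_lim_seq_plus with 0%R (Im l).
- apply is_lim_seq_abs_0.
  apply is_lim_seq_le_le with (u := fun _ => 0%R) (w := fun n => Cmod (u n - l)); trivial.
  + intros n; split; [apply Rabs_pos|apply Cmod_ge_Im].
  + apply is_lim_seq_const.
- apply is_lim_seq_const.
- reflexivity.
Qed.

Lemma Clim_parts (u : nat -> C) (l : C) :
  is_lim_seq (fun n => Re (u n)) (Re l) -> is_lim_seq (fun n => Im (u n)) (Im l) -> Clim u l.
Proof.
intros H1 H2.
apply Clim_squeeze with (fun n => Rabs (Re (u n) - Re l) + Rabs (Im (u n) - Im l))%R.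
- exists 0%nat; intros n _. eapply Rle_trans; [apply Cmod_le_sum|].
  unfold Cminus. rewrite re_plus, re_opp, im_plus, im_opp. right; reflexivity.
- assert (E : forall v (m : R), is_lim_seq v m -> is_lim_seq (fun n => Rabs (v n - m)) 0%R).
  { intros v m Hv. apply -> is_lim_seq_abs_0.
    replace (Finite 0) with (Rbar_minus m m) by (simpl; f_equal; ring).
    apply is_lim_seq_minus with m m; trivial; [apply is_lim_seq_const|reflexivity]. }
  replace (Finite 0) with (Rbar_plus 0 0) by (simpl; f_equal; ring).
  apply is_lim_seq_plus with 0%R 0%R; [now apply E|now apply E|reflexivity].
Qed.

Lemma Clim_unique (u : nat -> C) (l l' : C) : Clim u l -> Clim u l' -> l = l'.
Proof.
intros H H'. apply C_eq.
- pose proof (is_lim_seq_unique _ _ (Clim_Re _ _ H)). pose proof (is_lim_seq_unique _ _ (Clim_Re _ _ H')). congruence.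
- pose proof (is_lim_seq_unique _ _ (Clim_Im _ _ H)). pose proof (is_lim_seq_unique _ _ (Clim_Im _ _ H')). congruence.
Qed.

Lemma Clim_ext (u v : nat -> C) (l : C) : (forall n, u n = v n) -> Clim u l -> Clim v l.
Proof. intros E. apply is_lim_seq_ext. intros; now rewrite E. Qed.

Lemma Clim_const (c : C) : Clim (fun _ => c) c.
Proof.
apply Clim_squeeze with (fun _ => 0%R); [|apply is_lim_seq_const].
exists 0%nat; intros n _. replace (c - c) with (RtoC 0) by ring. rewrite Cmod_0. lra.
Qed.

Lemma Clim_plus (u v : nat -> C) (a b : C) : Clim u a -> Clim v b -> Clim (fun n => u n + v n) (a + b).
Proof.
intros H1 H2. apply Clim_squeeze with (fun n => Cmod (u n - a) + Cmod (v n - b))%R.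
- exists 0%nat; intros n _. replace (u n + v n - (a + b)) with ((u n - a) + (v n - b)) by ring. apply Cmod_triangle.
- replace (Finite 0) with (Rbar_plus 0 0) by (simpl; f_equal; ring).
  apply is_lim_seq_plus with 0%R 0%R; [trivial|trivial|reflexivity].
Qed.

Lemma Clim_scal (c : C) (u : nat -> C) (a : C) : Clim u a -> Clim (fun n => c * u n) (c * a).
Proof.
intros H. apply Clim_squeeze with (fun n => Cmod c * Cmod (u n - a))%R.
- exists 0%nat; intros n _. replace (c * u n - c * a) with (c * (u n - a)) by ring. rewrite Cmod_mult. lra.
- replace (Finite 0) with (Rbar_mult (Cmod c) 0) by (simpl; f_equal; ring).
  now apply is_lim_seq_scal_l.
Qed.

Lemma Clim_minus (u v : nat -> C) (a b : C) : Clim u a -> Clim v b -> Clim (fun n => u n - v n) (a - b).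
Proof.
intros H1 H2. replace (a - b) with (a + (-1) * b) by ring.
eapply Clim_ext; [|apply Clim_plus; [exact H1|apply (Clim_scal (-1)); exact H2]].
intros; simpl; ring.
Qed.

Lemma Clim_mult (u v : nat -> C) (a b : C) : Clim u a -> Clim v b -> Clim (fun n => u n * v n) (a * b).
Proof.
intros H1 H2. pose proof (Clim_Re _ _ H1). pose proof (Clim_Im _ _ H1).
pose proof (Clim_Re _ _ H2). pose proof (Clim_Im _ _ H2).
apply Clim_parts.
- eapply is_lim_seq_minus; [apply is_lim_seq_mult'; eassumption|apply is_lim_seq_mult'; eassumption|reflexivity].
- eapply is_lim_seq_plus; [apply is_lim_seq_mult'; eassumption|apply is_lim_seq_mult'; eassumption|reflexivity].
Qed.

Lemma Clim_Cmod (u : nat -> C) (a : C) : Clim u a -> is_lim_seq (fun n => Cmod (u n)) (Cmod a).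
Proof.
intros H. apply is_lim_seq_le_le with (u := fun n => (Cmod a - Cmod (u n - a))%R) (w := fun n => (Cmod a + Cmod (u n - a))%R).
- intros n. pose proof (Cmod_triangle_inv a (u n)). pose proof (Cmod_triangle_inv (u n) a).
  pose proof (Cmod_minus_sym a (u n)).
  pose proof (Cmod_triangle_inv a (a - u n)). replace (a - (a - u n)) with (u n) in H3 by ring. lra.
- replace (Finite (Cmod a)) with (Rbar_minus (Cmod a) 0) by (simpl; f_equal; ring).
  eapply is_lim_seq_minus; [apply is_lim_seq_const|exact H|reflexivity].
- replace (Finite (Cmod a)) with (Rbar_plus (Cmod a) 0) by (simpl; f_equal; ring).
  eapply is_lim_seq_plus; [apply is_lim_seq_const|exact H|reflexivity].
Qed.

Lemma Clim_incr_n (u : nat -> C) (N : nat) (l : C) : Clim (fun n => u (n + N)%nat) l -> Clim u l.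
Proof. intros H. now apply (is_lim_seq_incr_n _ N). Qed.

Lemma Clim_incr_n' (u : nat -> C) (N : nat) (l : C) : Clim u l -> Clim (fun n => u (n + N)%nat) l.
Proof. intros H. now apply (is_lim_seq_incr_n (fun n => Cmod (u n - l)) N). Qed.

Lemma Clim_bound (u : nat -> C) (l : C) (B : R) :
  eventually (fun n => Cmod (u n) <= B)%R -> Clim u l -> (Cmod l <= B)%R.
Proof.
intros Hb H. apply Clim_Cmod in H.
apply (is_lim_seq_le_loc _ (fun _ => B) (Cmod l) B Hb H). apply is_lim_seq_const.
Qed.

(** * Absolutely convergent complex series *)

Fixpoint Csum (u : nat -> C) (N : nat) : C :=
  match N with 0%nat => 0 | S N' => Csum u N' + u N' end.

Lemma Csum_S (u : nat -> C) (N : nat) : Csum u (S N) = Csum u N + u N.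
Proof. reflexivity. Qed.

Lemma Csum_ext (u v : nat -> C) (N : nat) : (forall k, (k < N)%nat -> u k = v k) -> Csum u N = Csum v N.
Proof. induction N as [|N IH]; intros H; simpl; trivial. rewrite IH, H; auto. Qed.

Lemma Csum_plus (u v : nat -> C) (N : nat) : Csum (fun k => u k + v k) N = Csum u N + Csum v N.
Proof. induction N as [|N IH]; simpl; [ring|rewrite IH; ring]. Qed.

Lemma Csum_minus (u v : nat -> C) (N : nat) : Csum (fun k => u k - v k) N = Csum u N - Csum v N.
Proof. induction N as [|N IH]; simpl; [ring|rewrite IH; ring]. Qed.

Lemma Csum_scal (c : C) (u : nat -> C) (N : nat) : Csum (fun k => c * u k) N = c * Csum u N.
Proof. induction N as [|N IH]; simpl; [ring|rewrite IH; ring]. Qed.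

Lemma Csum_shift (u : nat -> C) (N M : nat) : Csum u (N + M) = Csum u N + Csum (fun k => u (N + k)%nat) M.
Proof.
induction M as [|M IH]; simpl.
- rewrite Nat.add_0_r. ring.
- rewrite Nat.add_succ_r. simpl. rewrite IH. ring.
Qed.

Lemma sum_n_Csum (u : nat -> C) (N : nat) : @sum_n C_AbelianMonoid u N = Csum u (S N).
Proof.
induction N as [|N IH].
- rewrite sum_O. simpl. ring.
- rewrite sum_Sn, IH. reflexivity.
Qed.

Fixpoint Rsum (u : nat -> R) (N : nat) : R :=
  match N with 0%nat => 0%R | S N' => (Rsum u N' + u N')%R end.

Lemma sum_n_Rsum (u : nat -> R) (N : nat) : @sum_n R_AbelianMonoid u N = Rsum u (S N).
Proof.
induction N as [|N IH].
- rewrite sum_O. simpl. ring.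
- rewrite sum_Sn, IH. reflexivity.
Qed.

Lemma Rsum_le (u v : nat -> R) (N : nat) : (forall k, (k < N)%nat -> u k <= v k)%R -> (Rsum u N <= Rsum v N)%R.
Proof. induction N as [|N IH]; intros H; simpl; [lra|]. pose proof (H N ltac:(lia)). assert (Rsum u N <= Rsum v N)%R by auto. lra. Qed.

Lemma Cmod_Csum (u : nat -> C) (N : nat) : (Cmod (Csum u N) <= Rsum (fun k => Cmod (u k)) N)%R.
Proof.
induction N as [|N IH]; simpl; [rewrite Cmod_0; lra|].
pose proof (Cmod_triangle (Csum u N) (u N)). lra.
Qed.

Lemma Re_Csum (u : nat -> C) (N : nat) : Re (Csum u N) = Rsum (fun k => Re (u k)) N.
Proof. induction N as [|N IH]; trivial. simpl Csum; simpl Rsum. now rewrite re_plus, IH. Qed.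

Lemma Im_Csum (u : nat -> C) (N : nat) : Im (Csum u N) = Rsum (fun k => Im (u k)) N.
Proof. induction N as [|N IH]; trivial. simpl Csum; simpl Rsum. now rewrite im_plus, IH. Qed.

Lemma Rsum_lim (u : nat -> R) (l : R) : is_series u l -> is_lim_seq (Rsum u) l.
Proof.
intros H. apply is_lim_seq_incr_1. eapply is_lim_seq_ext; [|exact H].
intros n. apply sum_n_Rsum.
Qed.

Lemma Rsum_lim_inv (u : nat -> R) (l : R) : is_lim_seq (Rsum u) l -> is_series u l.
Proof.
intros H. apply is_lim_seq_incr_1 in H. red.
apply (is_lim_seq_ext (fun n => Rsum u (S n)) (sum_n u) l); trivial.
intros n. symmetry. apply sum_n_Rsum.
Qed.

Definition Cabs (u : nat -> C) : Prop := ex_series (fun n => Cmod (u n)).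

Lemma Cabs_le (u : nat -> C) (b : nat -> R) :
  (forall n, Cmod (u n) <= b n)%R -> ex_series b -> Cabs u.
Proof.
intros H Hb. apply (ex_series_le (K := R_AbsRing) (V := R_CompleteNormedModule) _ b); trivial.
intros n. change (norm (Cmod (u n))) with (Rabs (Cmod (u n))).
rewrite Rabs_pos_eq by apply Cmod_ge_0. apply H.
Qed.

Lemma Cabs_Re (u : nat -> C) : Cabs u -> ex_series (fun n => Re (u n)).
Proof.
intros H. apply (ex_series_le (K := R_AbsRing) (V := R_CompleteNormedModule) _ (fun n => Cmod (u n))); trivial.
intros n. apply Cmod_ge_Re.
Qed.

Lemma Cabs_Im (u : nat -> C) : Cabs u -> ex_series (fun n => Im (u n)).
Proof.
intros H. apply (ex_series_le (K := R_AbsRing) (V := R_CompleteNormedModule) _ (fun n => Cmod (u n))); trivial.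
intros n. apply Cmod_ge_Im.
Qed.

Lemma CSeries_lim (u : nat -> C) : Cabs u -> Clim (Csum u) (CSeries u).
Proof.
intros H. apply Clim_parts.
- eapply is_lim_seq_ext; [intros n; symmetry; apply Re_Csum|].
  apply Rsum_lim, Series_correct. now apply Cabs_Re.
- eapply is_lim_seq_ext; [intros n; symmetry; apply Im_Csum|].
  apply Rsum_lim, Series_correct. now apply Cabs_Im.
Qed.

Lemma CSeries_unique (u : nat -> C) (l : C) : Clim (Csum u) l -> CSeries u = l.
Proof.
intros H. apply C_eq; simpl; apply is_series_unique, Rsum_lim_inv.
- eapply is_lim_seq_ext; [intros n; apply Re_Csum|]. now apply Clim_Re.
- eapply is_lim_seq_ext; [intros n; apply Im_Csum|]. now apply Clim_Im.
Qed.

Lemma CSeries_ext (u v : nat -> C) : (forall n, u n = v n) -> CSeries u = CSeries v.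
Proof. intros H. unfold CSeries. f_equal; apply Series_ext; intros; now rewrite H. Qed.

Lemma Cabs_ext (u v : nat -> C) : (forall n, u n = v n) -> Cabs u -> Cabs v.
Proof. intros H. apply ex_series_ext. intros; now rewrite H. Qed.

Lemma Cabs_plus (u v : nat -> C) : Cabs u -> Cabs v -> Cabs (fun n => u n + v n).
Proof.
intros H1 H2. apply Cabs_le with (fun n => Cmod (u n) + Cmod (v n))%R.
- intros; apply Cmod_triangle.
- now apply (ex_series_plus (V := R_NormedModule)).
Qed.

Lemma Cabs_scal (c : C) (u : nat -> C) : Cabs u -> Cabs (fun n => c * u n).
Proof.
intros H1. apply Cabs_le with (fun n => Cmod c * Cmod (u n))%R.
- intros; rewrite Cmod_mult; lra.
- now apply (ex_series_scal (K:=R_AbsRing) (V := R_NormedModule) (Cmod c)).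
Qed.

Lemma CSeries_plus (u v : nat -> C) : Cabs u -> Cabs v ->
  CSeries (fun n => u n + v n) = CSeries u + CSeries v.
Proof.
intros H1 H2. apply CSeries_unique.
eapply Clim_ext; [intros n; symmetry; apply Csum_plus|].
apply Clim_plus; now apply CSeries_lim.
Qed.

Lemma CSeries_scal (c : C) (u : nat -> C) : Cabs u -> CSeries (fun n => c * u n) = c * CSeries u.
Proof.
intros H1. apply CSeries_unique.
eapply Clim_ext; [intros n; symmetry; apply Csum_scal|].
apply Clim_scal; now apply CSeries_lim.
Qed.

Lemma Cabs_minus (u v : nat -> C) : Cabs u -> Cabs v -> Cabs (fun n => u n - v n).
Proof.
intros H1 H2. eapply Cabs_ext; [|apply Cabs_plus; [exact H1|apply (Cabs_scal (-1)); exact H2]].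
intros; simpl; ring.
Qed.

Lemma CSeries_minus (u v : nat -> C) : Cabs u -> Cabs v ->
  CSeries (fun n => u n - v n) = CSeries u - CSeries v.
Proof.
intros H1 H2. apply CSeries_unique.
eapply Clim_ext; [intros n; symmetry; apply Csum_minus|].
apply Clim_minus; now apply CSeries_lim.
Qed.

Lemma Cmod_CSeries (u : nat -> C) (b : nat -> R) :
  (forall n, Cmod (u n) <= b n)%R -> ex_series b -> (Cmod (CSeries u) <= Series b)%R.
Proof.
intros H Hb. assert (Hu := Cabs_le u b H Hb).
apply Clim_bound with (Csum u); [|now apply CSeries_lim].
exists 0%nat; intros n _. eapply Rle_trans; [apply Cmod_Csum|].
eapply Rle_trans; [apply Rsum_le; intros k _; apply H|].
apply (is_lim_seq_incr_compare (Rsum b) (Series b)).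
- apply Rsum_lim, Series_correct, Hb.
- intros k; simpl. pose proof (Cmod_ge_0 (u k)). specialize (H k). lra.
Qed.

Lemma Cabs_incr_n (u : nat -> C) (N : nat) : Cabs u -> Cabs (fun k => u (N + k)%nat).
Proof. intros H. unfold Cabs. now apply (ex_series_incr_n (fun n => Cmod (u n)) N). Qed.

Lemma CSeries_incr_n (u : nat -> C) (N : nat) : Cabs u ->
  CSeries u = Csum u N + CSeries (fun k => u (N + k)%nat).
Proof.
intros H. apply CSeries_unique. apply Clim_incr_n with N.
eapply Clim_ext; [intros n; rewrite Nat.add_comm; symmetry; apply Csum_shift|].
apply Clim_plus; [apply Clim_const|]. now apply CSeries_lim, Cabs_incr_n.
Qed.

Lemma Csum_tail_bound (u : nat -> C) (b : nat -> R) (N : nat) :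
  (forall n, Cmod (u n) <= b n)%R -> ex_series b ->
  (Cmod (CSeries u - Csum u N) <= Series (fun k => b (N + k)%nat))%R.
Proof.
intros H Hb. rewrite (CSeries_incr_n u N) by now apply Cabs_le with b.
replace (_ - _) with (CSeries (fun k => u (N + k)%nat)) by ring.
apply Cmod_CSeries; auto. now apply ex_series_incr_n.
Qed.

Lemma Series_tail_lim (b : nat -> R) : ex_series b -> is_lim_seq (fun N => Series (fun k => b (N + k)%nat)) 0%R.
Proof.
intros H.
apply (is_lim_seq_ext_loc (fun N => Series b - Rsum b N)%R).
- exists 1%nat. intros N HN. rewrite (Series_incr_n b N) by (trivial; lia).
  destruct N as [|N]; [lia|]. simpl pred.
  replace (sum_f_R0 b N) with (Rsum b (S N)); [simpl; ring|].
  rewrite <- sum_n_Reals, sum_n_Rsum. reflexivity.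
- replace (Finite 0) with (Rbar_minus (Series b) (Series b)) by (simpl; f_equal; ring).
  eapply is_lim_seq_minus; [apply is_lim_seq_const|apply Rsum_lim, Series_correct, H|reflexivity].
Qed.

(** * Integrals of continuous complex functions *)

Definition CC (f : R -> C) (x : R) : Prop :=
  continuous (fun y => Re (f y)) x /\ continuous (fun y => Im (f y)) x.

Definition CI (f : R -> C) (a b : R) : C := (RInt (fun y => Re (f y)) a b, RInt (fun y => Im (f y)) a b).

Lemma CD_CC (f : R -> C) (x : R) (l : C) : CD f x l -> CC f x.
Proof. intros [H1 H2]; split; apply (ex_derive_continuous (V := R_NormedModule)); eexists; eassumption. Qed.

Lemma CC_const (c : C) (x : R) : CC (fun _ => c) x.
Proof. eapply CD_CC, CD_const. Qed.

Lemma CC_RtoC (f : R -> R) (x : R) : continuous f x -> CC (fun y => RtoC (f y)) x.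
Proof. intros H; split; simpl; trivial. apply continuous_const. Qed.

Lemma CC_plus (f g : R -> C) (x : R) : CC f x -> CC g x -> CC (fun y => f y + g y) x.
Proof. intros [H1 H2] [H3 H4]; split; simpl; now apply (continuous_plus (V := R_NormedModule)). Qed.

Lemma CC_minus (f g : R -> C) (x : R) : CC f x -> CC g x -> CC (fun y => f y - g y) x.
Proof.
intros [H1 H2] [H3 H4]; split.
- now apply (continuous_minus (V := R_NormedModule) (fun y => Re (f y)) (fun y => Re (g y))).
- now apply (continuous_minus (V := R_NormedModule) (fun y => Im (f y)) (fun y => Im (g y))).
Qed.

Lemma CC_mult (f g : R -> C) (x : R) : CC f x -> CC g x -> CC (fun y => f y * g y) x.
Proof.
intros [H1 H2] [H3 H4]; split; simpl.
- apply (continuous_minus (V := R_NormedModule) (fun y => Re (f y) * Re (g y))%R (fun y => Im (f y) * Im (g y))%R);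
  now apply (continuous_mult (K := R_AbsRing)).
- apply (continuous_plus (V := R_NormedModule) (fun y => Re (f y) * Im (g y))%R (fun y => Im (f y) * Re (g y))%R);
  now apply (continuous_mult (K := R_AbsRing)).
Qed.

Lemma CC_Cexp (f : R -> C) (x : R) : CC f x -> CC (fun y => Cexp (f y)) x.
Proof.
intros [H1 H2].
assert (He : continuous (fun y => exp (Re (f y))) x)
  by (apply (continuous_comp (fun y => Re (f y)) exp); trivial; apply continuous_exp).
split.
- apply (continuous_ext (fun y => exp (Re (f y)) * cos (Im (f y)))%R).
  { intros; unfold Cexp, Re, Im; simpl; ring. }
  apply (continuous_mult (K := R_AbsRing)); trivial.
  apply (continuous_comp (fun y => Im (f y)) cos); trivial; apply continuous_cos.
- apply (continuous_ext (fun y => exp (Re (f y)) * sin (Im (f y)))%R).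
  { intros; unfold Cexp, Re, Im; simpl; ring. }
  apply (continuous_mult (K := R_AbsRing)); trivial.
  apply (continuous_comp (fun y => Im (f y)) sin); trivial; apply continuous_sin.
Qed.

Lemma CC_ext (f g : R -> C) (x : R) : (forall y, f y = g y) -> CC f x -> CC g x.
Proof.
intros E [H1 H2]; split.
- apply (continuous_ext (fun y => Re (f y))); trivial. intros; simpl; now rewrite E.
- apply (continuous_ext (fun y => Im (f y))); trivial. intros; simpl; now rewrite E.
Qed.

Lemma CC_Csum (f : nat -> R -> C) (N : nat) (x : R) : (forall k, CC (f k) x) -> CC (fun y => Csum (fun k => f k y) N) x.
Proof. intros H. induction N as [|N IH]; simpl; [apply CC_const|now apply CC_plus]. Qed.

Definition Con (f : R -> C) (a b : R) : Prop := forall x, (a <= x <= b)%R -> CC f x.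

Lemma Con_ex (f : R -> C) (a b : R) : (a <= b)%R -> Con f a b ->
  ex_RInt (fun y => Re (f y)) a b /\ ex_RInt (fun y => Im (f y)) a b.
Proof.
intros Hab H; split; apply (ex_RInt_continuous (V := R_CompleteNormedModule));
 intros z Hz; rewrite Rmin_left, Rmax_right in Hz by trivial; now apply H.
Qed.

Lemma CI_ext (f g : R -> C) (a b : R) : (a <= b)%R -> (forall x, (a < x < b)%R -> f x = g x) -> CI f a b = CI g a b.
Proof.
intros Hab H. unfold CI. f_equal; apply RInt_ext; intros x Hx; rewrite Rmin_left, Rmax_right in Hx by trivial; now rewrite H.
Qed.

Lemma CI_plus (f g : R -> C) (a b : R) : (a <= b)%R -> Con f a b -> Con g a b ->
  CI (fun x => f x + g x) a b = CI f a b + CI g a b.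
Proof.
intros Hab Hf Hg. destruct (Con_ex f a b Hab Hf), (Con_ex g a b Hab Hg).
apply C_eq; simpl; now apply (RInt_plus (V := R_CompleteNormedModule)).
Qed.

Lemma CI_scal (c : C) (f : R -> C) (a b : R) : (a <= b)%R -> Con f a b ->
  CI (fun x => c * f x) a b = c * CI f a b.
Proof.
intros Hab Hf. destruct (Con_ex f a b Hab Hf) as [H1 H2].
assert (E : forall k (h : R -> R), ex_RInt h a b -> RInt (fun x => k * h x)%R a b = (k * RInt h a b)%R)
  by (intros; now apply (RInt_scal (V := R_CompleteNormedModule))).
assert (E' : forall k (h : R -> R), ex_RInt h a b -> ex_RInt (fun x => k * h x)%R a b)
  by (intros; now apply (ex_RInt_scal (V := R_CompleteNormedModule))).
apply C_eq; simpl.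
- unfold Re, Im in *. rewrite (RInt_minus (V := R_CompleteNormedModule) (fun y => fst c * fst (f y))%R (fun y => snd c * snd (f y))%R) by now apply E'.
  rewrite !E by trivial. reflexivity.
- unfold Re, Im in *. rewrite (RInt_plus (V := R_CompleteNormedModule) (fun y => fst c * snd (f y))%R (fun y => snd c * fst (f y))%R) by now apply E'.
  rewrite !E by trivial. reflexivity.
Qed.

Lemma Con_scal (c : C) (f : R -> C) (a b : R) : Con f a b -> Con (fun x => c * f x) a b.
Proof. intros H x Hx. apply CC_mult; [apply CC_const|now apply H]. Qed.

Lemma Con_minus (f g : R -> C) (a b : R) : Con f a b -> Con g a b -> Con (fun x => f x - g x) a b.
Proof. intros H H' x Hx. apply CC_minus; auto. Qed.

Lemma CI_minus (f g : R -> C) (a b : R) : (a <= b)%R -> Con f a b -> Con g a b ->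
  CI (fun x => f x - g x) a b = CI f a b - CI g a b.
Proof.
intros Hab Hf Hg. rewrite (CI_ext _ (fun x => f x + (-1) * g x)) by (trivial; intros; ring).
rewrite CI_plus, CI_scal by (trivial; now apply Con_scal). ring.
Qed.

Lemma CI_Csum (f : nat -> R -> C) (a b : R) (N : nat) : (a <= b)%R -> (forall k, Con (f k) a b) ->
  CI (fun x => Csum (fun k => f k x) N) a b = Csum (fun k => CI (f k) a b) N.
Proof.
intros Hab H. induction N as [|N IH]; simpl.
- apply C_eq; simpl; rewrite RInt_const; unfold scal; simpl; unfold mult; simpl; apply Rmult_0_r.
- rewrite CI_plus, IH; trivial. intros x Hx. apply CC_Csum. intros k. now apply H.
Qed.

Lemma CI_bound (f : R -> C) (m : R -> R) (a b : R) : (a <= b)%R -> Con f a b -> ex_RInt m a b ->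
  (forall x, (a < x < b)%R -> Cmod (f x) <= m x)%R -> (Cmod (CI f a b) <= RInt m a b)%R.
Proof.
intros Hab Hf Hm Hle. apply Cmod_le_rot. intros c Hc.
rewrite <- CI_scal by trivial. simpl.
apply RInt_le; trivial.
- now apply (Con_ex (fun x => c * f x)), Con_scal.
- intros x Hx. change (Re (c * f x) <= m x)%R.
  pose proof (Rle_abs (Re (c * f x))). pose proof (Cmod_ge_Re (c * f x)).
  rewrite Cmod_mult in H0. specialize (Hle x Hx).
  pose proof (Rmult_le_compat_r (Cmod (f x)) (Cmod c) 1 (Cmod_ge_0 _) Hc). lra.
Qed.

Lemma CI_bound_const (f : R -> C) (B a b : R) : (a <= b)%R -> Con f a b ->
  (forall x, (a < x < b)%R -> Cmod (f x) <= B)%R -> (Cmod (CI f a b) <= B * (b - a))%R.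
Proof.
intros Hab Hf H. replace (B * (b - a))%R with (RInt (fun _ => B) a b).
- apply CI_bound; trivial. apply ex_RInt_const.
- rewrite RInt_const. unfold scal; simpl; unfold mult; simpl. ring.
Qed.

Lemma CI_Chasles (f : R -> C) (a b c : R) : (a <= b)%R -> (b <= c)%R -> Con f a c ->
  CI f a c = CI f a b + CI f b c.
Proof.
intros Hab Hbc Hf.
assert (H1 : Con f a b) by (intros x Hx; apply Hf; lra).
assert (H2 : Con f b c) by (intros x Hx; apply Hf; lra).
destruct (Con_ex f a b Hab H1), (Con_ex f b c Hbc H2).
apply C_eq; simpl; symmetry; now apply (RInt_Chasles (V := R_CompleteNormedModule)).
Qed.

Lemma CI_FTC (F f : R -> C) (a b : R) : (a <= b)%R ->
  (forall x, (a <= x <= b)%R -> CD F x (f x)) -> Con f a b -> CI f a b = F b - F a.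
Proof.
intros Hab H Hf.
apply C_eq; simpl; apply is_RInt_unique;
  [apply (is_RInt_derive (fun y => Re (F y))) | apply (is_RInt_derive (fun y => Im (F y)))];
  intros x Hx; rewrite Rmin_left, Rmax_right in Hx by trivial; try (now apply H); now apply Hf.
Qed.

Lemma CC_lin (f : R -> C) (u v y : R) : CC f (u * y + v)%R -> CC (fun y => f (u * y + v)%R) y.
Proof.
assert (Hl : continuous (fun y => u * y + v)%R y)
  by (apply (ex_derive_continuous (V := R_NormedModule)); auto_derive; trivial).
intros [H1 H2]; split.
- apply (continuous_comp (fun y => u * y + v)%R (fun y => Re (f y))); trivial.
- apply (continuous_comp (fun y => u * y + v)%R (fun y => Im (f y))); trivial.
Qed.

Lemma CI_comp_lin (f : R -> C) (u v a b : R) : (0 < u)%R -> (a <= b)%R -> Con f (u * a + v) (u * b + v) ->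
  CI f (u * a + v) (u * b + v) = u * CI (fun y => f (u * y + v)%R) a b.
Proof.
intros Hu Hab Hf.
assert (Hab' : (u * a + v <= u * b + v)%R) by nra.
destruct (Con_ex f _ _ Hab' Hf) as [H1 H2].
assert (Hc : Con (fun y => f (u * y + v)%R) a b).
{ intros x Hx. apply CC_lin, Hf. nra. }
destruct (Con_ex _ _ _ Hab Hc) as [H3 H4].
apply C_eq; rewrite ?re_scal_l, ?im_scal_l; simpl.
- rewrite <- (RInt_comp_lin (V := R_CompleteNormedModule) (fun y => Re (f y))) by trivial.
  now apply (RInt_scal (V := R_CompleteNormedModule)).
- rewrite <- (RInt_comp_lin (V := R_CompleteNormedModule) (fun y => Im (f y))) by trivial.
  now apply (RInt_scal (V := R_CompleteNormedModule)).
Qed.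

(** * Euler-Maclaurin summation *)

(* The Bernoulli polynomial [B_3 / 6]. *)
Definition kap (u : R) : R := (u ^ 3 / 6 - u ^ 2 / 4 + u / 12)%R.

Lemma kap_bound (u : R) : (0 <= u <= 1)%R -> (Rabs (kap u) <= 1)%R.
Proof. intros H. apply Rabs_le. unfold kap. nra. Qed.

Definition em (f3 : R -> C) (n : nat) : C :=
  CI (fun x => kap (x - INR n) * f3 x) (INR n) (INR n + 1).

Lemma em_con (f3 : R -> C) (n : nat) : Con f3 (INR n) (INR n + 1) ->
  Con (fun x => kap (x - INR n) * f3 x) (INR n) (INR n + 1).
Proof.
intros H x Hx. apply CC_mult; [|now apply H].
apply CC_RtoC. apply (ex_derive_continuous (V := R_NormedModule)). unfold kap. auto_derive. trivial.
Qed.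

(** Three integrations by parts packed into one antiderivative, with [kap' = k1], [k1' = k2],
    [k2' = 1]. Since [kap] vanishes at 0 and 1, no [f2] term survives; [k1] is [1/12] at both ends,
    and [k2] is [-1/2] and [1/2], which gives the trapezoidal term. *)
Lemma em_step (Q f f1 f2 f3 : R -> C) (n : nat) :
  (forall x, INR n <= x <= INR n + 1 -> CD Q x (f x))%R ->
  (forall x, INR n <= x <= INR n + 1 -> CD f x (f1 x))%R ->
  (forall x, INR n <= x <= INR n + 1 -> CD f1 x (f2 x))%R ->
  (forall x, INR n <= x <= INR n + 1 -> CD f2 x (f3 x))%R ->
  Con f3 (INR n) (INR n + 1) ->
  em f3 n = (f (INR n) + f (INR n + 1)%R) / 2 - (Q (INR n + 1)%R - Q (INR n))
            - (f1 (INR n + 1)%R - f1 (INR n)) / 12.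
Proof.
intros HQ Hf Hf1 Hf2 Hc.
set (k1 := fun u : R => (u ^ 2 / 2 - u / 2 + 1 / 12)%R).
set (k2 := fun u : R => (u - 1 / 2)%R).
unfold em.
rewrite (CI_FTC (fun x => kap (x - INR n) * f2 x - k1 (x - INR n)%R * f1 x + k2 (x - INR n)%R * f x - Q x)).
- unfold kap, k1, k2. replace (INR n + 1 - INR n)%R with 1%R by ring.
  replace (INR n - INR n)%R with 0%R by ring.
  rewrite ?Rminus_0_l.
  replace (1 ^ 3 / 6 - 1 ^ 2 / 4 + 1 / 12)%R with 0%R by field.
  replace (0 ^ 3 / 6 - 0 ^ 2 / 4 + 0 / 12)%R with 0%R by field.
  replace (1 ^ 2 / 2 - 1 / 2 + 1 / 12)%R with (/ 12)%R by field.
  replace (0 ^ 2 / 2 - 0 / 2 + 1 / 12)%R with (/ 12)%R by field.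
  replace (1 - 1 / 2)%R with (/ 2)%R by field.
  replace (- (1 / 2))%R with (- / 2)%R by field.
  rewrite RtoC_opp, !RtoC_inv by lra.
  field.
- lra.
- intros x Hx.
  eapply CD_eq.
  + apply CD_minus; [apply CD_plus; [apply CD_minus|]|].
    * apply CD_mult; [apply CD_RtoC with (l := k1 (x - INR n)%R)|apply Hf2, Hx].
      unfold kap, k1. auto_derive; trivial; field.
    * apply CD_mult; [apply CD_RtoC with (l := k2 (x - INR n)%R)|apply Hf1, Hx].
      unfold k1, k2. auto_derive; trivial; field.
    * apply CD_mult; [apply CD_RtoC with (l := 1%R)|apply Hf, Hx].
      unfold k2. auto_derive; trivial; field.
    * apply HQ, Hx.
  + cbv beta. ring.
- now apply em_con.
Qed.

Lemma em_sum (Q f f1 f2 f3 : R -> C) (N : nat) :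
  (forall x, 1 <= x -> CD Q x (f x))%R ->
  (forall x, 1 <= x -> CD f x (f1 x))%R ->
  (forall x, 1 <= x -> CD f1 x (f2 x))%R ->
  (forall x, 1 <= x -> CD f2 x (f3 x))%R ->
  (forall x, 1 <= x -> CC f3 x)%R ->
  Csum (fun k => em f3 (S k)) N =
  Csum (fun k => f (INR (S k))) N + (f (INR (S N)) - f 1%R) / 2
  - (Q (INR (S N)) - Q 1%R) - (f1 (INR (S N)) - f1 1%R) / 12.
Proof.
intros HQ Hf Hf1 Hf2 Hc. induction N as [|N IH].
- simpl. field.
- rewrite !Csum_S, IH.
  assert (H1 : (1 <= INR (S N))%R) by (rewrite S_INR; pose proof (pos_INR N); lra).
  rewrite (em_step Q f f1 f2) by (intros x Hx; (apply HQ || apply Hf || apply Hf1 || apply Hf2 || apply Hc); lra).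
  rewrite <- (S_INR (S N)). field.
Qed.

Lemma em_bound (f3 : R -> C) (n : nat) (B : R) : Con f3 (INR n) (INR n + 1) ->
  (forall x, INR n < x < INR n + 1 -> Cmod (f3 x) <= B)%R -> (Cmod (em f3 n) <= B)%R.
Proof.
intros Hc HB. unfold em. replace B with (B * (INR n + 1 - INR n))%R by ring.
apply CI_bound_const; [lra|now apply em_con|].
intros x Hx. rewrite Cmod_mult, Cmod_R. specialize (HB x Hx).
pose proof (kap_bound (x - INR n) ltac:(lra)). pose proof (Cmod_ge_0 (f3 x)). pose proof (Rabs_pos (kap (x - INR n))).
nra.
Qed.

Lemma em_scal (c : C) (f : R -> C) (n : nat) : Con f (INR n) (INR n + 1) ->
  em (fun x => c * f x) n = c * em f n.
Proof.
intros H. unfold em. rewrite <- CI_scal; [|lra|now apply em_con].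
apply CI_ext; [lra|]. intros; ring.
Qed.

Lemma em_minus (f g : R -> C) (n : nat) : Con f (INR n) (INR n + 1) -> Con g (INR n) (INR n + 1) ->
  em (fun x => f x - g x) n = em f n - em g n.
Proof.
intros H H'. unfold em. rewrite <- CI_minus; [|lra|now apply em_con|now apply em_con].
apply CI_ext; [lra|]. intros; ring.
Qed.

Lemma em_Csum (f : nat -> R -> C) (n N : nat) : (forall k, Con (f k) (INR n) (INR n + 1)) ->
  em (fun x => Csum (fun k => f k x) N) n = Csum (fun k => em (f k) n) N.
Proof.
intros H. unfold em. rewrite <- CI_Csum; [|lra|intros; now apply em_con].
apply CI_ext; [lra|]. intros; now rewrite Csum_scal.
Qed.

(** * Complex powers of positive reals *)

Definition pw (s : C) (x : R) : C := Cexp (s * ln x).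

Lemma CD_ln (x : R) : (0 < x)%R -> CD (fun y => RtoC (ln y)) x (/ x)%R.
Proof. intros H. apply CD_RtoC. auto_derive; trivial; field; lra. Qed.

Lemma pw_minus_1 (s : C) (x : R) : (0 < x)%R -> pw (s - 1) x = pw s x * (/ x)%R.
Proof.
intros H. unfold pw. replace ((s - 1) * ln x) with (s * ln x + (- ln x)%R) by (rewrite RtoC_opp; ring).
now rewrite Cexp_add, Cexp_R, exp_Ropp, exp_ln.
Qed.

Lemma CD_pw (s : C) (x : R) : (0 < x)%R -> CD (pw s) x (s * pw (s - 1) x).
Proof.
intros H. rewrite pw_minus_1 by trivial. unfold pw.
eapply CD_eq.
- apply CD_Cexp, CD_scal, CD_ln, H.
- cbv beta; ring.
Qed.

Lemma Cmod_pw (s : C) (x : R) : Cmod (pw s x) = exp (Re s * ln x).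
Proof. unfold pw. rewrite Cmod_Cexp, re_scal_r. reflexivity. Qed.

Lemma ln_nonneg (x : R) : (1 <= x)%R -> (0 <= ln x)%R.
Proof. intros H. rewrite <- ln_1. apply ln_le; lra. Qed.

Lemma Cmod_pw_le (s : C) (x y a : R) : (1 <= y <= x)%R -> (Re s <= a <= 0)%R -> (Cmod (pw s x) <= exp (a * ln y))%R.
Proof.
intros Hx Hs. rewrite Cmod_pw. pose proof (ln_nonneg y ltac:(lra)).
assert (ln y <= ln x)%R by (apply ln_le; lra).
apply exp_mono. nra.
Qed.

Lemma pw_CC (s : C) (x : R) : (0 < x)%R -> CC (pw s) x.
Proof. intros H. eapply CD_CC, CD_pw, H. Qed.

Lemma pw_con (s : C) (n : nat) : Con (pw s) (INR (S n)) (INR (S n) + 1).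
Proof. intros x Hx. apply pw_CC. pose proof (lt_0_INR (S n) ltac:(lia)). lra. Qed.

(** * Convergence of [sum n^(-3/2)] *)

Lemma ex_series_nonneg_bounded (a : nat -> R) (B : R) :
  (forall n, 0 <= a n)%R -> (forall N, Rsum a N <= B)%R -> ex_series a.
Proof.
intros Ha HB.
destruct (ex_finite_lim_seq_incr (Rsum a) B) as [l Hl].
- intros n. simpl. specialize (Ha n). lra.
- exact HB.
- exists l. now apply Rsum_lim_inv.
Qed.

(** The terms are compared with increments of [- 2 / sqrt x], which telescope. The exponent [3/2] is
    the common majorant of the remainders: it is summable, and falling short of 2 by [1/2] it leaves
    room for the factors [x^(1/2)] in [Jz_LE] and [sqrt |t|] in [em_remainder]. *)
Lemma ex_series_pow_32 : ex_series (fun n => exp (- (3 / 2) * ln (INR (S n))))%R.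
Proof.
apply ex_series_nonneg_bounded with 3%R.
{ intros; left; apply exp_pos. }
assert (H : forall N, (Rsum (fun n => exp (- (3 / 2) * ln (INR (S n)))) (S N) <= 3 - 2 / sqrt (INR (S N)))%R).
{ induction N as [|N IH].
  - simpl. rewrite ln_1, sqrt_1, Rmult_0_r, exp_0. lra.
  - change (Rsum _ (S (S N))) with (Rsum (fun n => exp (- (3 / 2) * ln (INR (S n)))) (S N) + exp (- (3 / 2) * ln (INR (S (S N)))))%R.
    rewrite (S_INR (S N)). set (x := INR (S N)) in *.
    assert (Hx : (1 <= x)%R) by (unfold x; rewrite S_INR; pose proof (pos_INR N); lra).
    replace (exp (- (3 / 2) * ln (x + 1)))%R with (/ (sqrt (x + 1) * (x + 1)))%R.
    2:{ replace (- (3 / 2) * ln (x + 1))%R with (- (ln (x + 1) + / 2 * ln (x + 1)))%R by field.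
        rewrite exp_Ropp, exp_plus, exp_ln by lra.
        rewrite <- Rpower_sqrt by lra. unfold Rpower. rewrite Rmult_comm. reflexivity. }
    set (p := sqrt x) in *. set (q := sqrt (x + 1)).
    assert (Hp : (0 < p)%R) by (apply sqrt_lt_R0; lra).
    assert (Hpq : (p <= q)%R) by (apply sqrt_le_1; lra).
    assert (Ep : (p * p = x)%R) by (apply sqrt_sqrt; lra).
    assert (Eq : (q * q = x + 1)%R) by (apply sqrt_sqrt; lra).
    enough (/ (q * (x + 1)) <= 2 / p - 2 / q)%R by lra.
    replace (2 / p - 2 / q)%R with (2 / (p * q * (p + q)))%R.
    + rewrite <- Eq. apply Rmult_le_reg_r with (q * (q * q) * (p * q * (p + q)))%R.
      { repeat apply Rmult_lt_0_compat; lra. }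
      replace (/ (q * (q * q)) * (q * (q * q) * (p * q * (p + q))))%R with (p * q * (p + q))%R by (field; lra).
      replace (2 / (p * q * (p + q)) * (q * (q * q) * (p * q * (p + q))))%R with (2 * (q * (q * q)))%R by (field; lra).
      assert (p * q <= q * q)%R by nra. assert (0 <= p * q)%R by nra. nra.
    + replace 2%R with (2 * (q * q - p * p))%R at 1 by (rewrite Eq, Ep; ring). field. lra. }
intros [|N]; [simpl; lra|]. specialize (H N).
assert (0 < 2 / sqrt (INR (S N)))%R.
{ apply Rdiv_lt_0_compat; [lra|]. apply sqrt_lt_R0, lt_0_INR. lia. }
lra.
Qed.

(** * The analytic continuation of the zeta function to [Re s >= -1] *)

(* Euler-Maclaurin gives [zeta s = 1/(s-1) + 1/2 + s/12 - s (s+1) (s+2) Jz s]. *)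
Definition Jz (s : C) : C := CSeries (fun k => em (pw (- s - 3)) (S k)).

Lemma Jz_abs (s : C) : (-1 <= Re s)%R -> Cabs (fun k => em (pw (- s - 3)) (S k)).
Proof.
intros Hs. apply Cabs_le with (2 := ex_series_pow_32).
intros k. apply em_bound; [apply pw_con|].
intros x Hx. apply Cmod_pw_le.
- split; [rewrite S_INR; pose proof (pos_INR k)|]; lra.
- unfold Cminus. rewrite re_plus, !re_opp, re_RtoC. lra.
Qed.

Lemma exp_pow_ge (x : R) (K : nat) : (0 <= x)%R -> (x ^ K / INR (fact K) <= exp x)%R.
Proof.
intros Hx.
assert (H : is_series (fun k => x ^ k / INR (fact k))%R (exp x)).
{ pose proof (is_exp_Reals x) as E. unfold is_pseries in E.
  eapply is_series_ext; [|exact E].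
  intros n. rewrite pow_n_pow. reflexivity. }
assert (Hp : forall k, (0 <= x ^ k / INR (fact k))%R).
{ intros k. apply Rmult_le_pos; [now apply pow_le|]. left. apply Rinv_0_lt_compat, INR_fact_lt_0. }
apply Rsum_lim in H.
apply Rle_trans with (Rsum (fun k => x ^ k / INR (fact k))%R (S K)).
- simpl. enough (0 <= Rsum (fun k => x ^ k / INR (fact k))%R K)%R by lra.
  induction K as [|K IH]; simpl; [lra|]. specialize (Hp K). lra.
- apply (is_lim_seq_incr_compare _ (exp x) H). intros n. simpl. specialize (Hp n). lra.
Qed.

(* Restricted to [-1 <= Re s], where [Jz] is known to converge; this still determines the derivative at [-1]. *)
Definition LE (F : C -> C) (s0 : C) : Prop := exists (c : nat -> C) (r : R), (0 < r)%R /\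
  forall w : C, (Cmod w < r)%R -> (-1 <= Re (s0 + w))%R -> Clim (Csum (fun k => c k * Cpow w k)) (F (s0 + w)).

Lemma em_ext (f g : R -> C) (n : nat) : (forall x, INR n < x < INR n + 1 -> f x = g x)%R -> em f n = em g n.
Proof. intros H. unfold em. apply CI_ext; [lra|]. intros x Hx; now rewrite H. Qed.

(** Under the integral, [x^(-w) = e^(-w ln x)] is expanded in powers of [w]. With [a = |w| ln x],
    the bound [a^K / K! <= 2^(-K) e^(2 a)] makes the remainder geometric in [K] at the cost of
    [e^(3 a)]. For [|w| <= 1/6] this cost is at most [x^(1/2)], which is the margin between the
    decay [x^(-2)] guaranteed by [-1 <= Re s0] and the summable [x^(-3/2)]. *)
Lemma Jz_LE (s0 : C) : (-1 <= Re s0)%R -> LE Jz s0.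
Proof.
intros Hs0.
set (g := fun (k : nat) (x : R) => pw (- s0 - 3) x * Cpow (- ln x)%R k / INR (fact k)).
assert (Hf : forall k, RtoC (INR (fact k)) <> 0).
{ intros k E; apply RtoC_inj in E. revert E. apply INR_fact_neq_0. }
assert (Hg : forall k x, (0 < x)%R -> CC (g k) x).
{ intros k x Hx. apply CC_mult; [apply CC_mult; [now apply pw_CC|]|apply CC_const].
  induction k as [|k IH].
  - apply CC_const.
  - eapply CC_ext; [intros; symmetry; apply Cpow_S|]. apply CC_mult; trivial.
    eapply CC_ext; [intros; symmetry; apply RtoC_opp|].
    eapply CD_CC. apply CD_opp, CD_ln, Hx. }
assert (Hgc : forall k n, Con (g k) (INR (S n)) (INR (S n) + 1)).
{ intros k n x Hx. apply Hg. pose proof (lt_0_INR (S n) ltac:(lia)). lra. }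
set (e32 := fun n => exp (- (3 / 2) * ln (INR (S n)))%R).
assert (Hrem : forall (K : nat) (w : C) (n : nat), (Cmod w <= 1 / 6)%R -> (-1 <= Re (s0 + w))%R ->
  (Cmod (em (pw (- (s0 + w) - 3)) (S n) - Csum (fun k => Cpow w k * em (g k) (S n))%C K)
   <= (/ 2) ^ K * e32 n)%R).
{ intros K w n Hw Hre.
  rewrite (Csum_ext _ (fun k => em (fun x => Cpow w k * g k x) (S n)))
    by (intros; symmetry; apply em_scal, Hgc).
  assert (Hgs : forall k, Con (fun x => Cpow w k * g k x) (INR (S n)) (INR (S n) + 1))
    by (intros; apply Con_scal, Hgc).
  assert (Hsum : Con (fun x => Csum (fun k => Cpow w k * g k x) K) (INR (S n)) (INR (S n) + 1)).
  { intros x Hx. apply CC_Csum. intros k. now apply Hgs. }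
  rewrite <- em_Csum by trivial.
  rewrite <- em_minus by (trivial; apply pw_con).
  apply em_bound.
  { apply Con_minus; trivial. apply pw_con. }
  intros x Hx.
  assert (Hn : (1 <= INR (S n))%R) by (rewrite S_INR; pose proof (pos_INR n); lra).
  assert (Hl := ln_nonneg x ltac:(lra)). set (L := ln x) in *.
  assert (E1 : pw (- (s0 + w) - 3) x = pw (- s0 - 3) x * Cexp (w * (- L)%R)).
  { unfold pw. fold L. rewrite <- Cexp_add. f_equal. rewrite RtoC_opp. ring. }
  assert (E2 : Csum (fun k => Cpow w k * g k x) K = pw (- s0 - 3) x * Cexp_taylor K (w * (- L)%R)).
  { clear - Hf. induction K as [|K IH]; [simpl; ring|]; rewrite Csum_S; simpl Cexp_taylor.
    rewrite IH, Cpow_mult_l. unfold g. fold L. field. apply Hf. }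
  rewrite E1, E2. replace (_ - _) with (pw (- s0 - 3) x * (Cexp (w * (- L)%R) - Cexp_taylor K (w * (- L)%R))) by ring.
  rewrite Cmod_mult, Cmod_pw. fold L.
  pose proof (Cexp_taylor_bound K (w * (- L)%R)) as Hb.
  rewrite Cmod_mult, Cmod_R, Rabs_Ropp, Rabs_pos_eq in Hb by trivial.
  set (a := (Cmod w * L)%R) in *.
  assert (Ha : (0 <= a)%R) by (apply Rmult_le_pos; trivial; apply Cmod_ge_0).
  assert (Ha2 : (a <= L / 6)%R) by (unfold a; nra).
  assert (Hq : (a ^ K / INR (fact K) <= (/ 2) ^ K * exp (2 * a))%R).
  { pose proof (exp_pow_ge (2 * a) K ltac:(lra)) as H.
    rewrite Rpow_mult_distr in H. rewrite pow_inv.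
    apply Rmult_le_reg_l with (2 ^ K)%R; [apply pow_lt; lra|].
    rewrite <- Rmult_assoc, Rinv_r by (apply pow_nonzero; lra). lra. }
  pose proof (exp_pos a). pose proof (exp_pos (2 * a)). pose proof (pow_lt (/ 2) K ltac:(lra)).
  apply Rle_trans with (exp (Re (- s0 - 3) * L) * ((/ 2) ^ K * exp (2 * a) * exp a))%R.
  { apply Rmult_le_compat_l; [left; apply exp_pos|]. eapply Rle_trans; [exact Hb|].
    apply Rmult_le_compat_r; lra. }
  replace (exp (Re (- s0 - 3) * L) * ((/ 2) ^ K * exp (2 * a) * exp a))%R
    with ((/ 2) ^ K * exp (Re (- s0 - 3) * L + 2 * a + a))%R by (rewrite !exp_plus; ring).
  apply Rmult_le_compat_l; [lra|]. unfold e32. apply exp_mono.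
  assert (ln (INR (S n)) <= L)%R by (apply ln_le; lra).
  assert (Re (- s0 - 3) <= -2)%R.
  { unfold Cminus. rewrite re_plus, !re_opp, re_RtoC. lra. }
  nra. }
assert (Hgabs : forall k, Cabs (fun n => em (g k) (S n))).
{ (* coefficient [k] is bounded through the remainder estimate at the point [w = 1/6] *)
  intros k. set (w := RtoC (1 / 6)).
  assert (Hw : (Cmod w <= 1 / 6)%R) by (unfold w; rewrite Cmod_RtoC_pos; lra).
  assert (Hre : (-1 <= Re (s0 + w))%R) by (rewrite re_plus; unfold w; rewrite re_RtoC; lra).
  assert (Hwk : Cpow w k <> 0).
  { apply Cpow_nz. unfold w. intros E; apply RtoC_inj in E; lra. }
  eapply Cabs_ext; [|apply (Cabs_scal (/ Cpow w k))].
  - intros n.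
    instantiate (1 := fun n => Cpow w k * em (g k) (S n)). simpl. field. trivial.
  - apply Cabs_le with (fun n => (/ 2) ^ k * e32 n + (/ 2) ^ S k * e32 n)%R.
    + intros n. replace (Cpow w k * em (g k) (S n)) with
        ((em (pw (- (s0 + w) - 3)) (S n) - Csum (fun k => Cpow w k * em (g k) (S n)) k) -
         (em (pw (- (s0 + w) - 3)) (S n) - Csum (fun k => Cpow w k * em (g k) (S n)) (S k)))
        by (rewrite !Csum_S; ring).
      eapply Rle_trans; [apply Cmod_triangle_minus|]. apply Rplus_le_compat; now apply Hrem.
    + apply (ex_series_plus (V := R_NormedModule)); apply (ex_series_scal (V := R_NormedModule)); exact ex_series_pow_32. }
exists (fun k => CSeries (fun n => em (g k) (S n))), (1 / 6)%R. split; [lra|].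
intros w Hw Hre.
apply Clim_squeeze with (fun K => (/ 2) ^ K * Series e32)%R.
- exists 0%nat. intros K _.
  assert (E : Cabs (fun n => Csum (fun k => Cpow w k * em (g k) (S n)) K) /\
     Csum (fun k => CSeries (fun n => em (g k) (S n)) * Cpow w k) K =
     CSeries (fun n => Csum (fun k => Cpow w k * em (g k) (S n)) K)).
  { induction K as [|K [IH1 IH2]].
    - split.
      + simpl. apply Cabs_le with (fun _ => 0%R); [intros; rewrite Cmod_0; lra|].
        exists 0%R. apply Rsum_lim_inv. apply is_lim_seq_ext with (fun _ => 0%R); [|apply is_lim_seq_const].
        induction n; simpl; lra.
      + symmetry. apply CSeries_unique. apply Clim_ext with (fun _ => RtoC 0); [|apply Clim_const].
        induction n as [|n IHn]; simpl in *; trivial. rewrite <- IHn. ring.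
    - assert (Hs : Cabs (fun n => Cpow w K * em (g K) (S n))) by apply Cabs_scal, Hgabs.
      split.
      + exact (Cabs_plus _ _ IH1 Hs).
      + rewrite Csum_S, IH2; transitivity (CSeries (fun n => Csum (fun k => Cpow w k * em (g k) (S n)) K + Cpow w K * em (g K) (S n))); [|reflexivity].
        rewrite CSeries_plus, CSeries_scal by (trivial; apply Hgabs). ring. }
  destruct E as [E1 E2]. rewrite E2, Cmod_minus_sym. unfold Jz.
  rewrite <- CSeries_minus by (trivial; now apply Jz_abs).
  rewrite <- Series_scal_l.
  apply Cmod_CSeries.
  + intros n. apply Hrem; trivial; lra.
  + apply (ex_series_scal (V := R_NormedModule)); exact ex_series_pow_32.
- replace (Finite 0) with (Rbar_mult 0 (Series e32)) by (simpl; f_equal; ring).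
  apply is_lim_seq_scal_r. apply is_lim_seq_geom. rewrite Rabs_pos_eq; lra.
Qed.

(** * Truncation of power series *)

Definition ps (c : nat -> C) (w : C) (k : nat) : C := c k * Cpow w k.

(** Convergence at [w0] bounds the partial sums there, hence the terms [c j * w0^j]; at half the
    radius the tail is dominated by a geometric series. The bound is what allows coefficients to be
    read off from the size of the values. *)
Lemma ps_bound (c : nat -> C) (w0 l : C) (k : nat) : w0 <> 0 -> Clim (Csum (ps c w0)) l ->
  exists B : R, (0 <= B)%R /\ forall w v : C, (Cmod w <= Cmod w0 / 2)%R -> Clim (Csum (ps c w)) v ->
    (Cmod (v - Csum (ps c w) k) <= B * Cmod w ^ k)%R.
Proof.
intros Hw0 Hl. assert (Hp : (0 < Cmod w0)%R) by now apply Cmod_gt_0.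
destruct (maj_by_pos (fun n => Cmod (Csum (ps c w0) n))) as [M [HM0 HM]].
{ exists (Cmod l). apply is_lim_seq_Reals. now apply Clim_Cmod. }
assert (Hterm : forall j, (Cmod (c j) * Cmod w0 ^ j <= 2 * M)%R).
{ intros j. rewrite <- Cmod_pow, <- Cmod_mult.
  change (c j * Cpow w0 j) with (ps c w0 j).
  replace (ps c w0 j) with (Csum (ps c w0) (S j) - Csum (ps c w0) j) by (rewrite Csum_S; ring).
  pose proof (HM j) as H1. pose proof (HM (S j)) as H2.
  rewrite Rabs_pos_eq in H1, H2 by apply Cmod_ge_0.
  pose proof (Cmod_triangle_minus (Csum (ps c w0) (S j)) (Csum (ps c w0) j)). lra. }
assert (Hgeo : forall N, (Rsum (fun j => (/ 2) ^ j) N <= 2)%R).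
{ intros N. assert (E : (Rsum (fun j => (/ 2) ^ j) N = 2 - 2 * (/ 2) ^ N)%R).
  { induction N as [|N IH]; simpl; [ring|rewrite IH; field]. }
  pose proof (pow_lt (/ 2) N ltac:(lra)). lra. }
exists (4 * M / Cmod w0 ^ k)%R. split.
{ apply Rmult_le_pos; [lra|]. left. apply Rinv_0_lt_compat, pow_lt, Hp. }
intros w v Hw Hv.
assert (Hq : (Cmod w / Cmod w0 <= / 2)%R).
{ apply Rmult_le_reg_r with (Cmod w0); trivial. unfold Rdiv. rewrite Rmult_assoc, Rinv_l by lra. lra. }
assert (Hq0 : (0 <= Cmod w / Cmod w0)%R).
{ apply Rmult_le_pos; [apply Cmod_ge_0|]. left. now apply Rinv_0_lt_compat. }
set (q := (Cmod w / Cmod w0)%R) in *.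
apply Clim_bound with (fun n => Csum (ps c w) (n + k)%nat - Csum (ps c w) k).
- exists 0%nat. intros n _.
  rewrite (Nat.add_comm n k), Csum_shift.
  replace (_ - _) with (Csum (fun j => ps c w (k + j)%nat) n) by ring.
  eapply Rle_trans; [apply Cmod_Csum|].
  apply Rle_trans with (Rsum (fun j => 2 * M * q ^ k * (/ 2) ^ j)%R n).
  + apply Rsum_le. intros j _. unfold ps. rewrite Cmod_mult, Cmod_pow.
    replace (Cmod w) with (q * Cmod w0)%R by (unfold q; field; lra).
    rewrite Rpow_mult_distr. rewrite (pow_add q k j).
    pose proof (pow_le q k Hq0). pose proof (pow_le q j Hq0). pose proof (pow_incr q (/2) j ltac:(lra)).
    pose proof (Hterm (k + j)%nat). pose proof (Rmult_le_pos _ _ (Cmod_ge_0 (c (k + j)%nat)) (pow_le (Cmod w0) (k + j) ltac:(lra))).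
    apply Rle_trans with (2 * M * (q ^ k * q ^ j))%R.
    * replace (Cmod (c (k + j)%nat) * (q ^ k * q ^ j * Cmod w0 ^ (k + j)))%R with
       ((Cmod (c (k + j)%nat) * Cmod w0 ^ (k + j)) * (q ^ k * q ^ j))%R by ring.
      apply Rmult_le_compat_r; [nra|lra].
    * replace (2 * M * q ^ k * (/ 2) ^ j)%R with (2 * M * (q ^ k * (/ 2) ^ j))%R by ring. apply Rmult_le_compat_l; [lra|]. apply Rmult_le_compat_l; lra.
  + assert (E : forall b, Rsum (fun j => b * (/ 2) ^ j)%R n = (b * Rsum (fun j => (/ 2) ^ j) n)%R).
    { intros b. induction n as [|n IH]; simpl; [ring|rewrite IH; ring]. }
    rewrite E. specialize (Hgeo n).
    replace (4 * M / Cmod w0 ^ k * Cmod w ^ k)%R with (2 * M * q ^ k * 2)%R.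
    * apply Rmult_le_compat_l; trivial. pose proof (pow_le q k Hq0). apply Rmult_le_pos; lra.
    * unfold q. unfold Rdiv. rewrite Rpow_mult_distr, pow_inv. field. apply pow_nonzero. lra.
- apply Clim_minus; [|apply Clim_const]. now apply Clim_incr_n'.
Qed.

(** * Uniqueness of analytic continuation along a segment *)

(** Let [m] be the supremum of the [t] such that [g] vanishes on [[0, t]]. As [m >= d > 0], there
    are zeros [m - h] arbitrarily close on the left, and they force the coefficients of the
    expansion at [m] to vanish one after the other. Then [g] is zero on both sides of [m], so
    [m < 1] is impossible. *)
Lemma segment_identity (g : R -> C) (d : R) : (0 < d <= 1)%R ->
  (forall x, 0 <= x <= d -> g x = 0)%R ->
  (forall x0, (0 <= x0 <= 1)%R -> exists (c : nat -> C) (r : R), (0 < r)%R /\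
     forall h : R, (Rabs h < r)%R -> (0 <= x0 + h <= 1)%R -> Clim (Csum (ps c h)) (g (x0 + h)%R)) ->
  forall x, (0 <= x <= 1)%R -> g x = 0.
Proof.
intros Hd Hz HLE.
set (E := fun t => (0 <= t <= 1)%R /\ forall x, (0 <= x <= t)%R -> g x = 0).
destruct (completeness E) as [m [Hub Hlub]].
{ exists 1%R. intros t [Ht _]. lra. }
{ exists d. split; [lra|exact Hz]. }
assert (Hm : (d <= m)%R) by (apply Hub; split; [lra|exact Hz]).
assert (Hm1 : (m <= 1)%R) by (apply Hlub; intros t [Ht _]; lra).
assert (Hbelow : forall x, (0 <= x < m)%R -> g x = 0).
{ intros x Hx. apply NNPP. intros Hn.
  assert (m <= x)%R; [|lra]. apply Hlub. intros t [Ht Ht'].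
  destruct (Rle_dec t x) as [|Htx]; trivial. exfalso. apply Hn, Ht'. lra. }
destruct (HLE m ltac:(lra)) as [c [r [Hr Hc]]].
assert (Hck : forall k, c k = 0).
{ intros k. induction k as [k IH] using lt_wf_ind.
  (* The minimum with [m] keeps [m - rho] inside the segment. *)
  set (rho := Rmin (r / 2) m).
  assert (Hrho : (0 < rho)%R) by (apply Rmin_glb_lt; lra).
  assert (rho <= r / 2)%R by apply Rmin_l. assert (rho <= m)%R by apply Rmin_r.
  assert (Hrn : RtoC (- rho)%R <> 0) by (intros F; apply RtoC_inj in F; lra).
  destruct (ps_bound c (- rho)%R (g (m + - rho)%R) (S k) Hrn) as [B [HB0 HB]].
  { apply Hc; [rewrite Rabs_Ropp, Rabs_pos_eq; lra|lra]. }
  rewrite Cmod_R, Rabs_Ropp, Rabs_pos_eq in HB by lra.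
  assert (Hh : forall h, (0 < h <= rho / 2)%R -> (Cmod (c k) <= B * h)%R).
  { intros h Hh. specialize (HB (- h)%R (g (m + - h)%R)).
    rewrite Cmod_R, Rabs_Ropp, Rabs_pos_eq in HB by lra.
    specialize (HB ltac:(lra)).
    assert (Hlim : Clim (Csum (ps c (- h)%R)) (g (m + - h)%R))
      by (apply Hc; [rewrite Rabs_Ropp, Rabs_pos_eq; lra|lra]).
    specialize (HB Hlim). rewrite Hbelow in HB by lra.
    rewrite Csum_S in HB.
    replace (Csum (ps c (- h)%R) k) with (RtoC 0) in HB.
    2:{ symmetry. clear - IH. assert (forall n, (n <= k)%nat -> Csum (ps c (- h)%R) n = 0).
        { intros n. induction n as [|n IHn]; intros Hn; simpl; trivial.
          rewrite IHn by lia. unfold ps. rewrite IH by lia. ring. }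
        now apply H. }
    replace (0 - (0 + ps c (- h)%R k)) with (- ps c (- h)%R k) in HB by ring.
    unfold ps in HB. rewrite Cmod_opp, Cmod_mult, Cmod_pow, Cmod_R, Rabs_Ropp, Rabs_pos_eq in HB by lra.
    simpl in HB. pose proof (pow_lt h k ltac:(lra)). nra. }
  apply Cmod_eq_0. apply Rle_antisym; [|apply Cmod_ge_0].
  apply le_epsilon. intros eps He.
  set (h := Rmin (rho / 2) (eps / (B + 1))%R).
  assert (H1 : (0 < h)%R) by (apply Rmin_glb_lt; [lra|apply Rdiv_lt_0_compat; lra]).
  assert (H2 : (h <= rho / 2)%R) by apply Rmin_l.
  assert (H3 : (h <= eps / (B + 1))%R) by apply Rmin_r.
  specialize (Hh h ltac:(lra)).
  assert (eps / (B + 1) * (B + 1) = eps)%R by (field; lra).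
  nra. }
assert (Hnear : forall x, (0 <= x <= 1)%R -> (Rabs (x - m) < r)%R -> g x = 0).
{ intros x Hx Hxr. replace x with (m + (x - m))%R by ring.
  apply Clim_unique with (Csum (ps c (x - m)%R)).
  - apply Hc; [trivial|lra].
  - eapply Clim_ext; [|apply Clim_const].
    intros n. induction n as [|n IHn]; simpl; trivial. rewrite <- IHn. unfold ps. rewrite Hck. ring. }
assert (m = 1)%R.
{ destruct (Req_dec m 1) as [|Hn]; trivial. exfalso.
  set (t := Rmin 1 (m + r / 2)%R).
  assert (m < t)%R by (apply Rmin_glb_lt; lra).
  assert (t <= 1)%R by apply Rmin_l. assert (t <= m + r / 2)%R by apply Rmin_r.
  assert (t <= m)%R; [|lra]. apply Hub. split; [lra|].
  intros x Hx. destruct (Rlt_dec x m) as [Hl|Hl]; [apply Hbelow; lra|].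
  apply Hnear; [lra|]. rewrite Rabs_pos_eq; lra. }
intros x Hx. destruct (Rlt_dec x m) as [Hl|Hl]; [apply Hbelow; lra|].
apply Hnear; trivial. replace (x - m)%R with 0%R by lra. now rewrite Rabs_R0.
Qed.

(** * Closure properties of local expansions *)

Lemma LE_minus (F G : C -> C) (s0 : C) : LE F s0 -> LE G s0 -> LE (fun s => F s - G s) s0.
Proof.
intros [c [r [Hr H]]] [c' [r' [Hr' H']]].
exists (fun k => c k - c' k), (Rmin r r'). split; [now apply Rmin_glb_lt|].
intros w Hw Hre. pose proof (Rmin_l r r'). pose proof (Rmin_r r r').
eapply Clim_ext; [|apply Clim_minus; [apply H|apply H']; trivial; lra].
intros n. cbv beta; rewrite <- Csum_minus. apply Csum_ext. intros; ring.
Qed.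

Lemma LE_const (a s0 : C) : LE (fun _ => a) s0.
Proof.
exists (fun k => match k with 0%nat => a | _ => 0 end), 1%R. split; [lra|].
intros w _ _. apply Clim_incr_n with 1%nat. eapply Clim_ext; [|apply Clim_const].
intros n. rewrite Nat.add_1_r. induction n as [|n IH]; [simpl; ring|].
rewrite Csum_S, <- IH. ring.
Qed.

(** [zdiff] is written with linear factors [s - a] so that this is the one product rule it calls
    for. *)
Lemma LE_mult_lin (a : C) (F : C -> C) (s0 : C) : LE F s0 -> LE (fun s => (s - a) * F s) s0.
Proof.
intros [c [r [Hr H]]].
set (c1 := fun k => match k with 0%nat => RtoC 0 | S k => c k end).
exists (fun k => (s0 - a) * c k + c1 k), r. split; trivial.
intros w Hw Hre. specialize (H w Hw Hre).
replace ((s0 + w - a) * F (s0 + w)) with ((s0 - a) * F (s0 + w) + w * F (s0 + w)) by ring.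
eapply Clim_ext; [intros n; symmetry; etransitivity; [|apply Csum_plus with (u := fun k => (s0 - a) * (c k * Cpow w k)) (v := fun k => c1 k * Cpow w k)]; apply Csum_ext; intros; ring|].
apply Clim_plus.
- eapply Clim_ext; [intros; symmetry; apply Csum_scal|]. now apply Clim_scal.
- apply Clim_incr_n with 1%nat.
  eapply Clim_ext; [|apply Clim_scal; exact H].
  intros n. rewrite Nat.add_1_r. induction n as [|n IH]; [simpl; ring|].
  rewrite (Csum_S _ n), (Csum_S _ (S n)), <- IH. simpl c1. rewrite Cpow_S. ring.
Qed.

Lemma is_series_Clim (u : nat -> C) (l : C) : is_series (K := C_AbsRing) (V := C_NormedModule) u l -> Clim (Csum u) l.
Proof.
intros H. apply is_lim_seq_incr_1. apply is_lim_seq_spec. intros eps.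
red in H. assert (Hl : locally (T := C_UniformSpace) l (fun y => Cmod (y - l) < eps)%R).
{ apply (locally_le_locally_norm (V := C_NormedModule)). exists eps. intros y Hy. exact Hy. }
specialize (H _ Hl). eapply filter_imp; [|exact H].
intros n Hn. rewrite Rminus_0_r, Rabs_pos_eq by apply Cmod_ge_0.
rewrite <- sum_n_Csum. exact Hn.
Qed.

Lemma analytic_LE (F : C -> C) (s0 : C) : analytic_at F s0 -> exists (c : nat -> C) (r : R), (0 < r)%R /\
  forall w : C, (Cmod w < r)%R -> Clim (Csum (ps c w)) (F (s0 + w)).
Proof.
intros [c [r [Hr H]]]. exists c, r. split; trivial. intros w Hw.
specialize (H (s0 + w)). replace (s0 + w - s0) with w in H by ring. specialize (H Hw).
apply is_series_Clim in H. eapply Clim_ext; [|exact H].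
intros n. apply Csum_ext. intros k _. unfold ps. rewrite Cmult_comm. unfold scal; simpl. f_equal.
Qed.

Lemma ps_at_0 (c : nat -> C) (l : C) : Clim (Csum (ps c 0)) l -> l = c 0%nat.
Proof.
intros H. apply Clim_unique with (1 := H). apply Clim_incr_n with 1%nat.
eapply Clim_ext; [|apply Clim_const].
intros n. rewrite Nat.add_1_r. induction n as [|n IH].
- unfold ps; simpl; ring.
- rewrite Csum_S, <- IH. unfold ps. rewrite Cpow_S. ring.
Qed.

(** [C_derive] is a total operator and says nothing by itself; the second-order bound from the power
    series identifies it with the coefficient [c 1]. *)
Lemma analytic_first_order (F : C -> C) (s0 : C) : analytic_at F s0 ->
  exists (B r : R), (0 < r)%R /\ (0 <= B)%R /\
  forall w : C, (Cmod w <= r)%R -> (Cmod (F (s0 + w)%C - F s0 - C_derive F s0 * w) <= B * Cmod w ^ 2)%R.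
Proof.
intros H. destruct (analytic_LE F s0 H) as [c [r [Hr Hc]]].
assert (Hr2 : RtoC (r / 2)%R <> 0) by (intros E; apply RtoC_inj in E; lra).
destruct (ps_bound c (r / 2)%R (F (s0 + (r / 2)%R)) 2 Hr2) as [B [HB0 HB]].
{ apply Hc. rewrite Cmod_RtoC_pos; lra. }
rewrite Cmod_RtoC_pos in HB by lra.
assert (H0 : F s0 = c 0%nat).
{ rewrite <- (ps_at_0 c (F (s0 + 0))); [f_equal; ring|]. apply Hc. rewrite Cmod_0; lra. }
assert (HB' : forall w : C, (Cmod w <= r / 4)%R -> (Cmod (F (s0 + w)%C - F s0 - c 1%nat * w) <= B * Cmod w ^ 2)%R).
{ intros w Hw. specialize (HB w (F (s0 + w)) ltac:(lra) (Hc w ltac:(lra))).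
  replace (F (s0 + w) - F s0 - c 1%nat * w) with (F (s0 + w) - Csum (ps c w) 2); trivial.
  rewrite H0. unfold ps; simpl. ring. }
assert (Hd : C_derive F s0 = c 1%nat).
{ apply is_C_derive_unique. split.
  { apply (is_linear_scal_l (K := C_AbsRing) (V := C_NormedModule)). }
  intros x Hx. apply (is_filter_lim_locally_unique (K := C_AbsRing) (V := AbsRing_NormedModule C_AbsRing)) in Hx. subst x.
  intros eps.
  set (e := Rmin (r / 4) (eps / (B + 1))%R).
  assert (He : (0 < e)%R).
  { apply Rmin_glb_lt; [lra|]. apply Rdiv_lt_0_compat; [apply cond_pos|lra]. }
  apply (locally_le_locally_norm (V := AbsRing_NormedModule C_AbsRing)). exists (mkposreal e He).
  change (forall y : C, Cmod (y - s0) < e -> Cmod ((F y - F s0) - ((y - s0) * c 1%nat)) <= eps * Cmod (y - s0))%R.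
  intros y Hy.
  specialize (HB' (y - s0)). replace (s0 + (y - s0)) with y in HB' by ring.
  pose proof (Rmin_l (r / 4) (eps / (B + 1))%R). pose proof (Rmin_r (r / 4) (eps / (B + 1))%R). fold e in H1, H2.
  specialize (HB' ltac:(lra)). rewrite (Cmult_comm (y - s0)).
  eapply Rle_trans; [exact HB'|]. pose proof (Cmod_ge_0 (y - s0)).
  assert (eps / (B + 1) * (B + 1) = eps)%R by (field; lra).
  simpl. rewrite Rmult_1_r, <- Rmult_assoc. apply Rmult_le_compat_r; trivial. nra. }
exists B, (r / 4)%R. repeat split; trivial; [lra|]. intros w Hw. rewrite Hd. now apply HB'.
Qed.

(** * The zeta function at [3] and its derivative at [-1] *)

Lemma Cpower_pw (n : nat) (s : C) : Cpower (INR (S n)) s = pw s (INR (S n)).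
Proof. unfold Cpower, pw. rewrite Clog_R by (apply lt_0_INR; lia). reflexivity. Qed.

Lemma exp_ln_lim (a : R) : (a < 0)%R -> is_lim_seq (fun N => exp (a * ln (INR (S N)))) 0%R.
Proof.
intros Ha.
assert (H : is_lim_seq (fun N => ln (INR N)) p_infty).
{ apply (is_lim_comp_seq ln INR p_infty p_infty); [apply is_lim_ln_p| |apply is_lim_seq_INR].
  exists 0%nat. intros n _. discriminate. }
assert (H2 : is_lim_seq (fun N => a * ln (INR N))%R m_infty).
{ replace m_infty with (Rbar_mult a p_infty).
  - apply is_lim_seq_scal_l, H.
  - simpl. destruct (Rle_dec 0 a); [exfalso; lra|reflexivity]. }
apply (is_lim_seq_incr_1 (fun N => exp (a * ln (INR N)))).
apply (is_lim_comp_seq exp (fun N => a * ln (INR N))%R m_infty 0%R); trivial.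
- apply is_lim_exp_m.
- exists 0%nat. intros n _. discriminate.
Qed.

Lemma pw_lim (s : C) : (Re s < 0)%R -> Clim (fun N => pw s (INR (S N))) 0.
Proof.
intros H. eapply Clim_squeeze; [|exact (exp_ln_lim (Re s) H)].
exists 0%nat. intros n _. replace (pw s (INR (S n)) - 0) with (pw s (INR (S n))) by ring.
rewrite Cmod_pw. lra.
Qed.

(** Euler-Maclaurin for [x^(-s)] from 1 on. The boundary terms at infinity involve the exponents
    [-s], [1 - s] and [-s - 1], all of negative real part. *)
Lemma zeta_half_plane (zeta : C -> C) (s : C) : is_riemann_zeta zeta -> (1 < Re s)%R ->
  zeta s = 1 / (s - 1) + 1 / 2 + s / 12 - s * (s + 1) * (s + 2) * Jz s.
Proof.
intros [_ Hz] Hs. specialize (Hz s Hs). apply is_series_Clim in Hz.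
assert (Hs1 : 1 - s <> 0).
{ intros E. apply (f_equal Re) in E. unfold Cminus in E. rewrite re_plus, re_opp, !re_RtoC in E. lra. }
assert (Hsum : forall N, Csum (fun k => (- s * (s + 1) * (s + 2)) * em (pw (- s - 3)) (S k)) N =
   Csum (fun n => Cpower (INR (S n)) (- s)) N + (pw (- s) (INR (S N)) - 1) / 2
   - (/ (1 - s) * pw (1 - s) (INR (S N)) - / (1 - s))
   - (- s * pw (- s - 1) (INR (S N)) - - s) / 12).
{ intros N.
  assert (H1 : forall z, pw z 1 = 1) by (intros z; unfold pw; rewrite ln_1, Cmult_0_r; apply Cexp_0).
  pose proof (em_sum (fun x => / (1 - s) * pw (1 - s) x) (pw (- s)) (fun x => - s * pw (- s - 1) x)
    (fun x => - s * (- s - 1) * pw (- s - 1 - 1) x)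
    (fun x => - s * (- s - 1) * (- s - 1 - 1) * pw (- s - 1 - 1 - 1) x) N) as H.
  cbv beta in H. rewrite !H1, !Cmult_1_r in H.
  rewrite (Csum_ext (fun n => Cpower (INR (S n)) (- s)) (fun n => pw (- s) (INR (S n)))) by (intros; apply Cpower_pw).
  rewrite <- H; clear H.
  - apply Csum_ext. intros k _. rewrite <- em_scal by apply pw_con.
    apply em_ext. intros x _. replace (- s - 1 - 1 - 1) with (- s - 3) by ring. ring.
  - intros x Hx. eapply CD_eq; [apply CD_scal, CD_pw; lra|].
    replace (1 - s - 1) with (- s) by ring. field. trivial.
  - intros x Hx. apply CD_pw; lra.
  - intros x Hx. eapply CD_eq; [apply CD_scal, CD_pw; lra|]. ring.
  - intros x Hx. eapply CD_eq; [apply CD_scal, CD_pw; lra|]. ring.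
  - intros x Hx. apply CC_mult; [apply CC_const|]. apply pw_CC; lra. }
assert (HJ : Clim (Csum (fun k => (- s * (s + 1) * (s + 2)) * em (pw (- s - 3)) (S k))) (- s * (s + 1) * (s + 2) * Jz s)).
{ eapply Clim_ext; [intros; symmetry; apply Csum_scal|]. apply Clim_scal. apply CSeries_lim, Jz_abs. lra. }
assert (HL : Clim (Csum (fun k => (- s * (s + 1) * (s + 2)) * em (pw (- s - 3)) (S k)))
   (zeta s + (/ 2) * (0 - 1) - (/ (1 - s) * 0 - / (1 - s)) - (/ 12) * (- s * 0 - - s))).
{ eapply Clim_ext; [intros n; symmetry; apply Hsum|].
  assert (R1 : (Re (- s) < 0)%R) by (rewrite re_opp; lra).
  assert (R2 : (Re (1 - s) < 0)%R) by (unfold Cminus; rewrite re_plus, re_opp, re_RtoC; lra).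
  assert (R3 : (Re (- s - 1) < 0)%R) by (unfold Cminus; rewrite re_plus, !re_opp, re_RtoC; lra).
  apply Clim_minus; [apply Clim_minus; [apply Clim_plus|]|].
  - exact Hz.
  - eapply Clim_ext; [|apply Clim_scal, Clim_minus; [apply (pw_lim _ R1)|apply Clim_const]]. intros; simpl. unfold Cdiv. ring.
  - apply Clim_minus; [apply Clim_scal, (pw_lim _ R2)|apply Clim_const].
  - eapply Clim_ext; [|apply Clim_scal, Clim_minus; [apply Clim_scal, (pw_lim _ R3)|apply Clim_const]]. intros; simpl. unfold Cdiv. ring. }
pose proof (Clim_unique _ _ _ HJ HL) as E.
assert (Hs1' : s - 1 <> 0) by (intros F; apply Hs1; replace (1 - s) with (- (s - 1)) by ring; rewrite F; ring).
replace (s * (s + 1) * (s + 2) * Jz s) with (- (- s * (s + 1) * (s + 2) * Jz s)) by ring.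
rewrite E. field. split; trivial.
Qed.

(** [s - 1] times the difference of the two sides of [zeta_half_plane], so that the pole is cleared;
    [(s + 6) / 12] is [1/2 + s/12]. *)
Definition zdiff (zeta : C -> C) (s : C) : C :=
  (s - 1) * zeta s - (1 - (s - 1) * ((s - (-6)) * (- / 12))) - (s - 1) * ((s - 0) * ((s - -1) * ((s - -2) * (0 - Jz s)))).

(** The path is slanted because the real segment from 2 to [-1] meets the pole: here the imaginary
    part is positive until the endpoint [-1] is reached. *)
Lemma zeta_continuation (zeta : C -> C) (x : R) : is_riemann_zeta zeta -> (0 <= x <= 1)%R ->
  zdiff zeta (((2 - 3 * x)%R, (2 - 2 * x)%R) : C) = 0.
Proof.
intros Hz. revert x.
assert (Hne : forall x : R, (0 <= x <= 1)%R -> (((2 - 3 * x)%R, (2 - 2 * x)%R) : C) <> 1).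
{ intros x Hx E. injection E as E1 E2. lra. }
(* For [x <= 1/4] the real part is at least [5/4], within the half-plane of the series. *)
apply segment_identity with (1 / 4)%R.
- lra.
- intros x Hx. set (s := ((2 - 3 * x)%R, (2 - 2 * x)%R) : C).
  assert (Hs1 : s - 1 <> 0) by (intros F; apply (Hne x ltac:(lra)); fold s; replace s with (s - 1 + 1) by ring; rewrite F; ring).
  unfold zdiff. rewrite (zeta_half_plane zeta s Hz) by (unfold s, Re; simpl; lra).
  field. trivial.
- intros x0 Hx0. set (s0 := ((2 - 3 * x0)%R, (2 - 2 * x0)%R) : C).
  assert (HL : LE (zdiff zeta) s0).
  { unfold zdiff. apply LE_minus; [apply LE_minus|].
    - apply LE_mult_lin. destruct Hz as [Hz _]. destruct (analytic_LE zeta s0 (Hz s0 (Hne x0 Hx0))) as [c [r [Hr H]]].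
      exists c, r. split; trivial. intros w Hw _. now apply H.
    - apply LE_minus; [apply LE_const|]. apply LE_mult_lin, LE_mult_lin, LE_const.
    - do 4 apply LE_mult_lin. apply LE_minus; [apply LE_const|]. apply Jz_LE.
      unfold s0, Re; simpl; lra. }
  destruct HL as [c [r [Hr H]]].
  set (dir := ((-3)%R, (-2)%R) : C).
  assert (Hdir : (0 < Cmod dir)%R) by (apply Cmod_gt_0; intros F; injection F as F1 F2; lra).
  exists (fun k => c k * Cpow dir k), (r / Cmod dir)%R.
  split; [now apply Rdiv_lt_0_compat|]. intros h Hh Hx.
  specialize (H (h * dir)).
  replace (s0 + h * dir) with (((2 - 3 * (x0 + h))%R, (2 - 2 * (x0 + h))%R) : C) in H.
  2:{ unfold s0, dir. apply C_eq; simpl; ring. }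
  eapply Clim_ext; [|apply H].
  + intros n. apply Csum_ext. intros k _. unfold ps. rewrite Cpow_mult_l. ring.
  + rewrite Cmod_mult, Cmod_R. apply Rmult_lt_reg_r with (/ Cmod dir)%R; [now apply Rinv_0_lt_compat|].
    rewrite Rmult_assoc, Rinv_r by lra. unfold Rdiv in Hh. lra.
  + unfold Re; simpl. lra.
Qed.

Lemma LE_continuous (F : C -> C) (s0 : C) (u : nat -> C) : LE F s0 -> (-1 <= Re s0)%R ->
  (forall n, -1 <= Re (u n))%R -> Clim u s0 -> Clim (fun n => F (u n)) (F s0).
Proof.
intros [c [r [Hr Hc]]] Hs0 Hu Hlim.
assert (Hr2 : RtoC (r / 2)%R <> 0) by (intros E; apply RtoC_inj in E; lra).
destruct (ps_bound c (r / 2)%R (F (s0 + (r / 2)%R)) 1 Hr2) as [B [HB0 HB]].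
{ apply Hc; [rewrite Cmod_RtoC_pos; lra|]. rewrite re_plus, re_RtoC. lra. }
rewrite Cmod_RtoC_pos in HB by lra.
assert (H0 : F s0 = c 0%nat).
{ rewrite <- (ps_at_0 c (F (s0 + 0))); [f_equal; ring|]. apply Hc; [rewrite Cmod_0; lra|]. rewrite re_plus, re_RtoC. lra. }
assert (Hev : eventually (fun n => Cmod (u n - s0) < r / 4)%R).
{ apply is_lim_seq_spec in Hlim. specialize (Hlim (mkposreal (r / 4) ltac:(lra))). simpl in Hlim.
  eapply filter_imp; [|exact Hlim]. intros n Hn. simpl in Hn. rewrite Rminus_0_r, Rabs_pos_eq in Hn by apply Cmod_ge_0. exact Hn. }
apply Clim_squeeze with (fun n => B * Cmod (u n - s0))%R.
- eapply filter_imp; [|exact Hev]. intros n Hn. simpl in Hn.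
  assert (E : u n = s0 + (u n - s0)) by ring.
  specialize (HB (u n - s0) (F (u n)) ltac:(lra)).
  simpl in HB. rewrite H0. unfold ps in HB at 2. simpl in HB.
  replace (0 + c 0%nat * 1) with (c 0%nat) in HB by ring. rewrite Rmult_1_r in HB.
  apply HB. rewrite E at 2. apply Hc; [lra|]. rewrite <- E. apply Hu.
- replace (Finite 0) with (Rbar_mult B 0) by (simpl; f_equal; ring). now apply is_lim_seq_scal_l.
Qed.

(** At [s = -1] the factor [s + 1] kills the integral, so [- s (s+1) (s+2) Jz s] contributes
    [Jz (-1)] by continuity of [Jz] alone, and [1/(s-1) + 1/2 + s/12] contributes
    [-1/4 + 1/12 = -1/6]. The difference quotient is taken along [-1 + (3 + 2 i) / (n + 1)], points
    of the segment on which the formula is known. *)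
Lemma zeta_derive_m1 (zeta : C -> C) : is_riemann_zeta zeta ->
  C_derive zeta (RtoC (-1)) = Jz (-1) - 1 / 6.
Proof.
intros Hz.
set (w := fun n => ((3 / INR (S n))%R, (2 / INR (S n))%R) : C).
assert (Hn0 : forall n, (0 < / INR (S n) <= 1)%R).
{ intros n. rewrite S_INR. pose proof (pos_INR n). split; [apply Rinv_0_lt_compat; lra|].
  rewrite <- Rinv_1. apply Rinv_le_contravar; lra. }
assert (Hwnz : forall n, w n <> 0).
{ intros n E. apply (f_equal Re) in E. change (3 / INR (S n) = 0)%R in E. specialize (Hn0 n). unfold Rdiv in E. lra. }
assert (Hinv : is_lim_seq (fun n => / INR (S n))%R 0%R).
{ apply (is_lim_seq_incr_1 (fun n => / INR n)%R).
  apply (is_lim_seq_inv INR p_infty); [apply is_lim_seq_INR|discriminate]. }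
assert (Hw : Clim w 0).
{ apply Clim_parts; unfold w; simpl.
  - replace (Finite 0) with (Rbar_mult 3 0) by (simpl; f_equal; ring). apply (is_lim_seq_scal_l (fun n => / INR (S n))%R 3 0), Hinv.
  - replace (Finite 0) with (Rbar_mult 2 0) by (simpl; f_equal; ring). apply (is_lim_seq_scal_l (fun n => / INR (S n))%R 2 0), Hinv. }
assert (Hm1 : RtoC (-1) <> 1) by (intros E; apply RtoC_inj in E; lra).
destruct (analytic_first_order zeta (-1) (proj1 Hz _ Hm1)) as [B [r [Hr [HB0 HB]]]].
assert (L1 : Clim (fun n => (zeta (-1 + w n) - zeta (-1)) / w n) (C_derive zeta (-1))).
{ apply Clim_squeeze with (fun n => B * Cmod (w n - 0))%R.
  - apply is_lim_seq_spec in Hw. specialize (Hw (mkposreal r Hr)). simpl in Hw.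
    eapply filter_imp; [|exact Hw]. intros n Hn. simpl in Hn.
    rewrite Rminus_0_r, Rabs_pos_eq in Hn by apply Cmod_ge_0.
    replace (w n - 0) with (w n) in * by ring.
    specialize (HB (w n) ltac:(lra)).
    replace ((zeta (-1 + w n) - zeta (-1)) / w n - C_derive zeta (-1)) with
      ((zeta (-1 + w n) - zeta (-1) - C_derive zeta (-1) * w n) / w n) by (field; auto).
    rewrite Cmod_div by auto. assert (Hp : (0 < Cmod (w n))%R) by (apply Cmod_gt_0; auto).
    apply Rmult_le_reg_r with (Cmod (w n)); trivial. unfold Rdiv. rewrite Rmult_assoc, Rinv_l by lra.
    simpl in HB. lra.
  - replace (Finite 0) with (Rbar_mult B 0) by (simpl; f_equal; ring). now apply is_lim_seq_scal_l. }
assert (Hpt : forall n, -1 + w n = (((2 - 3 * (1 - / INR (S n)))%R, (2 - 2 * (1 - / INR (S n)))%R) : C)).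
{ intros n. unfold w. apply C_eq; simpl; unfold Rdiv; ring. }
assert (HZ : forall n, zeta (-1 + w n) = 1 / (-1 + w n - 1) + 1 / 2 + (-1 + w n) / 12 - (-1 + w n) * (-1 + w n + 1) * (-1 + w n + 2) * Jz (-1 + w n) /\ -1 + w n - 1 <> 0).
{ intros n.
  assert (Hs1 : -1 + w n - 1 <> 0).
  { rewrite Hpt. intros F. injection F as F1 F2. specialize (Hn0 n). lra. }
  split; trivial.
  pose proof (zeta_continuation zeta (1 - / INR (S n))%R Hz) as E.
  specialize (Hn0 n). specialize (E ltac:(lra)). rewrite <- Hpt in E. set (s := -1 + w n) in *.
  unfold zdiff in E.
  assert (E' : (s - 1) * zeta s = (1 - (s - 1) * ((s - (-6)) * (- / 12))) + (s - 1) * ((s - 0) * ((s - -1) * ((s - -2) * (0 - Jz s))))).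
  { match type of E with ?a - ?b - ?c = _ => replace a with ((a - b - c) + b + c) by ring; rewrite E; ring end. }
  replace (zeta s) with ((s - 1) * zeta s / (s - 1)) by (field; trivial).
  rewrite E'. field. trivial. }
assert (HZ1 : zeta (-1) = - (1 / 12)).
{ pose proof (zeta_continuation zeta 1 Hz ltac:(lra)) as E.
  replace (((2 - 3 * 1)%R, (2 - 2 * 1)%R) : C) with (RtoC (-1)) in E by (apply C_eq; simpl; ring).
  unfold zdiff in E. 
  replace (zeta (-1)) with (((-1 - 1) * zeta (-1) -
     (1 - (-1 - 1) * ((-1 - -6) * - / 12)) -
     (-1 - 1) * ((-1 - 0) * ((-1 - -1) * ((-1 - -2) * (0 - Jz (-1)))))) * (- / 2) - 1 / 12) by field.
  rewrite E. field. }
assert (HJ : Clim (fun n => Jz (-1 + w n)) (Jz (-1))).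
{ apply LE_continuous.
  - apply Jz_LE. rewrite re_RtoC. lra.
  - rewrite re_RtoC. lra.
  - intros n. rewrite Hpt. change (-1 <= 2 - 3 * (1 - / INR (S n)))%R. specialize (Hn0 n). lra.
  - replace (RtoC (-1)) with (-1 + 0) at 1 by ring. apply Clim_plus; [apply Clim_const|exact Hw]. }
apply (Clim_unique _ _ _ L1).
replace (Jz (-1) - 1 / 6) with ((-(1/4)) + (1/12) - (-1 + 0) * ((-1 + 0 + 2) * Jz (-1))) by field.
eapply Clim_ext; [intros n; symmetry|].
{ destruct (HZ n) as [E Hs1]. rewrite E, HZ1.
  instantiate (1 := fun n => / (2 * (-1 + w n - 1)) + (1 / 12) - (-1 + w n) * ((-1 + w n + 2) * Jz (-1 + w n))).
  cbv beta. field. split; auto. }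
apply Clim_minus.
- apply Clim_plus; [|apply Clim_const].
  assert (HR : Clim (fun n => (w n) / (4 * (w n - 2)) + - (1 / 4)) (0 * 0 + - (1 / 4))).
  { apply Clim_plus; [|apply Clim_const].
    eapply Clim_squeeze with (fun n => Cmod (w n - 0)); [|exact Hw].
    exists 5%nat. intros n Hn. replace (0 * 0) with (RtoC 0) by ring.
    replace (w n - 0) with (w n) by ring.
    replace (w n / (4 * (w n - 2)) - 0) with (w n * / (4 * (w n - 2))) by (unfold Cdiv; ring).
    rewrite Cmod_mult. rewrite <- (Rmult_1_r (Cmod (w n))) at 2.
    apply Rmult_le_compat_l; [apply Cmod_ge_0|].
    assert (Hge : (1 <= Cmod (4 * (w n - 2)))%R).
    { eapply Rle_trans; [|apply Cmod_ge_Re]. rewrite re_scal_l.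
      replace (Re (w n - 2)) with (3 / INR (S n) - 2)%R by reflexivity.
      assert (/ INR (S n) <= / 6)%R.
      { apply Rinv_le_contravar; [lra|]. rewrite S_INR. apply le_INR in Hn. simpl in Hn. lra. }
      unfold Rdiv. rewrite Rabs_left; lra. }
    rewrite Cmod_inv by (apply Cmod_pos_nz; lra). rewrite <- Rinv_1. apply Rinv_le_contravar; lra. }
  replace (- (1 / 4)) with (0 * 0 + - (1 / 4)) by ring.
  eapply Clim_ext; [|exact HR]. intros n. cbv beta. destruct (HZ n) as [_ Hs1].
  assert (w n - 2 <> 0) by (replace (w n - 2) with (-1 + w n - 1) by ring; trivial).
  field. trivial.
- apply Clim_mult; [apply Clim_plus; [apply Clim_const|exact Hw]|].
  apply Clim_mult; [|exact HJ].
  apply Clim_plus; [apply Clim_plus; [apply Clim_const|exact Hw]|apply Clim_const].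
Qed.

Lemma zeta_3 (zeta : C -> C) : is_riemann_zeta zeta ->
  zeta 3 = CSeries (fun n => / Cpow (INR (S n)) 3).
Proof.
intros [_ Hz]. specialize (Hz (RtoC 3)). rewrite re_RtoC in Hz. specialize (Hz ltac:(lra)).
symmetry. apply CSeries_unique. apply is_series_Clim in Hz.
eapply Clim_ext; [|exact Hz]. intros n. apply Csum_ext. intros k _.
rewrite Cpower_pw. unfold pw.
rewrite <- RtoC_opp, <- RtoC_mult, Cexp_R.
assert (0 < INR (S k))%R by (apply lt_0_INR; lia).
rewrite <- RtoC_pow, <- RtoC_inv by (apply pow_nonzero; lra). f_equal.
replace (- (3) * ln (INR (S k)))%R with (- (INR 3 * ln (INR (S k))))%R by (simpl; ring).
rewrite exp_Ropp. f_equal. rewrite <- (Rpower_pow 3) by trivial. reflexivity.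
Qed.

(** * Exponential series [sum a_j e^(-j z)] *)

(** Differentiation under a series or an integral sign thus reduces to summing or integrating a
    uniform quadratic remainder. *)
Lemma CD_of_quadratic (f : R -> C) (x : R) (l : C) (B r : R) : (0 < r)%R ->
  (forall h : R, (Rabs h < r)%R -> (Cmod (f (x + h)%R - f x - h * l) <= B * h ^ 2)%R) -> CD f x l.
Proof.
intros Hr H.
assert (HB : (0 <= B)%R).
{ specialize (H (r / 2)%R ltac:(rewrite Rabs_pos_eq; lra)).
  pose proof (Rle_trans _ _ _ (Cmod_ge_0 _) H). assert (0 < (r / 2) ^ 2)%R by (apply pow_lt; lra). nra. }
assert (G : forall (u : R -> R) (m : R), (forall h, (Rabs h < r)%R -> (Rabs (u (x + h) - u x - h * m) <= B * h ^ 2)%R) -> is_derive u x m).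
{ intros u m Hu. apply is_derive_Reals. intros eps He.
  set (d := Rmin r (eps / (B + 1))%R).
  assert (Hd : (0 < d)%R) by (apply Rmin_glb_lt; [lra|apply Rdiv_lt_0_compat; lra]).
  exists (mkposreal d Hd). intros h Hh0 Hh. simpl in Hh.
  pose proof (Rmin_l r (eps / (B + 1))%R). pose proof (Rmin_r r (eps / (B + 1))%R). fold d in H0, H1.
  specialize (Hu h ltac:(lra)).
  replace ((u (x + h) - u x) / h - m)%R with ((u (x + h) - u x - h * m) / h)%R by (field; trivial).
  unfold Rdiv at 1. rewrite Rabs_mult, Rabs_inv.
  assert (Ha : (0 < Rabs h)%R) by now apply Rabs_pos_lt.
  apply Rmult_lt_reg_r with (Rabs h); trivial. rewrite Rmult_assoc, Rinv_l, Rmult_1_r by lra.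
  eapply Rle_lt_trans; [exact Hu|].
  replace (h ^ 2)%R with (Rabs h * Rabs h)%R by (pose proof (pow2_abs h); simpl in *; lra).
  assert (eps / (B + 1) * (B + 1) = eps)%R by (field; lra).
  rewrite <- Rmult_assoc. apply Rmult_lt_compat_r; trivial. nra. }
split; apply G; intros h Hh; specialize (H h Hh); (eapply Rle_trans; [|exact H]).
- replace (Re (f (x + h)%R) - Re (f x) - h * Re l)%R with (Re (f (x + h)%R - f x - h * l)).
  + apply Cmod_ge_Re.
  + unfold Cminus. rewrite !re_plus, !re_opp, re_scal_l. ring.
- replace (Im (f (x + h)%R) - Im (f x) - h * Im l)%R with (Im (f (x + h)%R - f x - h * l)).
  + apply Cmod_ge_Im.
  + unfold Cminus. rewrite !im_plus, !im_opp, im_scal_l. ring.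
Qed.

(** Half of the exponential absorbs the power, the other half is a geometric series. *)
Lemma ex_series_poly_exp (m : nat) (d : R) : (0 < d)%R ->
  ex_series (fun j => INR (S j) ^ m * exp (- (INR (S j) * d)))%R.
Proof.
intros Hd.
set (K := (INR (fact m) / (d / 2) ^ m)%R).
apply (ex_series_le (K := R_AbsRing) (V := R_CompleteNormedModule) _ (fun j => K * exp (- (d / 2)) ^ (S j))%R).
- intros j. change (norm ?u) with (Rabs u).
  pose proof (pos_INR (S j)) as Hj.
  rewrite Rabs_pos_eq by (apply Rmult_le_pos; [now apply pow_le|left; apply exp_pos]).
  pose proof (exp_pow_ge (INR (S j) * (d / 2)) m ltac:(apply Rmult_le_pos; lra)) as H.
  replace (exp (- (d / 2)) ^ S j)%R with (exp (- (INR (S j) * (d / 2))))%R.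
  2:{ rewrite <- Rpower_pow by apply exp_pos. unfold Rpower. rewrite ln_exp. f_equal. ring. }
  replace (exp (- (INR (S j) * d)))%R with (exp (- (INR (S j) * (d / 2))) * exp (- (INR (S j) * (d / 2))))%R
    by (rewrite <- exp_plus; f_equal; field).
  rewrite <- Rmult_assoc. apply Rmult_le_compat_r; [left; apply exp_pos|].
  rewrite exp_Ropp. pose proof (exp_pos (INR (S j) * (d / 2))).
  apply Rmult_le_reg_r with (exp (INR (S j) * (d / 2))); trivial.
  rewrite Rmult_assoc, Rinv_l, Rmult_1_r by lra.
  rewrite Rpow_mult_distr in H. unfold K.
  assert (Hdm : (0 < (d / 2) ^ m)%R) by (apply pow_lt; lra).
  pose proof (INR_fact_lt_0 m).
  apply Rmult_le_reg_r with ((d / 2) ^ m / INR (fact m))%R; [apply Rdiv_lt_0_compat; trivial|].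
  replace (INR (fact m) / (d / 2) ^ m * exp (INR (S j) * (d / 2)) * ((d / 2) ^ m / INR (fact m)))%R with (exp (INR (S j) * (d / 2))) by (field; lra).
  unfold Rdiv in *. lra.
- apply (ex_series_scal (V := R_NormedModule)).
  apply (ex_series_incr_1 (fun j => exp (- (d / 2)) ^ j)%R).
  apply ex_series_geom. rewrite Rabs_pos_eq by (left; apply exp_pos).
  rewrite <- exp_0. apply exp_increasing. lra.
Qed.

Definition DS (a : nat -> C) (z : C) : C := CSeries (fun j => a j * Cexp (- (INR (S j) * z))).

Definition nmul (a : nat -> C) : nat -> C := fun j => INR (S j) * a j.

Lemma Cmod_DS_term (a : nat -> C) (m : nat) (z : C) (j : nat) : (Cmod (a j) <= INR (S j) ^ m)%R ->
  (Cmod (a j * Cexp (- (INR (S j) * z))) <= INR (S j) ^ m * exp (- (INR (S j) * Re z)))%R.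
Proof.
intros H. rewrite Cmod_mult, Cmod_Cexp, re_opp, re_scal_l.
apply Rmult_le_compat_r; trivial. left; apply exp_pos.
Qed.

Lemma DS_abs (a : nat -> C) (m : nat) (z : C) : (forall j, Cmod (a j) <= INR (S j) ^ m)%R -> (0 < Re z)%R ->
  Cabs (fun j => a j * Cexp (- (INR (S j) * z))).
Proof.
intros Ha Hz. eapply Cabs_le; [intros j; apply Cmod_DS_term, Ha|]. now apply ex_series_poly_exp.
Qed.

Lemma Cexp_taylor2 (w : C) : (Cmod (Cexp w - 1 - w) <= Cmod w ^ 2 * exp (Cmod w))%R.
Proof.
pose proof (Cexp_taylor_bound 2 w) as H. simpl Cexp_taylor in H.
replace (Cexp w - (0 + 1 / 1 + w * 1 / 1)) with (Cexp w - 1 - w) in H by field.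
eapply Rle_trans; [exact H|]. simpl. pose proof (exp_pos (Cmod w)). pose proof (Cmod_ge_0 w). nra.
Qed.

Lemma CD_DS (a : nat -> C) (m : nat) (t : C) (x : R) : (forall j, Cmod (a j) <= INR (S j) ^ m)%R ->
  (0 < Re t)%R -> (0 < x)%R -> CD (fun y => DS a (y * t)) x (- t * DS (nmul a) (x * t)).
Proof.
intros Ha Ht Hx.
set (T := Cmod t). assert (HT : (0 < T)%R) by now apply Cmod_pos_Re.
(* Half of the decay rate: the Taylor remainder of term [n] costs [e^(n d)], and the term itself
   brings [e^(-2 n d)]. *)
set (d := (x * Re t / 2)%R). assert (Hd : (0 < d)%R) by (unfold d; apply Rdiv_lt_0_compat; [now apply Rmult_lt_0_compat|lra]).
set (B := Series (fun j => T ^ 2 * (INR (S j) ^ (m + 2) * exp (- (INR (S j) * d))))%R).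
assert (Ha' : (forall j, Cmod (nmul a j) <= INR (S j) ^ S m)%R).
{ intros j. unfold nmul. rewrite Cmod_mult, Cmod_RtoC_pos by apply pos_INR. rewrite <- tech_pow_Rmult.
  apply Rmult_le_compat_l; [apply pos_INR|apply Ha]. }
apply CD_of_quadratic with B (Rmin (d / T) (x / 2)).
{ apply Rmin_glb_lt; [now apply Rdiv_lt_0_compat|lra]. }
intros h Hh. pose proof (Rmin_l (d / T) (x / 2)). pose proof (Rmin_r (d / T) (x / 2)).
assert (HhT : (Rabs h * T <= d)%R).
{ apply Rle_trans with (d / T * T)%R; [apply Rmult_le_compat_r; lra|right; field; lra]. }
assert (Hxh : (0 < x + h)%R) by (assert (Rabs h < x / 2)%R by lra; apply Rabs_def2 in H1; lra).
assert (R1 : (0 < Re (x * t))%R) by (rewrite re_scal_l; nra).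
assert (R2 : (0 < Re ((x + h)%R * t))%R) by (rewrite re_scal_l; nra).
assert (A1 := DS_abs a m _ Ha R1). assert (A2 := DS_abs a m _ Ha R2). assert (A3 := DS_abs _ _ _ Ha' R1).
unfold DS. replace (h * (- t * _)) with ((- (h * t)) * CSeries (fun j => nmul a j * Cexp (- (INR (S j) * (x * t))))) by ring.
rewrite <- CSeries_scal by trivial.
rewrite <- !CSeries_minus by first [assumption | apply Cabs_minus; assumption | apply Cabs_scal; assumption].
replace (B * h ^ 2)%R with (Series (fun j => h ^ 2 * (T ^ 2 * (INR (S j) ^ (m + 2) * exp (- (INR (S j) * d)))))%R)
  by (rewrite Series_scal_l; unfold B; ring).
apply Cmod_CSeries.
- intros j. set (n := INR (S j)). assert (Hn : (0 < n)%R) by (apply lt_0_INR; lia).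
  replace (a j * Cexp (- (n * ((x + h)%R * t))) - a j * Cexp (- (n * (x * t))) - - (h * t) * (nmul a j * Cexp (- (n * (x * t)))))
    with (a j * Cexp (- (n * (x * t))) * (Cexp (- (n * (h * t))) - 1 - (- (n * (h * t))))).
  2:{ unfold nmul. fold n. replace (- (n * ((x + h)%R * t))) with (- (n * (x * t)) + - (n * (h * t))) by (rewrite RtoC_plus; ring).
      rewrite Cexp_add. ring. }
  rewrite !Cmod_mult.
  pose proof (Cexp_taylor2 (- (n * (h * t)))) as Hb.
  rewrite Cmod_opp, !Cmod_mult, !Cmod_R in Hb. fold T in Hb. rewrite (Rabs_pos_eq n) in Hb by lra.
  rewrite Cmod_Cexp, re_opp, !re_scal_l.
  specialize (Ha j). fold n in Ha.
  assert (E1 : (exp (n * (Rabs h * T)) <= exp (n * d))%R) by (apply exp_mono; apply Rmult_le_compat_l; lra).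
  replace (exp (- (n * (x * Re t))))%R with (exp (- (n * d)) * exp (- (n * d)))%R by (rewrite <- exp_plus; f_equal; unfold d; field).
  assert (Hh2 : (Rabs h ^ 2 = h ^ 2)%R) by apply pow2_abs.
  assert (Hb2 : (Cmod (Cexp (- (n * (h * t))) - 1 - (- (n * (h * t)))) <= h ^ 2 * (T ^ 2 * (n ^ 2 * exp (n * d))))%R).
  { eapply Rle_trans; [exact Hb|]. rewrite !Rpow_mult_distr, Hh2.
    replace (h ^ 2 * (T ^ 2 * (n ^ 2 * exp (n * d))))%R with (n ^ 2 * (h ^ 2 * T ^ 2) * exp (n * d))%R by ring.
    apply Rmult_le_compat_l; trivial. pose proof (pow2_ge_0 n). pose proof (pow2_ge_0 h). pose proof (pow2_ge_0 T).
    apply Rmult_le_pos; trivial. apply Rmult_le_pos; trivial. }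
  apply Rle_trans with (n ^ m * (exp (- (n * d)) * exp (- (n * d))) * (h ^ 2 * (T ^ 2 * (n ^ 2 * exp (n * d)))))%R.
  + pose proof (exp_pos (- (n * d))).
    apply Rmult_le_compat; [|apply Cmod_ge_0| |trivial].
    * apply Rmult_le_pos; [apply Cmod_ge_0|nra].
    * apply Rmult_le_compat_r; [nra|trivial].
  + right. rewrite pow_add. replace (exp (n * d)) with (/ exp (- (n * d)))%R by (rewrite exp_Ropp; now rewrite Rinv_inv).
    field. apply Rgt_not_eq, exp_pos.
- apply (ex_series_scal (V := R_NormedModule)). apply (ex_series_scal (V := R_NormedModule)). now apply ex_series_poly_exp.
Qed.

(** The constant depends on [m] and [Re t] only, which makes the truncation of the product uniform
    on the whole vertical line [Re t = e]. *)
Lemma DS_decay (m : nat) (e : R) : (0 < e)%R -> exists B : R, (0 <= B)%R /\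
  forall (a : nat -> C) (t : C) (x : R), (forall j, Cmod (a j) <= INR (S j) ^ m)%R -> Re t = e -> (1 <= x)%R ->
  (Cmod (DS a (x * t)) <= B * exp (- (x * e)))%R.
Proof.
intros He.
set (S0 := Series (fun j => INR (S j) ^ m * exp (- (INR (S j) * e)))%R).
assert (Hpe := ex_series_poly_exp m e He).
exists (exp e * S0)%R. split.
{ apply Rmult_le_pos; [left; apply exp_pos|].
  eapply Rle_trans; [apply (Cmod_ge_0 (CSeries (fun _ => 0)))|]. apply Cmod_CSeries; trivial.
  intros j. rewrite Cmod_0. apply Rmult_le_pos; [apply pow_le, pos_INR|left; apply exp_pos]. }
intros a t x Ha Ht Hx. unfold DS.
replace (exp e * S0 * exp (- (x * e)))%R with (Series (fun j => exp e * exp (- (x * e)) * (INR (S j) ^ m * exp (- (INR (S j) * e))))%R)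
  by (rewrite Series_scal_l; unfold S0; ring).
apply Cmod_CSeries.
- intros j. eapply Rle_trans; [apply Cmod_DS_term, Ha|].
  rewrite re_scal_l, Ht.
  replace (exp e * exp (- (x * e)) * (INR (S j) ^ m * exp (- (INR (S j) * e))))%R
    with (INR (S j) ^ m * exp (e + - (x * e) + - (INR (S j) * e)))%R by (rewrite !exp_plus; ring).
  apply Rmult_le_compat_l; [apply pow_le, pos_INR|]. apply exp_mono.
  rewrite S_INR. pose proof (pos_INR j).
  assert (0 <= INR j * (x - 1) * e)%R by (repeat apply Rmult_le_pos; lra). nra.
- now apply (ex_series_scal (V := R_NormedModule)).
Qed.

(** With [n = j + 1] this is [z0^n n^(m - 3)]; the shift by 3 lets a natural [m] run from [Li_3] at
    [m = 0] to [Li_(-2)] at [m = 5]. *)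
Definition co (z0 : C) (m : nat) : nat -> C := fun j => Cpow z0 (S j) * Cpow (INR (S j)) m / Cpow (INR (S j)) 3.

Lemma INR_S_nz (j : nat) : RtoC (INR (S j)) <> 0.
Proof. intros E; apply RtoC_inj in E. revert E. now apply not_0_INR. Qed.

Lemma INR_S_ge1 (j : nat) : (1 <= INR (S j))%R.
Proof. rewrite S_INR. pose proof (pos_INR j). lra. Qed.

Lemma co_nmul (z0 : C) (m j : nat) : nmul (co z0 m) j = co z0 (S m) j.
Proof. unfold nmul, co. rewrite (Cpow_S _ m). field. apply INR_S_nz. Qed.

Lemma Cmod_co (z0 : C) (m j : nat) : (Cmod z0 <= 1)%R -> (Cmod (co z0 m j) <= INR (S j) ^ m / INR (S j) ^ 3)%R.
Proof.
intros H. unfold co. rewrite Cmod_div by apply Cpow_nz, INR_S_nz.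
rewrite Cmod_mult, !Cmod_pow, Cmod_RtoC_pos by apply pos_INR.
pose proof (INR_S_ge1 j).
apply Rmult_le_compat_r; [left; apply Rinv_0_lt_compat, pow_lt; lra|].
rewrite <- (Rmult_1_l (INR (S j) ^ m)) at 2. apply Rmult_le_compat_r; [apply pow_le; lra|].
rewrite <- (pow1 (S j)). apply pow_incr. split; [apply Cmod_ge_0|trivial].
Qed.

Lemma Cmod_co' (z0 : C) (m j : nat) : (Cmod z0 <= 1)%R -> (Cmod (co z0 m j) <= INR (S j) ^ m)%R.
Proof.
intros H. eapply Rle_trans; [now apply Cmod_co|]. pose proof (INR_S_ge1 j).
rewrite <- (Rmult_1_r (INR (S j) ^ m)) at 2. apply Rmult_le_compat_l; [apply pow_le; lra|].
rewrite <- Rinv_1. apply Rinv_le_contravar; [lra|]. now apply pow_R1_Rle.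
Qed.

(* [Li_(3-m) (z0 e^(-z))]: differentiation in [z] raises [m] by one, up to sign. *)
Definition pl (z0 : C) (m : nat) (z : C) : C := DS (co z0 m) z.

Lemma CD_pl (z0 : C) (m : nat) (t : C) (x : R) : (Cmod z0 <= 1)%R -> (0 < Re t)%R -> (0 < x)%R ->
  CD (fun y => pl z0 m (y * t)) x (- t * pl z0 (S m) (x * t)).
Proof.
intros Hz Ht Hx. eapply CD_eq; [apply (CD_DS _ m); trivial; intros; now apply Cmod_co'|].
f_equal. apply CSeries_ext. intros j. now rewrite co_nmul.
Qed.

Lemma pl_abs (z0 : C) (m : nat) (z : C) : (Cmod z0 <= 1)%R -> (0 < Re z)%R ->
  Cabs (fun j => co z0 m j * Cexp (- (INR (S j) * z))).
Proof. intros H1 H2. apply (DS_abs _ m); trivial. intros; now apply Cmod_co'. Qed.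

Lemma pl_decay (m : nat) (e : R) : (0 < e)%R -> exists B : R, (0 <= B)%R /\
  forall (z0 t : C) (x : R), (Cmod z0 <= 1)%R -> Re t = e -> (1 <= x)%R -> (Cmod (pl z0 m (x * t)) <= B * exp (- (x * e)))%R.
Proof.
intros He. destruct (DS_decay m e He) as [B [HB0 HB]]. exists B. split; trivial.
intros. apply HB; trivial. intros; now apply Cmod_co'.
Qed.

Lemma pl_lim (z0 : C) (m : nat) (t : C) : (Cmod z0 <= 1)%R -> (0 < Re t)%R ->
  Clim (fun N => INR (S N) * pl z0 m (INR (S N) * t)) 0.
Proof.
intros H1 H2. destruct (pl_decay m (Re t) H2) as [B [HB0 HB]].
assert (L : is_lim_seq (fun N => B * (INR (S N) ^ 1 * exp (- (INR (S N) * Re t))))%R 0%R).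
{ replace (Finite 0) with (Rbar_mult B 0) by (simpl; f_equal; ring).
  apply is_lim_seq_scal_l. apply (ex_series_lim_0 (fun N => INR (S N) ^ 1 * exp (- (INR (S N) * Re t)))%R).
  now apply ex_series_poly_exp. }
apply Clim_squeeze with (2 := L). exists 0%nat. intros N _.
replace (_ - 0) with (INR (S N) * pl z0 m (INR (S N) * t)) by ring.
rewrite Cmod_mult, Cmod_RtoC_pos by apply pos_INR. rewrite pow_1.
specialize (HB z0 t _ H1 eq_refl (INR_S_ge1 N)). pose proof (INR_S_ge1 N). nra.
Qed.

Lemma pl_lim' (z0 : C) (m : nat) (t : C) : (Cmod z0 <= 1)%R -> (0 < Re t)%R ->
  Clim (fun N => pl z0 m (INR (S N) * t)) 0.
Proof.
intros H1 H2. eapply Clim_squeeze; [|exact (pl_lim z0 m t H1 H2)].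
exists 0%nat. intros N _. replace (_ - 0) with (pl z0 m (INR (S N) * t)) by ring.
replace (INR (S N) * pl z0 m (INR (S N) * t) - 0) with (INR (S N) * pl z0 m (INR (S N) * t)) by ring.
rewrite Cmod_mult, Cmod_RtoC_pos by apply pos_INR.
pose proof (INR_S_ge1 N). pose proof (Cmod_ge_0 (pl z0 m (INR (S N) * t))). nra.
Qed.

(** * Closed forms *)

Definition ww (z0 z : C) : C := z0 * Cexp (- z).

Lemma Cmod_ww (z0 z : C) : (Cmod z0 <= 1)%R -> (Cmod (ww z0 z) <= exp (- Re z))%R.
Proof.
intros H. unfold ww. rewrite Cmod_mult, Cmod_Cexp, re_opp.
pose proof (exp_pos (- Re z)). nra.
Qed.

Lemma exp_neg_lt1 (x : R) : (0 < x)%R -> (exp (- x) < 1)%R.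
Proof. intros H. rewrite <- exp_0. apply exp_increasing. lra. Qed.

Lemma ww_nz (z0 z : C) : (Cmod z0 <= 1)%R -> (0 < Re z)%R -> 1 - ww z0 z <> 0.
Proof.
intros H1 H2 E. pose proof (Cmod_ww z0 z H1). pose proof (exp_neg_lt1 _ H2).
assert (ww z0 z = 1) by (replace (ww z0 z) with (1 - (1 - ww z0 z)) by ring; rewrite E; ring).
rewrite H3, Cmod_1 in H. lra.
Qed.

Lemma co_term (z0 z : C) (m j : nat) :
  co z0 (S (S (S m))) j * Cexp (- (INR (S j) * z)) = Cpow (INR (S j)) m * Cpow (ww z0 z) (S j).
Proof.
unfold co, ww. rewrite Cpow_mult_l, Cexp_pow, !(Cpow_S _ (S _)), !Cpow_1_r.
replace (INR (S j) * - z) with (- (INR (S j) * z)) by ring.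
rewrite !(Cpow_S (INR (S j))), Cpow_S. simpl Cpow. field. apply INR_S_nz.
Qed.

(* Each closed form satisfies a telescoping relation obtained from the previous one by [(1 - w)]. *)
Lemma pl_closed (z0 z : C) : (Cmod z0 <= 1)%R -> (0 < Re z)%R -> let w := ww z0 z in
  pl z0 3 z = w / (1 - w) /\ pl z0 4 z = w / ((1 - w) * (1 - w)) /\
  pl z0 5 z = w * (1 + w) / ((1 - w) * (1 - w) * (1 - w)).
Proof.
intros H1 H2 w. assert (Hnz := ww_nz z0 z H1 H2). fold w in Hnz.
set (T := fun (m n : nat) => Cpow (INR n) m * Cpow w n).
assert (HT : forall m, Clim (fun n => T m (S n)) 0).
{ intros m. apply Clim_squeeze with (fun n => INR (S n) ^ m * exp (- (INR (S n) * Re z)))%R.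
  - exists 0%nat. intros n _. replace (T m (S n) - 0) with (T m (S n)) by ring.
    unfold T, w. rewrite <- co_term. eapply Rle_trans; [apply (Cmod_DS_term _ m)|lra].
    eapply Rle_trans; [now apply Cmod_co|]. pose proof (INR_S_ge1 n).
    right. change (S (S (S m))) with (3 + m)%nat. rewrite pow_add. field. lra.
  - apply (ex_series_lim_0 (fun n => INR (S n) ^ m * exp (- (INR (S n) * Re z)))%R). now apply ex_series_poly_exp. }
assert (HS : forall m, Clim (Csum (fun j => T m (S j))) (pl z0 (S (S (S m))) z)).
{ intros m. eapply Clim_ext; [|apply CSeries_lim, (pl_abs z0 (S (S (S m))) z H1 H2)].
  intros n. apply Csum_ext. intros j _. apply co_term. }
assert (E0 : pl z0 3 z = w / (1 - w)).
{ apply (Clim_unique _ _ _ (HS 0%nat)).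
  replace (w / (1 - w)) with (/ (1 - w) * (w - w * 0)) by (field; trivial).
  apply Clim_incr_n with 1%nat.
  eapply Clim_ext; [|apply Clim_scal, Clim_minus; [apply Clim_const|apply Clim_scal, (HT 0%nat)]].
  intros n. cbv beta. rewrite Nat.add_1_r. induction n as [|n IH].
  - unfold T. simpl. field. trivial.
  - rewrite Csum_S, <- IH. unfold T. simpl Cpow. rewrite !Cmult_1_l. field. trivial. }
assert (E1 : pl z0 4 z = w / ((1 - w) * (1 - w))).
{ apply (Clim_unique _ _ _ (HS 1%nat)).
  replace (w / ((1 - w) * (1 - w))) with (/ (1 - w) * (w / (1 - w) - w * 0)) by (field; trivial).
  rewrite <- E0. apply Clim_incr_n with 1%nat.
  eapply Clim_ext; [|apply Clim_scal, Clim_minus; [apply (Clim_incr_n' (Csum (fun j => T 0%nat (S j))) 1), (HS 0%nat)|apply Clim_scal, (HT 1%nat)]].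
  intros n. cbv beta. rewrite Nat.add_1_r. induction n as [|n IH].
  - unfold T. simpl. field. trivial.
  - rewrite !(Csum_S _ (S n)), <- IH. unfold T. rewrite !Cpow_1_r, (Cpow_S w (S n)). simpl (Cpow _ 0).
    rewrite (S_INR (S n)), RtoC_plus. field. trivial. }
split; [exact E0|]. split; [exact E1|].
apply (Clim_unique _ _ _ (HS 2%nat)).
replace (w * (1 + w) / ((1 - w) * (1 - w) * (1 - w))) with (/ (1 - w) * (2 * (w / ((1 - w) * (1 - w))) - w / (1 - w) - w * 0)) by (field; trivial).
rewrite <- E0, <- E1. apply Clim_incr_n with 1%nat.
eapply Clim_ext; [|apply Clim_scal, Clim_minus; [apply Clim_minus; [apply Clim_scal, (Clim_incr_n' (Csum (fun j => T 1%nat (S j))) 1), (HS 1%nat)|apply (Clim_incr_n' (Csum (fun j => T 0%nat (S j))) 1), (HS 0%nat)]|apply Clim_scal, (HT 2%nat)]].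
intros n. cbv beta. rewrite Nat.add_1_r. induction n as [|n IH].
- unfold T. simpl. field. trivial.
- rewrite !(Csum_S _ (S n)), <- IH. unfold T. rewrite !Cpow_1_r, (Cpow_S w (S n)). simpl (Cpow _ 0).
  rewrite !(Cpow_S _ 1), !Cpow_1_r.
  rewrite (S_INR (S n)), RtoC_plus. field. trivial.
Qed.

Lemma Re_1_ww (z0 z : C) : (Cmod z0 <= 1)%R -> (0 < Re z)%R -> (0 < Re (1 - ww z0 z))%R.
Proof.
intros H1 H2. pose proof (Cmod_ww z0 z H1). pose proof (exp_neg_lt1 _ H2).
unfold Cminus. rewrite re_plus, re_opp, re_RtoC.
pose proof (Cmod_ge_Re (ww z0 z)). pose proof (Rle_abs (Re (ww z0 z))). lra.
Qed.

Lemma CD_ww (z0 t : C) (x : R) : CD (fun y => ww z0 (y * t)) x (- t * ww z0 (x * t)).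
Proof.
unfold ww. eapply CD_eq.
- apply CD_scal, CD_Cexp, CD_opp, CD_mult; [apply CD_id|apply CD_const].
- cbv beta. ring.
Qed.

Lemma Clog_1_bound (v : C) : (Cmod v <= / 2)%R -> (Cmod (Clog (1 + v)) <= 2 * Cmod v)%R.
Proof.
intros Hv.
assert (Hre : forall x : R, (0 <= x <= 1)%R -> (/ 2 <= Re (1 + x * v))%R).
{ intros x Hx. rewrite re_plus, re_scal_l, re_RtoC. pose proof (Cmod_ge_Re v).
  pose proof (Rle_abs (- Re v)). rewrite Rabs_Ropp in H0. nra. }
pose proof (CD_MVT_const (fun x => Clog (1 + x * v)) (fun x => v / (1 + x * v)) (2 * Cmod v) 0 1 ltac:(lra)) as H.
cbv beta in H. rewrite Cmult_0_l, Cmult_1_l, Cplus_0_r, Clog_1 in H.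
replace (Clog (1 + v) - 0) with (Clog (1 + v)) in H by ring. rewrite Rminus_0_r, Rmult_1_r in H.
apply H.
- intros x Hx. apply (CD_Clog (fun x => 1 + x * v)). { specialize (Hre x Hx). lra. }
  eapply CD_eq; [apply CD_plus; [apply CD_const|apply CD_mult; [apply CD_id|apply CD_const]]|]. cbv beta; ring.
- intros x Hx. specialize (Hre x Hx).
  assert (Hm : (/ 2 <= Cmod (1 + x * v))%R).
  { pose proof (Cmod_ge_Re (1 + x * v)). pose proof (Rle_abs (Re (1 + x * v))). lra. }
  rewrite Cmod_div by (apply Cmod_pos_nz; lra). rewrite Rmult_comm.
  apply Rmult_le_compat_l; [apply Cmod_ge_0|].
  rewrite <- (Rinv_inv 2). apply Rinv_le_contravar; lra.
Qed.

(** Along the ray from [z] to infinity the two sides have the same derivative, by the closed form of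
    [pl z0 3], and both tend to 0. *)
Lemma pl_log (z0 z : C) : (Cmod z0 <= 1)%R -> (0 < Re z)%R -> pl z0 2 z = - Clog (1 - ww z0 z).
Proof.
intros H1 H2.
set (f := fun x : R => pl z0 2 (x * z) + Clog (1 - ww z0 (x * z))).
assert (Hc : forall X, (1 <= X)%R -> f X = f 1%R).
{ intros X HX. assert (E : (Cmod (f X - f 1%R) <= 0)%R).
  { replace 0%R with (0 * (X - 1))%R by ring.
    apply CD_MVT_const with (fun _ => 0); trivial; [|intros; rewrite Cmod_0; lra].
    intros x Hx. assert (Hr : (0 < Re (x * z))%R) by (rewrite re_scal_l; nra).
    eapply CD_eq.
    - apply CD_plus; [apply CD_pl; trivial; lra|].
      apply (CD_Clog (fun y => 1 - ww z0 (y * z))); [now apply Re_1_ww|].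
      apply CD_minus; [apply CD_const|apply CD_ww].
    - cbv beta. destruct (pl_closed z0 (x * z) H1 Hr) as [E _]. rewrite E.
      pose proof (ww_nz z0 (x * z) H1 Hr). field. trivial. }
  apply Ceq_minus, Cmod_eq_0, Rle_antisym; [exact E|apply Cmod_ge_0]. }
assert (L : Clim (fun N => f (INR (S N))) 0).
{ unfold f. replace (RtoC 0) with (0 + 0) by ring. apply Clim_plus; [now apply pl_lim'|].
  assert (L0 : is_lim_seq (fun N => exp (- (INR (S N) * Re z)))%R 0%R).
  { eapply is_lim_seq_ext; [|apply (ex_series_lim_0 _ (ex_series_poly_exp 0 (Re z) H2))]. intros; simpl; ring. }
  apply Clim_squeeze with (fun N => 2 * exp (- (INR (S N) * Re z)))%R.
  - apply is_lim_seq_spec in L0. specialize (L0 (mkposreal (/ 2) ltac:(lra))).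
    eapply filter_imp; [|exact L0]. intros N HN. cbv beta in HN. rewrite Rminus_0_r, Rabs_pos_eq in HN by (left; apply exp_pos).
    simpl pos in HN.
    pose proof (Cmod_ww z0 (INR (S N) * z) H1) as Hw. rewrite re_scal_l in Hw.
    replace (Clog (1 - ww z0 (INR (S N) * z)) - 0) with (Clog (1 + - ww z0 (INR (S N) * z))) by (unfold Cminus; ring).
    eapply Rle_trans; [apply Clog_1_bound; rewrite Cmod_opp; lra|]. rewrite Cmod_opp. lra.
  - replace (Finite 0) with (Rbar_mult 2 0) by (simpl; f_equal; ring). now apply is_lim_seq_scal_l. }
assert (E : f 1%R = 0).
{ apply (Clim_unique (fun N => f (INR (S N)))); trivial.
  eapply Clim_ext; [|apply Clim_const]. intros N. symmetry. apply Hc, INR_S_ge1. }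
unfold f in E. rewrite !Cmult_1_l in E.
replace (pl z0 2 z) with (pl z0 2 z + Clog (1 - ww z0 z) - Clog (1 - ww z0 z)) by ring. rewrite E. ring.
Qed.

(** * Euler-Maclaurin for [sum n Li_1 (z0 e^(-n t))] *)

(** The third derivative of [x -> x Li_1 (z0 e^(-x t))]; [Qe] is the antiderivative of the same
    function that vanishes at infinity. *)
Definition Fe3 (z0 t : C) (x : R) : C := t * t * (3 * pl z0 4 (x * t) - x * t * pl z0 5 (x * t)).
Definition Qe (z0 t : C) (x : R) : C := - (x * pl z0 1 (x * t) / t) - pl z0 0 (x * t) / (t * t).

Lemma CD_Qe (z0 t : C) (x : R) : (Cmod z0 <= 1)%R -> (0 < Re t)%R -> (0 < x)%R ->
  CD (Qe z0 t) x (x * pl z0 2 (x * t)).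
Proof.
intros H1 H2 Hx. assert (Ht : t <> 0) by now apply Re_pos_nz.
unfold Qe, Cdiv. eapply CD_eq.
- apply CD_minus.
  + apply CD_opp. apply CD_mult; [apply CD_mult; [apply CD_id|now apply CD_pl]|apply CD_const].
  + apply CD_mult; [now apply CD_pl|apply CD_const].
- cbv beta. field. trivial.
Qed.

Lemma Fe3_CC (z0 t : C) (x : R) : (Cmod z0 <= 1)%R -> (0 < Re t)%R -> (0 < x)%R -> CC (Fe3 z0 t) x.
Proof.
intros H1 H2 Hx. unfold Fe3.
apply CC_mult; [apply CC_const|]. apply CC_minus.
- apply CC_mult; [apply CC_const|]. eapply CD_CC. now apply CD_pl.
- apply CC_mult; [apply CC_mult; [eapply CD_CC, CD_id|apply CC_const]|]. eapply CD_CC. now apply CD_pl.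
Qed.

Definition em_value (z0 t E : C) : C :=
  pl z0 2 t / 2 - Qe z0 t 1 - (pl z0 2 t - t * pl z0 3 t) / 12 + E.

(** The boundary terms at infinity decay exponentially. Those at [x = 1] remain, and their behaviour
    as [t -> 0] is settled by [origin_data] and [Qe_at_1]. *)
Lemma em_limit (z0 t : C) : (Cmod z0 <= 1)%R -> (0 < Re t)%R -> Cabs (fun k => em (Fe3 z0 t) (S k)) ->
  Clim (Csum (fun n => INR (S n) * pl z0 2 (INR (S n) * t))) (em_value z0 t (CSeries (fun k => em (Fe3 z0 t) (S k)))).
Proof.
intros H1 H2 HE. assert (Ht : t <> 0) by now apply Re_pos_nz.
set (F := fun x : R => x * pl z0 2 (x * t)).
set (F1 := fun x : R => pl z0 2 (x * t) - x * t * pl z0 3 (x * t)).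
set (F2 := fun x : R => - (2 * t * pl z0 3 (x * t)) + x * t * t * pl z0 4 (x * t)).
assert (HS : forall N, Csum (fun n => INR (S n) * pl z0 2 (INR (S n) * t)) N =
   Csum (fun k => em (Fe3 z0 t) (S k)) N - (/ 2) * (F (INR (S N)) - F 1%R) + (Qe z0 t (INR (S N)) - Qe z0 t 1) + (/ 12) * (F1 (INR (S N)) - F1 1%R)).
{ intros N. rewrite (em_sum (Qe z0 t) F F1 F2).
  - change (Csum (fun n => INR (S n) * pl z0 2 (INR (S n) * t)) N) with (Csum (fun k => F (INR (S k))) N). unfold Cdiv. rewrite <- !RtoC_inv by lra. ring.
  - intros x Hx. apply CD_Qe; trivial; lra.
  - intros x Hx. unfold F. eapply CD_eq.
    + apply CD_mult; [apply CD_id|apply CD_pl; trivial; lra].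
    + cbv beta. unfold F1. ring.
  - intros x Hx. unfold F1. eapply CD_eq.
    + apply CD_minus; [apply CD_pl; trivial; lra|]. apply CD_mult; [apply CD_mult; [apply CD_id|apply CD_const]|apply CD_pl; trivial; lra].
    + cbv beta. unfold F2. ring.
  - intros x Hx. unfold F2. eapply CD_eq.
    + apply CD_plus; [apply CD_opp, CD_scal, CD_pl; trivial; lra|].
      apply CD_mult; [apply CD_mult; [apply CD_mult; [apply CD_id|apply CD_const]|apply CD_const]|apply CD_pl; trivial; lra].
    + cbv beta. unfold Fe3. ring.
  - intros x Hx. apply Fe3_CC; trivial; lra. }
assert (LF : Clim (fun N => F (INR (S N))) 0) by now apply pl_lim.
assert (LF1 : Clim (fun N => F1 (INR (S N))) 0).
{ replace (RtoC 0) with (0 - t * 0) by ring. unfold F1. apply Clim_minus; [now apply pl_lim'|].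
  eapply Clim_ext; [|apply Clim_scal, (pl_lim z0 3 t); trivial]. intros; cbv beta; ring. }
assert (LQ : Clim (fun N => Qe z0 t (INR (S N))) 0).
{ replace (RtoC 0) with ((- / t) * 0 - / (t * t) * 0) by ring.
  eapply Clim_ext; [|apply Clim_minus; apply Clim_scal; [apply (pl_lim z0 1 t); trivial|apply (pl_lim' z0 0 t); trivial]].
  intros; cbv beta; unfold Qe. field. trivial. }
eapply Clim_ext; [intros N; symmetry; apply HS|].
replace (em_value z0 t (CSeries (fun k => em (Fe3 z0 t) (S k)))) with
  (CSeries (fun k => em (Fe3 z0 t) (S k)) - (/ 2) * (0 - F 1%R) + (0 - Qe z0 t 1) + (/ 12) * (0 - F1 1%R)).
2:{ unfold em_value, F, F1. rewrite !Cmult_1_l. field. }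
apply Clim_plus; [apply Clim_plus; [apply Clim_minus|]|].
- now apply CSeries_lim.
- apply Clim_scal, Clim_minus; [exact LF|apply Clim_const].
- apply Clim_minus; [exact LQ|apply Clim_const].
- apply Clim_scal, Clim_minus; [exact LF1|apply Clim_const].
Qed.

(** * Expansions at the origin *)

Lemma Cexp_lip (w : C) : (0 <= Re w)%R -> (Cmod (Cexp (- w) - 1) <= Cmod w)%R.
Proof.
intros Hw.
pose proof (CD_MVT_const (fun x => Cexp (x * (- w))) (fun x => - w * Cexp (x * (- w))) (Cmod w) 0 1 ltac:(lra)) as H.
cbv beta in H. rewrite Cmult_0_l, Cmult_1_l, Cexp_0, Rminus_0_r, Rmult_1_r in H. apply H.
- intros x _. apply CD_scaled_exp.
- intros x Hx. rewrite Cmod_mult, Cmod_opp, Cmod_Cexp, re_scal_l, re_opp.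
  rewrite <- (Rmult_1_r (Cmod w)) at 2. apply Rmult_le_compat_l; [apply Cmod_ge_0|].
  rewrite <- exp_0. apply exp_mono. nra.
Qed.

(* [e^(-z) = 1 - z + z^2 h] with [h = 1/2 + z B]. *)
Lemma Cexp_neg_expand (z : C) : (0 < Cmod z <= / 2)%R -> exists B : C, (Cmod B <= / 2)%R /\
  (Cmod (/ 2 + z * B) <= 1)%R /\ ww 1 z = 1 - z + z * z * (/ 2 + z * B).
Proof.
intros Hz. assert (Hnz : z <> 0) by (apply Cmod_pos_nz; lra).
exists ((Cexp (- z) - (1 - z + z * z / 2)) / (z * z * z)).
assert (HB : (Cmod ((Cexp (- z) - (1 - z + z * z / 2)) / (z * z * z)) <= / 2)%R).
{ rewrite Cmod_div by (repeat apply Cmult_neq_0; trivial).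
  pose proof (Cexp_taylor_bound 3 (- z)) as H. rewrite Cmod_opp in H.
  replace (Cexp_taylor 3 (- z)) with (1 - z + z * z / 2) in H by (simpl; rewrite ?RtoC_plus; field).
  rewrite !Cmod_mult. set (r := Cmod z) in *.
  assert (He : (exp r <= 3)%R).
  { eapply Rle_trans; [|apply exp_le_3]. apply exp_mono. lra. }
  apply Rmult_le_reg_r with (r * r * r)%R; [repeat apply Rmult_lt_0_compat; lra|].
  unfold Rdiv. rewrite Rmult_assoc, Rinv_l, Rmult_1_r by (apply Rgt_not_eq; repeat apply Rmult_lt_0_compat; lra).
  eapply Rle_trans; [exact H|]. simpl.
  assert (0 < r * r * r)%R by (repeat apply Rmult_lt_0_compat; lra).
  replace (r * (r * (r * 1)))%R with (r * r * r)%R by ring. nra. }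
repeat split; trivial.
- eapply Rle_trans; [apply Cmod_triangle|]. rewrite Cmod_mult.
  rewrite <- RtoC_inv, Cmod_RtoC_pos by lra. pose proof (Cmod_ge_0 ((Cexp (- z) - (1 - z + z * z / 2)) / (z * z * z))). nra.
- unfold ww. field. trivial.
Qed.

(** The scaled third derivative without its singular part at the origin: [Fe3 z0 t x - dl / x^2 =
    t^2 * rr z0 dl (x * t)]. *)
Definition rr (z0 dl z : C) : C := 3 * pl z0 4 z - z * pl z0 5 z - dl / (z * z).

Lemma Cmod_mult_le (z w : C) (a b : R) : (Cmod z <= a)%R -> (Cmod w <= b)%R -> (Cmod (z * w) <= a * b)%R.
Proof. intros. rewrite Cmod_mult. apply Rmult_le_compat; trivial; apply Cmod_ge_0. Qed.

Lemma Cmod_plus_le (z w : C) (a b : R) : (Cmod z <= a)%R -> (Cmod w <= b)%R -> (Cmod (z + w) <= a + b)%R.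
Proof. intros. pose proof (Cmod_triangle z w). lra. Qed.

Lemma Cmod_minus_le (z w : C) (a b : R) : (Cmod z <= a)%R -> (Cmod w <= b)%R -> (Cmod (z - w) <= a + b)%R.
Proof. intros. pose proof (Cmod_triangle_minus z w). lra. Qed.

Lemma Cmod_IZR_le (n : Z) (a : R) : (Rabs (IZR n) <= a)%R -> (Cmod (RtoC (IZR n)) <= a)%R.
Proof. now rewrite Cmod_R. Qed.

Lemma Cmod_inv_le (z : C) (a : R) : (0 < a)%R -> (a <= Cmod z)%R -> (Cmod (/ z) <= / a)%R.
Proof.
intros Ha H. rewrite Cmod_inv by (apply Cmod_pos_nz; lra). apply Rinv_le_contravar; lra.
Qed.

(** With [w = 1 - z + z^2 h] and [1 - w = z u], the closed forms satisfy [w = u^2 + O(z^2)] and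
    [w (1 + w) = 2 u^3 + O(z^2)]. The poles are then [3/z^2], [-2/z^2] and [-1/z^2], which cancel;
    what is left is a polynomial in [z], [h], [B] over powers of [u]. The bound 1000 is crude. *)
Lemma rr_small_1 (z : C) : (Cmod z <= / 2)%R -> (0 < Re z)%R -> (Cmod (rr 1 1 z) <= 1000)%R.
Proof.
intros Hz Hre. pose proof (Cmod_pos_Re z Hre) as Hp. assert (Hnz := Re_pos_nz z Hre).
destruct (Cexp_neg_expand z (conj Hp Hz)) as [B [HB [Hh Hw]]].
destruct (pl_closed 1 z ltac:(rewrite Cmod_1; lra) Hre) as [_ [E1 E2]].
assert (Hwnz := ww_nz 1 z ltac:(rewrite Cmod_1; lra) Hre).
set (h := / 2 + z * B) in *. set (u := 1 - z * h).
assert (Hu : (/ 2 <= Cmod u)%R).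
{ unfold u. pose proof (Cmod_triangle_inv 1 (z * h)) as H. rewrite Cmod_1 in H.
  pose proof (Cmod_mult_le z h _ _ Hz Hh). lra. }
assert (Hunz : u <> 0) by (apply Cmod_pos_nz; lra).
assert (E : rr 1 1 z = (3 * (1 / 4 + 2 * B - z * z * B * B) * / (u * u)) - (((1 + 3 * h) + 6 * B - 6 * h * h - 2 * z * h + z * z * h * h + 2 * z * h * h * h) * / (u * u * u))).
{ unfold rr. rewrite E1, E2. 
  assert (Hwu : 1 - ww 1 z = z * u) by (rewrite Hw; unfold u; ring).
  rewrite Hwu.
  assert (P1 : ww 1 z = u * u + z * z * (1 / 4 + 2 * B - z * z * B * B)).
  { rewrite Hw. unfold u, h. field. }
  assert (P2 : ww 1 z * (1 + ww 1 z) = 2 * (u * u * u) + z * z * ((1 + 3 * h) + 6 * B - 6 * h * h - 2 * z * h + z * z * h * h + 2 * z * h * h * h)).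
  { rewrite Hw. unfold u, h. field. }
  rewrite P2, P1. field. split; trivial. }
rewrite E.
assert (Hi1 : (Cmod (/ (u * u)) <= 4)%R).
{ replace 4%R with (/ (/ 2 * / 2))%R by field. apply Cmod_inv_le; [lra|]. rewrite Cmod_mult. nra. }
assert (Hi2 : (Cmod (/ (u * u * u)) <= 8)%R).
{ replace 8%R with (/ (/ 2 * / 2 * / 2))%R by field. apply Cmod_inv_le; [lra|]. rewrite !Cmod_mult.
  assert (/ 2 * / 2 <= Cmod u * Cmod u)%R by nra. nra. }
assert (Hz1 : (Cmod z <= 1)%R) by lra. assert (HB1 : (Cmod B <= 1)%R) by lra.
assert (Hn : forall n : Z, (0 <= IZR n)%R -> (Cmod (RtoC (IZR n)) <= IZR n)%R) by (intros; rewrite Cmod_RtoC_pos; lra).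
eapply Rle_trans.
{ apply Cmod_minus_le.
  - apply Cmod_mult_le; [apply Cmod_mult_le; [apply Hn; lra|]|exact Hi1].
    apply Cmod_minus_le; [apply Cmod_plus_le|].
    + instantiate (1 := 1%R). replace (1 / 4) with (RtoC (1 / 4)) by (rewrite RtoC_div by lra; reflexivity).
      rewrite Cmod_RtoC_pos; lra.
    + apply Cmod_mult_le; [apply Hn; lra|exact HB1].
    + repeat apply Cmod_mult_le; eassumption.
  - apply Cmod_mult_le; [|exact Hi2].
    apply Cmod_plus_le; [apply Cmod_plus_le; [apply Cmod_minus_le; [apply Cmod_minus_le; [apply Cmod_plus_le; [apply Cmod_plus_le; [apply Hn; lra|]|]|]|]|]|];
    repeat apply Cmod_mult_le; first [eassumption | apply Hn; lra]. }
lra.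
Qed.

Lemma pl_bounds (z0 z : C) (m : R) : (Cmod z0 <= 1)%R -> (0 < Re z)%R -> (0 < m <= Cmod (1 - ww z0 z))%R -> (m <= 1)%R ->
  (Cmod (pl z0 3 z) <= exp (- Re z) / (m * m * m))%R /\
  (Cmod (pl z0 4 z) <= 2 * exp (- Re z) / (m * m * m))%R /\ (Cmod (pl z0 5 z) <= 2 * exp (- Re z) / (m * m * m))%R.
Proof.
intros H1 H2 Hm Hm1. destruct (pl_closed z0 z H1 H2) as [E0 [E1 E2]].
assert (Hnz := ww_nz z0 z H1 H2). pose proof (Cmod_ww z0 z H1) as Hw.
pose proof (exp_neg_lt1 _ H2). rewrite E0, E1, E2.
set (w := ww z0 z) in *. set (e := exp (- Re z)) in *.
assert (He : (0 < e)%R) by apply exp_pos.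
assert (Hm2 : (m * m <= Cmod ((1 - w) * (1 - w)))%R) by (rewrite Cmod_mult; nra).
assert (Hm3 : (m * m * m <= Cmod ((1 - w) * (1 - w) * (1 - w)))%R) by (rewrite Cmod_mult; nra).
assert (P : (0 < m * m * m)%R) by (repeat apply Rmult_lt_0_compat; lra).
assert (P2 : (0 < m * m)%R) by (apply Rmult_lt_0_compat; lra).
assert (I1 : (/ m <= / (m * m * m))%R) by (apply Rinv_le_contravar; [lra|]; nra).
assert (I2 : (/ (m * m) <= / (m * m * m))%R) by (apply Rinv_le_contravar; [lra|]; nra).
assert (I3 : (0 < / (m * m * m))%R) by now apply Rinv_0_lt_compat.
unfold Cdiv, Rdiv. repeat split.
- eapply Rle_trans; [apply Cmod_mult_le; [exact Hw|apply Cmod_inv_le; [|apply Hm]; lra]|].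
  apply Rmult_le_compat_l; lra.
- eapply Rle_trans; [apply Cmod_mult_le; [exact Hw|apply Cmod_inv_le; [|exact Hm2]; lra]|].
  nra.
- eapply Rle_trans; [apply Cmod_mult_le; [apply Cmod_mult_le; [exact Hw|apply (Cmod_plus_le 1 w 1 1)]|apply Cmod_inv_le; [|exact Hm3]; lra]|].
  + rewrite Cmod_1; lra.
  + lra.
  + right; ring.
Qed.

Definition cone (k : R) (z : C) : Prop := (0 < Re z)%R /\ (Rabs (Im z) <= k * Re z)%R.

Lemma cone_mod (k : R) (z : C) : cone k z -> (Cmod z <= (1 + k) * Re z)%R.
Proof. intros [H1 H2]. pose proof (Cmod_le_sum z). rewrite (Rabs_pos_eq (Re z)) in H by lra. lra. Qed.

Lemma cone_scal (k x : R) (z : C) : (0 < x)%R -> cone k z -> cone k (x * z).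
Proof.
intros Hx [H1 H2]. split; [rewrite re_scal_l; nra|].
rewrite re_scal_l, im_scal_l, Rabs_mult, (Rabs_pos_eq x) by lra. nra.
Qed.

(** In a cone [|z| <= (1 + k) Re z], so [e^(- Re z)] beats every power of [|z|], and [Re z >= a]
    keeps [1 - z0 e^(-z)] away from 0. The order [|z|^(-2)] is that of the subtracted term
    [dl / z^2]. *)
Lemma rr_large (z0 dl : C) (k d : R) : (Cmod z0 <= 1)%R -> (Cmod dl <= 1)%R -> (0 <= k)%R -> (0 < d)%R ->
  exists K : R, (0 < K)%R /\ forall z, cone k z -> (d <= Cmod z)%R -> (Cmod (rr z0 dl z) <= K / Cmod z ^ 2)%R.
Proof.
intros H0 Hdl Hk Hd.
set (a := (d / (1 + k))%R). assert (Ha : (0 < a)%R) by (apply Rdiv_lt_0_compat; lra).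
set (m := (1 - exp (- a))%R).
assert (Hm : (0 < m < 1)%R) by (unfold m; pose proof (exp_neg_lt1 a Ha); pose proof (exp_pos (- a)); lra).
set (M := (/ (m * m * m))%R). assert (HM : (0 < M)%R) by (apply Rinv_0_lt_compat; repeat apply Rmult_lt_0_compat; lra).
exists (1 + (12 * M * (1 + k) ^ 2 + 12 * M * (1 + k) ^ 3))%R.
assert (Hk1 : (0 < 1 + k)%R) by lra.
assert (P2 : (0 < (1 + k) ^ 2)%R) by now apply pow_lt. assert (P3 : (0 < (1 + k) ^ 3)%R) by now apply pow_lt.
split; [assert (0 < M * (1 + k) ^ 2)%R by nra; assert (0 < M * (1 + k) ^ 3)%R by nra; lra|].
intros z Hc Hz. pose proof (cone_mod k z Hc) as Hcm. destruct Hc as [Hre _].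
assert (Hrea : (a <= Re z)%R).
{ unfold a. apply Rmult_le_reg_l with (1 + k)%R; trivial. replace ((1 + k) * (d / (1 + k)))%R with d by (field; lra). lra. }
destruct (pl_bounds z0 z m H0 Hre) as [_ [B1 B2]]; [|lra|].
{ split; [lra|]. pose proof (Cmod_triangle_inv 1 (ww z0 z)) as H. rewrite Cmod_1 in H.
  pose proof (Cmod_ww z0 z H0). assert (exp (- Re z) <= exp (- a))%R by (apply exp_mono; lra). unfold m. lra. }
set (x := Re z) in *. set (r := Cmod z) in *.
assert (Hexp : forall j, (x ^ j * exp (- x) <= INR (fact j))%R).
{ intros j. pose proof (exp_pow_ge x j ltac:(lra)) as H. rewrite exp_Ropp.
  pose proof (INR_fact_lt_0 j). pose proof (exp_pos x).
  apply Rmult_le_reg_r with (exp x); trivial. rewrite Rmult_assoc, Rinv_l, Rmult_1_r by lra.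
  apply Rmult_le_reg_r with (/ INR (fact j))%R; [now apply Rinv_0_lt_compat|].
  replace (INR (fact j) * exp x * / INR (fact j))%R with (exp x) by (field; lra). exact H. }
pose proof (Hexp 2%nat) as X2. pose proof (Hexp 3%nat) as X3.
change (INR (fact 2)) with (1 + 1)%R in X2. replace (INR (fact 3)) with 6%R in X3 by (simpl; ring).
assert (Hr0 : (0 < r)%R) by lra.
assert (R2 : (r ^ 2 * exp (- x) <= (1 + k) ^ 2 * 2)%R).
{ pose proof (exp_pos (- x)).
  assert (r ^ 2 <= ((1 + k) * x) ^ 2)%R by (apply pow_incr; lra).
  pose proof (Rmult_le_compat_r (exp (- x)) _ _ (Rlt_le _ _ H) H1). rewrite Rpow_mult_distr in H2. nra. }
assert (R3 : (r ^ 3 * exp (- x) <= (1 + k) ^ 3 * 6)%R).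
{ pose proof (exp_pos (- x)).
  assert (r ^ 3 <= ((1 + k) * x) ^ 3)%R by (apply pow_incr; lra).
  pose proof (Rmult_le_compat_r (exp (- x)) _ _ (Rlt_le _ _ H) H1). rewrite Rpow_mult_distr in H2. nra. }
assert (Hr2 : (0 < r ^ 2)%R) by now apply pow_lt.
unfold rr. apply Rmult_le_reg_r with (r ^ 2)%R; trivial.
unfold Rdiv at 1. rewrite Rmult_assoc, Rinv_l, Rmult_1_r by lra.
assert (Hb : (Cmod (3 * pl z0 4 z - z * pl z0 5 z - dl / (z * z)) <= 3 * (2 * exp (- x) * M) + r * (2 * exp (- x) * M) + 1 * / r ^ 2)%R).
{ apply Cmod_minus_le; [apply Cmod_minus_le; apply Cmod_mult_le; trivial; try lra; try apply Rle_refl|].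
  - rewrite Cmod_RtoC_pos; lra.
  - unfold Cdiv. apply Cmod_mult_le; trivial. apply Cmod_inv_le; trivial. rewrite Cmod_mult. fold r. simpl; lra. }
apply Rle_trans with ((3 * (2 * exp (- x) * M) + r * (2 * exp (- x) * M) + 1 * / r ^ 2) * r ^ 2)%R.
{ apply Rmult_le_compat_r; lra. }
replace ((3 * (2 * exp (- x) * M) + r * (2 * exp (- x) * M) + 1 * / r ^ 2) * r ^ 2)%R with
  (6 * M * (r ^ 2 * exp (- x)) + 2 * M * (r ^ 3 * exp (- x)) + 1)%R by (field; lra).
assert (M * (r ^ 2 * exp (- x)) <= M * ((1 + k) ^ 2 * 2))%R by (apply Rmult_le_compat_l; lra).
assert (M * (r ^ 3 * exp (- x)) <= M * ((1 + k) ^ 3 * 6))%R by (apply Rmult_le_compat_l; lra).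
lra.
Qed.

(* The singular behaviour at [z = 0] comes only from [z0 = 1] ([dl = 1]); otherwise [dl = 0]. *)
Definition origin_data (z0 dl k0 : C) : Prop :=
  (Cmod z0 <= 1)%R /\ (Cmod dl <= 1)%R /\
  exists K d : R, (0 < K)%R /\ (0 < d <= 1)%R /\ forall z : C, (0 < Re z)%R -> (Cmod z <= d)%R ->
    (Cmod (rr z0 dl z) <= K)%R /\ (Cmod (pl z0 2 z + dl * Clog z - k0) <= K * Cmod z)%R /\
    (Cmod (z * pl z0 3 z - dl) <= K * Cmod z)%R.

Lemma Cexp_inj (a b : C) : Cexp a = Cexp b -> (Rabs (Im a - Im b) < 2 * PI)%R -> a = b.
Proof.
intros E Hi. assert (E1 : Cexp (a - b) = 1) by (rewrite Cexp_minus, E; field; apply Cexp_nz).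
assert (Hre : Re (a - b) = 0%R).
{ apply (f_equal Cmod) in E1. rewrite Cmod_Cexp, Cmod_1 in E1. rewrite <- exp_0 in E1. now apply exp_inv. }
assert (Him : Im (a - b) = (Im a - Im b)%R) by (unfold Cminus; rewrite im_plus, im_opp; ring).
apply (f_equal Re) in E1. unfold Cexp in E1. rewrite re_scal_l, Hre, exp_0, re_RtoC, Him in E1. unfold Re in E1; simpl fst in E1.
set (y := (Im a - Im b)%R) in *.
assert (Hc : cos y = 1%R) by lra.
assert (Hy : y = 0%R).
{ assert (Hs : sin (y / 2) = 0%R).
  { replace y with (2 * (y / 2))%R in Hc by field. rewrite cos_2a_sin in Hc.
    assert (sin (y / 2) * sin (y / 2) = 0)%R by lra. nra. }
  destruct (Rtotal_order y 0) as [Hn|[Hn|Hn]]; trivial; exfalso.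
  - rewrite Rabs_left in Hi by lra. assert (0 < sin (- (y / 2)))%R by (apply sin_gt_0; lra). rewrite sin_neg in H. lra.
  - rewrite Rabs_pos_eq in Hi by lra. assert (0 < sin (y / 2))%R by (apply sin_gt_0; lra). lra. }
apply C_eq; [|unfold y in Hy; lra]. unfold Cminus in Hre. rewrite re_plus, re_opp in Hre. lra.
Qed.

(** The three arguments are below [PI / 2] in modulus, so the two sides differ by less than [2 PI]
    in imaginary part. *)
Lemma Clog_mult (z u : C) : (0 < Re z)%R -> (0 < Re u)%R -> (0 < Re (z * u))%R -> Clog (z * u) = Clog z + Clog u.
Proof.
intros H1 H2 H3. apply Cexp_inj.
- now rewrite Cexp_add, !Cexp_Clog.
- rewrite im_plus. pose proof (Clog_bound z H1). pose proof (Clog_bound u H2). pose proof (Clog_bound _ H3).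
  pose proof PI_RGT_0. apply Rabs_def1; lra.
Qed.

Lemma origin_data_1 : origin_data 1 1 0.
Proof.
split; [rewrite Cmod_1; lra|]. split; [rewrite Cmod_1; lra|].
exists 1000%R, (/ 2)%R. split; [lra|]. split; [lra|]. intros z Hre Hz.
pose proof (Cmod_pos_Re z Hre) as Hp. assert (Hnz := Re_pos_nz z Hre).
split; [now apply rr_small_1|].
destruct (Cexp_neg_expand z (conj Hp Hz)) as [B [HB [Hh Hw]]].
set (h := / 2 + z * B) in *. set (u := 1 - z * h).
assert (Hzh : (Cmod (- (z * h)) <= / 2 * 1)%R) by (rewrite Cmod_opp; now apply Cmod_mult_le).
assert (Hzh' : (Cmod (- (z * h)) <= Cmod z * 1)%R) by (rewrite Cmod_opp; apply Cmod_mult_le; lra).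
assert (Hu : (/ 2 <= Re u)%R).
{ unfold u. unfold Cminus. rewrite re_plus, re_RtoC. pose proof (Cmod_ge_Re (- (z * h))).
  pose proof (Rle_abs (- Re (- (z * h)))). rewrite Rabs_Ropp in H0. lra. }
assert (Hwu : 1 - ww 1 z = z * u) by (rewrite Hw; unfold u; ring).
split.
- rewrite pl_log by (trivial; rewrite Cmod_1; lra). rewrite Hwu, Clog_mult; trivial; [|lra|rewrite <- Hwu; apply Re_1_ww; trivial; rewrite Cmod_1; lra].
  replace (- (Clog z + Clog u) + 1 * Clog z - 0) with (- Clog (1 + - (z * h))) by (unfold u, Cminus; ring).
  rewrite Cmod_opp. eapply Rle_trans; [apply Clog_1_bound; lra|]. lra.
- destruct (pl_closed 1 z ltac:(rewrite Cmod_1; lra) Hre) as [E _]. rewrite E, Hwu.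
  assert (Hum : (/ 2 <= Cmod u)%R) by (pose proof (Cmod_ge_Re u); pose proof (Rle_abs (Re u)); lra).
  assert (Hunz : u <> 0) by (apply Cmod_pos_nz; lra).
  replace (z * (ww 1 z / (z * u)) - 1) with (z * (- 1 + z * h + h) * / u).
  2:{ rewrite Hw. unfold u. fold u. field_simplify_eq; [unfold u; ring|split; trivial]. }
  replace (1000 * Cmod z)%R with (Cmod z * 500 * 2)%R by ring.
  rewrite <- (Rinv_inv 2).
  apply Cmod_mult_le; [apply Cmod_mult_le; [lra|]|apply Cmod_inv_le; lra].
  eapply Rle_trans; [apply Cmod_plus_le; [apply Cmod_plus_le|exact Hh]|].
  + instantiate (1 := 1%R). rewrite Cmod_R, Rabs_left; lra.
  + rewrite Cmod_opp in Hzh. exact Hzh.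
  + lra.
Qed.

(** For [|z| <= |1 - z0| / 2] the quantity [1 - z0 e^(-x z)] stays at distance [m] from 0 along the
    whole ray, so the closed forms are bounded and the logarithm is Lipschitz. *)
Lemma origin_data_neq (z0 : C) : Cmod z0 = 1%R -> z0 <> 1 -> origin_data z0 0 (- Clog (1 - z0)).
Proof.
intros H1 Hne. assert (Hle : (Cmod z0 <= 1)%R) by lra.
split; [trivial|]. split; [rewrite Cmod_0; lra|].
set (m := (Rmin 1 (Cmod (1 - z0) / 2))%R).
assert (Hz1 : (0 < Cmod (1 - z0))%R).
{ apply Cmod_gt_0. intros E. apply Hne. replace z0 with (1 - (1 - z0)) by ring. rewrite E; ring. }
assert (Hre0 : (0 < Re (1 - z0))%R).
{ unfold Cminus. rewrite re_plus, re_opp, re_RtoC. pose proof (Cmod_ge_Re z0). pose proof (Rle_abs (Re z0)).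
  destruct (Req_dec (Re z0) 1) as [E|E]; [exfalso|lra].
  apply Hne. pose proof (Cmod_sqr z0) as Hs. rewrite H1, E in Hs. apply C_eq; simpl; trivial.
  assert (Im z0 * Im z0 = 0)%R by lra. nra. }
assert (Hm : (0 < m)%R) by (apply Rmin_glb_lt; lra).
assert (Hm1 : (m <= 1)%R) by apply Rmin_l. assert (Hm2 : (m <= Cmod (1 - z0) / 2)%R) by apply Rmin_r.
set (M := (/ (m * m * m))%R). assert (HM : (0 < M)%R) by (apply Rinv_0_lt_compat; repeat apply Rmult_lt_0_compat; lra).
assert (HmM : (/ m <= M)%R) by (apply Rinv_le_contravar; [repeat apply Rmult_lt_0_compat; lra|]; nra).
exists (8 * M)%R, m. split; [lra|]. split; [lra|]. intros z Hre Hz.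
assert (Hlow : forall x : R, (0 <= x <= 1)%R -> (m <= Cmod (1 - ww z0 (x * z)))%R).
{ intros x Hx.
  replace (1 - ww z0 (x * z)) with ((1 - z0) - z0 * (Cexp (- (x * z)) - 1)) by (unfold ww; ring).
  pose proof (Cmod_triangle_inv (1 - z0) (z0 * (Cexp (- (x * z)) - 1))).
  rewrite Cmod_mult, H1 in H. pose proof (Cexp_lip (x * z) ltac:(rewrite re_scal_l; nra)) as Hl.
  rewrite Cmod_mult, Cmod_RtoC_pos in Hl by lra. pose proof (Cmod_ge_0 z). nra. }
pose proof (Hlow 1%R ltac:(lra)) as Hl1. rewrite Cmult_1_l in Hl1.
destruct (pl_bounds z0 z m Hle Hre (conj Hm Hl1) Hm1) as [B0 [B1 B2]].
pose proof (exp_neg_lt1 _ Hre). pose proof (exp_pos (- Re z)). pose proof (Cmod_ge_0 z).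
unfold Rdiv in B0, B1, B2. fold M in B0, B1, B2.
assert (B0' : (Cmod (pl z0 3 z) <= M)%R) by nra.
assert (B1' : (Cmod (pl z0 4 z) <= 2 * M)%R) by nra.
assert (B2' : (Cmod (pl z0 5 z) <= 2 * M)%R) by nra.
repeat split.
- unfold rr. replace (0 / (z * z)) with (RtoC 0) by (unfold Cdiv; ring).
  replace (_ - 0) with (3 * pl z0 4 z - z * pl z0 5 z) by ring.
  eapply Rle_trans; [apply Cmod_minus_le; apply Cmod_mult_le; [apply Cmod_IZR_le; right; apply Rabs_pos_eq; lra|exact B1'|exact (Rle_trans _ _ _ Hz Hm1)|exact B2']|]. lra.
- rewrite pl_log by trivial.
  replace (- Clog (1 - ww z0 z) + 0 * Clog z - - Clog (1 - z0)) with (- (Clog (1 - ww z0 z) - Clog (1 - z0))) by ring.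
  rewrite Cmod_opp.
  pose proof (CD_MVT_const (fun x => Clog (1 - ww z0 (x * z))) (fun x => z * ww z0 (x * z) / (1 - ww z0 (x * z))) (Cmod z * 1 * / m) 0 1 ltac:(lra)) as HV.
  cbv beta in HV. rewrite Cmult_0_l, Cmult_1_l in HV.
  replace (ww z0 0) with z0 in HV by (unfold ww; rewrite Copp_0, Cexp_0; ring).
  eapply Rle_trans; [apply HV|].
  + intros x Hx.
    assert (Hrx : (0 < Re (1 - ww z0 (x * z)))%R).
    { destruct (Req_dec x 0) as [->|Hx0].
      - rewrite Cmult_0_l. unfold ww. rewrite Copp_0, Cexp_0, Cmult_1_r. trivial.
      - apply Re_1_ww; trivial. rewrite re_scal_l. assert (0 < x)%R by lra. nra. }
    eapply CD_eq; [apply (CD_Clog (fun x => 1 - ww z0 (x * z))); [exact Hrx|apply CD_minus; [apply CD_const|apply CD_ww]]|].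
    cbv beta. field. apply Re_pos_nz, Hrx.
  + intros x Hx. unfold Cdiv. apply Cmod_mult_le; [apply Cmod_mult_le; [lra|]|apply Cmod_inv_le; trivial; now apply Hlow].
    eapply Rle_trans; [apply Cmod_ww; trivial|]. rewrite <- exp_0. apply exp_mono. rewrite re_scal_l. nra.
  + rewrite Rminus_0_r. nra.
- replace (z * pl z0 3 z - 0) with (z * pl z0 3 z) by ring.
  eapply Rle_trans; [apply Cmod_mult_le; [apply Rle_refl|exact B0']|]. nra.
Qed.

(** * The expansion of [sum n Li_1 (z0 e^(-n t))] as [t -> 0] in a cone *)

Lemma ex_series_sq : ex_series (fun n => / INR (S n) ^ 2)%R.
Proof.
apply (ex_series_le (K := R_AbsRing) (V := R_CompleteNormedModule) _ (fun n => exp (- (3 / 2) * ln (INR (S n))))%R); [|exact ex_series_pow_32].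
intros n. change (norm ?u) with (Rabs u). pose proof (INR_S_ge1 n) as Hn.
rewrite Rabs_pos_eq by (left; apply Rinv_0_lt_compat, pow_lt; lra).
replace (/ INR (S n) ^ 2)%R with (exp (- 2 * ln (INR (S n)))).
- apply exp_mono. pose proof (ln_nonneg _ Hn). nra.
- replace (-2 * ln (INR (S n)))%R with (- (INR 2 * ln (INR (S n))))%R by (simpl; ring).
  rewrite exp_Ropp. f_equal. apply (Rpower_pow 2). lra.
Qed.

Definition l3 (z0 : C) : C := CSeries (co z0 0).

(** [Qe] is known through its decay at infinity, whereas its value at 1 is wanted for small [t]. [R]
    subtracts from [Qe] an antiderivative of the model [x (k0 - dl log (x t))], so [R'] is [x] times
    the error of the model. At [x = 0] its limit is [- l3 z0 / t^2], the source of the main term. *)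
Lemma Qe_at_1 (z0 dl k0 t : C) (B : R) : (Cmod z0 <= 1)%R -> (0 < Re t)%R ->
  (forall x, 0 < x <= 1 -> Cmod (pl z0 2 (x * t) + dl * Clog (x * t) - k0) <= B)%R ->
  (Cmod (Qe z0 t 1 + dl * (Clog t / 2 - 1 / 4) - k0 / 2 + l3 z0 / (t * t)) <= B)%R.
Proof.
intros H0 Ht HB. assert (Htnz := Re_pos_nz t Ht).
set (R := fun x : R => Qe z0 t x + dl * (x * x / 2 * Clog (x * t) - x * x / 4) - k0 * (x * x) / 2).
assert (HR1 : forall x : Rdefinitions.R, (0 < x <= 1)%R -> (Cmod (R 1%R - R x) <= B * (1 - x))%R).
{ intros x Hx. apply CD_MVT_const with (fun y => y * (pl z0 2 (y * t) + dl * Clog (y * t) - k0)); [lra| |].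
  - intros y Hy. assert (Hyn : RtoC y <> 0) by (intros E; apply RtoC_inj in E; lra).
    assert (Hl : CD (fun y : Rdefinitions.R => y * t) y t)
      by (eapply CD_eq; [apply CD_mult; [apply CD_id|apply CD_const]|cbv beta; ring]).
    assert (Hsq : CD (fun y : Rdefinitions.R => y * y) y (2 * y))
      by (eapply CD_eq; [apply CD_mult; apply CD_id|cbv beta; ring]).
    unfold R, Cdiv. eapply CD_eq.
    + apply CD_minus; [apply CD_plus; [apply CD_Qe; trivial; lra|]|].
      * apply CD_scal, CD_minus.
        -- apply CD_mult; [apply CD_mult; [exact Hsq|apply CD_const]|].
           apply (CD_Clog (fun y => y * t)); [rewrite re_scal_l; nra|exact Hl].
        -- apply CD_mult; [exact Hsq|apply CD_const].
      * apply CD_mult; [apply CD_scal, Hsq|apply CD_const].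
    + cbv beta. field. split; trivial.
  - intros y Hy. rewrite Cmod_mult, Cmod_RtoC_pos by lra.
    specialize (HB y ltac:(lra)). pose proof (Cmod_ge_0 (pl z0 2 (y * t) + dl * Clog (y * t) - k0)). nra. }
assert (HB0 : (0 <= B)%R) by (eapply Rle_trans; [apply Cmod_ge_0|apply (HB 1%R); lra]).
set (x_ := fun n => (/ INR (S n))%R).
assert (Hx_ : forall n, (0 < x_ n <= 1)%R).
{ intros n. unfold x_. pose proof (INR_S_ge1 n). split; [apply Rinv_0_lt_compat; lra|].
  rewrite <- Rinv_1. apply Rinv_le_contravar; lra. }
assert (Hlim : is_lim_seq x_ 0%R).
{ apply (is_lim_seq_incr_1 (fun n => / INR n)%R).
  apply (is_lim_seq_inv INR p_infty); [apply is_lim_seq_INR|discriminate]. }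
assert (Hc1 : forall (m j : nat), (m <= 1)%nat -> (Cmod (co z0 m j) <= / INR (S j) ^ 2)%R).
{ intros m j Hm. eapply Rle_trans; [now apply Cmod_co|]. pose proof (INR_S_ge1 j) as Hj.
  assert (INR (S j) ^ m <= INR (S j) ^ 1)%R by (apply Rle_pow; trivial).
  apply Rle_trans with (INR (S j) ^ 1 / INR (S j) ^ 3)%R.
  - apply Rmult_le_compat_r; trivial. left. apply Rinv_0_lt_compat, pow_lt. lra.
  - right. field. lra. }
set (S2 := Series (fun n => / INR (S n) ^ 2)%R).
assert (HL : Clim (fun n => R (x_ n)) (- (l3 z0 / (t * t)))).
{ apply Clim_squeeze with (fun n => x_ n * (S2 * / Cmod t + Cmod t * S2 * / (Cmod t * Cmod t) + Cmod dl * (1 + Cmod (Clog t) + 1) + Cmod k0))%R.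
  - exists 0%nat. intros n _. specialize (Hx_ n). set (x := x_ n) in *.
    assert (Hxr : (0 < Re (x * t))%R) by (rewrite re_scal_l; nra).
    replace (R x - - (l3 z0 / (t * t))) with
      (- (x * pl z0 1 (x * t) * / t) - (pl z0 0 (x * t) - l3 z0) * / (t * t) + dl * ((x * x / 2 * Clog (x * t)) - x * x / 4) - k0 * (x * x) / 2)
      by (unfold R, Qe; field; trivial).
    assert (T1 : (Cmod (- (x * pl z0 1 (x * t) * / t)) <= x * S2 * / Cmod t)%R).
    { rewrite Cmod_opp, !Cmod_mult, Cmod_inv, Cmod_RtoC_pos by (trivial; lra).
      apply Rmult_le_compat_r; [left; apply Rinv_0_lt_compat, Cmod_gt_0; trivial|].
      apply Rmult_le_compat_l; [lra|].
      apply Cmod_CSeries; [|exact ex_series_sq]. intros j. rewrite Cmod_mult, Cmod_Cexp, re_opp, re_scal_l.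
      rewrite <- (Rmult_1_r (/ INR (S j) ^ 2)).
      apply Rmult_le_compat; [apply Cmod_ge_0|left; apply exp_pos|now apply Hc1|].
      rewrite <- exp_0. apply exp_mono. pose proof (pos_INR (S j)). nra. }
    assert (T2 : (Cmod (pl z0 0 (x * t) - l3 z0) <= x * (Cmod t * S2))%R).
    { assert (Hab : Cabs (co z0 0)).
      { apply Cabs_le with (2 := ex_series_sq). intros j. apply Hc1; lia. }
      unfold pl, DS, l3. rewrite <- CSeries_minus by (trivial; now apply pl_abs).
      replace (x * (Cmod t * S2))%R with (Series (fun j => (x * Cmod t) * / INR (S j) ^ 2)%R) by (rewrite Series_scal_l; unfold S2; ring).
      apply Cmod_CSeries.
      - intros j. replace (_ - _) with (co z0 0 j * (Cexp (- (INR (S j) * (x * t))) - 1)) by ring.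
        rewrite Cmod_mult. pose proof (pos_INR (S j)) as Hj.
        pose proof (Cexp_lip (INR (S j) * (x * t)) ltac:(rewrite re_scal_l; nra)) as Hl.
        rewrite !Cmod_mult, !Cmod_RtoC_pos in Hl by (trivial; lra).
        pose proof (Cmod_co z0 0 j H0) as Hc. simpl (_ ^ 0)%R in Hc.
        apply Rle_trans with ((1 / INR (S j) ^ 3) * (INR (S j) * (x * Cmod t)))%R.
        + apply Rmult_le_compat; trivial; apply Cmod_ge_0.
        + right. pose proof (INR_S_ge1 j). field. lra.
      - apply (ex_series_scal (V := R_NormedModule)). exact ex_series_sq. }
    assert (T3 : (Cmod (x * x / 2 * Clog (x * t)) <= x * (1 + Cmod (Clog t)))%R).
    { replace (Clog (x * t)) with (RtoC (ln x) + Clog t).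
      2:{ rewrite <- Clog_R by lra. symmetry. apply Clog_mult; trivial. simpl; lra. }
      assert (Hlx : (Rabs (ln x) * x <= 1)%R).
      { assert (Hlx : (ln x <= 0)%R) by (rewrite <- ln_1; apply ln_le; lra).
        rewrite Rabs_left1 by trivial.
        pose proof (exp_ineq1_le (- ln x)) as He. rewrite exp_Ropp, exp_ln in He by lra.
        apply Rmult_le_reg_r with (/ x)%R; [apply Rinv_0_lt_compat; lra|].
        rewrite Rmult_assoc, Rinv_r by lra. lra. }
      rewrite !Cmod_mult, Cmod_div, Cmod_mult, !(Cmod_RtoC_pos x), (Cmod_RtoC_pos 2) by (try lra; intros E; apply RtoC_inj in E; lra).
      pose proof (Cmod_triangle (ln x) (Clog t)) as Htr. rewrite (Cmod_R (ln x)) in Htr.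
      pose proof (Cmod_ge_0 (Clog t)). pose proof (Cmod_ge_0 (ln x + Clog t)). pose proof (Rabs_pos (ln x)).
      apply Rle_trans with (x * (x * (Rabs (ln x) + Cmod (Clog t))))%R.
      - replace (x * x / 2 * Cmod (ln x + Clog t))%R with (x * (x * (/ 2 * Cmod (ln x + Clog t))))%R by field.
        apply Rmult_le_compat_l; [lra|]. apply Rmult_le_compat_l; [lra|]. lra.
      - apply Rmult_le_compat_l; [lra|]. nra. }
    assert (T4 : (Cmod (RtoC x * x / 4) <= x)%R).
    { rewrite Cmod_div, Cmod_mult, !(Cmod_RtoC_pos x), (Cmod_RtoC_pos 4) by (try lra; intros E; apply RtoC_inj in E; lra). nra. }
    assert (T5 : (Cmod (k0 * (x * x) / 2) <= x * Cmod k0)%R).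
    { rewrite Cmod_div, !Cmod_mult, !(Cmod_RtoC_pos x), (Cmod_RtoC_pos 2) by (try lra; intros E; apply RtoC_inj in E; lra).
      pose proof (Cmod_ge_0 k0). assert (x * x <= x)%R by nra. nra. }
    assert (Hti : (0 < / (Cmod t * Cmod t))%R) by (apply Rinv_0_lt_compat, Rmult_lt_0_compat; now apply Cmod_pos_Re).
    assert (T2' : (Cmod ((pl z0 0 (x * t) - l3 z0) * / (t * t)) <= x * (Cmod t * S2) * / (Cmod t * Cmod t))%R).
    { apply Cmod_mult_le; trivial. rewrite <- Cmod_mult, Cmod_inv by (apply Cmult_neq_0; trivial). lra. }
    assert (T34 : (Cmod (dl * ((x * x / 2 * Clog (x * t)) - x * x / 4)) <= Cmod dl * (x * (1 + Cmod (Clog t)) + x))%R).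
    { apply Cmod_mult_le; [lra|]. now apply Cmod_minus_le. }
    eapply Rle_trans; [apply Cmod_minus_le; [apply Cmod_plus_le; [apply Cmod_minus_le; [exact T1|exact T2']|exact T34]|exact T5]|].
    right; ring.
  - match goal with |- is_lim_seq (fun n => x_ n * ?c)%R _ => replace (Finite 0) with (Rbar_mult 0 c) by (simpl; f_equal; ring) end.
    apply is_lim_seq_scal_r. exact Hlim. }
replace (Qe z0 t 1 + dl * (Clog t / 2 - 1 / 4) - k0 / 2 + l3 z0 / (t * t)) with (R 1%R - - (l3 z0 / (t * t))).
2:{ unfold R. rewrite !Cmult_1_l. field. trivial. }
apply Clim_bound with (fun n => R 1%R - R (x_ n)).
- exists 0%nat. intros n _. specialize (Hx_ n). specialize (HR1 (x_ n) Hx_). nra.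
- apply Clim_minus; [apply Clim_const|exact HL].
Qed.

(** The exponent [3/2] interpolates between the boundedness at the origin and the order [|z|^(-2)]
    at infinity. *)
Lemma rr_bound (z0 dl k0 : C) (k : R) : origin_data z0 dl k0 -> (0 <= k)%R ->
  exists K : R, (0 < K)%R /\ forall z, cone k z -> (Cmod (rr z0 dl z) <= K * exp (- (3 / 2) * ln (Cmod z)))%R.
Proof.
intros [H0 [Hdl [K1 [d [HK1 [Hd H]]]]]] Hk.
destruct (rr_large z0 dl k d H0 Hdl Hk ltac:(lra)) as [K2 [HK2 H2]].
assert (Hd2 : (0 < d ^ 2 <= 1)%R) by (split; [apply pow_lt; lra|rewrite <- (pow1 2); apply pow_incr; lra]).
assert (HK2d : (K2 <= K2 / d ^ 2)%R).
{ rewrite <- (Rmult_1_r K2) at 1. apply Rmult_le_compat_l; [lra|]. rewrite <- Rinv_1. apply Rinv_le_contravar; lra. }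
exists (K1 + K2 / d ^ 2)%R. split; [lra|]. intros z Hz.
assert (Hp := Cmod_pos_Re z (proj1 Hz)). set (r := Cmod z) in *.
assert (Hone : (r <= 1)%R -> (1 <= exp (- (3 / 2) * ln r))%R).
{ intros Hr. rewrite <- exp_0. apply exp_mono. assert (ln r <= 0)%R by (rewrite <- ln_1; apply ln_le; lra). lra. }
destruct (Rle_dec r d) as [Hr|Hr].
- destruct (H z (proj1 Hz) Hr) as [B _]. specialize (Hone ltac:(lra)). nra.
- specialize (H2 z Hz ltac:(fold r; lra)). fold r in H2. eapply Rle_trans; [exact H2|].
  destruct (Rle_dec r 1) as [Hr1|Hr1].
  + specialize (Hone Hr1). apply Rle_trans with (K2 / d ^ 2)%R; [|nra].
    apply Rmult_le_compat_l; [lra|]. apply Rinv_le_contravar; [lra|]. apply pow_incr. lra.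
  + assert (E : (/ r ^ 2 <= exp (- (3 / 2) * ln r))%R).
    { replace (/ r ^ 2)%R with (exp (- (INR 2 * ln r))).
      - apply exp_mono. pose proof (ln_nonneg r ltac:(lra)). simpl. lra.
      - rewrite exp_Ropp. f_equal. apply (Rpower_pow 2). trivial. }
    pose proof (exp_pos (- (3 / 2) * ln r)). unfold Rdiv in *.
    apply Rle_trans with (K2 * exp (- (3 * / 2) * ln r))%R; [apply Rmult_le_compat_l; lra|].
    apply Rmult_le_compat_r; lra.
Qed.

Lemma pw_m2 (x : R) : (0 < x)%R -> pw (-2) x = / (x * x).
Proof.
intros H. assert (RtoC x <> 0) by (intros E; apply RtoC_inj in E; lra).
replace (RtoC (-2)) with (0 - 1 - 1) by ring. rewrite !pw_minus_1 by trivial.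
replace (pw 0 x) with (RtoC 1) by (unfold pw; rewrite Cmult_0_l, Cexp_0; reflexivity).
rewrite RtoC_inv by lra. field. trivial.
Qed.

(** The scaling gives [|t|^2 (x |t|)^(-3/2) = sqrt |t| x^(-3/2)]: summable in [x] and small in [t].
    The subtracted part [dl / x^2] sums to [dl * Jz (-1)], which is how the constant of the zeta
    side enters. *)
Lemma em_remainder (z0 dl k0 : C) (k : R) : origin_data z0 dl k0 -> (0 <= k)%R ->
  exists K : R, (0 < K)%R /\ forall t, cone k t -> Cabs (fun j => em (Fe3 z0 t) (S j)) /\
    (Cmod (CSeries (fun j => em (Fe3 z0 t) (S j)) - dl * Jz (-1)) <= K * sqrt (Cmod t))%R.
Proof.
intros Ho Hk. destruct (rr_bound z0 dl k0 k Ho Hk) as [K [HK H]]. destruct Ho as [H0 _].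
set (e32 := fun n => exp (- (3 / 2) * ln (INR (S n)))%R).
exists (K * Series e32 + 1)%R. split.
{ assert (0 <= Series e32)%R; [|nra].
  eapply Rle_trans; [apply (Cmod_ge_0 (CSeries (fun _ => 0)))|]. apply Cmod_CSeries; [|exact ex_series_pow_32].
  intros j. rewrite Cmod_0. left; apply exp_pos. }
intros t Ht. assert (Hre := proj1 Ht). assert (Hnz := Re_pos_nz t Hre). assert (Hp := Cmod_pos_Re t Hre).
assert (Hpos : forall j x, (INR (S j) <= x)%R -> (0 < x)%R) by (intros j x Hx; pose proof (INR_S_ge1 j); lra).
assert (Hf : forall j, Con (Fe3 z0 t) (INR (S j)) (INR (S j) + 1)).
{ intros j x Hx. apply Fe3_CC; trivial. now apply (Hpos j). }
assert (Hp2 : forall j, Con (fun x => dl * pw (-2) x) (INR (S j)) (INR (S j) + 1)) by (intros; apply Con_scal, pw_con).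
assert (Hb : forall j, (Cmod (em (Fe3 z0 t) (S j) - dl * em (pw (-2)) (S j)) <= K * sqrt (Cmod t) * e32 j)%R).
{ intros j. rewrite <- em_scal, <- em_minus by (trivial; apply pw_con).
  apply em_bound; [now apply Con_minus|]. intros x Hx. assert (Hx0 := Hpos j x ltac:(lra)).
  assert (Hxn : RtoC x <> 0) by (intros E; apply RtoC_inj in E; lra).
  replace (Fe3 z0 t x - dl * pw (-2) x) with (t * t * rr z0 dl (x * t)).
  2:{ unfold Fe3, rr. rewrite pw_m2 by trivial. field. split; trivial. }
  rewrite !Cmod_mult. specialize (H (x * t) (cone_scal k x t Hx0 Ht)).
  rewrite Cmod_mult, Cmod_RtoC_pos, ln_mult in H by lra.
  set (r := Cmod t) in *.
  assert (Hs : sqrt r = exp (/ 2 * ln r)) by (rewrite <- Rpower_sqrt by trivial; reflexivity).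
  apply Rle_trans with (r * r * (K * exp (- (3 / 2) * (ln x + ln r))))%R.
  { apply Rmult_le_compat_l; [nra|exact H]. }
  rewrite Hs. unfold e32.
  replace (r * r * (K * exp (- (3 / 2) * (ln x + ln r))))%R with (K * exp (/ 2 * ln r) * exp (- (3 / 2) * ln x))%R.
  - apply Rmult_le_compat_l; [pose proof (exp_pos (/ 2 * ln r)); nra|]. apply exp_mono.
    pose proof (INR_S_ge1 j). assert (ln (INR (S j)) <= ln x)%R by (apply ln_le; lra). lra.
  - replace (r * r)%R with (exp (2 * ln r)) by (replace (2 * ln r)%R with (ln r + ln r)%R by ring; rewrite exp_plus, exp_ln by trivial; reflexivity).
    replace (exp (2 * ln r) * (K * exp (- (3 / 2) * (ln x + ln r))))%R
      with (K * (exp (2 * ln r) * exp (- (3 / 2) * (ln x + ln r))))%R by ring.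
    rewrite Rmult_assoc, <- !exp_plus. do 2 f_equal. field. }
assert (HJ : Cabs (fun j => em (pw (-2)) (S j))).
{ eapply Cabs_ext; [|apply (Jz_abs (-1)); rewrite re_RtoC; lra].
  intros j. cbv beta. do 2 f_equal. ring. }
assert (HE : ex_series (fun j => K * sqrt (Cmod t) * e32 j)%R) by (apply (ex_series_scal (V := R_NormedModule)), ex_series_pow_32).
assert (HD : Cabs (fun j => em (Fe3 z0 t) (S j) - dl * em (pw (-2)) (S j))) by now apply Cabs_le with (2 := HE).
assert (HF : Cabs (fun j => em (Fe3 z0 t) (S j))).
{ eapply Cabs_ext; [|apply Cabs_plus; [exact HD|apply (Cabs_scal dl), HJ]]. intros j; cbv beta; ring. }
split; trivial.
replace (Jz (-1)) with (CSeries (fun j => em (pw (-2)) (S j))).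
2:{ apply CSeries_ext. intros j. do 2 f_equal. ring. }
rewrite <- CSeries_scal, <- CSeries_minus by (trivial; now apply Cabs_scal).
eapply Rle_trans; [apply Cmod_CSeries; [exact Hb|exact HE]|].
rewrite Series_scal_l. pose proof (sqrt_pos (Cmod t)). fold e32. nra.
Qed.

(* The logarithm of [prod_n (1 - z0 e^(-n t))^(-n)]; the generating function at [q = e^(-t)] is [exp (Lam 1 t - Lam z0 t)]. *)
Definition Lam (z0 t : C) : C := CSeries (fun n => INR (S n) * pl z0 2 (INR (S n) * t)).

Lemma Lam_expansion (z0 dl k0 : C) (k : R) : origin_data z0 dl k0 -> (0 <= k)%R ->
  exists K d : R, (0 < d)%R /\ (0 <= K)%R /\ forall t, cone k t -> (Cmod t <= d)%R ->
    (Cmod (Lam z0 t - (l3 z0 / (t * t) + dl * (Clog t / 12 + Jz (-1) - 1 / 6) - k0 / 12)) <= K * sqrt (Cmod t))%R.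
Proof.
intros Ho Hk. destruct (em_remainder z0 dl k0 k Ho Hk) as [K1 [HK1 H1]].
destruct Ho as [H0 [Hdl [K2 [d [HK2 [Hd H2]]]]]].
exists (K1 + 3 * K2)%R, d. split; [lra|]. split; [lra|]. intros t Ht Htd.
assert (Hre := proj1 Ht). assert (Hnz := Re_pos_nz t Hre). assert (Hp := Cmod_pos_Re t Hre).
destruct (H1 t Ht) as [HE HE1]. destruct (H2 t Hre Htd) as [_ [HP HP0]].
unfold Lam. rewrite (CSeries_unique _ _ (em_limit z0 t H0 Hre HE)).
set (E := CSeries (fun j => em (Fe3 z0 t) (S j))) in *.
assert (HQ : (Cmod (Qe z0 t 1 + dl * (Clog t / 2 - 1 / 4) - k0 / 2 + l3 z0 / (t * t)) <= K2 * Cmod t)%R).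
{ apply Qe_at_1; trivial. intros x Hx. destruct (H2 (x * t)) as [_ [HPx _]].
  - rewrite re_scal_l. nra.
  - rewrite Cmod_mult, Cmod_RtoC_pos by lra. nra.
  - eapply Rle_trans; [exact HPx|]. rewrite Cmod_mult, Cmod_RtoC_pos by lra. apply Rmult_le_compat_l; [lra|]. nra. }
set (e1 := pl z0 2 t + dl * Clog t - k0) in *. set (e2 := Qe z0 t 1 + dl * (Clog t / 2 - 1 / 4) - k0 / 2 + l3 z0 / (t * t)) in *.
set (e3 := t * pl z0 3 t - dl) in *. set (e4 := E - dl * Jz (-1)) in *.
(* Bookkeeping of the boundary terms: [log t] receives [-5/12 + 1/2 = 1/12], the constant
   [-1/4 + 1/12 = -1/6], and [k0] receives [5/12 - 1/2 = -1/12]. *)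
replace (em_value z0 t E - (l3 z0 / (t * t) + dl * (Clog t / 12 + Jz (-1) - 1 / 6) - k0 / 12))
  with ((5 / 12)%R * e1 - e2 + (1 / 12)%R * e3 + e4).
2:{ unfold em_value, e1, e2, e3, e4. rewrite !RtoC_div by lra. field. trivial. }
assert (Hst : (Cmod t <= sqrt (Cmod t))%R).
{ rewrite <- (sqrt_sqrt (Cmod t)) at 1 by lra. rewrite <- (Rmult_1_r (sqrt (Cmod t))) at 3.
  apply Rmult_le_compat_l; [apply sqrt_pos|]. rewrite <- sqrt_1. apply sqrt_le_1; lra. }
eapply Rle_trans; [apply Cmod_plus_le; [apply Cmod_plus_le; [apply Cmod_minus_le; [apply Cmod_mult_le; [|exact HP]|exact HQ]|apply Cmod_mult_le; [|exact HP0]]|exact HE1]|].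
- rewrite Cmod_RtoC_pos; [apply Rle_refl|lra].
- rewrite Cmod_RtoC_pos; [apply Rle_refl|lra].
- nra.
Qed.

(** The logarithm of the product of the first [N] factors. The coefficient integral is exact for
    each [N >= n], so the infinite product is never formed as a power series. *)
Definition Lam_part (z0 : C) (N : nat) (t : C) : C :=
  Csum (fun n => INR (S n) * (pl 1 2 (INR (S n) * t) - pl z0 2 (INR (S n) * t))) N.

Lemma Lam_part_uniform (e eps : R) : (0 < e)%R -> (0 < eps)%R -> exists N0 : nat, forall N z0 t, (N0 <= N)%nat ->
  (Cmod z0 <= 1)%R -> Re t = e -> (Cmod (Lam_part z0 N t - (Lam 1 t - Lam z0 t)) <= eps)%R.
Proof.
intros He Heps. destruct (pl_decay 2 e He) as [B [HB0 HB]].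
set (b := fun n => (2 * B * (INR (S n) ^ 1 * exp (- (INR (S n) * e))))%R).
assert (Hb : ex_series b) by (apply (ex_series_scal (V := R_NormedModule)); now apply ex_series_poly_exp).
pose proof (Series_tail_lim b Hb) as HT. apply is_lim_seq_spec in HT. destruct (HT (mkposreal eps Heps)) as [N0 HN0].
exists N0. intros N z0 t HN Hz Ht.
assert (Hpl : forall z1, (Cmod z1 <= 1)%R -> forall n, (Cmod (INR (S n) * pl z1 2 (INR (S n) * t)) <= b n / 2)%R).
{ intros z1 Hz1 n. rewrite Cmod_mult, Cmod_RtoC_pos by apply pos_INR. unfold b. rewrite pow_1.
  specialize (HB z1 t _ Hz1 Ht (INR_S_ge1 n)). pose proof (INR_S_ge1 n). nra. }
assert (Hb2 : ex_series (fun n => b n / 2)%R).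
{ eapply ex_series_ext; [|apply (ex_series_scal (V := R_NormedModule) (/ 2)%R b Hb)].
  intros n. unfold scal; simpl; unfold mult; simpl. field. }
assert (Ha : forall z1, (Cmod z1 <= 1)%R -> Cabs (fun n => INR (S n) * pl z1 2 (INR (S n) * t))).
{ intros z1 Hz1. apply Cabs_le with (2 := Hb2). now apply Hpl. }
assert (H1 : (Cmod 1 <= 1)%R) by (rewrite Cmod_1; lra).
unfold Lam. rewrite <- CSeries_minus by now apply Ha.
rewrite (CSeries_ext _ (fun n => INR (S n) * (pl 1 2 (INR (S n) * t) - pl z0 2 (INR (S n) * t)))) by (intros; ring).
rewrite Cmod_minus_sym. eapply Rle_trans; [apply (Csum_tail_bound _ b); trivial|].
- intros n. replace (_ * (_ - _)) with (INR (S n) * pl 1 2 (INR (S n) * t) - INR (S n) * pl z0 2 (INR (S n) * t)) by ring.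
  replace (b n) with (b n / 2 + b n / 2)%R by field. apply Cmod_minus_le; now apply Hpl.
- specialize (HN0 N HN). simpl in HN0. rewrite Rminus_0_r in HN0.
  pose proof (Rle_abs (Series (fun k => b (N + k)%nat))). unfold b in *. lra.
Qed.

(** * Coefficients of the generating function *)

Definition cauchy (U V : nat -> C) (n : nat) : C := Csum (fun k => U k * V (n - k)%nat) (S n).

Lemma sum_f_R0_Rsum (f : nat -> R) (n : nat) : sum_f_R0 f n = Rsum f (S n).
Proof. rewrite <- sum_n_Reals, sum_n_Rsum. reflexivity. Qed.

Lemma Rsum_ext (u v : nat -> R) (N : nat) : (forall k, (k < N)%nat -> u k = v k) -> Rsum u N = Rsum v N.
Proof. induction N as [|N IH]; intros H; simpl; trivial. rewrite IH, H; auto. Qed.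

Lemma Rsum_minus (u v : nat -> R) (N : nat) : (Rsum u N - Rsum v N = Rsum (fun k => u k - v k) N)%R.
Proof. induction N as [|N IH]; simpl; [ring|rewrite <- IH; ring]. Qed.

Lemma Rsum_plus (u v : nat -> R) (N : nat) : (Rsum u N + Rsum v N = Rsum (fun k => u k + v k) N)%R.
Proof. induction N as [|N IH]; simpl; [ring|rewrite <- IH; ring]. Qed.

Lemma cauchy_series (U V : nat -> C) : Cabs U -> Cabs V ->
  Cabs (cauchy U V) /\ CSeries (cauchy U V) = CSeries U * CSeries V.
Proof.
intros HU HV.
assert (Hmul : forall a b : nat -> R, ex_series (fun n => Rabs (a n)) -> ex_series (fun n => Rabs (b n)) ->
   is_series (fun n => sum_f_R0 (fun k => a k * b (n - k)%nat) n)%R (Series a * Series b)%R).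
{ intros a b Ha Hb. apply is_series_mult; trivial; apply Series_correct; now apply ex_series_Rabs. }
assert (Hr : forall W, Cabs W -> ex_series (fun n => Rabs (Re (W n))) /\ ex_series (fun n => Rabs (Im (W n)))
   /\ ex_series (fun n => Rabs (Cmod (W n)))).
{ intros W HW. repeat split; apply (ex_series_le (K := R_AbsRing) (V := R_CompleteNormedModule) _ (fun n => Cmod (W n))); trivial;
  intros n; change (norm ?u) with (Rabs u); rewrite Rabs_Rabsolu.
  - apply Cmod_ge_Re.
  - apply Cmod_ge_Im.
  - rewrite Rabs_pos_eq by apply Cmod_ge_0. lra. }
destruct (Hr U HU) as [U1 [U2 U3]], (Hr V HV) as [V1 [V2 V3]].
split.
- apply Cabs_le with (fun n => sum_f_R0 (fun k => Cmod (U k) * Cmod (V (n - k)%nat))%R n).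
  + intros n. rewrite sum_f_R0_Rsum. eapply Rle_trans; [apply Cmod_Csum|].
    apply Rsum_le. intros k _. rewrite Cmod_mult. lra.
  + eexists. apply (Hmul (fun k => Cmod (U k)) (fun k => Cmod (V k))); trivial.
- unfold CSeries at 1. apply C_eq; simpl.
  + apply is_series_unique. eapply is_series_ext.
    2:{ apply (is_series_minus (V := R_NormedModule)); [apply (Hmul (fun k => Re (U k)) (fun k => Re (V k)))|apply (Hmul (fun k => Im (U k)) (fun k => Im (V k)))]; trivial. }
    intros n. transitivity (Re (cauchy U V n)); [|reflexivity]. unfold cauchy. rewrite Re_Csum. cbv beta. change (plus ?u (opp ?v)) with (u - v)%R.
    rewrite !sum_f_R0_Rsum, Rsum_minus. apply Rsum_ext. intros; now rewrite re_mult.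
  + apply is_series_unique. eapply is_series_ext.
    2:{ apply (is_series_plus (V := R_NormedModule)); [apply (Hmul (fun k => Re (U k)) (fun k => Im (V k)))|apply (Hmul (fun k => Im (U k)) (fun k => Re (V k)))]; trivial. }
    intros n. transitivity (Im (cauchy U V n)); [|reflexivity]. unfold cauchy. rewrite Im_Csum. cbv beta. change (plus ?u ?v) with (u + v)%R.
    rewrite !sum_f_R0_Rsum, Rsum_plus. apply Rsum_ext. intros; now rewrite im_mult.
Qed.

(** Absolute convergence is part of the relation because Cauchy products and termwise integration
    rest on it. *)
Definition fps_at (u : fps) (q v : C) : Prop := Cabs (ps u q) /\ CSeries (ps u q) = v.

Lemma fps_at_mul (u v : fps) (q a b : C) : fps_at u q a -> fps_at v q b -> fps_at (fps_mul u v) q (a * b).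
Proof.
intros [H1 <-] [H2 <-]. destruct (cauchy_series _ _ H1 H2) as [H3 H4].
assert (E : forall n, cauchy (ps u q) (ps v q) n = ps (fps_mul u v) q n).
{ intros n. unfold ps, cauchy, fps_mul. rewrite sum_n_Csum, Cmult_comm, <- Csum_scal.
  apply Csum_ext. intros k Hk. replace (Cpow q n) with (Cpow q k * Cpow q (n - k)); [ring|].
  rewrite <- Cpow_add_r. f_equal. lia. }
split; [eapply Cabs_ext; [exact E|trivial]|]. rewrite <- H4. apply CSeries_ext. intros; now rewrite E.
Qed.

Lemma fps_at_delta (z q : C) (m : nat) : fps_at (fun n => if (n =? m)%nat then z else 0) q (z * Cpow q m).
Proof.
assert (L : forall f : nat -> C, Clim (Csum (fun k => if (k =? m)%nat then f k else 0)) (f m)).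
{ intros f. apply Clim_incr_n with (S m). eapply Clim_ext; [|apply Clim_const].
  intros n. rewrite Nat.add_comm. induction n as [|n IH].
  - rewrite Nat.add_0_r, Csum_S, Nat.eqb_refl, (Csum_ext _ (fun _ => 0)).
    + replace (Csum (fun _ => 0) m) with (RtoC 0); [ring|]. induction m as [|p IHp]; simpl; trivial. rewrite <- IHp. ring.
    + intros k Hk. destruct (Nat.eqb_spec k m); [lia|trivial].
  - rewrite Nat.add_succ_r, Csum_S, <- IH. destruct (Nat.eqb_spec (S m + n) m); [lia|]. ring. }
assert (E : forall n, (if (n =? m)%nat then z * Cpow q n else 0) = ps (fun n => if (n =? m)%nat then z else 0) q n).
{ intros n. unfold ps. destruct (n =? m)%nat; ring. }
split.
- exists (Cmod (z * Cpow q m)). apply Rsum_lim_inv.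
  specialize (L (fun n => RtoC (Cmod (z * Cpow q n)))). apply Clim_Re in L. rewrite re_RtoC in L.
  eapply is_lim_seq_ext; [|exact L]. intros n. cbv beta. rewrite Re_Csum. apply Rsum_ext. intros k _.
  rewrite <- E. destruct (k =? m)%nat; simpl; [reflexivity|now rewrite Cmod_0].
- apply CSeries_unique. eapply Clim_ext; [|apply (L (fun n => z * Cpow q n))].
  intros n. apply Csum_ext. intros; apply E.
Qed.

Lemma fps_at_one (q : C) : fps_at fps_one q 1.
Proof. pose proof (fps_at_delta 1 q 0) as H. replace (1 * Cpow q 0) with (RtoC 1) in H by (simpl; ring). exact H. Qed.

Lemma fps_at_binomial (z q : C) (m : nat) : fps_at (fps_binomial z m) q (1 - z * Cpow q m).
Proof.
destruct (fps_at_one q) as [H1 E1]. destruct (fps_at_delta z q m) as [H2 E2].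
assert (E : forall n, ps fps_one q n - ps (fun n => if (n =? m)%nat then z else 0) q n = ps (fps_binomial z m) q n).
{ intros n. unfold ps, fps_binomial. ring. }
split.
- eapply Cabs_ext; [exact E|now apply Cabs_minus].
- rewrite <- E1, <- E2, <- CSeries_minus by trivial. apply CSeries_ext. intros; now rewrite E.
Qed.

(** The value is not summed: the formal identity [fps_binomial_geom] and multiplicativity of
    evaluation give [(1 - q^m) x = 1]. *)
Lemma fps_at_geom (q : C) (m : nat) : (1 <= m)%nat -> (Cmod q < 1)%R -> fps_at (fps_geom m) q (/ (1 - Cpow q m)).
Proof.
intros Hm Hq.
assert (Ha : Cabs (ps (fps_geom m) q)).
{ apply Cabs_le with (fun n => Cmod q ^ n)%R.
  - intros n. unfold ps, fps_geom. rewrite Cmod_mult, Cmod_pow.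
    pose proof (pow_le (Cmod q) n (Cmod_ge_0 q)).
    destruct (n mod m =? 0)%nat; [rewrite Cmod_1|rewrite Cmod_0]; lra.
  - apply ex_series_geom. rewrite Rabs_pos_eq; trivial. apply Cmod_ge_0. }
split; trivial.
destruct (fps_at_mul _ _ _ _ _ (fps_at_binomial 1 q m) (conj Ha eq_refl)) as [_ E].
assert (E1 : CSeries (ps (fps_mul (fps_binomial 1 m) (fps_geom m)) q) = 1).
{ transitivity (CSeries (ps fps_one q)); [|apply (fps_at_one q)].
  apply CSeries_ext. intros n. unfold ps. now rewrite fps_binomial_geom. }
rewrite E1 in E. rewrite Cmult_1_l in E.
assert (Hnz : 1 - Cpow q m <> 0) by (intros F; rewrite F, Cmult_0_l in E; now apply C1_nz).
set (x := CSeries (ps (fps_geom m) q)) in *. set (d := 1 - Cpow q m) in *.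
replace x with (/ d * (d * x)) by (field; trivial). rewrite <- E. ring.
Qed.

Lemma fps_at_pow (u : fps) (q a : C) (m : nat) : fps_at u q a -> fps_at (fps_pow u m) q (Cpow a m).
Proof.
intros H. induction m as [|m IH]; [apply fps_at_one|]. rewrite Cpow_S. exact (fps_at_mul _ _ _ _ _ H IH).
Qed.

Lemma partial_product_at (z t : C) (N : nat) : (Cmod z <= 1)%R -> (0 < Re t)%R ->
  fps_at (partial_product z N) (Cexp (- t)) (Cexp (Lam_part z N t)).
Proof.
intros Hz Ht. induction N as [|N IH].
- unfold Lam_part. simpl. rewrite Cexp_0. apply fps_at_one.
- unfold Lam_part. rewrite Csum_S, Cexp_add. apply fps_at_mul; [exact IH|].
  rewrite <- Cexp_pow. apply fps_at_pow.
  assert (Hq : (Cmod (Cexp (- t)) < 1)%R) by (rewrite Cmod_Cexp, re_opp; now apply exp_neg_lt1).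
  assert (Hrt : (0 < Re (INR (S N) * t))%R) by (rewrite re_scal_l; pose proof (INR_S_ge1 N); nra).
  assert (E : forall z1, (Cmod z1 <= 1)%R -> Cexp (- pl z1 2 (INR (S N) * t)) = 1 - z1 * Cpow (Cexp (- t)) (S N)).
  { intros z1 Hz1. rewrite pl_log by trivial. replace (- - Clog (1 - ww z1 (INR (S N) * t))) with (Clog (1 - ww z1 (INR (S N) * t))) by ring.
    rewrite Cexp_Clog by now apply Re_1_ww. unfold ww. rewrite Cexp_pow. do 3 f_equal. ring. }
  replace (pl 1 2 (INR (S N) * t) - pl z 2 (INR (S N) * t)) with (- pl z 2 (INR (S N) * t) - (- pl 1 2 (INR (S N) * t))) by ring.
  rewrite Cexp_minus, !E by (trivial; rewrite Cmod_1; lra). rewrite Cmult_1_l.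
  apply fps_at_mul; [apply fps_at_binomial|apply fps_at_geom; [lia|trivial]].
Qed.

Lemma CI_char (c : R) : c <> 0%R -> Cexp (2 * PI * c * Ci) = 1 -> CI (fun y => Cexp (y * (c * Ci))) (- PI) PI = 0.
Proof.
intros Hc E. pose proof PI_RGT_0.
assert (Hnz : RtoC c * Ci <> 0) by (apply Cmult_neq_0; [intros F; apply RtoC_inj in F; lra|exact Ci_nz]).
rewrite (CI_FTC (fun y => / (c * Ci) * Cexp (y * (c * Ci)))); [|lra| |].
- replace (Cexp (PI * (c * Ci))) with (Cexp ((- PI)%R * (c * Ci))); [ring|].
  rewrite <- (Cmult_1_r (Cexp ((- PI)%R * (c * Ci)))), <- E, <- Cexp_add. f_equal. rewrite RtoC_opp. ring.
- intros x _. eapply CD_eq; [apply CD_scal, CD_scaled_exp|]. field. split; [exact Ci_nz|]. intros F; apply RtoC_inj in F; lra.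
- intros x _. eapply CD_CC, CD_scaled_exp.
Qed.

Lemma Cexp_2PI_INR (n : nat) : Cexp (2 * PI * INR n * Ci) = 1.
Proof.
replace (2 * PI * INR n * Ci) with (INR n * (2 * PI * Ci)) by ring. rewrite <- Cexp_pow.
replace (Cexp (2 * PI * Ci)) with (RtoC 1); [apply Cpow_1_l|].
replace (2 * PI * Ci) with ((0%R, (2 * PI)%R) : C) by (apply C_eq; simpl; ring).
unfold Cexp. simpl Re. simpl Im. rewrite exp_0, cos_2PI, sin_2PI. apply C_eq; simpl; ring.
Qed.

Lemma CI_orthogonal (n k : nat) :
  CI (fun y => Cexp (y * ((INR n - INR k)%R * Ci))) (- PI) PI = if (k =? n)%nat then RtoC (2 * PI) else 0.
Proof.
pose proof PI_RGT_0. destruct (Nat.eqb_spec k n) as [->|Hn].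
- rewrite (CI_ext _ (fun _ => 1)); [|lra|].
  + apply C_eq; simpl; rewrite RInt_const; unfold scal; simpl; unfold mult; simpl; ring.
  + intros x _. rewrite Rminus_diag, Cmult_0_l, Cmult_0_r. apply Cexp_0.
- apply CI_char.
  + intros E. apply Hn, INR_eq. lra.
  + replace (2 * PI * (INR n - INR k)%R * Ci) with (2 * PI * INR n * Ci - 2 * PI * INR k * Ci) by (rewrite RtoC_minus; ring).
    rewrite Cexp_minus, !Cexp_2PI_INR. field.
Qed.

(** Cauchy's formula through the orthogonality of characters: on the line [Re t = e] the moduli of
    the terms do not depend on [y], so the tail of the series is uniformly small. *)
Lemma coefficient_integral (u : fps) (f : R -> C) (e : R) (n : nat) : (forall y, CC f y) ->
  (forall y : R, fps_at u (Cexp (- (e + y * Ci))) (f y)) ->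
  2 * PI * u n = CI (fun y => f y * Cexp (INR n * (e + y * Ci))) (- PI) PI.
Proof.
intros Hf H. pose proof PI_RGT_0 as HPI.
set (g := fun (k : nat) (y : R) => u k * Cexp ((INR n - INR k)%R * e) * Cexp (y * ((INR n - INR k)%R * Ci))).
assert (Hg : forall k y, CC (g k) y).
{ intros k y. apply CC_mult; [apply CC_const|]. eapply CD_CC, CD_scaled_exp. }
assert (Hgk : forall k y, g k y = ps u (Cexp (- (e + y * Ci))) k * Cexp (INR n * (e + y * Ci))).
{ intros k y. unfold g, ps. rewrite Cexp_pow, <- !Cmult_assoc, <- !Cexp_add. do 2 f_equal. rewrite RtoC_minus. ring. }
set (F := fun y : R => f y * Cexp (INR n * (e + y * Ci))).
assert (HF : forall y, CC F y).
{ intros y. apply CC_mult; [apply Hf|]. apply CC_Cexp, CC_mult; [apply CC_const|].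
  apply CC_plus; [apply CC_const|]. apply CC_mult; [|apply CC_const]. eapply CD_CC, CD_id. }
set (b := fun k => (Cmod (u k) * exp (- (INR k * e)))%R).
assert (Hbm : forall k (y : R), Cmod (ps u (Cexp (- (e + y * Ci))) k) = b k).
{ intros k y. unfold ps, b. rewrite Cmod_mult, Cexp_pow, Cmod_Cexp.
  rewrite re_scal_l, re_opp, re_plus, re_scal_l, re_RtoC. do 2 f_equal. simpl. ring. }
assert (Hb : ex_series b).
{ destruct (H 0%R) as [Ha _]. eapply ex_series_ext; [|exact Ha]. intros k. apply Hbm. }
set (M := exp (INR n * e)).
assert (HM : forall y : R, Cmod (Cexp (INR n * (e + y * Ci))) = M).
{ intros y. rewrite Cmod_Cexp, re_scal_l, re_plus, re_scal_l, re_RtoC. unfold M. f_equal. simpl. ring. }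
apply (Clim_unique (fun N => CI (fun y => Csum (fun k => g k y) N) (- PI) PI)).
- apply Clim_incr_n with (S n). eapply Clim_ext; [|apply Clim_const].
  intros N. rewrite CI_Csum by (try lra; intros k y _; apply Hg).
  rewrite (Csum_ext _ (fun k => if (k =? n)%nat then 2 * PI * u k else 0)).
  2:{ intros k _. unfold g. rewrite CI_scal; [|lra|intros y _; eapply CD_CC, CD_scaled_exp].
      rewrite CI_orthogonal. destruct (Nat.eqb_spec k n) as [->|]; [|ring].
      rewrite Rminus_diag, Cmult_0_l, Cexp_0, RtoC_mult. ring. }
  rewrite Nat.add_comm. induction N as [|N IH].
  + rewrite Nat.add_0_r, Csum_S, Nat.eqb_refl, (Csum_ext _ (fun _ => 0)).
    * replace (Csum (fun _ => 0) n) with (RtoC 0); [ring|]. clear. induction n as [|p IHp]; simpl; trivial. rewrite <- IHp. ring.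
    * intros k Hk. destruct (Nat.eqb_spec k n); [lia|trivial].
  + rewrite Nat.add_succ_r, Csum_S, <- IH. destruct (Nat.eqb_spec (S n + N) n); [lia|]. ring.
- apply Clim_squeeze with (fun N => M * (PI - - PI) * Series (fun k => b (N + k)%nat))%R.
  + exists 0%nat. intros N _.
    assert (HS : Con (fun y => Csum (fun k => g k y) N) (- PI) PI) by (intros y _; apply CC_Csum; intros; apply Hg).
    assert (HFc : Con F (- PI) PI) by (intros y _; apply HF).
    change (CI (fun y => f y * Cexp (INR n * (e + y * Ci))) (- PI) PI) with (CI F (- PI) PI).
    rewrite <- CI_minus by (trivial; lra).
    replace (M * (PI - - PI) * Series (fun k => b (N + k)%nat))%R with (M * Series (fun k => b (N + k)%nat) * (PI - - PI))%R by ring.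
    apply CI_bound_const; [lra|now apply Con_minus|]. intros y _.
    rewrite (Csum_ext _ (fun k => Cexp (INR n * (e + y * Ci)) * ps u (Cexp (- (e + y * Ci))) k)) by (intros; rewrite Hgk; ring).
    rewrite Csum_scal. unfold F. destruct (H y) as [_ <-].
    replace (_ - _) with (Cexp (INR n * (e + y * Ci)) * (Csum (ps u (Cexp (- (e + y * Ci)))) N - CSeries (ps u (Cexp (- (e + y * Ci)))))) by ring.
    rewrite Cmod_mult, HM, Cmod_minus_sym. apply Rmult_le_compat_l; [left; apply exp_pos|].
    apply Csum_tail_bound; trivial. intros k. rewrite Hbm. lra.
  + replace (Finite 0) with (Rbar_mult (M * (PI - - PI))%R 0) by (simpl; f_equal; ring).
    apply is_lim_seq_scal_l. now apply Series_tail_lim.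
Qed.

Lemma pl_log_CC (z0 : C) (e x y : R) : (Cmod z0 <= 1)%R -> (0 < e)%R -> (0 < x)%R ->
  CC (fun y => pl z0 2 (x * (e + y * Ci))) y.
Proof.
intros Hz He Hx.
assert (Hr : forall y : R, (0 < Re (x * (e + y * Ci)))%R).
{ intros w. rewrite re_scal_l, re_plus, re_scal_l, re_RtoC. simpl. nra. }
apply (CC_ext (fun y => - Clog (1 - ww z0 (x * (e + y * Ci))))).
{ intros w. symmetry. apply pl_log; trivial. }
eapply CD_CC. apply CD_opp. apply (CD_Clog (fun y => 1 - ww z0 (x * (e + y * Ci)))); [now apply Re_1_ww|].
apply CD_minus; [apply CD_const|]. unfold ww. apply CD_scal, CD_Cexp, CD_opp, CD_scal, CD_plus; [apply CD_const|].
apply CD_mult; [apply CD_id|apply CD_const].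
Qed.

Lemma Lam_part_CC (z0 : C) (N : nat) (e y : R) : (Cmod z0 <= 1)%R -> (0 < e)%R ->
  CC (fun y => Lam_part z0 N (e + y * Ci)) y.
Proof.
intros Hz He. unfold Lam_part. apply CC_Csum. intros k. apply CC_mult; [apply CC_const|].
pose proof (INR_S_ge1 k).
apply CC_minus; apply pl_log_CC; trivial; try lra. rewrite Cmod_1; lra.
Qed.

Lemma A_integral (z : C) (n N : nat) (e : R) : (Cmod z <= 1)%R -> (0 < e)%R -> (n <= N)%nat ->
  2 * PI * A n z = CI (fun y => Cexp (Lam_part z N (e + y * Ci) + INR n * (e + y * Ci))) (- PI) PI.
Proof.
intros Hz He HN. rewrite <- (partial_product_stable z n N HN). pose proof PI_RGT_0.
rewrite (coefficient_integral _ (fun y => Cexp (Lam_part z N (e + y * Ci))) e).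
- apply CI_ext; [lra|]. intros y _. now rewrite Cexp_add.
- intros y. apply CC_Cexp. now apply Lam_part_CC.
- intros y. apply partial_product_at; trivial. rewrite re_plus, re_scal_l, re_RtoC. simpl. lra.
Qed.

(** * Elementary sums *)

(** After the first term, [1/(x+1)^2 <= 1/(x+1/2) - 1/(x+3/2)] telescopes, and [5/3 = 1 + 2/3]. For
    cubes the comparison is with [1/(2 x (x+1))], and [5/4 = 1 + 1/4]. These constants enter
    [minor_bound], so cruder ones would endanger the final inequality. *)
Lemma Rsum_inv_sq (J : nat) : (Rsum (fun j => / INR (S j) ^ 2) J <= 5 / 3)%R.
Proof.
assert (H : forall n, (Rsum (fun j => / INR (S j) ^ 2) (S n) <= 5 / 3 - / (INR (S n) + / 2))%R).
{ induction n as [|n IH].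
  - simpl. lra.
  - change (Rsum ?f (S (S n))) with (Rsum f (S n) + f (S n))%R. cbv beta.
    pose proof (INR_S_ge1 n) as Hn. rewrite (S_INR (S n)). set (x := INR (S n)) in *.
    enough (/ (x + 1) ^ 2 <= / (x + / 2) - / (x + 1 + / 2))%R by lra.
    replace (/ (x + / 2) - / (x + 1 + / 2))%R with (/ ((x + / 2) * (x + 1 + / 2)))%R by (field; lra).
    apply Rinv_le_contravar; nra. }
destruct J as [|n]; [simpl; lra|]. specialize (H n).
assert (0 < / (INR (S n) + / 2))%R by (apply Rinv_0_lt_compat; pose proof (INR_S_ge1 n); lra). lra.
Qed.

Lemma Rsum_inv_cube (J : nat) : (Rsum (fun j => / INR (S j) ^ 3) J <= 5 / 4)%R.
Proof.
assert (H : forall n, (Rsum (fun j => / INR (S j) ^ 3) (S n) <= 5 / 4 - / (2 * INR (S n) * (INR (S n) + 1)))%R).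
{ induction n as [|n IH].
  - simpl. lra.
  - change (Rsum ?f (S (S n))) with (Rsum f (S n) + f (S n))%R. cbv beta.
    pose proof (INR_S_ge1 n) as Hn. rewrite (S_INR (S n)). set (x := INR (S n)) in *.
    enough (/ (x + 1) ^ 3 <= / (2 * x * (x + 1)) - / (2 * (x + 1) * (x + 1 + 1)))%R by lra.
    replace (/ (2 * x * (x + 1)) - / (2 * (x + 1) * (x + 1 + 1)))%R with (/ (x * (x + 1) * (x + 2)))%R by (field; lra).
    apply Rinv_le_contravar; [repeat apply Rmult_lt_0_compat; lra|]. nra. }
destruct J as [|n]; [simpl; lra|]. specialize (H n). pose proof (INR_S_ge1 n).
assert (0 < / (2 * INR (S n) * (INR (S n) + 1)))%R by (apply Rinv_0_lt_compat; nra). lra.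
Qed.

Lemma ex_series_cube : ex_series (fun j => / INR (S j) ^ 3)%R.
Proof.
apply ex_series_nonneg_bounded with (5 / 4)%R; [|apply Rsum_inv_cube].
intros n. left. apply Rinv_0_lt_compat, pow_lt. pose proof (INR_S_ge1 n). lra.
Qed.

Lemma Series_le_Rsum (b : nat -> R) (B : R) : ex_series b -> (forall N, Rsum b N <= B)%R -> (Series b <= B)%R.
Proof.
intros Hb H. apply (is_lim_seq_le (Rsum b) (fun _ => B) (Series b) B H).
- now apply Rsum_lim, Series_correct.
- apply is_lim_seq_const.
Qed.

(** Each pair [2 i, 2 i + 1] contains at most one selected index, and its term is charged to
    [u (2 i)] by monotonicity. The induction carries two successive lengths because a selected index
    sends the argument back by two. *)
Lemma nonconsecutive_sum (P : nat -> bool) (u : nat -> R) (M : nat) :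
  (forall m, (1 <= m)%nat -> 0 <= u (S m) <= u m)%R -> P 1%nat = false ->
  (forall m, (S m <= M)%nat -> P m = true -> P (S m) = true -> False) ->
  (Rsum (fun j => if P (S j) then u (S j) else 0) M <= Rsum (fun j => u (2 * S j)%nat) (Nat.div2 M))%R.
Proof.
intros Hu HP1 HP.
set (F := Rsum (fun j => if P (S j) then u (S j) else 0%R)).
set (E := Rsum (fun j => u (2 * S j)%nat)).
assert (Hmono : forall m k, (1 <= m)%nat -> (u (m + k)%nat <= u m)%R).
{ intros m k Hm. induction k as [|k IH]; [rewrite Nat.add_0_r; lra|].
  rewrite Nat.add_succ_r. specialize (Hu (m + k)%nat ltac:(lia)). lra. }
assert (Hpos : forall j, (0 <= u (2 * S j)%nat)%R).
{ intros j. replace (2 * S j)%nat with (S (2 * j + 1)) by lia. apply Hu. lia. }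
assert (HE : forall a b, (a <= b)%nat -> (E a <= E b)%R).
{ intros a b. induction 1 as [|b _ IH]; [lra|]. change (E (S b)) with (E b + u (2 * S b)%nat)%R. specialize (Hpos b). lra. }
enough (H : forall k, ((k <= M)%nat -> F k <= E (Nat.div2 k))%R /\ ((S k <= M)%nat -> F (S k) <= E (Nat.div2 (S k)))%R)
  by (now apply (H M)).
induction k as [|k [IH1 IH2]].
- split; intros _; unfold F, E; simpl; rewrite ?HP1; lra.
- split; trivial. intros Hk.
  change (Nat.div2 (S (S k))) with (S (Nat.div2 k)).
  change (F (S (S k))) with (F (S k) + (if P (S (S k)) then u (S (S k)) else 0))%R.
  destruct (P (S (S k))) eqn:H2.
  + assert (H1 : P (S k) = false) by (destruct (P (S k)) eqn:H1; trivial; exfalso; now apply (HP (S k))).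
    change (F (S k)) with (F k + (if P (S k) then u (S k) else 0))%R. rewrite H1.
    change (E (S (Nat.div2 k))) with (E (Nat.div2 k) + u (2 * S (Nat.div2 k))%nat)%R.
    specialize (IH1 ltac:(lia)).
    assert (Hd : (2 * Nat.div2 k <= k)%nat).
    { pose proof (Nat.div2_odd k). lia. }
    set (h := Nat.div2 k) in *. clearbody h.
    pose proof (Hmono (2 * S h)%nat (S (S k) - 2 * S h)%nat ltac:(lia)) as Hm.
    replace (2 * S h + (S (S k) - 2 * S h))%nat with (S (S k)) in Hm by lia. lra.
  + specialize (IH2 ltac:(lia)). pose proof (HE (Nat.div2 (S k)) (S (Nat.div2 k))) as Hd.
    rewrite Rplus_0_r. eapply Rle_trans; [exact IH2|]. apply Hd.
    change (S (Nat.div2 k)) with (Nat.div2 (S (S k))).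
    rewrite !Nat.div2_div. apply Nat.Div0.div_le_mono. lia.
Qed.

(** * Bounds for [sum n w^n = w / (1 - w)^2] *)

Lemma sinh_ge (x : R) : (0 <= x)%R -> (2 * x <= exp x - exp (- x))%R.
Proof.
intros Hx.
pose proof (CD_MVT (fun x => RtoC (2 * x)%R) (fun _ => RtoC 2) (fun x => exp x - exp (- x))%R (fun x => exp x + exp (- x))%R 0 x Hx) as H.
cbv beta in H. rewrite Ropp_0, exp_0, Rmult_0_r in H. replace (2 * x)%R with (Cmod (RtoC (2 * x)%R - 0)).
- replace (exp x - exp (- x))%R with (exp x - exp (- x) - (1 - 1))%R by ring. apply H.
  + intros y _. apply CD_RtoC. auto_derive; trivial; ring.
  + intros y _. auto_derive; trivial; ring.
  + intros y _. rewrite Cmod_RtoC_pos by lra. rewrite exp_Ropp. pose proof (exp_pos y).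
    apply Rmult_le_reg_r with (exp y); trivial. rewrite Rmult_plus_distr_r, Rinv_l by lra. pose proof (pow2_ge_0 (exp y - 1)). nra.
- replace (RtoC (2 * x)%R - 0) with (RtoC (2 * x)%R) by ring. apply Cmod_RtoC_pos. lra.
Qed.

Lemma sin_ge_mul_cos (x : R) : (0 <= x <= PI)%R -> (x * cos x <= sin x)%R.
Proof.
intros Hx.
pose proof (CD_MVT (fun _ => RtoC 0) (fun _ => RtoC 0) (fun x => sin x - x * cos x)%R (fun x => x * sin x)%R 0 x ltac:(lra)) as H.
cbv beta in H. rewrite sin_0, Rmult_0_l in H. replace (RtoC 0 - 0) with (RtoC 0) in H by ring. rewrite Cmod_0 in H.
assert (0 <= sin x - x * cos x - (0 - 0))%R; [apply H|lra].
- intros y _. apply CD_const.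
- intros y _. auto_derive; trivial; ring.
- intros y Hy. apply Rmult_le_pos; [lra|]. apply sin_ge_0; lra.
Qed.

(** [sin x = 2 sin (x/2) cos (x/2) >= x cos^2 (x/2) >= x/2], the last step from [cos x >= 0]. *)
Lemma sin_ge_half (x : R) : (0 <= x <= PI / 2)%R -> (x / 2 <= sin x)%R.
Proof.
intros Hx. pose proof PI_RGT_0. pose proof (sin_ge_mul_cos (x / 2) ltac:(lra)) as H1.
assert (Hc : (/ 2 <= cos (x / 2) * cos (x / 2))%R).
{ assert (0 <= cos x)%R by (apply cos_ge_0; lra). replace x with (2 * (x / 2))%R in H0 by field. rewrite cos_2a_cos in H0. lra. }
assert (Hc0 : (0 <= cos (x / 2))%R) by (apply cos_ge_0; lra).
replace x with (2 * (x / 2))%R at 2 by field. rewrite sin_2a.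
assert (x / 2 * cos (x / 2) * cos (x / 2) <= sin (x / 2) * cos (x / 2))%R by (apply Rmult_le_compat_r; trivial).
nra.
Qed.

(** With [rho = |w|], [|1 - w|^2 = (1 - rho)^2 + 4 rho sin^2 (m y / 2)], and
    [(1 - rho)^2 >= rho (m e)^2] is [sinh x >= x] at [x = m e / 2]. Dividing [|w|] by this cancels
    [rho]. *)
Lemma pl4_bound (m e y : R) : (0 < m)%R -> (0 < e)%R ->
  (Cmod (pl 1 4 (m * (e + y * Ci))%C) <= / ((m * e) ^ 2 + 4 * sin (m * y / 2) ^ 2))%R.
Proof.
intros Hm He. set (z := m * (e + y * Ci)).
assert (Hre : Re z = (m * e)%R) by (unfold z; rewrite re_scal_l, re_plus, re_scal_l, re_RtoC; simpl; ring).
assert (Him : Im z = (m * y)%R) by (unfold z; rewrite im_scal_l, im_plus, im_scal_l, im_RtoC; simpl; ring).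
assert (Hpos : (0 < Re z)%R) by (rewrite Hre; nra).
assert (H1 : (Cmod 1 <= 1)%R) by (rewrite Cmod_1; lra).
destruct (pl_closed 1 z H1 Hpos) as [_ [E _]]. rewrite E. clear E.
assert (Hnz := ww_nz 1 z H1 Hpos). set (w := ww 1 z) in *.
assert (Hw : w = Cexp (- z)) by (unfold w, ww; ring).
assert (Hmw : Cmod w = exp (- (m * e))) by (rewrite Hw, Cmod_Cexp, re_opp, Hre; reflexivity).
set (rho := exp (- (m * e))) in *. assert (Hrho : (0 < rho)%R) by apply exp_pos.
assert (Hrw : Re w = (rho * cos (m * y))%R).
{ rewrite Hw. unfold Cexp. rewrite re_scal_l, re_opp, im_opp, Hre, Him. simpl. rewrite cos_neg. reflexivity. }
assert (Hsq : (Cmod (1 - w) * Cmod (1 - w) = (1 - rho) ^ 2 + 4 * rho * sin (m * y / 2) ^ 2)%R).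
{ assert (Hww : (Re w * Re w + Im w * Im w = rho * rho)%R) by (rewrite <- Cmod_sqr, Hmw; reflexivity).
  rewrite Cmod_sqr. unfold Cminus. rewrite re_plus, im_plus, re_opp, im_opp, re_RtoC, im_RtoC.
  replace ((1 + - Re w) * (1 + - Re w) + (0 + - Im w) * (0 + - Im w))%R with (1 - 2 * Re w + (Re w * Re w + Im w * Im w))%R by ring.
  rewrite Hww, Hrw. replace (cos (m * y)) with (1 - 2 * sin (m * y / 2) * sin (m * y / 2))%R; [ring|].
  rewrite <- cos_2a_sin. f_equal. field. }
assert (Hmp : (0 < Cmod (1 - w))%R) by now apply Cmod_gt_0.
rewrite Cmod_div by now apply Cmult_neq_0. rewrite Cmod_mult, Hmw, Hsq.
assert (Hsh : ((m * e) ^ 2 * rho <= (1 - rho) ^ 2)%R).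
{ pose proof (sinh_ge (m * e / 2) ltac:(nra)) as Hs.
  set (p := exp (- (m * e / 2))). assert (Hp : (0 < p)%R) by apply exp_pos.
  assert (Ep : (exp (m * e / 2) = / p)%R) by (unfold p; rewrite exp_Ropp, Rinv_inv; reflexivity).
  assert (Erho : rho = (p * p)%R) by (unfold rho, p; rewrite <- exp_plus; f_equal; field).
  fold p in Hs. rewrite Ep in Hs.
  assert (Hs2 : (m * e * p <= 1 - p * p)%R).
  { replace (1 - p * p)%R with ((/ p - p) * p)%R by (field; lra). apply Rmult_le_compat_r; lra. }
  rewrite Erho. replace ((m * e) ^ 2 * (p * p))%R with ((m * e * p) ^ 2)%R by ring.
  apply pow_incr. split; [|exact Hs2]. apply Rmult_le_pos; nra. }
assert (Hden : (0 < (m * e) ^ 2 + 4 * sin (m * y / 2) ^ 2)%R).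
{ assert (0 < (m * e) ^ 2)%R by (apply pow_lt; nra). pose proof (pow2_ge_0 (sin (m * y / 2))). lra. }
replace (/ ((m * e) ^ 2 + 4 * sin (m * y / 2) ^ 2))%R with (rho / (rho * ((m * e) ^ 2 + 4 * sin (m * y / 2) ^ 2)))%R by (field; lra).
apply Rmult_le_compat_l; [lra|]. apply Rinv_le_contravar; [now apply Rmult_lt_0_compat|]. nra.
Qed.

(** * Summing over the exponent first *)

Lemma co_1_4 (j : nat) : co 1 4 j = INR (S j).
Proof.
unfold co. rewrite Cpow_1_l. pose proof (INR_S_nz j) as H. revert H. generalize (RtoC (INR (S j))). intros x H.
simpl. field. trivial.
Qed.

Lemma co_2 (z0 : C) (j : nat) : co z0 2 j = Cpow z0 (S j) / INR (S j).
Proof.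
unfold co. pose proof (INR_S_nz j) as H. revert H. generalize (RtoC (INR (S j))), (Cpow z0 (S j)). intros x p H.
simpl. field. trivial.
Qed.

Definition cj (z0 : C) (j : nat) : C := (1 - Cpow z0 (S j)) / INR (S j).

Lemma Cmod_cj (z0 : C) (j : nat) : Cmod z0 = 1%R -> (Cmod (cj z0 j) <= 2 / INR (S j))%R.
Proof.
intros H. unfold cj. rewrite Cmod_div by apply INR_S_nz. rewrite (Cmod_RtoC_pos (INR (S j))) by apply pos_INR.
apply Rmult_le_compat_r; [left; apply Rinv_0_lt_compat; pose proof (INR_S_ge1 j); lra|].
pose proof (Cmod_triangle_minus 1 (Cpow z0 (S j))). rewrite Cmod_1, Cmod_pow, H, pow1 in H0. lra.
Qed.

(** For a finite number [N] of factors the exchange of summations is linearity. The inner sums are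
    dominated by their values at [y = 0], hence by [1 / ((j+1) e)^2] uniformly in [N], so the tail
    estimate with [|cj| <= 2 / (j+1)] holds before [N] tends to infinity and survives the limit. *)
Lemma Lam_by_exponent (z0 : C) (e y : R) (M : nat) : Cmod z0 = 1%R -> (0 < e)%R -> let t := e + y * Ci in
  (Cmod (Lam 1 t - Lam z0 t - Csum (fun j => cj z0 j * pl 1 4 (INR (S j) * t))%C M)
    <= 2 / e ^ 2 * Series (fun k => / INR (S (M + k)) ^ 3))%R.
Proof.
intros Hz He t.
assert (Hre : Re t = e) by (unfold t; rewrite re_plus, re_scal_l, re_RtoC; simpl; ring).
assert (H1 : (Cmod 1 <= 1)%R) by (rewrite Cmod_1; lra). assert (Hz1 : (Cmod z0 <= 1)%R) by lra.
set (S_ := fun (N j : nat) => Csum (fun n => INR (S n) * Cexp (- (INR (S j) * (INR (S n) * t)))) N).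
assert (HSb : forall N j, (Cmod (S_ N j) <= / (INR (S j) * e) ^ 2)%R).
{ intros N j. pose proof (INR_S_ge1 j) as Hj. pose proof (pl4_bound (INR (S j)) e 0 ltac:(lra) He) as Hb.
  replace (INR (S j) * 0 / 2)%R with 0%R in Hb by field. rewrite sin_0 in Hb.
  replace ((INR (S j) * e) ^ 2 + 4 * 0 ^ 2)%R with ((INR (S j) * e) ^ 2)%R in Hb by (simpl; ring).
  eapply Rle_trans; [|exact Hb]. clear Hb.
  eapply Rle_trans; [apply Cmod_Csum|].
  set (x := (INR (S j) * e)%R). assert (Hx : (0 < x)%R) by (apply Rmult_lt_0_compat; lra).
  assert (Hser := ex_series_poly_exp 1 x Hx).
  apply Rle_trans with (Series (fun n => INR (S n) ^ 1 * exp (- (INR (S n) * x)))%R).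
  - apply Rle_trans with (Rsum (fun n => INR (S n) ^ 1 * exp (- (INR (S n) * x)))%R N).
    + apply Rsum_le. intros n _. rewrite Cmod_mult, Cmod_RtoC_pos, Cmod_Cexp, re_opp, !re_scal_l, Hre by apply pos_INR.
      right. rewrite pow_1. unfold x. do 2 f_equal. ring.
    + apply (is_lim_seq_incr_compare _ _ (Rsum_lim _ _ (Series_correct _ Hser))).
      intros n. change (Rsum ?f (S n)) with (Rsum f n + f n)%R. cbv beta.
      assert (0 <= INR (S n) ^ 1 * exp (- (INR (S n) * x)))%R by (apply Rmult_le_pos; [apply pow_le, pos_INR|left; apply exp_pos]). lra.
  - replace (INR (S j) * (e + 0 * Ci)) with (RtoC x) by (unfold x; rewrite RtoC_mult; ring).
    eapply Rle_trans; [|apply Cmod_ge_Re]. eapply Rle_trans; [|apply Rle_abs].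
    right. transitivity (Series (fun n => Re (co 1 4 n * Cexp (- (INR (S n) * x))))); [|reflexivity]. apply Series_ext. intros n.
    rewrite co_1_4.
    replace (- (INR (S n) * x)) with (RtoC (- (INR (S n) * x))%R) by (rewrite RtoC_opp, RtoC_mult; reflexivity).
    rewrite Cexp_R, pow_1, <- RtoC_mult. reflexivity. }
assert (HLp : forall N, Lam_part z0 N t = CSeries (fun j => cj z0 j * S_ N j) /\ Cabs (fun j => cj z0 j * S_ N j)).
{ intros N. unfold Lam_part. induction N as [|N [IH1 IH2]].
  - split.
    + symmetry. apply CSeries_unique. apply Clim_ext with (fun _ => RtoC 0); [|apply Clim_const].
      intros n. symmetry. induction n as [|n IHn]; simpl; trivial. rewrite IHn. unfold S_. simpl. ring.
    + apply Cabs_le with (fun j => 0 * / INR (S j) ^ 3)%R.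
      * intros j. unfold S_. simpl. rewrite Cmult_0_r, Cmod_0. lra.
      * apply (ex_series_scal (V := R_NormedModule)), ex_series_cube.
  - assert (Hr : (0 < Re (INR (S N) * t))%R) by (rewrite re_scal_l, Hre; pose proof (INR_S_ge1 N); nra).
    pose proof (pl_abs 1 2 _ H1 Hr) as A1. pose proof (pl_abs z0 2 _ Hz1 Hr) as A2.
    assert (E : forall j, INR (S N) * (co 1 2 j * Cexp (- (INR (S j) * (INR (S N) * t))) - co z0 2 j * Cexp (- (INR (S j) * (INR (S N) * t))))
       = cj z0 j * (INR (S N) * Cexp (- (INR (S j) * (INR (S N) * t))))).
    { intros j. rewrite !co_2, Cpow_1_l. unfold cj. field. apply INR_S_nz. }
    assert (A3 : Cabs (fun j => cj z0 j * (INR (S N) * Cexp (- (INR (S j) * (INR (S N) * t)))))).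
    { eapply Cabs_ext; [exact E|]. apply (Cabs_scal (INR (S N))). now apply Cabs_minus. }
    assert (E2 : forall j, cj z0 j * S_ N j + cj z0 j * (INR (S N) * Cexp (- (INR (S j) * (INR (S N) * t)))) = cj z0 j * S_ (S N) j).
    { intros j. unfold S_. rewrite (Csum_S _ N). ring. }
    split.
    + rewrite Csum_S, IH1. unfold pl, DS. rewrite <- CSeries_minus by trivial.
      rewrite <- CSeries_scal by now apply Cabs_minus.
      rewrite (CSeries_ext _ _ E), <- CSeries_plus by trivial. apply CSeries_ext. exact E2.
    + eapply Cabs_ext; [exact E2|]. now apply Cabs_plus. }
set (b := fun j => (2 / e ^ 2 * / INR (S j) ^ 3)%R).
assert (Hb : forall N j, (Cmod (cj z0 j * S_ N j) <= b j)%R).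
{ intros N j. rewrite Cmod_mult. pose proof (Cmod_cj z0 j Hz). specialize (HSb N j). pose proof (INR_S_ge1 j).
  apply Rle_trans with (2 / INR (S j) * / (INR (S j) * e) ^ 2)%R.
  - apply Rmult_le_compat; trivial; apply Cmod_ge_0.
  - right. unfold b. field. lra. }
assert (Hbs : ex_series b) by (apply (ex_series_scal (V := R_NormedModule)), ex_series_cube).
rewrite <- Series_scal_l.
apply Clim_bound with (fun N => Lam_part z0 N t - Csum (fun j => cj z0 j * S_ N j) M).
- exists 0%nat. intros N _. destruct (HLp N) as [-> _]. apply (Csum_tail_bound _ b); trivial.
- apply Clim_minus.
  + unfold Clim. apply is_lim_seq_spec. intros eps.
    destruct (Lam_part_uniform e (eps / 2) He ltac:(pose proof (cond_pos eps); lra)) as [N0 HN0].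
    exists N0. intros N HN. rewrite Rminus_0_r, Rabs_pos_eq by apply Cmod_ge_0.
    specialize (HN0 N z0 t HN Hz1 Hre). pose proof (cond_pos eps). lra.
  + induction M as [|M IH]; [apply (Clim_const 0)|].
    rewrite Csum_S. apply Clim_ext with (fun N => Csum (fun j => cj z0 j * S_ N j) M + cj z0 M * S_ N M); [reflexivity|].
    apply Clim_plus; [exact IH|]. apply Clim_scal.
    assert (Hr : (0 < Re (INR (S M) * t))%R) by (rewrite re_scal_l, Hre; pose proof (INR_S_ge1 M); nra).
    eapply Clim_ext; [|apply CSeries_lim, (pl_abs 1 4 _ H1 Hr)].
    intros N. apply Csum_ext. intros n _. rewrite co_1_4.
    replace (INR (S n) * (INR (S M) * t)) with (INR (S M) * (INR (S n) * t)) by ring. reflexivity.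
Qed.

(** * The minor arcs *)

(* [sum min(m d, 2) / m^3] over the even [m], the worst set of non-consecutive [m > 1],
   with [zeta(2) <= 5/3] and [zeta(3) <= 5/4]. *)
Definition minor_bound (d : R) : R := Rmin (5 / 12 * d) (5 / 16).

Lemma one_minus_pow (z0 : C) (m : nat) : Cmod z0 = 1%R -> (Cmod (1 - Cpow z0 m) <= INR m * Cmod (1 - z0))%R.
Proof.
intros H. induction m as [|m IH].
- simpl. replace (1 - 1) with (RtoC 0) by ring. rewrite Cmod_0. lra.
- replace (1 - Cpow z0 (S m)) with ((1 - Cpow z0 m) + Cpow z0 m * (1 - z0)) by (rewrite Cpow_S; ring).
  eapply Rle_trans; [apply Cmod_triangle|]. rewrite Cmod_mult, Cmod_pow, H, pow1, S_INR. lra.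
Qed.

(** An exponent [m <= M] is near (predicate [P]) when [|sin (m y / 2)| < L m e]. Far exponents
    contribute at most [5/(8 L^2) / e^2] together, exponents above [M] at most [(eps/2) / e^2]. If
    [m] and [m + 1] were both near, subtraction of angles would give [|sin (y/2)| < 2 L M e], which
    the lower bound on [|y|] excludes; so the near ones are pairwise non-consecutive. *)
Lemma minor_arc (z0 : C) (eps : R) : Cmod z0 = 1%R -> (0 < eps)%R -> exists k : R, (0 < k)%R /\
  forall e y : R, (0 < e)%R -> (k * e <= Rabs y <= PI)%R ->
  (Cmod (Lam 1 (e + y * Ci)%C - Lam z0 (e + y * Ci)%C) <= (minor_bound (Cmod (1 - z0)) + eps) / e ^ 2)%R.
Proof.
intros Hz Heps. set (d := Cmod (1 - z0)). assert (Hd0 : (0 <= d)%R) by apply Cmod_ge_0.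
pose proof (Series_tail_lim _ ex_series_cube) as HT. apply is_lim_seq_spec in HT.
destruct (HT (mkposreal (eps / 4) ltac:(lra))) as [M0 HM0]. set (M := S M0).
specialize (HM0 M ltac:(unfold M; lia)). simpl pos in HM0. rewrite Rminus_0_r in HM0.
(* Chosen so that the far exponents cost at most [eps / 2]. *)
set (L := (1 + 2 / eps)%R). assert (HL : (1 < L)%R) by (unfold L; assert (0 < 2 / eps)%R by (apply Rdiv_lt_0_compat; lra); lra).
assert (HLe : (5 / 8 / L ^ 2 <= eps / 2)%R).
{ assert (HLeps : (2 / eps * eps = 2)%R) by (field; lra).
  apply Rmult_le_reg_r with (L ^ 2)%R; [apply pow_lt; lra|]. unfold Rdiv at 1. rewrite Rmult_assoc, Rinv_l by (apply pow_nonzero; lra).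
  assert (2 <= L * eps)%R by (unfold L; nra). simpl. nra. }
pose proof (INR_S_ge1 M0) as HM1. fold M in HM1.
(* From [|sin (y/2)| >= |y| / 4] this gives [|sin (y/2)| >= 2 L M e], which also excludes
   [m = 1]. *)
exists (8 * L * INR M)%R. split; [nra|]. intros e y He Hy.
pose proof (Lam_by_exponent z0 e y M Hz He) as Hmain. cbv zeta in Hmain. set (t := e + y * Ci) in *.
assert (He2 : (0 < e ^ 2)%R) by now apply pow_lt.
pose proof PI_RGT_0 as HPI.
assert (Hsin : (2 * L * INR M * e <= Rabs (sin (y / 2)))%R).
{ assert (Hs : (Rabs y / 4 <= Rabs (sin (y / 2)))%R).
  { unfold Rabs at 1. destruct (Rcase_abs y) as [Hn|Hp].
    - rewrite Rabs_left in Hy by trivial. pose proof (sin_ge_half (- (y / 2)) ltac:(lra)) as H. rewrite sin_neg in H.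
      rewrite Rabs_left1; lra.
    - rewrite Rabs_pos_eq in Hy by lra. pose proof (sin_ge_half (y / 2) ltac:(lra)) as H. rewrite Rabs_pos_eq; lra. }
  lra. }
set (P := fun m : nat => if Rlt_dec (Rabs (sin (INR m * y / 2))) (L * INR m * e) then true else false).
set (u := fun m : nat => (Rmin (INR m * d) 2 / INR m ^ 3)%R).
assert (Hterm : forall j, (Cmod (cj z0 j * pl 1 4 (INR (S j) * t)%C) <=
   (if P (S j) then u (S j) else 0) / e ^ 2 + (/ (2 * L ^ 2 * e ^ 2)) * / INR (S j) ^ 3)%R).
{ intros j. pose proof (INR_S_ge1 j) as Hj. set (m := INR (S j)) in *.
  pose proof (pl4_bound m e y ltac:(lra) He) as Hb. fold t in Hb.
  assert (Hm3 : (0 < / m ^ 3)%R) by (apply Rinv_0_lt_compat, pow_lt; lra).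
  assert (HLL : (0 < / (2 * L ^ 2 * e ^ 2))%R) by (apply Rinv_0_lt_compat; repeat apply Rmult_lt_0_compat; try lra; apply pow_lt; lra).
  assert (Hme : (0 < (m * e) ^ 2)%R) by (apply pow_lt; nra).
  rewrite Cmod_mult. unfold P. fold m. destruct (Rlt_dec (Rabs (sin (m * y / 2))) (L * m * e)) as [Hs|Hs].
  - assert (Hc : (Cmod (cj z0 j) <= Rmin (m * d) 2 / m)%R).
    { pose proof (Cmod_cj z0 j Hz) as Hc2. fold m in Hc2. unfold cj in *. fold m in Hc2 |- *.
      rewrite Cmod_div in * by apply INR_S_nz. rewrite (Cmod_RtoC_pos m) in * by lra.
      pose proof (one_minus_pow z0 (S j) Hz) as H1. fold m in H1. fold d in H1.
      apply Rmult_le_compat_r; [left; apply Rinv_0_lt_compat; lra|].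
      apply Rmin_glb; trivial.
      apply Rmult_le_reg_r with (/ m)%R; [apply Rinv_0_lt_compat; lra|exact Hc2]. }
    assert (Hb' : (Cmod (pl 1 4 (m * t)%C) <= / (m * e) ^ 2)%R).
    { eapply Rle_trans; [exact Hb|]. apply Rinv_le_contravar; trivial. pose proof (pow2_ge_0 (sin (m * y / 2))). lra. }
    apply Rle_trans with (Rmin (m * d) 2 / m * / (m * e) ^ 2)%R.
    + apply Rmult_le_compat; trivial; apply Cmod_ge_0.
    + replace (Rmin (m * d) 2 / m * / (m * e) ^ 2)%R with (u (S j) / e ^ 2)%R by (unfold u; fold m; field; lra). nra.
  - apply Rnot_lt_le in Hs.
    assert (Hb' : (Cmod (pl 1 4 (m * t)%C) <= / (4 * (L * m * e) ^ 2))%R).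
    { eapply Rle_trans; [exact Hb|]. apply Rinv_le_contravar.
      - apply Rmult_lt_0_compat; [lra|]. apply pow_lt. repeat apply Rmult_lt_0_compat; lra.
      - rewrite <- (pow2_abs (sin (m * y / 2))).
        assert ((L * m * e) ^ 2 <= Rabs (sin (m * y / 2)) ^ 2)%R by (apply pow_incr; split; trivial; repeat apply Rmult_le_pos; lra). lra. }
    pose proof (Cmod_cj z0 j Hz) as Hc. fold m in Hc.
    apply Rle_trans with (2 / m * / (4 * (L * m * e) ^ 2))%R.
    + apply Rmult_le_compat; trivial; apply Cmod_ge_0.
    + replace (2 / m * / (4 * (L * m * e) ^ 2))%R with (/ (2 * L ^ 2 * e ^ 2) * / m ^ 3)%R by (field; lra). lra. }
assert (Hu : forall m, (1 <= m)%nat -> (0 <= u (S m) <= u m)%R).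
{ intros m Hm. destruct m as [|j]; [lia|]. pose proof (INR_S_ge1 j) as Hj. unfold u. rewrite (S_INR (S j)). set (x := INR (S j)) in *.
  assert (P3 : (0 < x ^ 3)%R) by (apply pow_lt; lra). assert (P4 : (0 < (x + 1) ^ 3)%R) by (apply pow_lt; lra).
  split; [apply Rmult_le_pos; [apply Rmin_glb; nra|left; now apply Rinv_0_lt_compat]|].
  destruct (Rle_dec (x * d) 2) as [Hx|Hx].
  - rewrite (Rmin_left (x * d)) by trivial.
    apply Rle_trans with ((x + 1) * d / (x + 1) ^ 3)%R.
    + apply Rmult_le_compat_r; [left; now apply Rinv_0_lt_compat|apply Rmin_l].
    + replace ((x + 1) * d / (x + 1) ^ 3)%R with (d * / (x + 1) ^ 2)%R by (field; lra).
      replace (x * d / x ^ 3)%R with (d * / x ^ 2)%R by (field; lra).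
      apply Rmult_le_compat_l; trivial. apply Rinv_le_contravar; [apply pow_lt; lra|]. apply pow_incr; lra.
  - rewrite (Rmin_right (x * d)) by lra.
    apply Rle_trans with (2 / (x + 1) ^ 3)%R.
    + apply Rmult_le_compat_r; [left; now apply Rinv_0_lt_compat|apply Rmin_r].
    + apply Rmult_le_compat_l; [lra|]. apply Rinv_le_contravar; trivial. apply pow_incr; lra. }
assert (HS : (Rsum (fun j => if P (S j) then u (S j) else 0) M <= minor_bound d)%R).
{ eapply Rle_trans; [apply nonconsecutive_sum; trivial|].
  - unfold P. simpl INR. rewrite Rmult_1_l, Rmult_1_r. destruct (Rlt_dec _ _) as [H|H]; trivial. exfalso.
    assert (0 < L * e)%R by (apply Rmult_lt_0_compat; lra). assert (L * e * 1 <= L * e * INR M)%R by (apply Rmult_le_compat_l; lra). lra.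
  - intros m Hm H1 H2. unfold P in H1, H2.
    destruct (Rlt_dec (Rabs (sin (INR m * y / 2))) (L * INR m * e)) as [G1|]; [|discriminate].
    destruct (Rlt_dec (Rabs (sin (INR (S m) * y / 2))) (L * INR (S m) * e)) as [G2|]; [|discriminate].
    assert (Hle : (Rabs (sin (y / 2)) <= Rabs (sin (INR (S m) * y / 2)) + Rabs (sin (INR m * y / 2)))%R).
    { replace (y / 2)%R with (INR (S m) * y / 2 - INR m * y / 2)%R at 1 by (rewrite S_INR; field).
      rewrite sin_minus. eapply Rle_trans; [apply Rabs_triang|]. rewrite Rabs_Ropp, !Rabs_mult.
      pose proof (COS_bound (INR m * y / 2)). pose proof (COS_bound (INR (S m) * y / 2)).
      pose proof (Rabs_pos (sin (INR (S m) * y / 2))). pose proof (Rabs_pos (sin (INR m * y / 2))).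
      assert (Rabs (cos (INR m * y / 2)) <= 1)%R by (apply Rabs_le; lra).
      assert (Rabs (cos (INR (S m) * y / 2)) <= 1)%R by (apply Rabs_le; lra). nra. }
    apply le_INR in Hm. rewrite S_INR in *.
    assert (L * (INR m + 1) * e + L * INR m * e <= 2 * L * INR M * e)%R.
    { replace (L * (INR m + 1) * e + L * INR m * e)%R with (L * e * (2 * INR m + 1))%R by ring.
      replace (2 * L * INR M * e)%R with (L * e * (2 * INR M))%R by ring. apply Rmult_le_compat_l; nra. }
    lra.
  - unfold minor_bound. apply Rmin_glb.
    + apply Rle_trans with (Rsum (fun j => d / 4 * / INR (S j) ^ 2)%R (Nat.div2 M)).
      * apply Rsum_le. intros j _. unfold u. rewrite mult_INR. pose proof (INR_S_ge1 j). simpl (INR 2).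
        set (x := INR (S j)) in *. apply Rle_trans with (2 * x * d / (2 * x) ^ 3)%R.
        -- apply Rmult_le_compat_r; [left; apply Rinv_0_lt_compat, pow_lt; lra|apply Rmin_l].
        -- right. field. lra.
      * assert (E : forall c f N, Rsum (fun j => c * f j)%R N = (c * Rsum f N)%R).
        { intros c f N. induction N as [|N IH]; simpl; [ring|rewrite IH; ring]. }
        rewrite E. pose proof (Rsum_inv_sq (Nat.div2 M)). nra.
    + apply Rle_trans with (Rsum (fun j => / 4 * / INR (S j) ^ 3)%R (Nat.div2 M)).
      * apply Rsum_le. intros j _. unfold u. rewrite mult_INR. pose proof (INR_S_ge1 j). simpl (INR 2).
        set (x := INR (S j)) in *. apply Rle_trans with (2 / (2 * x) ^ 3)%R.
        -- apply Rmult_le_compat_r; [left; apply Rinv_0_lt_compat, pow_lt; lra|apply Rmin_r].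
        -- right. field. lra.
      * assert (E : forall c f N, Rsum (fun j => c * f j)%R N = (c * Rsum f N)%R).
        { intros c f N. induction N as [|N IH]; simpl; [ring|rewrite IH; ring]. }
        rewrite E. pose proof (Rsum_inv_cube (Nat.div2 M)). lra. }
assert (Hsum : (Cmod (Csum (fun j => cj z0 j * pl 1 4 (INR (S j) * t))%C M) <= (minor_bound d + eps / 2) / e ^ 2)%R).
{ eapply Rle_trans; [apply Cmod_Csum|]. eapply Rle_trans; [apply Rsum_le; intros j _; apply Hterm|].
  assert (E : forall c c' f g N, Rsum (fun j => f j / c + c' * g j)%R N = (Rsum f N / c + c' * Rsum g N)%R).
  { intros c c' f g N. unfold Rdiv. induction N as [|N IH]; simpl; [ring|rewrite IH; ring]. }
  rewrite (E (e ^ 2)%R (/ (2 * L ^ 2 * e ^ 2))%R (fun j => if P (S j) then u (S j) else 0)%R (fun j => / INR (S j) ^ 3)%R M).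
  pose proof (Rsum_inv_cube M) as Hcube.
  unfold Rdiv. rewrite Rmult_plus_distr_r. apply Rplus_le_compat.
  - apply Rmult_le_compat_r; trivial. left; now apply Rinv_0_lt_compat.
  - apply Rle_trans with (/ (2 * L ^ 2 * e ^ 2) * (5 / 4))%R.
    + apply Rmult_le_compat_l; trivial. left. apply Rinv_0_lt_compat. repeat apply Rmult_lt_0_compat; try lra; apply pow_lt; lra.
    + replace (/ (2 * L ^ 2 * e ^ 2) * (5 / 4))%R with (5 / 8 / L ^ 2 * / e ^ 2)%R by (field; split; try apply pow_nonzero; lra).
      apply Rmult_le_compat_r; [left; now apply Rinv_0_lt_compat|exact HLe]. }
pose proof (Cmod_triangle (Lam 1 t - Lam z0 t - Csum (fun j => cj z0 j * pl 1 4 (INR (S j) * t))%C M) (Csum (fun j => cj z0 j * pl 1 4 (INR (S j) * t))%C M)) as Htr.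
replace (Lam 1 t - Lam z0 t - Csum (fun j => cj z0 j * pl 1 4 (INR (S j) * t))%C M + Csum (fun j => cj z0 j * pl 1 4 (INR (S j) * t))%C M) with (Lam 1 t - Lam z0 t) in Htr by ring.
assert (Htail : (2 / e ^ 2 * Series (fun k => / INR (S (M + k)) ^ 3) <= (eps / 2) / e ^ 2)%R).
{ replace (eps / 2 / e ^ 2)%R with (2 / e ^ 2 * (eps / 4))%R by (field; lra).
  apply Rmult_le_compat_l; [apply Rlt_le, Rdiv_lt_0_compat; lra|].
  pose proof (Rle_abs (Series (fun k => / INR (S (M + k)) ^ 3)%R)). lra. }
replace ((minor_bound d + eps) / e ^ 2)%R with ((eps / 2) / e ^ 2 + (minor_bound d + eps / 2) / e ^ 2)%R by (field; lra).
lra.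
Qed.

(** * The saddle point dominates the minor arcs *)

Lemma Im_pow_bound (w : C) (m : nat) : Cmod w = 1%R -> (Rabs (Im (Cpow w m)) <= INR m * Rabs (Im w))%R.
Proof.
intros H. assert (Hp : forall k, Cmod (Cpow w k) = 1%R) by (intros; rewrite Cmod_pow, H, pow1; trivial).
induction m as [|m IH].
- simpl. rewrite Rabs_R0. lra.
- rewrite Cpow_S, im_mult, S_INR. eapply Rle_trans; [apply Rabs_triang|]. rewrite !Rabs_mult.
  pose proof (Cmod_ge_Re w). pose proof (Cmod_ge_Re (Cpow w m)). rewrite H in H0. rewrite Hp in H1.
  pose proof (Rabs_pos (Im w)). pose proof (Rabs_pos (Im (Cpow w m))). nra.
Qed.

(** The numerical core of the comparison. The first two terms are kept exactly and the tail is
    bounded in two ways: by a constant, for [w] far from 1, and by a multiple of [Im w], for [w]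
    near 1, where both sides of the inequality vanish linearly. *)
Lemma lower_series (w : C) : Cmod w = 1%R -> w <> 1 -> (0 <= Im w)%R ->
  (minor_bound (Cmod (1 - w)) < Series (fun j => (12 / 25 * (1 - Re (Cpow w (S j))) + 16 / 25 * Im (Cpow w (S j))) / INR (S j) ^ 3))%R.
Proof.
intros Hw Hne Hs. set (c := Re w). set (s := Im w) in *.
assert (Hcs : (c * c + s * s = 1)%R) by (unfold c, s; rewrite <- Cmod_sqr, Hw; ring).
set (d := Cmod (1 - w)). assert (Hd2 : (d * d = 2 - 2 * c)%R).
{ unfold d. rewrite Cmod_sqr. unfold Cminus. rewrite re_plus, im_plus, re_opp, im_opp, re_RtoC, im_RtoC. fold c s. lra. }
assert (Hd : (0 < d)%R).
{ apply Cmod_gt_0. intros E. apply Hne. replace w with (1 - (1 - w)) by ring. rewrite E. ring. }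
set (a := fun j => ((12 / 25 * (1 - Re (Cpow w (S j))) + 16 / 25 * Im (Cpow w (S j))) / INR (S j) ^ 3)%R).
assert (Hp : forall k, (Re (Cpow w k) * Re (Cpow w k) + Im (Cpow w k) * Im (Cpow w k) = 1)%R).
{ intros k. rewrite <- Cmod_sqr, Cmod_pow, Hw, pow1. ring. }
assert (Hi : forall j, (0 < / INR (S j) ^ 3)%R).
{ intros j. apply Rinv_0_lt_compat, pow_lt. pose proof (INR_S_ge1 j). lra. }
assert (Hex : ex_series a).
{ apply (ex_series_le (K := R_AbsRing) (V := R_CompleteNormedModule) _ (fun j => 2 * / INR (S j) ^ 3)%R).
  - intros j. change (norm ?u) with (Rabs u). unfold a, Rdiv. rewrite Rabs_mult, (Rabs_pos_eq (/ INR (S j) ^ 3)) by (left; apply Hi).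
    apply Rmult_le_compat_r; [left; apply Hi|]. specialize (Hp (S j)).
    set (x := Re (Cpow w (S j))) in *. set (y := Im (Cpow w (S j))) in *. assert (-1 <= x <= 1)%R by nra. assert (-1 <= y <= 1)%R by nra. apply Rabs_le. lra.
  - apply (ex_series_scal (V := R_NormedModule)), ex_series_cube. }
assert (E : forall b B, (forall k, - b k <= a (2 + k)%nat)%R -> ex_series b -> (forall N, Rsum b N <= B)%R ->
   (a 0%nat + a 1%nat - B <= Series a)%R).
{ intros b B Hb Hbs HB. rewrite (Series_incr_n a 2) by (trivial; lia). simpl pred. simpl sum_f_R0.
  pose proof (Series_le_Rsum b B Hbs HB).
  assert (Ha2 : ex_series (fun k => a (2 + k)%nat)) by now apply (ex_series_incr_n a 2).
  assert (- Series b <= Series (fun k => a (2 + k)%nat))%R; [|lra].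
  rewrite <- Series_opp. 
  apply (is_lim_seq_le (Rsum (fun k => - b k)%R) (Rsum (fun k => a (2 + k)%nat)) (Series (fun k => - b k)%R) (Series (fun k => a (2 + k)%nat))).
  - intros n. apply Rsum_le. intros k _. apply Hb.
  - apply Rsum_lim, Series_correct. now apply (ex_series_opp (V := R_NormedModule) b).
  - now apply Rsum_lim, Series_correct. }
assert (Ha0 : a 0%nat = (12 / 25 * (1 - c) + 16 / 25 * s)%R).
{ unfold a. rewrite Cpow_1_r. fold c s. simpl INR. field. }
assert (Ha1 : a 1%nat = (3 / 25 * (s * s) + 4 / 25 * (c * s))%R).
{ unfold a. rewrite Cpow_S, Cpow_1_r, re_mult, im_mult. fold c s. simpl INR.
  replace ((1 + 1) ^ 3)%R with 8%R by ring. replace (1 - (c * c - s * s))%R with (2 * (s * s))%R by lra. field. }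
assert (Hge3 : forall k, (3 <= INR (S (2 + k)))%R).
{ intros k. rewrite S_INR, plus_INR. pose proof (pos_INR k). simpl INR. lra. }
(* The vector [(12/25, 16/25)] has length [4/5], so each numerator is at least
   [12/25 - 4/5 = -8/25]; the inverse cubes from 3 on sum to at most [1/12]. *)
assert (HA : (a 0%nat + a 1%nat - 2 / 75 <= Series a)%R).
{ apply (E (fun k => 8 / 25 * / INR (S (2 + k)) ^ 3)%R).
  - intros k. unfold a. specialize (Hi (2 + k)%nat). specialize (Hp (S (2 + k))).
    set (x := Re (Cpow w (S (2 + k)))) in *. set (y := Im (Cpow w (S (2 + k)))) in *.
    assert (12 / 25 * x - 16 / 25 * y <= 4 / 5)%R by (pose proof (pow2_ge_0 (x - 3 / 5)); pose proof (pow2_ge_0 (y + 4 / 5)); nra).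
    unfold Rdiv in *. nra.
  - apply (ex_series_scal (V := R_NormedModule)). apply (ex_series_incr_n (fun j => / INR (S j) ^ 3)%R 2), ex_series_cube.
  - intros N. assert (H : (Rsum (fun k => 8 / 25 * / INR (S (2 + k)) ^ 3) N <= 8 / 25 * (/ 12 - / (2 * (INR N + 2) * (INR N + 3))))%R).
    { induction N as [|N IH]; [simpl; lra|]. change (Rsum ?f (S N)) with (Rsum f N + f N)%R. cbv beta.
      replace (INR (S (2 + N))) with (INR N + 3)%R by (rewrite S_INR, plus_INR; simpl INR; ring).
      rewrite S_INR. pose proof (pos_INR N). set (x := INR N) in *.
      enough (/ (x + 3) ^ 3 <= / (2 * (x + 2) * (x + 3)) - / (2 * (x + 1 + 2) * (x + 1 + 3)))%R by lra.
      replace (/ (2 * (x + 2) * (x + 3)) - / (2 * (x + 1 + 2) * (x + 1 + 3)))%R with (/ ((x + 2) * (x + 3) * (x + 4)))%R by (field; lra).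
      apply Rinv_le_contravar; [repeat apply Rmult_lt_0_compat; lra|]. simpl. nra. }
    pose proof (pos_INR N). assert (0 < / (2 * (INR N + 2) * (INR N + 3)))%R by (apply Rinv_0_lt_compat; nra). lra. }
(* Here [Im (w^m) >= - m s] lowers the power to [m^2], and the inverse squares from 3 on sum to at
   most [2/5]. *)
assert (HB : (a 0%nat + a 1%nat - 32 / 125 * s <= Series a)%R).
{ apply (E (fun k => 16 / 25 * s * / INR (S (2 + k)) ^ 2)%R).
  - intros k. unfold a. pose proof (Im_pow_bound w (S (2 + k)) Hw) as Hb. fold s in Hb. rewrite (Rabs_pos_eq s) in Hb by trivial.
    specialize (Hge3 k). set (m := INR (S (2 + k))) in *. specialize (Hp (S (2 + k))).
    set (x := Re (Cpow w (S (2 + k)))) in *. set (y := Im (Cpow w (S (2 + k)))) in *.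
    assert (Hy : (- (m * s) <= y)%R) by (pose proof (Rle_abs (- y)); rewrite Rabs_Ropp in H; lra).
    assert (Hx : (x <= 1)%R) by nra.
    replace (- (16 / 25 * s * / m ^ 2))%R with ((- (16 / 25) * (m * s)) / m ^ 3)%R by (field; lra).
    apply Rmult_le_compat_r; [left; apply Rinv_0_lt_compat, pow_lt; lra|]. lra.
  - apply (ex_series_scal (V := R_NormedModule)). apply (ex_series_incr_n (fun j => / INR (S j) ^ 2)%R 2), ex_series_sq.
  - intros N. assert (H : (Rsum (fun k => 16 / 25 * s * / INR (S (2 + k)) ^ 2) N <= 16 / 25 * s * (2 / 5 - / (INR N + 5 / 2)))%R).
    { induction N as [|N IH]; [simpl; lra|]. change (Rsum ?f (S N)) with (Rsum f N + f N)%R. cbv beta.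
      replace (INR (S (2 + N))) with (INR N + 3)%R by (rewrite S_INR, plus_INR; simpl INR; ring).
      rewrite S_INR. pose proof (pos_INR N). set (x := INR N) in *.
      enough (/ (x + 3) ^ 2 <= / (x + 5 / 2) - / (x + 1 + 5 / 2))%R by nra.
      replace (/ (x + 5 / 2) - / (x + 1 + 5 / 2))%R with (/ ((x + 5 / 2) * (x + 1 + 5 / 2)))%R by (field; lra).
      apply Rinv_le_contravar; nra. }
    pose proof (pos_INR N). assert (0 < / (INR N + 5 / 2))%R by (apply Rinv_0_lt_compat; lra). nra. }
rewrite Ha0, Ha1 in HA, HB. unfold minor_bound. change (Series _) with (Series a).
assert (Hc1 : (c <= 1)%R) by nra. assert (Hc2 : (-1 <= c)%R) by nra.
assert (Es : (s * s = d * d * (1 - d * d / 4))%R) by (rewrite Hd2; nra).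
destruct (Rle_dec d 1) as [Hd1|Hd1].
- eapply Rle_lt_trans; [apply Rmin_l|]. eapply Rlt_le_trans; [|exact HB].
  assert (Hdd : (0 <= d * d <= d)%R) by nra.
  assert (Hs2 : (d * (1 - d * d / 4) <= s)%R).
  { apply Rsqr_incr_0_var; [|trivial]. unfold Rsqr. rewrite Es. set (q := (1 - d * d / 4)%R). assert (3 / 4 <= q <= 1)%R by (unfold q; lra). nra. }
  assert (Ec : c = (1 - d * d / 2)%R) by lra.
  assert (Hl : (d * (1 - d * d / 4) * (68 / 125 - 2 / 25 * (d * d)) <= s * (68 / 125 - 2 / 25 * (d * d)))%R) by (apply Rmult_le_compat_r; lra).
  rewrite Ec.
  assert (Hl2 : (d * (68 / 125 - 27 / 125 * (d * d)) <= d * (1 - d * d / 4) * (68 / 125 - 2 / 25 * (d * d)))%R).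
  { rewrite Rmult_assoc. apply Rmult_le_compat_l; [lra|]. nra. }
  assert (Hss : (0 <= s * s)%R) by nra.
  assert (Hl3 : (d * (27 / 125 * (d * d)) <= d * (6 / 25 * d))%R) by (apply Rmult_le_compat_l; nra).
  nra.
- eapply Rle_lt_trans; [apply Rmin_r|]. eapply Rlt_le_trans; [|exact HA].
  (* For [d^2 >= 3/2] the first cosine term alone gives [9/25 - 2/75 = 1/3 > 5/16]. Otherwise
     [s >= 3/4], and the sine term takes over. *)
  destruct (Rle_dec (3 / 2) (d * d)) as [H|H].
  + assert (0 <= s * (1 + c))%R by nra. assert (0 <= s * s)%R by nra. nra.
  + assert (1 < d * d)%R by nra. assert (5 / 8 <= s * s)%R by (rewrite Es; nra).
    assert (3 / 4 <= s)%R by nra. assert (0 <= s * (1 + c))%R by nra. nra.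
Qed.

(** * The constant [zeta(3) - Li_3(z0)] *)

Definition CC3 (z0 : C) : C := l3 1 - l3 z0.

Lemma l3_abs (z0 : C) : (Cmod z0 <= 1)%R -> Cabs (co z0 0).
Proof.
intros H. apply Cabs_le with (2 := ex_series_cube). intros j. eapply Rle_trans; [now apply Cmod_co|].
simpl (INR (S j) ^ 0)%R. unfold Rdiv. lra.
Qed.

Lemma CC3_series (z0 c : C) : Cmod z0 = 1%R ->
  Re (c * CC3 z0) = Series (fun j => Re (c * (1 - Cpow z0 (S j))) / INR (S j) ^ 3)%R.
Proof.
intros H. assert (H1 : (Cmod 1 <= 1)%R) by (rewrite Cmod_1; lra). assert (Hz : (Cmod z0 <= 1)%R) by lra.
unfold CC3, l3. rewrite <- CSeries_minus by now apply l3_abs.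
rewrite <- CSeries_scal by (apply Cabs_minus; now apply l3_abs).
transitivity (Series (fun j => Re (c * (co 1 0 j - co z0 0 j)))); [reflexivity|].
apply Series_ext. intros j.
assert (Hj : (INR (S j) ^ 3 <> 0)%R) by (apply Rgt_not_eq, pow_lt; pose proof (INR_S_ge1 j); lra).
replace (c * (co 1 0 j - co z0 0 j)) with (RtoC (/ INR (S j) ^ 3) * (c * (1 - Cpow z0 (S j)))).
- rewrite re_scal_l. unfold Rdiv. ring.
- unfold co. rewrite Cpow_1_l, RtoC_inv, RtoC_pow by trivial. change (Cpow (INR (S j)) 0) with (RtoC 1).
  field. apply INR_S_nz.
Qed.

(** All terms are nonnegative and the first is positive. This puts the constant in the right
    half-plane, where its principal powers obey the usual rules. *)
Lemma Re_CC3_pos (z0 : C) : Cmod z0 = 1%R -> z0 <> 1 -> (0 < Re (CC3 z0))%R.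
Proof.
intros H Hne. rewrite <- (Cmult_1_l (CC3 z0)), CC3_series by trivial.
assert (Hk : forall k, (0 <= Re (1 * (1 - Cpow z0 k)) <= 2)%R).
{ intros k. rewrite Cmult_1_l. unfold Cminus. rewrite re_plus, re_opp, re_RtoC.
  pose proof (Cmod_ge_Re (Cpow z0 k)) as G. rewrite Cmod_pow, H, pow1 in G. apply Rabs_le_between in G. lra. }
assert (Hi : forall j, (0 < / INR (S j) ^ 3)%R).
{ intros j. apply Rinv_0_lt_compat, pow_lt. pose proof (INR_S_ge1 j). lra. }
assert (Hex : ex_series (fun j => Re (1 * (1 - Cpow z0 (S j))) / INR (S j) ^ 3)%R).
{ apply (ex_series_le (K := R_AbsRing) (V := R_CompleteNormedModule) _ (fun j => 2 * / INR (S j) ^ 3)%R).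
  - intros j. change (norm ?u) with (Rabs u). specialize (Hk (S j)). specialize (Hi j). unfold Rdiv.
    rewrite Rabs_pos_eq by (apply Rmult_le_pos; lra). apply Rmult_le_compat_r; lra.
  - apply (ex_series_scal (V := R_NormedModule)), ex_series_cube. }
assert (H0 : (0 < Re (1 * (1 - Cpow z0 1)) / INR 1 ^ 3)%R).
{ simpl INR. rewrite pow1, Rdiv_1_r, Cpow_1_r, Cmult_1_l. unfold Cminus. rewrite re_plus, re_opp, re_RtoC.
  pose proof (Cmod_ge_Re z0) as G. rewrite H in G. apply Rabs_le_between in G.
  destruct (Req_dec (Re z0) 1) as [E|E]; [exfalso|lra].
  apply Hne. pose proof (Cmod_sqr z0) as Hs. rewrite H, E in Hs. apply C_eq; simpl; trivial.
  assert (Im z0 * Im z0 = 0)%R by lra. nra. }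
rewrite Series_incr_1 by trivial.
assert (0 <= Series (fun k => Re (1 * (1 - Cpow z0 (S (S k)))) / INR (S (S k)) ^ 3))%R; [|lra].
apply (is_lim_seq_le (fun _ => 0%R) (Rsum (fun k => Re (1 * (1 - Cpow z0 (S (S k)))) / INR (S (S k)) ^ 3)%R) 0%R
  (Series (fun k => Re (1 * (1 - Cpow z0 (S (S k)))) / INR (S (S k)) ^ 3)%R)).
- intros n. induction n as [|n IH]; [simpl; lra|]. change (Rsum ?f (S n)) with (Rsum f n + f n)%R. cbv beta.
  specialize (Hk (S (S n))). specialize (Hi (S n)). unfold Rdiv in *. nra.
- apply is_lim_seq_const.
- apply Rsum_lim, Series_correct. now apply (ex_series_incr_1 (fun j => Re (1 * (1 - Cpow z0 (S j))) / INR (S j) ^ 3)%R).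
Qed.

(** For [v = -1/2] the factor [1 / (1 + i v)^2] is [(12 + 16 i) / 25]. Its imaginary part turns the
    contributions of [Im (z0^m)], which dominate near [z0 = 1], to the favourable side when
    [Im z0 >= 0]; the other case follows by conjugation. *)
Lemma CC3_lower (z0 : C) : Cmod z0 = 1%R -> z0 <> 1 -> exists v : R,
  (minor_bound (Cmod (1 - z0)) < Re (CC3 z0 / ((1 + v * Ci) * (1 + v * Ci))))%R.
Proof.
intros H Hne.
destruct (Rle_dec 0 (Im z0)) as [Hs|Hs].
- exists (- / 2)%R.
  replace (CC3 z0 / ((1 + (- / 2)%R * Ci) * (1 + (- / 2)%R * Ci))) with ((((12 / 25)%R, (16 / 25)%R) : C) * CC3 z0).
  + rewrite CC3_series by trivial. erewrite Series_ext; [now apply lower_series|].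
    intros j. simpl. unfold Re, Im. f_equal. field.
  + rewrite Cmult_comm. unfold Cdiv. f_equal. apply C_eq; simpl; field.
- exists (/ 2)%R.
  replace (CC3 z0 / ((1 + (/ 2)%R * Ci) * (1 + (/ 2)%R * Ci))) with ((((12 / 25)%R, (- (16 / 25))%R) : C) * CC3 z0).
  + rewrite CC3_series by trivial.
    assert (Hm : Cmod (1 - z0) = Cmod (1 - Cconj z0)).
    { rewrite <- (Cmod_conj (1 - z0)). f_equal. apply C_eq; simpl; ring. }
    rewrite Hm. erewrite Series_ext; [apply lower_series|].
    * now rewrite Cmod_conj.
    * intros E. apply Hne. rewrite <- (Cconj_conj z0), E. apply C_eq; simpl; ring.
    * rewrite im_conj. lra.
    * intros j. cbv beta. rewrite <- Cpow_conj, re_conj, im_conj. simpl. unfold Re, Im. f_equal. field.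
  + rewrite Cmult_comm. unfold Cdiv. f_equal. apply C_eq; simpl; field.
Qed.

(** * The complex Gaussian integral *)

Lemma CI_point (f : R -> C) (a : R) : CI f a a = 0.
Proof. apply C_eq; [exact (RInt_point (V := R_CompleteNormedModule) a (fun y => Re (f y)))|exact (RInt_point (V := R_CompleteNormedModule) a (fun y => Im (f y)))]. Qed.

Lemma CD_CI (f : R -> C) (a x : R) : (forall y, CC f y) -> CD (fun y => CI f a y) x (f x).
Proof.
intros Hf.
assert (G : forall g : R -> R, (forall y, continuous g y) -> is_derive (fun y => RInt g a y) x (g x)).
{ intros g Hg. apply (is_derive_RInt (V := R_NormedModule) g (fun y => RInt g a y) a x); trivial.
  exists (mkposreal 1 Rlt_0_1). intros y _. apply (RInt_correct (V := R_CompleteNormedModule)).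
  apply (ex_RInt_continuous (V := R_CompleteNormedModule)). intros z _. apply Hg. }
split; [apply (G (fun y => Re (f y)))|apply (G (fun y => Im (f y)))]; intros y; apply (Hf y).
Qed.

Lemma CI_bound_linear (f g h : R -> C) (c : C) (a b B : R) : (a <= b)%R -> Con f a b -> Con g a b -> Con h a b ->
  (forall t, a < t < b -> Cmod (f t - g t - c * h t) <= B)%R -> (Cmod (CI f a b - CI g a b - c * CI h a b) <= B * (b - a))%R.
Proof.
intros Hab Hf Hg Hh H. rewrite <- CI_scal, <- CI_minus, <- CI_minus; trivial; [|now apply Con_minus|now apply Con_scal].
apply CI_bound_const; trivial. apply Con_minus; [now apply Con_minus|now apply Con_scal].
Qed.

Lemma second_order_bound (f f1 f2 : R -> C) (x h B : R) :
  (forall y, Rabs (y - x) <= Rabs h -> CD f y (f1 y))%R -> (forall y, Rabs (y - x) <= Rabs h -> CD f1 y (f2 y))%R ->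
  (forall y, Rabs (y - x) <= Rabs h -> Cmod (f2 y) <= B)%R ->
  (Cmod (f (x + h)%R - f x - h * f1 x) <= B * h ^ 2)%R.
Proof.
intros H1 H2 HB.
assert (HB0 : (0 <= B)%R).
{ eapply Rle_trans; [apply Cmod_ge_0|apply (HB x)]. rewrite Rminus_diag, Rabs_R0. apply Rabs_pos. }
assert (Hu : forall u, (0 <= u <= 1)%R -> (Rabs (x + u * h - x) <= Rabs h)%R).
{ intros u Hu. replace (x + u * h - x)%R with (u * h)%R by ring. rewrite Rabs_mult, Rabs_pos_eq by lra. pose proof (Rabs_pos h). nra. }
assert (Hlin : forall u : R, is_derive (fun u => x + u * h)%R u h) by (intros; auto_derive; trivial; ring).
assert (G : forall u, (0 <= u <= 1)%R -> (Cmod (f1 (x + u * h)%R - f1 x) <= B * Rabs h)%R).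
{ intros u Hu1.
  pose proof (CD_MVT_const (fun u => f1 (x + u * h)%R) (fun u => h * f2 (x + u * h)%R) (Rabs h * B) 0 u ltac:(lra)) as H.
  cbv beta in H. replace (x + 0 * h)%R with x in H by ring. eapply Rle_trans; [apply H|].
  - intros y Hy. apply (CD_comp_real f1 (fun u => x + u * h)%R); [|apply Hlin]. apply H2, Hu. lra.
  - intros y Hy. rewrite Cmod_mult, Cmod_R. apply Rmult_le_compat_l; [apply Rabs_pos|]. apply HB, Hu. lra.
  - assert (0 <= Rabs h * B)%R by (apply Rmult_le_pos; trivial; apply Rabs_pos). nra. }
pose proof (CD_MVT_const (fun u => f (x + u * h)%R - u * (h * f1 x)) (fun u => h * (f1 (x + u * h)%R - f1 x)) (Rabs h * (B * Rabs h)) 0 1 ltac:(lra)) as H.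
cbv beta in H. replace (x + 0 * h)%R with x in H by ring. replace (x + 1 * h)%R with (x + h)%R in H by ring.
replace (f (x + h)%R - 1 * (h * f1 x) - (f x - 0 * (h * f1 x))) with (f (x + h)%R - f x - h * f1 x) in H by ring.
eapply Rle_trans; [apply H|].
- intros y Hy. eapply CD_eq.
  + apply CD_minus; [apply (CD_comp_real f (fun u => x + u * h)%R); [apply H1, Hu; lra|apply Hlin]|].
    apply CD_mult; [apply CD_id|apply CD_const].
  + cbv beta. ring.
- intros y Hy. rewrite Cmod_mult, Cmod_R. apply Rmult_le_compat_l; [apply Rabs_pos|]. apply G. lra.
- right. rewrite <- (pow2_abs h). simpl. ring.
Qed.

Definition gauss (a : C) (x : R) : C := Cexp (- a * (x * x)).

Lemma CD_gauss (a : C) (x : R) : CD (gauss a) x (- (2) * a * x * gauss a x).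
Proof.
unfold gauss. eapply CD_eq; [apply CD_Cexp, CD_scal, CD_mult; apply CD_id|]. cbv beta. ring.
Qed.

Lemma gauss_CC (a : C) (x : R) : CC (gauss a) x.
Proof. eapply CD_CC, CD_gauss. Qed.

Lemma Cmod_gauss (a : C) (x : R) : Cmod (gauss a x) = exp (- (Re a * (x * x))).
Proof. unfold gauss. rewrite Cmod_Cexp, <- RtoC_mult, re_scal_r, re_opp. f_equal. ring. Qed.

Lemma Cmod_gauss_le1 (a : C) (x : R) : (0 < Re a)%R -> (Cmod (gauss a x) <= 1)%R.
Proof. intros H. rewrite Cmod_gauss, <- exp_0. apply exp_mono. pose proof (Rle_0_sqr x). unfold Rsqr in *. nra. Qed.

(** The companion function of the classical elementary evaluation of the Gaussian integral; it
    applies to complex [a] directly, without rotating a contour. *)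
Definition gaussK (a : C) (x : R) : C := CI (fun t => / (1 + t * t)%R * gauss ((1 + t * t)%R * a) x) 0 1.

Lemma inv_1_sqr (t : R) : (0 < / (1 + t * t) <= 1)%R.
Proof.
assert (1 <= 1 + t * t)%R by nra. split; [apply Rinv_0_lt_compat; lra|].
rewrite <- Rinv_1. apply Rinv_le_contravar; lra.
Qed.

Lemma CC_1_sqr (t : R) : CC (fun t => RtoC (1 + t * t)%R) t.
Proof. apply CC_RtoC. apply (ex_derive_continuous (V := R_NormedModule)). auto_derive. trivial. Qed.

Lemma gauss_param_CC (a : C) (x t : R) : CC (fun t => gauss ((1 + t * t)%R * a) x) t.
Proof.
unfold gauss. apply CC_Cexp.
apply (CC_ext (fun t => (1 + t * t)%R * (- a * (x * x)))); [intros; ring|].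
apply CC_mult; [apply CC_1_sqr|apply CC_const].
Qed.

Lemma gaussK_CC (a : C) (x t : R) : CC (fun t => / (1 + t * t)%R * gauss ((1 + t * t)%R * a) x) t.
Proof.
apply CC_mult; [|apply gauss_param_CC].
apply (CC_ext (fun t => RtoC (/ (1 + t * t))%R)).
{ intros y. pose proof (Rle_0_sqr y). unfold Rsqr in *. rewrite RtoC_inv by lra. reflexivity. }
apply CC_RtoC. apply (ex_derive_continuous (V := R_NormedModule)). auto_derive. pose proof (Rle_0_sqr t). unfold Rsqr in *. lra.
Qed.

Lemma CD_gaussK (a : C) (x : R) : (0 < Re a)%R ->
  CD (gaussK a) x (CI (fun t => - (2) * a * x * gauss ((1 + t * t)%R * a) x) 0 1).
Proof.
intros Ha. set (A := Cmod a). assert (HA : (0 <= A)%R) by apply Cmod_ge_0.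
set (X := (Rabs x + 1)%R).
set (B := (2 * A + 8 * A * A * (X * X))%R).
apply CD_of_quadratic with B 1%R; [lra|]. intros h Hh. unfold gaussK.
assert (Hc2 : Con (fun t => - (2) * a * x * gauss ((1 + t * t)%R * a) x) 0 1).
{ intros t _. apply CC_mult; [apply CC_const|apply gauss_param_CC]. }
assert (Hc1 : forall y, Con (fun t => / (1 + t * t)%R * gauss ((1 + t * t)%R * a) y) 0 1) by (intros y t _; apply gaussK_CC).
replace (B * h ^ 2)%R with (B * h ^ 2 * (1 - 0))%R by ring.
apply CI_bound_linear; trivial; [lra|].
intros t Ht. set (s := (1 + t * t)%R). assert (Hs : (1 <= s <= 2)%R) by (unfold s; nra).
assert (Hsn : RtoC s <> 0) by (intros F; apply RtoC_inj in F; lra).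
apply (second_order_bound (fun x => / s * gauss (s * a) x) (fun x => - (2) * a * x * gauss (s * a) x)
  (fun x => (- (2) * a + 4 * (a * a) * s * (x * x)) * gauss (s * a) x)).
- intros y _. eapply CD_eq; [apply CD_scal, CD_gauss|]. cbv beta. field. trivial.
- intros y _. eapply CD_eq; [apply CD_mult; [apply CD_mult; [apply CD_const|apply CD_id]|apply CD_gauss]|]. cbv beta. ring.
- intros y Hy. rewrite Cmod_mult. rewrite <- (Rmult_1_r B).
  apply Rmult_le_compat; try apply Cmod_ge_0.
  + eapply Rle_trans; [apply Cmod_triangle|]. rewrite !Cmod_mult, Cmod_opp, !Cmod_R, (Rabs_pos_eq 2), (Rabs_pos_eq 4), (Rabs_pos_eq s) by lra. fold A.
    assert (Hy2 : (Rabs y <= X)%R).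
    { unfold X. replace y with (x + (y - x))%R by ring. eapply Rle_trans; [apply Rabs_triang|]. lra. }
    pose proof (Rabs_pos y). unfold B. assert (Hyy : (Rabs y * Rabs y <= X * X)%R) by nra.
    assert (Hyy0 : (0 <= Rabs y * Rabs y)%R) by nra.
    assert (s * (Rabs y * Rabs y) <= 2 * (X * X))%R by nra.
    assert (4 * (A * A) * (s * (Rabs y * Rabs y)) <= 4 * (A * A) * (2 * (X * X)))%R by (apply Rmult_le_compat_l; nra). lra.
  + apply Cmod_gauss_le1. rewrite re_scal_l. nra.
Qed.

(** The derivative of the left side vanishes: the substitution [s = y t] in the integral from 0 to
    [y] turns the first summand into the opposite of the second. At [x = 0] what remains is the
    integral of [1 / (1 + t^2)]. *)
Lemma gauss_square (a : C) (x : R) : (0 < Re a)%R -> (0 <= x)%R ->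
  a * (CI (gauss a) 0 x * CI (gauss a) 0 x) + gaussK a x = PI / 4.
Proof.
intros Ha Hx.
set (f := fun x => a * (CI (gauss a) 0 x * CI (gauss a) 0 x) + gaussK a x).
assert (Hf : f x = f 0%R).
{ assert (E : (Cmod (f x - f 0%R) <= 0)%R).
  { apply Rle_trans with (0 * (x - 0))%R; [|right; ring].
    apply CD_MVT_const with (fun _ => 0); trivial; [|intros; rewrite Cmod_0; lra].
    intros y Hy. unfold f. eapply CD_eq.
    - apply CD_plus; [apply CD_scal, CD_mult; apply CD_CI; intros; apply gauss_CC|now apply CD_gaussK].
    - cbv beta.
      assert (E : CI (gauss a) 0 y = y * CI (fun t => gauss a (y * t)%R) 0 1).
      { destruct (Req_dec y 0) as [->|Hy0].
        - rewrite Cmult_0_l. apply CI_point.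
        - pose proof (CI_comp_lin (gauss a) y 0 0 1 ltac:(lra) ltac:(lra)) as H.
          replace (y * 0 + 0)%R with 0%R in H by ring. replace (y * 1 + 0)%R with y in H by ring.
          rewrite H by (intros u _; apply gauss_CC). f_equal. apply CI_ext; [lra|]. intros u _. f_equal. ring. }
      rewrite (CI_ext (fun t => - (2) * a * y * gauss ((1 + t * t)%R * a) y) (fun t => (- (2) * a * y * gauss a y) * gauss a (y * t)%R)); [|lra|].
      + rewrite CI_scal; [|lra|intros t _].
        * rewrite E. ring.
        * apply (CC_ext (fun t => gauss a (y * t + 0)%R)); [intros; f_equal; ring|]. apply CC_lin, gauss_CC.
      + intros t _. unfold gauss. rewrite <- !Cmult_assoc. do 4 f_equal. rewrite <- Cexp_add. f_equal.
        rewrite RtoC_plus, !RtoC_mult. ring. }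
  apply Ceq_minus, Cmod_eq_0, Rle_antisym; [exact E|apply Cmod_ge_0]. }
change (f x = PI / 4). rewrite Hf. unfold f.
rewrite CI_point.
unfold gaussK. rewrite (CI_FTC (fun t => RtoC (atan t))).
- rewrite atan_1, atan_0, RtoC_div by lra. ring.
- lra.
- intros t _. eapply CD_eq; [apply CD_RtoC; apply is_derive_atan|].
  unfold gauss. rewrite Cmult_0_r, Cmult_0_r, Cexp_0. rewrite RtoC_inv; [unfold Rsqr; ring|]. pose proof (Rle_0_sqr t). lra.
- intros t _. apply gaussK_CC.
Qed.

(** The phase satisfies [|e^(- i Im a x^2) - 1| <= |Im a| x^2], and integration by parts bounds the
    integral of [x^2 e^(- Re a x^2)] by [1 / (2 Re a)] times that of the real Gaussian. [M] is the
    primitive that this computation yields. *)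
Lemma gauss_near_real (a : C) (W : R) : (0 < Re a)%R -> (0 <= W)%R ->
  (Cmod (CI (gauss a) 0 W - CI (gauss (Re a)) 0 W) <= Rabs (Im a) / (2 * Re a) * Re (CI (gauss (Re a)) 0 W))%R.
Proof.
intros Ha HW. set (q := (Rabs (Im a) / (2 * Re a))%R).
assert (Hq : (0 <= q)%R) by (apply Rmult_le_pos; [apply Rabs_pos|left; apply Rinv_0_lt_compat; lra]).
set (M := fun x => (q * (Re (CI (gauss (Re a)) 0 x) - x * exp (- (Re a * (x * x)))))%R).
set (m := fun x => (q * (2 * Re a * (x * x) * exp (- (Re a * (x * x)))))%R).
pose proof (CD_MVT (fun x => CI (gauss a) 0 x - CI (gauss (Re a)) 0 x) (fun x => gauss a x - gauss (Re a) x) M m 0 W HW) as H.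
assert (E0 : forall b, CI (gauss b) 0 0 = 0) by (intros b; apply CI_point).
assert (HM0 : M 0%R = 0%R) by (unfold M; rewrite E0; simpl; ring).
cbv beta in H. rewrite !E0, HM0, Rminus_0_r in H.
replace (CI (gauss a) 0 W - CI (gauss (Re a)) 0 W - (0 - 0)) with (CI (gauss a) 0 W - CI (gauss (Re a)) 0 W) in H by ring.
assert (HM : (Cmod (CI (gauss a) 0 W - CI (gauss (Re a)) 0 W) <= M W)%R).
{ apply H.
  - intros x _. apply CD_minus; apply CD_CI; intros; apply gauss_CC.
  - intros x _. unfold M, m.
    assert (Hd : is_derive (fun x => Re (CI (gauss (Re a)) 0 x)) x (exp (- (Re a * (x * x))))).
    { replace (exp (- (Re a * (x * x)))) with (Re (gauss (Re a) x)); [apply (CD_CI (gauss (Re a)) 0 x); intros; apply gauss_CC|].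
      unfold gauss. rewrite <- RtoC_opp, <- !RtoC_mult, Cexp_R, re_RtoC. f_equal. ring. }
    replace (q * (2 * Re a * (x * x) * exp (- (Re a * (x * x)))))%R with
      (q * (exp (- (Re a * (x * x))) - (1 * exp (- (Re a * (x * x))) + x * (- (2 * Re a * x) * exp (- (Re a * (x * x)))))))%R by ring.
    apply isd_scal, isd_minus; [exact Hd|]. auto_derive; trivial. ring.
  - intros x Hx. unfold m.
    replace (gauss a x - gauss (Re a) x) with (gauss (Re a) x * (Cexp (- ((Im a * (x * x))%R * Ci)) - 1)).
    + rewrite Cmod_mult, Cmod_gauss, re_RtoC.
      assert (Hl : (Cmod (Cexp (- ((Im a * (x * x))%R * Ci)) - 1) <= Cmod ((Im a * (x * x))%R * Ci))%R) by (apply Cexp_lip; simpl; lra).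
      rewrite Cmod_mult, Cmod_Ci, Rmult_1_r, Cmod_R, Rabs_mult, (Rabs_pos_eq (x * x)) in Hl by nra.
      replace (q * (2 * Re a * (x * x) * exp (- (Re a * (x * x)))))%R with (exp (- (Re a * (x * x))) * (Rabs (Im a) * (x * x)))%R by (unfold q; field; lra).
      apply Rmult_le_compat_l; [left; apply exp_pos|exact Hl].
    + unfold gauss. replace (- a * (x * x)) with (- Re a * (x * x) + - ((Im a * (x * x))%R * Ci)).
      * rewrite Cexp_add. ring.
      * apply C_eq; simpl; unfold Re, Im; ring. }
eapply Rle_trans; [exact HM|]. unfold M. apply Rmult_le_compat_l; trivial.
pose proof (exp_pos (- (Re a * (W * W)))). nra.
Qed.

Lemma RInt_even (f : R -> R) (W : R) : (forall y, continuous f y) -> (forall y, f (- y)%R = f y) ->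
  RInt f (- W) 0 = RInt f 0 W.
Proof.
intros Hf He.
assert (Hex : forall a b, ex_RInt f a b) by (intros; apply (ex_RInt_continuous (V := R_CompleteNormedModule)); intros; apply Hf).
pose proof (RInt_comp_lin (V := R_CompleteNormedModule) f (-1) 0 W 0 (Hex _ _)) as H.
replace (-1 * W + 0)%R with (- W)%R in H by ring. replace (-1 * 0 + 0)%R with 0%R in H by ring. rewrite <- H.
rewrite (RInt_ext (V := R_CompleteNormedModule) _ (fun y => scal (-1) (f y))).
- rewrite (RInt_scal (V := R_CompleteNormedModule)) by apply Hex.
  rewrite <- (opp_RInt_swap (V := R_CompleteNormedModule)) by apply Hex.
  unfold scal, opp; simpl; unfold mult; simpl. ring.
- intros y _. f_equal. rewrite <- (He y). f_equal. ring.
Qed.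

Lemma CI_even (f : R -> C) (W : R) : (forall y, CC f y) -> (forall y, f (- y)%R = f y) -> CI f (- W) 0 = CI f 0 W.
Proof.
intros Hf He. unfold CI. f_equal.
- apply (RInt_even (fun y => Re (f y))); intros y; [apply (Hf y)|now rewrite He].
- apply (RInt_even (fun y => Im (f y))); intros y; [apply (Hf y)|now rewrite He].
Qed.

(* The square of the integral is known from [gauss_square]; the sign is fixed by [gauss_near_real]. *)
Lemma gauss_limit (b : C) : (0 < Re (b * b))%R -> (Rabs (Im (b * b)) <= Re (b * b))%R -> (/ 2 * Cmod b < Re b)%R ->
  forall eps, (0 < eps)%R -> exists W0 : R, forall W, (W0 <= W)%R -> (Cmod (b * CI (gauss (b * b)) (- W) W - sqrt PI) <= eps)%R.
Proof.
intros Ha Hi Hb eps He. set (a := b * b) in *. pose proof PI_RGT_0 as HPI.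
set (s := (sqrt PI / 2)%R). assert (Hsq : (0 < sqrt PI)%R) by now apply sqrt_lt_R0.
assert (Hss : (s * s = PI / 4)%R) by (unfold s; replace (sqrt PI / 2 * (sqrt PI / 2))%R with (sqrt PI * sqrt PI / 4)%R by field; rewrite sqrt_sqrt by lra; reflexivity).
exists (1 + 2 / (Re a * s * eps))%R. intros W HW.
assert (Hq : (0 < Re a * s * eps)%R) by (repeat apply Rmult_lt_0_compat; trivial; unfold s; lra).
assert (H2q : (0 < 2 / (Re a * s * eps))%R) by (apply Rdiv_lt_0_compat; lra).
assert (HW1 : (1 < W)%R) by lra.
assert (HG : forall x y, Con (gauss a) x y) by (intros x y z _; apply gauss_CC).
assert (Esym : CI (gauss a) (- W) W = 2 * CI (gauss a) 0 W).
{ rewrite (CI_Chasles _ (- W) 0 W) by (trivial; lra).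
  assert (E : CI (gauss a) (- W) 0 = CI (gauss a) 0 W); [|rewrite E; ring].
  assert (Eg : forall y, gauss a (- y)%R = gauss a y) by (intros y; unfold gauss; f_equal; rewrite RtoC_opp; ring).
  apply CI_even; trivial. intros y; apply gauss_CC. }
set (J := CI (gauss a) 0 W) in *.
pose proof (gauss_square a W Ha ltac:(lra)) as HS. fold J in HS.
assert (HK : (Cmod (gaussK a W) <= / (Re a * W))%R).
{ eapply Rle_trans; [apply (CI_bound_const _ (/ (Re a * W))); [lra|intros t _; apply gaussK_CC|]|lra].
  intros t Ht. rewrite Cmod_mult, Cmod_gauss, re_scal_l.
  pose proof (inv_1_sqr t) as Hinv. assert (Ht1 : (0 < 1 + t * t)%R) by nra.
  rewrite <- RtoC_inv, Cmod_RtoC_pos by lra.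
  pose proof (exp_pos (- ((1 + t * t) * Re a * (W * W)))) as Hpos.
  apply Rle_trans with (1 * exp (- ((1 + t * t) * Re a * (W * W))))%R; [apply Rmult_le_compat_r; lra|].
  rewrite Rmult_1_l, exp_Ropp. apply Rinv_le_contravar; [nra|].
  pose proof (exp_ineq1_le ((1 + t * t) * Re a * (W * W))).
  assert (Re a * W <= Re a * (W * W))%R by (apply Rmult_le_compat_l; nra).
  assert (0 <= t * t * (Re a * (W * W)))%R by (repeat apply Rmult_le_pos; nra). nra. }
(* Since [|Im a| <= Re a], [J] differs from a nonnegative real [Jr] by at most [Jr / 2], and
   [Re b > |b| / 2] keeps the product in the right half-plane. *)
assert (HRe : (0 <= Re (b * J))%R).
{ pose proof (gauss_near_real a W Ha ltac:(lra)) as Hn. fold J in Hn.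
  set (Jr := CI (gauss (Re a)) 0 W) in *.
  assert (Hjr : Jr = Re Jr).
  { apply C_eq; [reflexivity|]. change (RInt (fun y => Im (gauss (Re a) y)) 0 W = 0%R).
    transitivity (RInt (fun _ => 0%R) 0 W).
    - apply RInt_ext. intros x _. unfold gauss. rewrite <- RtoC_opp, <- !RtoC_mult, Cexp_R. reflexivity.
    - rewrite RInt_const. unfold scal; simpl; unfold mult; simpl. ring. }
  assert (Hjr0 : (0 <= Re Jr)%R).
  { change (0 <= RInt (fun y => Re (gauss (Re a) y)) 0 W)%R. apply RInt_ge_0; [lra|apply (Con_ex (gauss (Re a))); [lra|intros z _; apply gauss_CC]|].
    intros x _. unfold gauss. rewrite <- RtoC_opp, <- !RtoC_mult, Cexp_R. simpl. left; apply exp_pos. }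
  assert (Hn2 : (Cmod (J - Jr) <= / 2 * Re Jr)%R).
  { eapply Rle_trans; [exact Hn|]. apply Rmult_le_compat_r; trivial.
    apply Rmult_le_reg_r with (2 * Re a)%R; [lra|]. unfold Rdiv. rewrite Rmult_assoc, Rinv_l by lra. lra. }
  replace (b * J) with (Re Jr * b + b * (J - Jr)) by (rewrite <- Hjr; ring).
  rewrite re_plus, re_scal_l. pose proof (Cmod_ge_Re (b * (J - Jr))) as G. rewrite Cmod_mult in G.
  apply Rabs_le_between in G. pose proof (Cmod_ge_0 b).
  assert (Cmod b * Cmod (J - Jr) <= Cmod b * (/ 2 * Re Jr))%R by (apply Rmult_le_compat_l; trivial).
  assert (Re Jr * (/ 2 * Cmod b) <= Re Jr * Re b)%R by (apply Rmult_le_compat_l; lra). lra. }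
(* The second factor has modulus at least [s] because [Re (b * J) >= 0], so the small product makes
   the first factor small. *)
assert (Hprod : (b * J - s) * (b * J + s) = - gaussK a W).
{ replace ((b * J - s) * (b * J + s)) with (a * (J * J) - s * s) by (unfold a; ring).
  rewrite <- RtoC_mult, Hss, RtoC_div, <- HS by lra. ring. }
assert (Hplus : (s <= Cmod (b * J + s))%R).
{ eapply Rle_trans; [|apply Cmod_ge_Re]. rewrite re_plus, re_RtoC. eapply Rle_trans; [|apply Rle_abs]. lra. }
assert (Hfin : (Cmod (b * J - s) * s <= / (Re a * W))%R).
{ eapply Rle_trans; [|exact HK]. rewrite <- (Cmod_opp (gaussK a W)), <- Hprod, Cmod_mult.
  apply Rmult_le_compat_l; trivial. apply Cmod_ge_0. }
rewrite Esym. replace (b * (2 * J) - sqrt PI) with (2 * (b * J - s)).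
2:{ unfold s. rewrite RtoC_div by lra. field. }
rewrite Cmod_mult, Cmod_RtoC_pos by lra.
assert (Hs0 : (0 < s)%R) by (unfold s; lra).
apply Rmult_le_reg_r with s; trivial.
apply Rle_trans with (2 * / (Re a * W))%R; [lra|].
apply Rmult_le_reg_r with (Re a * W)%R; [nra|].
rewrite Rmult_assoc, Rinv_l by nra.
assert (2 / (Re a * s * eps) * (Re a * s * eps) = 2)%R by (field; lra). nra.
Qed.

(** * Laplace's method *)

(* On the circle, [t = e * vt v]; the exponent [CC3 / t^2 + n t] has its saddle at [t = e * vt v0]. *)
Definition vt (v : R) : C := 1 + v * Ci.

Lemma Re_vt (v : R) : Re (vt v) = 1%R.
Proof. unfold vt. rewrite re_plus, re_scal_l, re_RtoC. simpl. ring. Qed.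

Lemma Im_vt (v : R) : Im (vt v) = v.
Proof. unfold vt. rewrite im_plus, im_scal_l, im_RtoC. simpl. ring. Qed.

Lemma vt_nz (v : R) : vt v <> 0.
Proof. apply Re_pos_nz. rewrite Re_vt. lra. Qed.

Lemma vt_ge1 (v : R) : (1 <= Cmod (vt v))%R.
Proof. pose proof (Cmod_ge_Re (vt v)). rewrite Re_vt, Rabs_R1 in H. trivial. Qed.

Lemma vt_le (v : R) : (Cmod (vt v) <= 1 + Rabs v)%R.
Proof. pose proof (Cmod_le_sum (vt v)). rewrite Re_vt, Im_vt, Rabs_R1 in H. trivial. Qed.

Lemma CD_vt (v : R) : CD vt v Ci.
Proof.
unfold vt. eapply CD_eq; [apply CD_plus; [apply CD_const|apply CD_mult; [apply CD_id|apply CD_const]]|]. cbv beta; ring.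
Qed.

(** The cofactor of [- (v - v0)^2] in the exponent scaled by [e^2], exact by [saddle_identity]; at
    [v = v0] it is [3 m / vt v0]. [gv] is the factor [t^(1/12)] divided by [e^(1/12)]. *)
Definition av (m v0 v : R) : C := m * ((2 * vt v + vt v0) / (vt v * vt v)).
Definition gv (v : R) : C := Cexp (Clog (vt v) / 12).

Lemma Re_av (m v0 v : R) : Re (av m v0 v) = (m * ((3 + v * v + 2 * v * v0) / ((1 + v * v) * (1 + v * v))))%R.
Proof.
unfold av. rewrite re_scal_l. f_equal.
assert (H : (0 < 1 + v * v)%R) by nra.
assert (E : / (vt v * vt v) = ((1 - v * v) / ((1 + v * v) * (1 + v * v)), - (2 * v) / ((1 + v * v) * (1 + v * v)))%R).
{ pose proof (vt_nz v) as Hn.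
  rewrite <- (Cmult_1_l (/ _)).
  replace (RtoC 1) with ((((1 - v * v) / ((1 + v * v) * (1 + v * v)))%R, (- (2 * v) / ((1 + v * v) * (1 + v * v)))%R) * (vt v * vt v)).
  - field. trivial.
  - unfold vt. apply C_eq; simpl; field; lra. }
unfold Cdiv. rewrite E. unfold vt. simpl. field. lra.
Qed.

(** The numerator in [Re_av] is [3 - v0^2 + (v + v0)^2], at least 2. *)
Lemma av_lower (m v0 v k : R) : (0 < m)%R -> (v0 * v0 <= / 3)%R -> (Rabs v <= k)%R ->
  (2 * m / ((1 + k * k) * (1 + k * k)) <= Re (av m v0 v))%R.
Proof.
intros Hm Hv0 Hv. rewrite Re_av. pose proof (Rabs_pos v).
assert (Hvv : (v * v <= k * k)%R) by (rewrite <- (Rabs_pos_eq (v * v)), Rabs_mult by nra; nra).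
assert (H1 : (0 < (1 + v * v) * (1 + v * v))%R) by nra.
unfold Rdiv. rewrite (Rmult_comm 2 m), Rmult_assoc. apply Rmult_le_compat_l; [lra|].
apply Rle_trans with (2 * / ((1 + v * v) * (1 + v * v)))%R.
- apply Rmult_le_compat_l; [lra|]. apply Rinv_le_contravar; trivial. nra.
- apply Rmult_le_compat_r; [left; now apply Rinv_0_lt_compat|]. pose proof (pow2_ge_0 (v + v0)). simpl in H0. nra.
Qed.

Lemma av_lip (m v0 v : R) : (0 < m)%R -> (Cmod (av m v0 v - av m v0 v0) <= 4 * m * Rabs (v - v0))%R.
Proof.
intros Hm. pose proof (vt_nz v). pose proof (vt_nz v0). pose proof (vt_ge1 v). pose proof (vt_ge1 v0).
replace (av m v0 v - av m v0 v0) with (m * ((v - v0)%R * (- Ci * (vt v0 + 3 * vt v) * / (vt v * vt v * vt v0)))).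
2:{ replace (RtoC (v - v0)) with (- Ci * (vt v - vt v0)).
    - unfold av. transitivity (m * ((Ci * Ci) * (vt v - vt v0) * (vt v0 + 3 * vt v) / (vt v * vt v * vt v0))).
      + field. split; trivial.
      + replace (Ci * Ci) with (RtoC (-1)) by (apply C_eq; simpl; ring). field. split; trivial.
    - unfold vt. apply C_eq; simpl; ring. }
rewrite !Cmod_mult, Cmod_opp, Cmod_Ci, !Cmod_R, (Rabs_pos_eq m) by lra.
replace (4 * m * Rabs (v - v0))%R with (m * (Rabs (v - v0) * 4))%R by ring. apply Rmult_le_compat_l; [lra|].
apply Rmult_le_compat_l; [apply Rabs_pos|].
rewrite Cmod_inv by (repeat apply Cmult_neq_0; trivial). rewrite !Cmod_mult.
set (p := Cmod (vt v)) in *. set (q := Cmod (vt v0)) in *.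
assert (Hs : (Cmod (vt v0 + 3 * vt v) <= q + 3 * p)%R).
{ apply Cmod_plus_le; [apply Rle_refl|]. rewrite Cmod_mult, Cmod_RtoC_pos by lra. apply Rle_refl. }
assert (Hpq : (0 < p * p * q)%R) by (repeat apply Rmult_lt_0_compat; lra).
rewrite Rmult_1_l. apply Rmult_le_reg_r with (p * p * q)%R; trivial. rewrite Rmult_assoc, Rinv_l, Rmult_1_r by lra.
assert (p <= p * p)%R by nra. assert (1 * q <= p * p * q)%R by nra. assert (p * 1 <= p * p * q)%R by nra. lra.
Qed.

Lemma gv_bound (v : R) : (Cmod (gv v) <= Cmod (vt v))%R.
Proof.
unfold gv. rewrite Cmod_Cexp. pose proof (vt_ge1 v).
replace (Clog (vt v) / 12) with ((/ 12)%R * Clog (vt v)) by (rewrite RtoC_inv by lra; unfold Cdiv; ring).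
rewrite re_scal_l. change (Re (Clog (vt v))) with (ln (Cmod (vt v))).
rewrite <- (exp_ln (Cmod (vt v))) at 2 by lra. apply exp_mono. pose proof (ln_nonneg _ H). lra.
Qed.

Lemma CD_gv (v : R) : CD gv v (Ci / vt v / 12 * gv v).
Proof.
unfold gv. apply CD_Cexp. unfold Cdiv. eapply CD_eq.
- apply CD_mult; [apply CD_Clog; [rewrite Re_vt; lra|apply CD_vt]|apply CD_const].
- cbv beta. field. apply vt_nz.
Qed.

Lemma gv_lip (v v0 : R) : (Cmod (gv v - gv v0) <= Rabs (v - v0))%R.
Proof.
assert (H : forall a b, (a <= b)%R -> (Cmod (gv b - gv a) <= b - a)%R).
{ intros a b Hab. rewrite <- (Rmult_1_l (b - a)). apply CD_MVT_const with (fun v => Ci / vt v / 12 * gv v); trivial.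
  - intros x _. apply CD_gv.
  - intros x _. pose proof (vt_ge1 x). pose proof (gv_bound x). pose proof (vt_nz x).
    rewrite Cmod_mult, !Cmod_div, Cmod_Ci, (Cmod_RtoC_pos 12) by (try lra; trivial; intros F; apply RtoC_inj in F; lra).
    set (p := Cmod (vt x)) in *. pose proof (Cmod_ge_0 (gv x)).
    apply Rle_trans with (1 / p / 12 * p)%R; [|replace (1 / p / 12 * p)%R with (1 / 12)%R by (field; lra); lra].
    apply Rmult_le_compat_l; trivial. apply Rlt_le, Rdiv_lt_0_compat; [apply Rdiv_lt_0_compat|]; lra. }
destruct (Rle_dec v0 v) as [Hv|Hv].
- rewrite Rabs_pos_eq by lra. now apply H.
- rewrite Cmod_minus_sym, Rabs_minus_sym, Rabs_pos_eq by lra. apply H. lra.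
Qed.

Lemma Cexp_lip2 (p q : C) : (0 <= Re p)%R -> (0 <= Re q)%R -> (Cmod (Cexp (- p) - Cexp (- q)) <= Cmod (p - q))%R.
Proof.
intros Hp Hq.
pose proof (CD_MVT_const (fun x => Cexp (- (q + x * (p - q)))) (fun x => - (p - q) * Cexp (- (q + x * (p - q)))) (Cmod (p - q)) 0 1 ltac:(lra)) as H.
cbv beta in H. replace (q + 1 * (p - q)) with p in H by ring. replace (q + 0 * (p - q)) with q in H by ring.
rewrite Rminus_0_r, Rmult_1_r in H. apply H.
- intros x _. apply (CD_Cexp (fun x => - (q + x * (p - q)))). apply CD_opp. eapply CD_eq; [apply CD_plus; [apply CD_const|apply CD_mult; [apply CD_id|apply CD_const]]|].
  cbv beta. ring.
- intros x Hx. rewrite Cmod_mult, Cmod_opp, Cmod_Cexp, re_opp, re_plus, re_scal_l. unfold Cminus at 2. rewrite re_plus, re_opp.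
  rewrite <- (Rmult_1_r (Cmod (p - q))) at 2. apply Rmult_le_compat_l; [apply Cmod_ge_0|].
  rewrite <- exp_0. apply exp_mono. nra.
Qed.

Lemma CI_tail_right (F : R -> C) (B W b : R) : (forall y, CC F y) -> (0 < W <= b)%R -> (0 <= B)%R ->
  (forall x, W <= x <= b -> Cmod (F x) <= B / (x * x))%R -> (Cmod (CI F W b) <= B / W)%R.
Proof.
intros HF HW HB H.
pose proof (CD_MVT (fun x => CI F W x) F (fun x => - (B / x))%R (fun x => B / (x * x))%R W b ltac:(lra)) as G.
cbv beta in G. rewrite CI_point in G. replace (CI F W b - 0) with (CI F W b) in G by ring.
eapply Rle_trans; [apply G|].
- intros x _. now apply CD_CI.
- intros x Hx. auto_derive; [lra|]. field. lra.
- exact H.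
- assert (0 <= B / b)%R by (apply Rmult_le_pos; trivial; left; apply Rinv_0_lt_compat; lra). lra.
Qed.

Lemma CI_tail_left (F : R -> C) (B W a : R) : (forall y, CC F y) -> (0 < W)%R -> (a <= - W)%R -> (0 <= B)%R ->
  (forall x, a <= x <= - W -> Cmod (F x) <= B / (x * x))%R -> (Cmod (CI F a (- W)) <= B / W)%R.
Proof.
intros HF HW Ha HB H.
pose proof (CD_MVT (fun x => CI F a x) F (fun x => - (B / x))%R (fun x => B / (x * x))%R a (- W) ltac:(lra)) as G.
cbv beta in G. rewrite CI_point in G. replace (CI F a (- W) - 0) with (CI F a (- W)%R) in G by ring.
eapply Rle_trans; [apply G|].
- intros x _. now apply CD_CI.
- intros x Hx. auto_derive; [lra|]. field. lra.
- exact H.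
- assert (0 <= B / - a)%R by (apply Rmult_le_pos; trivial; left; apply Rinv_0_lt_compat; lra).
  replace (- (B / - W) - - (B / a))%R with (B / W - B / - a)%R by (field; lra). lra.
Qed.

(* The square root of [av m v0 v0] with positive real part. *)
Definition bv (m v0 : R) : C := sqrt (3 * m) * Cexp (- (Clog (vt v0) / 2)).

Lemma bv_sqr (m v0 : R) : (0 < m)%R -> bv m v0 * bv m v0 = av m v0 v0.
Proof.
intros Hm. unfold bv, av. pose proof (vt_nz v0).
replace (sqrt (3 * m) * Cexp (- (Clog (vt v0) / 2)) * (sqrt (3 * m) * Cexp (- (Clog (vt v0) / 2))))
  with ((sqrt (3 * m) * sqrt (3 * m))%R * (Cexp (- (Clog (vt v0) / 2)) * Cexp (- (Clog (vt v0) / 2)))) by (rewrite RtoC_mult; ring).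
rewrite sqrt_sqrt, <- Cexp_add by lra.
replace (- (Clog (vt v0) / 2) + - (Clog (vt v0) / 2)) with (- Clog (vt v0)) by field.
rewrite Cexp_opp, Cexp_Clog by (rewrite Re_vt; lra). rewrite RtoC_mult. field. trivial.
Qed.

(** Here [Im] over [Re] of the square is [- v0], and the argument of the root is half that of
    [vt v0] up to sign, hence below [PI / 4 < PI / 3]. *)
Lemma bv_gauss (m v0 : R) : (0 < m)%R -> (v0 * v0 <= / 3)%R ->
  (0 < Re (bv m v0 * bv m v0))%R /\ (Rabs (Im (bv m v0 * bv m v0)) <= Re (bv m v0 * bv m v0))%R /\
  (/ 2 * Cmod (bv m v0) < Re (bv m v0))%R.
Proof.
intros Hm Hv. rewrite bv_sqr by trivial.
assert (Hv2 : (0 < 1 + v0 * v0)%R) by nra.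
assert (E : av m v0 v0 = ((3 * m / (1 + v0 * v0))%R, (- (3 * m * v0 / (1 + v0 * v0)))%R)).
{ unfold av. replace ((2 * vt v0 + vt v0) / (vt v0 * vt v0)) with (3 * / vt v0) by (field; apply vt_nz).
  unfold vt. apply C_eq; simpl; field; lra. }
rewrite E. split; [simpl; apply Rdiv_lt_0_compat; lra|]. split.
- simpl. rewrite Rabs_Ropp. unfold Rdiv. rewrite !Rabs_mult, (Rabs_pos_eq 3), (Rabs_pos_eq m), (Rabs_pos_eq (/ _)) by (try lra; left; now apply Rinv_0_lt_compat).
  apply Rmult_le_compat_r; [left; now apply Rinv_0_lt_compat|].
  assert (Rabs v0 <= 1)%R by (apply Rabs_le; nra). nra.
- pose proof PI_RGT_0. pose proof (Clog_bound (vt v0) ltac:(rewrite Re_vt; lra)) as Hb.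
  assert (Hs : (0 < sqrt (3 * m))%R) by (apply sqrt_lt_R0; lra).
  set (u := - (Clog (vt v0) / 2)).
  assert (Hu : (Im u = - (Im (Clog (vt v0)) / 2))%R).
  { unfold u. rewrite im_opp. f_equal. replace (Clog (vt v0) / 2) with ((/ 2)%R * Clog (vt v0)) by (rewrite RtoC_inv by lra; unfold Cdiv; ring).
    rewrite im_scal_l. field. }
  unfold bv. fold u. rewrite Cmod_mult, Cmod_RtoC_pos, Cmod_Cexp, re_scal_l by lra.
  unfold Cexp. rewrite re_scal_l. change (Re (cos (Im u), sin (Im u))) with (cos (Im u)).
  assert (Hcos : (/ 2 < cos (Im u))%R).
  { replace (/ 2)%R with (cos (PI / 3)) by (rewrite cos_PI3; field).
    destruct (Rle_dec 0 (Im u)).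
    - apply cos_decreasing_1; lra.
    - rewrite <- (cos_neg (Im u)). apply cos_decreasing_1; lra. }
  pose proof (exp_pos (Re u)). assert (0 < sqrt (3 * m) * exp (Re u))%R by now apply Rmult_lt_0_compat. nra.
Qed.

(* Substituting [v = v0 + e w], the integrand tends to a complex Gaussian. *)
Lemma laplace (m v0 k eps : R) : (0 < m)%R -> (v0 * v0 <= / 3)%R -> (1 <= k)%R -> (0 < eps)%R ->
  exists d : R, (0 < d)%R /\ forall (e : R) (F err : R -> C), (0 < e < d)%R -> (forall v, CC F v) ->
    (forall v, Rabs v <= k -> F v = Cexp (- (((v - v0) * (v - v0) / (e * e))%R * av m v0 v)) * gv v * Cexp (err v))%C ->
    (forall v, Rabs v <= k -> Cmod (err v) <= d)%R ->
    (Cmod (bv m v0 * (CI F (- k) k / e) - gv v0 * sqrt PI) <= eps)%R.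
Proof.
intros Hm Hv0 Hk Heps.
destruct (bv_gauss m v0 Hm Hv0) as [Hb1 [Hb2 Hb3]].
assert (Hv01 : (Rabs v0 <= 2 / 3)%R) by (apply Rabs_le; nra).
assert (Hv0b := proj1 (Rabs_le_between _ _) Hv01).
set (c := (2 * m / ((1 + k * k) * (1 + k * k)))%R).
assert (Hc : (0 < c)%R) by (apply Rdiv_lt_0_compat; nra).
set (B := (3 * (1 + k) / c)%R). assert (HB : (0 < B)%R) by (apply Rdiv_lt_0_compat; lra).
set (b := bv m v0) in *. assert (Hbp : (0 < Cmod b)%R) by (pose proof (Cmod_ge_0 b); pose proof (Cmod_ge_Re b); pose proof (Rle_abs (Re b)); destruct (Req_dec (Cmod b) 0) as [Eb|]; [rewrite Eb in *; lra|lra]).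
set (G := (1 + Cmod (gv v0))%R). assert (HG : (1 <= G)%R) by (unfold G; pose proof (Cmod_ge_0 (gv v0)); lra).
destruct (gauss_limit b Hb1 Hb2 Hb3 (eps / (3 * G))) as [W0 HW0].
{ apply Rdiv_lt_0_compat; lra. }
(* The window [|w| <= W] is fixed first: it is wide enough for the Gaussian limit, and the two
   tails, dominated by [B / w^2], cost at most [eps / 3]. *)
set (W := (Rmax 1 (Rmax W0 (6 * B * Cmod b / eps)))%R).
assert (HW1 : (1 <= W)%R) by apply Rmax_l.
assert (HW2 : (W0 <= W)%R) by (eapply Rle_trans; [apply Rmax_l|apply Rmax_r]).
assert (HW3 : (6 * B * Cmod b / eps <= W)%R) by (eapply Rle_trans; [apply Rmax_r|apply Rmax_r]).
(* [d * Q] bounds the error on the window: from [err], from the variation of [gv], and from that of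
   [av]. *)
set (Q := (3 * (1 + k) + W + 4 * m * G * (W * (W * W)))%R).
assert (HWW : (1 <= W * (W * W))%R) by (assert (1 <= W * W)%R by nra; nra).
assert (HmG : (0 < 4 * m * G * (W * (W * W)))%R) by (repeat apply Rmult_lt_0_compat; lra).
assert (HQ : (0 < Q)%R) by (unfold Q; lra).
(* As [|v0| <= 2/3] and [k >= 1], the condition [e W <= 1/3] keeps the window within [|v| <= k]. *)
set (d := Rmin (Rmin 1 (/ (3 * W))) (eps / (6 * Q * W * Cmod b))%R).
assert (HQW : (0 < 6 * Q * W * Cmod b)%R) by (repeat apply Rmult_lt_0_compat; lra).
assert (Hd0 : (0 < d)%R).
{ apply Rmin_glb_lt; [apply Rmin_glb_lt; [lra|apply Rinv_0_lt_compat; lra]|now apply Rdiv_lt_0_compat]. }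
assert (Hd1 : (d <= 1)%R) by (eapply Rle_trans; [apply Rmin_l|apply Rmin_l]).
assert (Hd2 : (d <= / (3 * W))%R) by (eapply Rle_trans; [apply Rmin_l|apply Rmin_r]).
assert (Hd3 : (d <= eps / (6 * Q * W * Cmod b))%R) by apply Rmin_r.
exists d. split; trivial. intros e F err He HF HFe Herr.
set (FW := fun w => F (e * w + v0)%R).
assert (HFW : forall w, CC FW w) by (intros w; apply CC_lin, HF).
assert (Hwv : forall w, (- k <= e * w + v0 <= k)%R -> FW w = Cexp (- ((w * w)%R * av m v0 (e * w + v0))) * gv (e * w + v0) * Cexp (err (e * w + v0)%R)).
{ intros w Hw. unfold FW. rewrite HFe by (now apply Rabs_le). do 6 f_equal. field. lra. }
assert (Hexp1 : forall v, (Rabs v <= k)%R -> (Cmod (Cexp (err v) - 1) <= 3 * d)%R /\ (Cmod (Cexp (err v)) <= 3)%R).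
{ intros v Hv. specialize (Herr v Hv).
  assert (He3 : forall x, (x <= 1)%R -> (exp x <= 3)%R) by (intros x Hx; eapply Rle_trans; [apply exp_mono, Hx|apply exp_le_3]).
  split.
  - pose proof (Cexp_taylor_bound 1 (err v)) as H. simpl Cexp_taylor in H. replace (Cexp (err v) - (0 + 1 / 1)) with (Cexp (err v) - 1) in H by field.
    simpl in H. rewrite Rmult_1_r, Rdiv_1_r in H. eapply Rle_trans; [exact H|].
    specialize (He3 (Cmod (err v)) ltac:(lra)). pose proof (Cmod_ge_0 (err v)). pose proof (exp_pos (Cmod (err v))). nra.
  - rewrite Cmod_Cexp. apply He3. pose proof (Cmod_ge_Re (err v)). pose proof (Rle_abs (Re (err v))). lra. }
assert (HE1 : forall w, (- k <= e * w + v0 <= k)%R -> (Cmod (Cexp (- ((w * w)%R * av m v0 (e * w + v0)))) <= exp (- (c * (w * w))))%R).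
{ intros w Hw. rewrite Cmod_Cexp, re_opp, re_scal_l. apply exp_mono.
  pose proof (av_lower m v0 (e * w + v0) k Hm Hv0 ltac:(now apply Rabs_le)) as H. fold c in H.
  assert (0 <= w * w)%R by nra. nra. }
assert (Hgk : forall v, (Rabs v <= k)%R -> (Cmod (gv v) <= 1 + k)%R).
{ intros v Hv. eapply Rle_trans; [apply gv_bound|]. eapply Rle_trans; [apply vt_le|]. lra. }
assert (HT : forall w, (- k <= e * w + v0 <= k)%R -> w <> 0%R -> (Cmod (FW w) <= B / (w * w))%R).
{ intros w Hw Hw0. rewrite Hwv by trivial. rewrite !Cmod_mult.
  assert (Hab : (Rabs (e * w + v0) <= k)%R) by now apply Rabs_le.
  destruct (Hexp1 _ Hab) as [_ H3]. specialize (Hgk _ Hab). specialize (HE1 w Hw).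
  assert (Hww : (0 < w * w)%R) by nra.
  assert (Hx : (exp (- (c * (w * w))) <= / (c * (w * w)))%R).
  { rewrite exp_Ropp. apply Rinv_le_contravar; [now apply Rmult_lt_0_compat|]. pose proof (exp_ineq1_le (c * (w * w))). lra. }
  apply Rle_trans with (/ (c * (w * w)) * (1 + k) * 3)%R.
  - apply Rmult_le_compat; try apply Cmod_ge_0; trivial; [apply Rmult_le_pos; apply Cmod_ge_0|].
    apply Rmult_le_compat; try apply Cmod_ge_0; trivial. lra.
  - right. unfold B. field. lra. }
set (a := ((- k - v0) / e)%R). set (bb := ((k - v0) / e)%R).
assert (Hea : (e * a + v0 = - k)%R) by (unfold a; field; lra).
assert (Heb : (e * bb + v0 = k)%R) by (unfold bb; field; lra).
assert (HeW : (e * W <= / 3)%R).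
{ apply Rle_trans with (/ (3 * W) * W)%R; [apply Rmult_le_compat_r; lra|right; field; lra]. }
assert (HaW : (a <= - W)%R) by (apply Rmult_le_reg_l with e; lra).
assert (HbW : (W <= bb)%R) by (apply Rmult_le_reg_l with e; lra).
assert (Hrange : forall w, (a <= w <= bb)%R -> (- k <= e * w + v0 <= k)%R) by (intros w Hw; split; nra).
assert (Esub : CI F (- k) k / e = CI FW a bb).
{ rewrite <- Hea at 1. rewrite <- Heb at 1. rewrite CI_comp_lin by (try lra; intros w _; apply HF).
  fold FW. field. intros E; apply RtoC_inj in E; lra. }
rewrite Esub.
rewrite (CI_Chasles FW a (- W) bb) by (try lra; intros w _; apply HFW).
rewrite (CI_Chasles FW (- W) W bb) by (try lra; intros w _; apply HFW).
assert (HL : (Cmod (CI FW a (- W)) <= B / W)%R).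
{ apply CI_tail_left; trivial; try lra. intros x Hx. apply HT; [apply Hrange; lra|lra]. }
assert (HR : (Cmod (CI FW W bb) <= B / W)%R).
{ apply CI_tail_right; trivial; try lra. intros x Hx. apply HT; [apply Hrange; lra|lra]. }
assert (HM : (Cmod (CI FW (- W) W - gv v0 * CI (gauss (b * b)) (- W) W) <= d * Q * (W - - W))%R).
{ rewrite <- CI_scal by (try lra; intros w _; apply gauss_CC).
  assert (HGc : Con (fun x => gv v0 * gauss (b * b) x) (- W) W) by (intros w _; apply CC_mult; [apply CC_const|apply gauss_CC]).
  rewrite <- CI_minus by (try lra; trivial; intros w _; apply HFW).
  apply CI_bound_const; [lra|apply Con_minus; trivial; intros w _; apply HFW|].
  intros w Hw. assert (Hr : (- k <= e * w + v0 <= k)%R) by (apply Hrange; lra).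
  assert (Hab : (Rabs (e * w + v0) <= k)%R) by now apply Rabs_le.
  rewrite Hwv by trivial. destruct (Hexp1 _ Hab) as [H2 _]. set (v := (e * w + v0)%R) in *.
  assert (Hwabs : (Rabs w <= W)%R) by (apply Rabs_le; lra).
  assert (Hvv : (Rabs (v - v0) <= d * W)%R).
  { unfold v. replace (e * w + v0 - v0)%R with (e * w)%R by ring. rewrite Rabs_mult, (Rabs_pos_eq e) by lra.
    apply Rmult_le_compat; try lra. apply Rabs_pos. }
  set (E := Cexp (- ((w * w)%R * av m v0 v))). set (E0 := gauss (b * b) w).
  assert (Hww : (0 <= w * w <= W * W)%R).
  { rewrite <- (Rabs_pos_eq (w * w)) by nra. rewrite Rabs_mult. pose proof (Rabs_pos w). nra. }
  assert (HE : (Cmod E <= 1)%R).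
  { eapply Rle_trans; [apply HE1; trivial|]. rewrite <- exp_0. apply exp_mono. nra. }
  assert (HEE : (Cmod (E - E0) <= W * W * (4 * m * (d * W)))%R).
  { unfold E, E0, gauss, b. rewrite bv_sqr by trivial. 
    replace (- av m v0 v0 * (w * w)) with (- ((w * w)%R * av m v0 v0)) by (rewrite RtoC_mult; ring).
    eapply Rle_trans; [apply Cexp_lip2|].
    - rewrite re_scal_l. pose proof (av_lower m v0 v k Hm Hv0 Hab). fold c in H. nra.
    - rewrite re_scal_l. pose proof (av_lower m v0 v0 k Hm Hv0 ltac:(lra)). fold c in H. nra.
    - replace (_ - _) with ((w * w)%R * (av m v0 v - av m v0 v0)) by ring. rewrite Cmod_mult, Cmod_RtoC_pos by lra.
      apply Rmult_le_compat; try lra; [apply Cmod_ge_0|]. eapply Rle_trans; [now apply av_lip|].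
      apply Rmult_le_compat_l; lra. }
  replace (E * gv v * Cexp (err v) - gv v0 * E0) with (E * gv v * (Cexp (err v) - 1) + E * (gv v - gv v0) + gv v0 * (E - E0)) by ring.
  eapply Rle_trans; [apply Cmod_plus_le; [apply Cmod_plus_le|]|].
  - apply Cmod_mult_le; [apply Cmod_mult_le; [exact HE|apply Hgk, Hab]|exact H2].
  - apply Cmod_mult_le; [exact HE|eapply Rle_trans; [apply gv_lip|exact Hvv]].
  - apply Cmod_mult_le; [apply Rle_refl|exact HEE].
  - assert (Hg0 : (0 <= Cmod (gv v0) <= G)%R) by (unfold G; pose proof (Cmod_ge_0 (gv v0)); lra).
    unfold Q. assert (0 <= 4 * m * d * (W * (W * W)))%R by (repeat apply Rmult_le_pos; lra).
    replace (Cmod (gv v0) * (W * W * (4 * m * (d * W))))%R with (Cmod (gv v0) * (4 * m * d * (W * (W * W))))%R by ring.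
    replace (d * (3 * (1 + k) + W + 4 * m * G * (W * (W * W))))%R with (1 * (1 + k) * (3 * d) + 1 * (d * W) + G * (4 * m * d * (W * (W * W))))%R by ring.
    apply Rplus_le_compat_l. apply Rmult_le_compat_r; lra. }
replace (b * (CI FW a (- W) + (CI FW (- W) W + CI FW W bb)) - gv v0 * sqrt PI)
  with (b * (CI FW a (- W)%R + CI FW W bb) + b * (CI FW (- W)%R W - gv v0 * CI (gauss (b * b)) (- W)%R W) + gv v0 * (b * CI (gauss (b * b)) (- W)%R W - sqrt PI)) by ring.
specialize (HW0 W HW2).
eapply Rle_trans; [apply Cmod_plus_le; [apply Cmod_plus_le; apply Cmod_mult_le; [apply Rle_refl|apply Cmod_plus_le; [exact HL|exact HR]|apply Rle_refl|exact HM]|apply Cmod_mult_le; [apply Rle_refl|exact HW0]]|].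
assert (T1 : (Cmod b * (B / W + B / W) <= eps / 3)%R).
{ apply Rmult_le_reg_r with W; [lra|]. replace (Cmod b * (B / W + B / W) * W)%R with (2 * B * Cmod b)%R by (field; lra).
  assert (6 * B * Cmod b / eps * eps = 6 * B * Cmod b)%R by (field; lra). nra. }
assert (T2 : (Cmod b * (d * Q * (W - - W)) <= eps / 3)%R).
{ replace (Cmod b * (d * Q * (W - - W)))%R with (d * (6 * Q * W * Cmod b) / 3)%R by field.
  apply Rmult_le_compat_r; [lra|]. apply Rle_trans with (eps / (6 * Q * W * Cmod b) * (6 * Q * W * Cmod b))%R.
  - apply Rmult_le_compat_r; lra.
  - right. field. repeat split; lra. }
assert (T3 : (Cmod (gv v0) * (eps / (3 * G)) <= eps / 3)%R).
{ apply Rle_trans with (G * (eps / (3 * G)))%R; [|right; field; lra].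
  apply Rmult_le_compat_r; [left; apply Rdiv_lt_0_compat; lra|unfold G; lra]. }
lra.
Qed.

(** Let [T = x (1 + i v0)] be the principal cube root of [c] and [m = x^3]. Positivity of
    [Re (T^3) = x^3 - 3 x y^2] is the bound [v0^2 <= 1/3]. The identity for [Clog] converts the
    principal fractional powers of [c] into powers of [m] and [vt v0]. *)
Lemma saddle_point (c : C) : (0 < Re c)%R -> exists m v0 : R, (0 < m)%R /\ (v0 * v0 <= / 3)%R /\
  c = m * (vt v0 * vt v0 * vt v0) /\ Clog c = ln m + 3 * Clog (vt v0).
Proof.
intros Hc. pose proof PI_RGT_0. pose proof (Clog_bound c Hc) as Hb.
assert (E3 : Clog c / 3 = (/ 3)%R * Clog c) by (rewrite RtoC_inv by lra; unfold Cdiv; ring).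
set (T := Cexp (Clog c / 3)).
assert (HT3 : T * T * T = c).
{ unfold T. rewrite <- !Cexp_add. replace (Clog c / 3 + Clog c / 3 + Clog c / 3) with (Clog c) by field. now apply Cexp_Clog. }
assert (HT : (0 < Re T)%R).
{ unfold T, Cexp. rewrite re_scal_l. apply Rmult_lt_0_compat; [apply exp_pos|].
  change (0 < cos (Im (Clog c / 3)))%R. rewrite E3, im_scal_l. apply cos_gt_0; lra. }
set (x := Re T) in *. set (y := Im T).
assert (HTn : RtoC x <> 0) by (intros F; apply RtoC_inj in F; lra).
assert (Hvt : vt (y / x) = / x * T).
{ rewrite <- RtoC_inv by lra. apply C_eq.
  - rewrite Re_vt, re_scal_l. fold x. field. lra.
  - rewrite Im_vt, im_scal_l. fold y. field. lra. }
assert (HxT : T = x * vt (y / x)) by (rewrite Hvt; field; trivial).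
exists (x * x * x)%R, (y / x)%R. split; [repeat apply Rmult_lt_0_compat; trivial|]. split; [|split].
- assert (Hre : (0 < x * x * x - 3 * (x * (y * y)))%R).
  { replace (x * x * x - 3 * (x * (y * y)))%R with (Re (T * T * T)); [now rewrite HT3|].
    rewrite !re_mult, im_mult. fold x y. ring. }
  apply Rmult_le_reg_r with (x * x)%R; [nra|]. replace (y / x * (y / x) * (x * x))%R with (y * y)%R by (field; lra).
  assert (x * (3 * (y * y)) < x * (x * x))%R by lra. apply Rmult_lt_reg_l in H0; lra.
- rewrite <- HT3, HxT. rewrite !RtoC_mult. ring.
- assert (HlT : Clog T = Clog c / 3).
  { unfold T. apply Clog_Cexp. rewrite E3, im_scal_l. lra. }
  assert (HlT2 : Clog T = ln x + Clog (vt (y / x))).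
  { rewrite HxT at 1. rewrite Clog_mult, Clog_R; trivial; rewrite ?Re_vt; try lra. rewrite <- HxT. trivial. }
  replace (ln (x * x * x)) with (ln x + ln x + ln x)%R by (rewrite !ln_mult by (try apply Rmult_lt_0_compat; trivial); reflexivity).
  rewrite !RtoC_plus. replace (Clog c) with (3 * (Clog c / 3)) by field. rewrite <- HlT, HlT2. ring.
Qed.

(** * The circle method *)

(** With [X = vt v0] and [Y = vt v] this is [X^3 + 2 Y^3 - 3 X Y^2 = (Y - X)^2 (2 Y + X)] divided by
    [Y^2], where [(Y - X)^2 = - (v - v0)^2]. *)
Lemma saddle_identity (m v0 v : R) :
  m * (vt v0 * vt v0 * vt v0) / (vt v * vt v) + 2 * m * vt v = 3 * m * vt v0 - ((v - v0) * (v - v0))%R * av m v0 v.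
Proof.
pose proof (vt_nz v).
replace (RtoC ((v - v0) * (v - v0))) with (- ((vt v - vt v0) * (vt v - vt v0))) by (unfold vt; apply C_eq; simpl; ring).
unfold av. field. trivial.
Qed.

(** Real parts in [saddle_identity] give [Re (c / (vt v)^2) = m - (v - v0)^2 Re (av m v0 v) <= m],
    so the lower bound at one [v] passes to [m]. *)
Lemma minor_below_saddle (z0 : C) (m v0 : R) : Cmod z0 = 1%R -> z0 <> 1 -> (0 < m)%R -> (v0 * v0 <= / 3)%R ->
  CC3 z0 = m * (vt v0 * vt v0 * vt v0) -> (minor_bound (Cmod (1 - z0)) < m)%R.
Proof.
intros Hz Hne Hm Hv0 HC. destruct (CC3_lower z0 Hz Hne) as [v Hv]. eapply Rlt_le_trans; [exact Hv|].
rewrite HC. change (1 + v * Ci) with (vt v).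
pose proof (saddle_identity m v0 v) as E.
assert (E2 : m * (vt v0 * vt v0 * vt v0) / (vt v * vt v) = 3 * m * vt v0 - ((v - v0) * (v - v0))%R * av m v0 v - 2 * m * vt v)
  by (rewrite <- E; ring).
rewrite E2. unfold Cminus. rewrite !re_plus, !re_opp, !re_scal_l. rewrite <- !RtoC_mult, !re_scal_l, !Re_vt.
pose proof (av_lower m v0 v (Rabs v) Hm Hv0 (Rle_refl _)) as Ha.
assert (0 < 2 * m / ((1 + Rabs v * Rabs v) * (1 + Rabs v * Rabs v)))%R by (apply Rdiv_lt_0_compat; [lra|]; pose proof (Rabs_pos v); nra).
assert (0 <= (v - v0) * (v - v0))%R by apply Rle_0_sqr.
assert (0 <= (v - v0) * (v - v0) * Re (av m v0 v))%R by (apply Rmult_le_pos; lra). lra.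
Qed.

(* [Jz (-1) - 1/6 = zeta'(-1)]. *)
Definition kappa (z0 : C) : C := Jz (-1) - 1 / 6 - Clog (1 - z0) / 12.

Definition main_factor (z0 : C) (m v0 e : R) : C :=
  Cexp (3 * m * vt v0 / (e * e) + ln e / 12 + kappa z0).

Lemma Lam_difference (z0 : C) (k : R) : Cmod z0 = 1%R -> z0 <> 1 -> (0 <= k)%R ->
  exists K d : R, (0 < d)%R /\ (0 <= K)%R /\ forall t, cone k t -> (Cmod t <= d)%R ->
    (Cmod (Lam 1 t - Lam z0 t - (CC3 z0 / (t * t) + Clog t / 12 + kappa z0)) <= K * sqrt (Cmod t))%R.
Proof.
intros Hz Hne Hk.
destruct (Lam_expansion 1 1 0 k origin_data_1 Hk) as [K1 [d1 [Hd1 [HK1 H1]]]].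
destruct (Lam_expansion z0 0 (- Clog (1 - z0)) k (origin_data_neq z0 Hz Hne) Hk) as [K2 [d2 [Hd2 [HK2 H2]]]].
exists (K1 + K2)%R, (Rmin d1 d2). split; [now apply Rmin_glb_lt|]. split; [lra|]. intros t Ht Htd.
pose proof (Rmin_l d1 d2). pose proof (Rmin_r d1 d2).
specialize (H1 t Ht ltac:(lra)). specialize (H2 t Ht ltac:(lra)).
assert (Hnz := Re_pos_nz t (proj1 Ht)).
match type of H1 with (Cmod ?a <= _)%R => match type of H2 with (Cmod ?b <= _)%R =>
  replace (Lam 1 t - Lam z0 t - (CC3 z0 / (t * t) + Clog t / 12 + kappa z0)) with (a - b)
    by (unfold CC3, kappa; field; trivial) end end.
rewrite Rmult_plus_distr_r. now apply Cmod_minus_le.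
Qed.

(** The relation [n e^3 = 2 m] puts both parts of the exponent on the scale [e^(-2)]: the saddle has
    height [3 m / e^2], while the outer arcs reach at most [(3 m - gap/2) / e^2 + e]. *)
Lemma main_estimate (z0 : C) (m v0 eps : R) : Cmod z0 = 1%R -> z0 <> 1 -> (0 < m)%R -> (v0 * v0 <= / 3)%R ->
  CC3 z0 = m * (vt v0 * vt v0 * vt v0) -> (0 < eps)%R ->
  exists d : R, (0 < d)%R /\ forall (e : R) (n : nat), (0 < e < d)%R -> (INR n * (e * e * e) = 2 * m)%R ->
  (Cmod (bv m v0 * (2 * PI * A n z0 / (e * e * main_factor z0 m v0 e)) - gv v0 * sqrt PI) <= eps)%R.
Proof.
intros Hz Hne Hm Hv0 HC Heps. pose proof PI_RGT_0 as HPI. pose proof PI2_3_2 as HPI3.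
pose proof (minor_below_saddle z0 m v0 Hz Hne Hm Hv0 HC) as Hgap.
set (gap := (m - minor_bound (Cmod (1 - z0)))%R). assert (Hg : (0 < gap)%R) by (unfold gap; lra).
(* The minor arcs dictate the aperture of the cone; [k >= 1] ensures that it contains the saddle. *)
destruct (minor_arc z0 (gap / 2) Hz ltac:(lra)) as [k1 [Hk1 Hminor]].
set (k := Rmax k1 1). assert (Hk : (1 <= k)%R) by apply Rmax_r. assert (Hkk : (k1 <= k)%R) by apply Rmax_l.
destruct (laplace m v0 k (eps / 2) Hm Hv0 Hk ltac:(lra)) as [dl [Hdl Hlap]].
destruct (Lam_difference z0 k Hz Hne ltac:(lra)) as [K [dL [HdL [HK HLam]]]].
set (M := (Cmod (bv m v0) * (2 * PI * (8 * exp (1 - Re (kappa z0)) / (gap * gap))))%R).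
assert (HM : (0 <= M)%R).
{ apply Rmult_le_pos; [apply Cmod_ge_0|]. apply Rmult_le_pos; [lra|]. apply Rmult_le_pos; [|left; apply Rinv_0_lt_compat; nra].
  pose proof (exp_pos (1 - Re (kappa z0))). lra. }
set (q := (dl / (2 * (K + 1)))%R). assert (Hq : (0 < q)%R) by (apply Rdiv_lt_0_compat; lra).
(* In order: the middle arc [|y| <= k e] fits inside [[-PI, PI]]; the truncation error is below
   [dl / 2]; [t] is within the range of the expansion; the term [K sqrt |t|] is below [dl / 2]; the
   outer arcs cost at most [eps / 2]. *)
set (d := Rmin (Rmin (/ k) (dl / 2)) (Rmin (Rmin (dL / (1 + k)) (q * q / (1 + k))) (eps / (2 * (M + 1))))%R).
assert (Hd : (0 < d)%R).
{ repeat apply Rmin_glb_lt; try (apply Rinv_0_lt_compat; lra); apply Rdiv_lt_0_compat; try lra; nra. }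
exists d. split; trivial. intros e n He Hn.
assert (Hd1 : (e < / k)%R) by (eapply Rlt_le_trans; [apply He|]; eapply Rle_trans; [apply Rmin_l|apply Rmin_l]).
assert (Hd2 : (e < dl / 2)%R) by (eapply Rlt_le_trans; [apply He|]; eapply Rle_trans; [apply Rmin_l|apply Rmin_r]).
assert (Hd3 : (e < dL / (1 + k))%R) by (eapply Rlt_le_trans; [apply He|]; eapply Rle_trans; [apply Rmin_r|]; eapply Rle_trans; [apply Rmin_l|apply Rmin_l]).
assert (Hd4 : (e < q * q / (1 + k))%R) by (eapply Rlt_le_trans; [apply He|]; eapply Rle_trans; [apply Rmin_r|]; eapply Rle_trans; [apply Rmin_l|apply Rmin_r]).
assert (Hd5 : (e < eps / (2 * (M + 1)))%R) by (eapply Rlt_le_trans; [apply He|]; eapply Rle_trans; [apply Rmin_r|apply Rmin_r]).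
assert (He0 : (0 < e)%R) by lra. assert (Hee : (0 < e * e)%R) by nra.
assert (Hke : (k * e <= 1)%R).
{ apply Rmult_le_reg_l with (/ k)%R; [apply Rinv_0_lt_compat; lra|]. rewrite <- Rmult_assoc, Rinv_l by lra. lra. }
assert (He1 : (e <= 1)%R) by nra.
assert (Hz1 : (Cmod z0 <= 1)%R) by lra.
(* The tolerance is [e] itself, so the truncation error vanishes with the radius; [N >= n] keeps the
   coefficient exact. *)
destruct (Lam_part_uniform e e He0 He0) as [N0 HN0]. set (N := Nat.max n N0).
specialize (fun t => HN0 N z0 t ltac:(unfold N; lia) Hz1).
set (Fy := fun y : R => Cexp (Lam_part z0 N (e + y * Ci) + INR n * (e + y * Ci))).
assert (HFy : forall y, CC Fy y).
{ intros y. apply CC_Cexp, CC_plus; [now apply Lam_part_CC|]. apply CC_mult; [apply CC_const|].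
  apply CC_plus; [apply CC_const|]. apply CC_mult; [eapply CD_CC, CD_id|apply CC_const]. }
rewrite (A_integral z0 n N e Hz1 He0) by (unfold N; lia). fold Fy.
assert (Hne2 : (INR n * e = 2 * m / (e * e))%R).
{ apply Rmult_eq_reg_r with (e * e)%R; [|lra]. replace (INR n * e * (e * e))%R with (INR n * (e * e * e))%R by ring. rewrite Hn. field. lra. }
set (D0 := main_factor z0 m v0 e). assert (HD0 : D0 <> 0) by apply Cexp_nz.
assert (Hen : RtoC e <> 0) by (intros F; apply RtoC_inj in F; lra).
set (F := fun v => / D0 * Fy (e * v)%R).
assert (HF : forall v, CC F v).
{ intros v. apply CC_mult; [apply CC_const|]. apply (CC_ext (fun v => Fy (e * v + 0)%R)); [intros; f_equal; ring|]. apply CC_lin, HFy. }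
assert (Hke0 : (0 < k * e)%R) by nra.
rewrite (CI_Chasles Fy (- PI) (- (k * e)) PI) by (try lra; intros y _; apply HFy).
rewrite (CI_Chasles Fy (- (k * e)) (k * e) PI) by (try lra; intros y _; apply HFy).
assert (Emid : CI Fy (- (k * e)) (k * e) = e * D0 * CI F (- k) k).
{ pose proof (CI_comp_lin Fy e 0 (- k) k He0 ltac:(lra)) as H.
  replace (e * - k + 0)%R with (- (k * e))%R in H by ring. replace (e * k + 0)%R with (k * e)%R in H by ring.
  rewrite H by (intros y _; apply HFy). rewrite <- Cmult_assoc, <- (CI_scal D0 F) by (try lra; intros v _; apply HF).
  f_equal. apply CI_ext; [lra|]. intros v _. unfold F. rewrite Rplus_0_r. field. trivial. }
rewrite Emid.
assert (HB : forall y, (k * e <= Rabs y <= PI)%R -> (Cmod (Fy y) <= exp ((3 * m - gap / 2) / (e * e) + e))%R).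
{ intros y Hy. unfold Fy. rewrite Cmod_Cexp. apply exp_mono.
  assert (Hret : Re (e + y * Ci) = e) by (rewrite re_plus, re_scal_l, re_RtoC; simpl; ring).
  rewrite re_plus, re_scal_l, Hret, Hne2.
  specialize (Hminor e y He0 ltac:(split; [nra|lra])). specialize (HN0 (e + y * Ci) Hret).
  set (L := Lam_part z0 N (e + y * Ci)) in *. set (L' := Lam 1 (e + y * Ci) - Lam z0 (e + y * Ci)) in *.
  pose proof (Cmod_ge_Re L) as G. pose proof (Rle_abs (Re L)).
  pose proof (Cmod_triangle (L - L') L') as Tr. replace (L - L' + L') with L in Tr by ring.
  replace ((3 * m - gap / 2) / (e * e) + e)%R with ((minor_bound (Cmod (1 - z0)) + gap / 2) / e ^ 2 + e + 2 * m / (e * e))%R by (unfold gap; field; lra). lra. }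
assert (HO1 : (Cmod (CI Fy (- PI) (- (k * e))) <= exp ((3 * m - gap / 2) / (e * e) + e) * PI)%R).
{ eapply Rle_trans; [apply CI_bound_const with (B := exp ((3 * m - gap / 2) / (e * e) + e)); [lra|intros y _; apply HFy|]|].
  - intros y Hy. apply HB. rewrite Rabs_left1; nra.
  - apply Rmult_le_compat_l; [left; apply exp_pos|]. nra. }
assert (HO2 : (Cmod (CI Fy (k * e) PI) <= exp ((3 * m - gap / 2) / (e * e) + e) * PI)%R).
{ eapply Rle_trans; [apply CI_bound_const with (B := exp ((3 * m - gap / 2) / (e * e) + e)); [lra|intros y _; apply HFy|]|].
  - intros y Hy. apply HB. rewrite Rabs_pos_eq; nra.
  - apply Rmult_le_compat_l; [left; apply exp_pos|]. nra. }
assert (HD : Cmod D0 = exp (3 * m / (e * e) + ln e / 12 + Re (kappa z0))).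
{ unfold D0, main_factor. rewrite Cmod_Cexp. f_equal. rewrite !re_plus. f_equal. f_equal.
  - replace (3 * m * vt v0 / (e * e)) with ((3 * m / (e * e))%R * vt v0).
    + rewrite re_scal_l, Re_vt. ring.
    + rewrite RtoC_div, !RtoC_mult by lra. field. trivial.
  - rewrite <- RtoC_div by lra. apply re_RtoC. }
(* The exponential gain is spent as a power: [e^(-x) <= 2 / x^2] supplies [e^4], which pays for
   [e^(-2)] and for [e^(-1/12) <= e^(-1)], and one factor [e] is left over. *)
assert (Hout : (exp ((3 * m - gap / 2) / (e * e) + e) / (e * e * Cmod D0) <= 8 * exp (1 - Re (kappa z0)) / (gap * gap) * e)%R).
{ rewrite HD. set (x := (gap / 2 / (e * e))%R). assert (Hx : (0 < x)%R) by (apply Rdiv_lt_0_compat; lra).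
  pose proof (exp_pow_ge x 2 ltac:(lra)) as Hx2. change (INR (fact 2)) with (1 + 1)%R in Hx2.
  assert (Hl : (- ln e / 12 <= - ln e)%R).
  { assert (ln e <= 0)%R by (rewrite <- ln_1; apply ln_le; lra). lra. }
  unfold Rdiv at 1. rewrite Rinv_mult. rewrite <- exp_Ropp.
  replace (exp ((3 * m - gap / 2) / (e * e) + e) * (/ (e * e) * exp (- (3 * m / (e * e) + ln e / 12 + Re (kappa z0)))))%R
    with (/ (e * e) * exp (- x + (e - Re (kappa z0)) + (- ln e / 12)))%R.
  2:{ rewrite (Rmult_comm (exp _)), Rmult_assoc, <- exp_plus. do 2 f_equal. unfold x. field. lra. }
  apply Rle_trans with (/ (e * e) * (exp (- x) * exp (1 - Re (kappa z0)) * exp (- ln e)))%R.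
  { apply Rmult_le_compat_l; [left; now apply Rinv_0_lt_compat|]. rewrite <- !exp_plus. apply exp_mono. lra. }
  rewrite (exp_Ropp (ln e)), exp_ln, (exp_Ropp x) by trivial.
  assert (Hix : (/ exp x <= 8 * (e * e * (e * e)) / (gap * gap))%R).
  { replace (8 * (e * e * (e * e)) / (gap * gap))%R with (/ (x ^ 2 / (1 + 1)))%R by (unfold x; field; lra).
    apply Rinv_le_contravar; trivial. apply Rdiv_lt_0_compat; [apply pow_lt; trivial|lra]. }
  replace (8 * exp (1 - Re (kappa z0)) / (gap * gap) * e)%R with (/ (e * e) * (8 * (e * e * (e * e)) / (gap * gap) * exp (1 - Re (kappa z0)) * / e))%R by (field; lra).
  apply Rmult_le_compat_l; [left; now apply Rinv_0_lt_compat|].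
  apply Rmult_le_compat_r; [left; now apply Rinv_0_lt_compat|].
  apply Rmult_le_compat_r; [left; apply exp_pos|exact Hix]. }
set (err := fun v => Lam_part z0 N (e * vt v) - (CC3 z0 / (e * vt v * (e * vt v)) + Clog (e * vt v) / 12 + kappa z0)).
assert (Hl : (Cmod (bv m v0 * (CI F (- k) k / e) - gv v0 * sqrt PI) <= eps / 2)%R).
{ apply (Hlap e F err); trivial; [split; lra| |].
  - intros v Hv. unfold F, Fy, D0, main_factor, gv.
    replace (e + (e * v)%R * Ci) with (e * vt v) by (unfold vt; rewrite RtoC_mult; ring).
    rewrite <- Cexp_opp, <- !Cexp_add. f_equal.
    replace (Lam_part z0 N (e * vt v)) with (err v + (CC3 z0 / (e * vt v * (e * vt v)) + Clog (e * vt v) / 12 + kappa z0)) by (unfold err; ring).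
    rewrite Clog_mult, Clog_R by (trivial; rewrite ?re_scal_l, ?Re_vt; simpl; lra).
    replace (INR n * (e * vt v)) with (2 * m / (e * e) * vt v).
    2:{ rewrite Cmult_assoc, <- (RtoC_mult (INR n) e), Hne2, RtoC_div, !RtoC_mult by lra. reflexivity. }
    rewrite HC. pose proof (saddle_identity m v0 v) as E. pose proof (vt_nz v).
    rewrite RtoC_div by lra. rewrite (RtoC_mult e e).
    assert (E2 : m * (vt v0 * vt v0 * vt v0) / (e * vt v * (e * vt v)) + 2 * m / (e * e) * vt v = (3 * m * vt v0 - ((v - v0) * (v - v0))%R * av m v0 v) / (e * e)).
    { rewrite <- E. field. split; trivial. }
    transitivity (- (3 * m * vt v0 / (e * e) + ln e / 12) + err v + (m * (vt v0 * vt v0 * vt v0) / (e * vt v * (e * vt v)) + 2 * m / (e * e) * vt v) + (ln e + Clog (vt v)) / 12); [unfold Cdiv; ring|].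
    rewrite E2. field. trivial.
  - intros v Hv. unfold err. set (t := e * vt v).
    assert (Hret : Re t = e) by (unfold t; rewrite re_scal_l, Re_vt; ring).
    assert (Himt : Im t = (e * v)%R) by (unfold t; rewrite im_scal_l, Im_vt; ring).
    assert (Htm : (Cmod t <= e * (1 + k))%R).
    { unfold t. rewrite Cmod_mult, Cmod_RtoC_pos by lra. apply Rmult_le_compat_l; [lra|]. eapply Rle_trans; [apply vt_le|lra]. }
    assert (Hek : (e * (1 + k) <= dL)%R).
    { apply Rle_trans with (dL / (1 + k) * (1 + k))%R; [apply Rmult_le_compat_r; lra|right; field; lra]. }
    assert (Heq : (e * (1 + k) <= q * q)%R).
    { apply Rle_trans with (q * q / (1 + k) * (1 + k))%R; [apply Rmult_le_compat_r; lra|right; field; lra]. }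
    assert (Hcone : cone k t).
    { split; rewrite Hret; [lra|]. rewrite Himt, Rabs_mult, (Rabs_pos_eq e) by lra. nra. }
    specialize (HLam t Hcone ltac:(lra)). specialize (HN0 t Hret).
    assert (Hsq : (sqrt (Cmod t) <= q)%R).
    { rewrite <- (sqrt_square q) by lra. apply sqrt_le_1; [apply Cmod_ge_0|nra|lra]. }
    set (L' := Lam 1 t - Lam z0 t) in *.
    match goal with |- (Cmod (?a - ?b) <= _)%R => replace (a - b) with ((a - L') + (L' - b)) by ring end.
    eapply Rle_trans; [apply Cmod_plus_le; [exact HN0|exact HLam]|].
    assert (K * sqrt (Cmod t) <= K * q)%R by (apply Rmult_le_compat_l; lra).
    assert (K * q <= dl / 2)%R.
    { apply Rle_trans with ((K + 1) * q)%R; [nra|]. right. unfold q. field. lra. }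
    lra. }
set (O1 := CI Fy (- PI) (- (k * e))) in *. set (O2 := CI Fy (k * e) PI) in *. set (X := CI F (- k) k) in *.
replace (bv m v0 * ((O1 + (e * D0 * X + O2)) / (e * e * D0)) - gv v0 * sqrt PI)
  with ((bv m v0 * (X / e) - gv v0 * sqrt PI) + bv m v0 * ((O1 + O2) * / ((e * e)%R * D0))).
2:{ rewrite RtoC_mult. field. split; trivial. }
assert (HDp : (0 < Cmod D0)%R) by now apply Cmod_gt_0.
assert (Hrest : (Cmod (bv m v0 * ((O1 + O2) * / ((e * e)%R * D0))) <= eps / 2)%R).
{ rewrite !Cmod_mult, Cmod_inv, Cmod_mult, (Cmod_RtoC_pos (e * e)) by (try lra; apply Cmult_neq_0; trivial; intros G; apply RtoC_inj in G; lra).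
  pose proof (Cmod_plus_le O1 O2 _ _ HO1 HO2) as HO.
  set (x := exp ((3 * m - gap / 2) / (e * e) + e)) in *.
  apply Rle_trans with (Cmod (bv m v0) * ((x * PI + x * PI) * / (e * e * Cmod D0)))%R.
  - apply Rmult_le_compat_l; [apply Cmod_ge_0|]. apply Rmult_le_compat_r; trivial. left. apply Rinv_0_lt_compat. nra.
  - apply Rle_trans with (M * e)%R.
    + unfold M. rewrite (Rmult_assoc (Cmod (bv m v0))), (Rmult_assoc (2 * PI)). apply Rmult_le_compat_l; [apply Cmod_ge_0|].
      replace ((x * PI + x * PI) * / (e * e * Cmod D0))%R with (2 * PI * (x / (e * e * Cmod D0)))%R by (unfold Rdiv; ring).
      apply Rmult_le_compat_l; [lra|exact Hout].
    + apply Rle_trans with ((M + 1) * e)%R; [nra|].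
      apply Rle_trans with ((M + 1) * (eps / (2 * (M + 1))))%R; [apply Rmult_le_compat_l; lra|right; field; lra]. }
eapply Rle_trans; [apply Cmod_plus_le; [exact Hl|exact Hrest]|]. lra.
Qed.

(** * Roots of unity and the final constants *)

Lemma zeta_root_unit (a b : Z) : (1 <= a <= b)%Z -> (IZR a / IZR b <> 1)%R ->
  Cmod (zeta_root a b) = 1%R /\ zeta_root a b <> 1.
Proof.
intros Hab Hne.
assert (Hb : (0 < IZR b)%R) by (apply IZR_lt; lia). assert (Ha : (0 < IZR a)%R) by (apply IZR_lt; lia).
assert (Hlt : (IZR a < IZR b)%R).
{ apply IZR_lt. destruct (Z.eq_dec a b) as [->|]; [|lia]. exfalso. apply Hne. field. lra. }
assert (E : zeta_root a b = Cexp ((2 * PI * (IZR a / IZR b))%R * Ci)).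
{ unfold zeta_root. f_equal. rewrite !RtoC_mult, RtoC_div by lra. unfold Cdiv. ring. }
rewrite E. split.
- rewrite Cmod_Cexp, re_scal_l. simpl. rewrite Rmult_0_r. apply exp_0.
- intros F. rewrite <- Cexp_0 in F. pose proof PI_RGT_0.
  assert (Hq : (0 < IZR a / IZR b < 1)%R).
  { split; [now apply Rdiv_lt_0_compat|]. apply Rmult_lt_reg_r with (IZR b); trivial. unfold Rdiv. rewrite Rmult_assoc, Rinv_l; lra. }
  apply Cexp_inj in F.
  + apply (f_equal Im) in F. rewrite im_scal_l, im_RtoC in F. simpl in F. nra.
  + rewrite im_scal_l, im_RtoC. simpl. rewrite Rabs_pos_eq; nra.
Qed.

Lemma asymp_equiv_Clim (f g : nat -> C) : Clim (fun n => f n / g n) 1 -> asymp_equiv f g.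
Proof.
intros H P [eps HP]. apply is_lim_seq_spec in H. specialize (H eps). unfold filtermap.
eapply filter_imp; [|exact H]. intros n Hn. apply HP.
apply C_NormedModule_mixin_compat1. cbv beta in Hn. rewrite Rminus_0_r, Rabs_pos_eq in Hn by apply Cmod_ge_0. exact Hn.
Qed.

Lemma l3_Li3 (z : C) : l3 z = Li3 z.
Proof. apply CSeries_ext. intros j. unfold co. change (Cpow (INR (S j)) 0) with (RtoC 1). unfold Cdiv. ring. Qed.

Lemma l3_1 : l3 1 = CSeries (fun n => / Cpow (INR (S n)) 3).
Proof. rewrite l3_Li3. apply CSeries_ext. intros j. rewrite Cpow_1_l. unfold Cdiv. ring. Qed.

Lemma sqrt_exp (x : R) : (0 < x)%R -> sqrt x = exp (ln x / 2).
Proof. intros H. rewrite <- Rpower_sqrt by trivial. unfold Rpower. f_equal. field. Qed.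

Lemma exp_div (x y : R) : (exp x / exp y = exp (x - y))%R.
Proof. unfold Rdiv, Rminus. now rewrite exp_plus, exp_Ropp. Qed.

(** [(2 m / n)^(1/3)], the real part of the saddle [(2 c / n)^(1/3)], because
    [c^(1/3) = m^(1/3) vt v0]. *)
Definition radius (m : R) (n : nat) : R := exp ((ln 2 + ln m - ln (INR n)) / 3).

Lemma radius_cube (m : R) (n : nat) : (0 < m)%R -> (1 <= n)%nat ->
  (INR n * (radius m n * radius m n * radius m n) = 2 * m)%R.
Proof.
intros Hm Hn. assert (Hp : (0 < INR n)%R) by (apply lt_0_INR; lia).
unfold radius. rewrite <- !exp_plus. rewrite <- (exp_ln (INR n)) at 1 by trivial.
rewrite <- exp_plus.
replace (ln (INR n) + _)%R with (ln (2 * m)) by (rewrite ln_mult by lra; field).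
apply exp_ln. lra.
Qed.

Lemma radius_lim (m : R) : is_lim_seq (radius m) 0%R.
Proof.
apply is_lim_seq_incr_1.
apply (is_lim_seq_ext (fun n => exp ((ln 2 + ln m) / 3) * exp (- / 3 * ln (INR (S n))))%R).
- intros n. unfold radius. rewrite <- exp_plus. f_equal. field.
- replace (Finite 0) with (Rbar_mult (exp ((ln 2 + ln m) / 3)) 0) by (simpl; f_equal; ring).
  apply is_lim_seq_scal_l. apply exp_ln_lim. lra.
Qed.

(** Matching of exponents. The power [c^(7/36)] carries [vt v0] to the [7/12 = 1/12 + 1/2], from
    [gv] and from [1 / bv]. The real factor [e^(25/12) / (2 sqrt (3 m))] gives [n^(-25/36)],
    [m^(25/36 - 1/2) = m^(7/36)] and [2^(25/36 - 1) = 2^(-11/36)]. *)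
Lemma leading_term (z0 c : C) (m v0 : R) (n : nat) : (0 < m)%R -> (1 <= n)%nat ->
  Clog c = ln m + 3 * Clog (vt v0) -> let e := radius m n in
  Cpower (1 - z0) (RtoC (- (1 / 12)))
    * (Cexp (Jz (-1) - 1 / 6) * Cpower c (RtoC (7 / 36))
       / RtoC (Rpower 2 (11 / 36) * sqrt (3 * PI) * Rpower (INR n) (25 / 36)))
    * Cexp (RtoC (3 / Rpower 2 (2 / 3)) * Cpower c (RtoC (1 / 3)) * RtoC (Rpower (INR n) (2 / 3)))
  = e * e * main_factor z0 m v0 e * (gv v0 * sqrt PI) / (2 * PI * bv m v0).
Proof.
intros Hm Hn Hc e. pose proof PI_RGT_0 as HPI.
assert (Hp : (0 < INR n)%R) by (apply lt_0_INR; lia).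
assert (Hlne : ln e = ((ln 2 + ln m - ln (INR n)) / 3)%R) by (unfold e, radius; apply ln_exp).
assert (Hen : (0 < e)%R) by apply exp_pos.
set (al := Clog (vt v0)) in *.
assert (Hexparg : RtoC (3 / Rpower 2 (2 / 3)) * Cpower c (RtoC (1 / 3)) * RtoC (Rpower (INR n) (2 / 3)) = 3 * m * vt v0 / (e * e)).
{ assert (E1 : Cpower c (RtoC (1 / 3)) = exp (ln m / 3) * vt v0).
  { unfold Cpower. rewrite Hc. replace (RtoC (1 / 3) * (ln m + 3 * al)) with ((ln m / 3)%R + al).
    - rewrite Cexp_add, Cexp_R. unfold al. rewrite Cexp_Clog by (rewrite Re_vt; lra). reflexivity.
    - rewrite !RtoC_div by lra. field. }
  rewrite E1. replace (3 * m * vt v0 / (e * e)) with ((3 * m / (e * e))%R * vt v0).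
  2:{ rewrite RtoC_div, !RtoC_mult by nra. unfold Cdiv. ring. }
  assert (E2 : (3 / Rpower 2 (2 / 3) * exp (ln m / 3) * Rpower (INR n) (2 / 3) = 3 * m / (e * e))%R).
  { replace (3 * m / (e * e))%R with (3 * (exp (ln m) * exp (- (ln e + ln e))))%R
      by (rewrite exp_Ropp, exp_plus, !exp_ln by trivial; field; lra).
    unfold Rpower, Rdiv at 1. rewrite <- exp_Ropp, !Rmult_assoc, <- !exp_plus. do 2 f_equal. rewrite Hlne. field. }
  rewrite <- E2, !RtoC_mult. ring. }
rewrite Hexparg. clear Hexparg. unfold main_factor, kappa.
set (B0 := 3 * m * vt v0 / (e * e)).
assert (Hreal : (e * e * exp (ln e / 12) * sqrt PI / (2 * PI * sqrt (3 * m)) = exp (7 / 36 * ln m) / (Rpower 2 (11 / 36) * sqrt (3 * PI) * Rpower (INR n) (25 / 36)))%R).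
{ replace (e * e * exp (ln e / 12) * sqrt PI)%R with (exp (ln e + ln e + ln e / 12 + ln PI / 2))
    by (rewrite (sqrt_exp PI), !exp_plus, exp_ln by trivial; reflexivity).
  replace (2 * PI * sqrt (3 * m))%R with (exp (ln 2 + ln PI + (ln 3 + ln m) / 2))
    by (rewrite sqrt_exp, ln_mult, !exp_plus, !exp_ln by lra; reflexivity).
  rewrite (sqrt_exp (3 * PI)), ln_mult by lra. unfold Rpower. rewrite <- !exp_plus, !exp_div.
  f_equal. rewrite Hlne. field. }
assert (HL : Cpower c (RtoC (7 / 36)) = exp (7 / 36 * ln m) * Cexp (al * (7 / 12)%R)).
{ unfold Cpower. rewrite Hc, <- Cexp_R, <- Cexp_add. f_equal. rewrite RtoC_mult, !RtoC_div by lra. field. }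
rewrite HL. unfold Cpower at 1.
assert (Hs3 : (0 < sqrt (3 * m))%R) by (apply sqrt_lt_R0; lra).
assert (Hden : (0 < Rpower 2 (11 / 36) * sqrt (3 * PI) * Rpower (INR n) (25 / 36))%R).
{ apply Rmult_lt_0_compat; [apply Rmult_lt_0_compat; [apply exp_pos|apply sqrt_lt_R0; lra]|apply exp_pos]. }
assert (HA : RtoC (exp (7 / 36 * ln m)) / RtoC (Rpower 2 (11 / 36) * sqrt (3 * PI) * Rpower (INR n) (25 / 36)) =
  RtoC (e * e * exp (ln e / 12) * sqrt PI / (2 * PI * sqrt (3 * m)))%R) by (rewrite Hreal, RtoC_div by lra; reflexivity).
transitivity (RtoC (e * e * exp (ln e / 12) * sqrt PI / (2 * PI * sqrt (3 * m)))%R *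
  (Cexp (- (1 / 12)%R * Clog (1 - z0)) * Cexp (Jz (-1) - 1 / 6) * Cexp (al * (7 / 12)%R) * Cexp B0)).
{ rewrite <- HA. unfold Cdiv. rewrite RtoC_opp. ring. }
rewrite <- !Cexp_add. unfold gv, bv. fold al. rewrite Cexp_opp.
replace (B0 + ln e / 12 + (Jz (-1) - 1 / 6 - Clog (1 - z0) / 12)) with ((ln e / 12)%R + (B0 + (Jz (-1) - 1 / 6 - Clog (1 - z0) / 12)))
  by (rewrite RtoC_div by lra; ring).
rewrite (Cexp_add (ln e / 12)%R), Cexp_R.
rewrite (RtoC_div (e * e * exp (ln e / 12) * sqrt PI)) by (apply Rgt_not_eq, Rmult_lt_0_compat; lra). rewrite !RtoC_mult.
assert (N1 : RtoC (sqrt (3 * m)) <> 0) by (intros F; apply RtoC_inj in F; lra).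
assert (N2 : RtoC PI <> 0) by (intros F; apply RtoC_inj in F; lra).
replace (- (1 / 12)%R * Clog (1 - z0) + (Jz (-1) - 1 / 6) + al * (7 / 12)%R + B0) with
  (B0 + (Jz (-1) - 1 / 6 - Clog (1 - z0) / 12) + al / 12 + al / 2) by (rewrite !RtoC_div by lra; field).
rewrite (Cexp_add _ (al / 2)), (Cexp_add _ (al / 12)).
field. repeat split; trivial. apply Cexp_nz.
Qed.

Theorem theorem1p3 (zeta : C -> C) (a b : Z)
  (Hzeta : is_riemann_zeta zeta)
  (Hab : (1 <= a <= b)%Z)
  (Hgcd : Z.gcd a b = 1%Z)
  (Hne : (IZR a / IZR b <> 1)%R) :
  asymp_equiv
    (fun n => A n (zeta_root a b))
    (fun n =>
       Cpower (RtoC 1 - zeta_root a b) (RtoC (- (1 / 12)))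
       * (Cexp (C_derive zeta (RtoC (-1)))
          * Cpower (zeta (RtoC 3) - Li3 (zeta_root a b)) (RtoC (7 / 36))
          / RtoC (Rpower 2 (11 / 36) * sqrt (3 * PI) * Rpower (INR n) (25 / 36)))
       * Cexp (RtoC (3 / Rpower 2 (2 / 3))
               * Cpower (zeta (RtoC 3) - Li3 (zeta_root a b)) (RtoC (1 / 3))
               * RtoC (Rpower (INR n) (2 / 3)))).
Proof.
destruct (zeta_root_unit a b Hab Hne) as [Hz Hz1]. set (z0 := zeta_root a b) in *.
rewrite (zeta_derive_m1 zeta Hzeta), (zeta_3 zeta Hzeta), <- l3_1, <- l3_Li3.
change (l3 1 - l3 z0) with (CC3 z0).
destruct (saddle_point (CC3 z0) (Re_CC3_pos z0 Hz Hz1)) as [m [v0 [Hm [Hv0 [HC Hlog]]]]].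
pose proof PI_RGT_0 as HPI.
assert (Hsp : (0 < sqrt PI)%R) by now apply sqrt_lt_R0.
set (w := gv v0 * sqrt PI).
assert (Hw : w <> 0).
{ apply Cmult_neq_0; [apply Cexp_nz|]. intros F; apply RtoC_inj in F; lra. }
assert (Hb : bv m v0 <> 0).
{ apply Cmult_neq_0; [|apply Cexp_nz]. intros F; apply RtoC_inj in F.
  assert (0 < sqrt (3 * m))%R by (apply sqrt_lt_R0; lra). lra. }
set (e := radius m). set (X := fun n => bv m v0 * (2 * PI * A n z0 / (e n * e n * main_factor z0 m v0 (e n)))).
assert (HX : Clim X w).
{ apply is_lim_seq_spec. intros eps.
  destruct (main_estimate z0 m v0 (eps / 2) Hz Hz1 Hm Hv0 HC ltac:(pose proof (cond_pos eps); lra)) as [d [Hd H]].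
  pose proof (radius_lim m) as HL. apply is_lim_seq_spec in HL. destruct (HL (mkposreal d Hd)) as [N0 HN0].
  exists (S N0). intros n Hn. rewrite Rminus_0_r, Rabs_pos_eq by apply Cmod_ge_0.
  specialize (HN0 n ltac:(lia)). simpl pos in HN0. rewrite Rminus_0_r in HN0.
  assert (Hep : (0 < e n)%R) by apply exp_pos.
  eapply Rle_lt_trans; [apply (H (e n) n)|pose proof (cond_pos eps); lra].
  - split; trivial. pose proof (Rle_abs (e n)). unfold e in *. lra.
  - apply radius_cube; trivial; lia. }
apply asymp_equiv_Clim.
(* The index 0 is dropped, since [ln] and [Rpower] have no meaningful value at [INR 0]. *)
apply Clim_incr_n with 1%nat.
apply Clim_ext with (fun n => / w * X (n + 1)%nat).
- intros n. rewrite (leading_term z0 (CC3 z0) m v0 (n + 1) Hm ltac:(lia) Hlog). cbv zeta. fold (e (n + 1)%nat).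
  unfold X. fold w.
  assert (He : RtoC (e (n + 1)%nat) <> 0).
  { intros F; apply RtoC_inj in F. pose proof (exp_pos ((ln 2 + ln m - ln (INR (n + 1))) / 3)). unfold e, radius in F. lra. }
  assert (Hpi : RtoC PI <> 0) by (intros F; apply RtoC_inj in F; lra).
  field. repeat split; trivial. apply Cexp_nz.
- replace (RtoC 1) with (/ w * w) by (field; trivial).
  apply Clim_scal. now apply Clim_incr_n'.
Qed.
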